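(* Let $\alpha\in(0,1)$. Let $\overline\beta\sim\mathrm{PDIP}(\alpha,0)$, respectively $\overline\beta\sim\mathrm{PDIP}(\alpha,\alpha)$, and, independently of $\overline\beta$, let $Z$ be a $\mathrm{BESQ}(0)$ process, respectively a $\mathrm{BESQ}(2\alpha)$ process, with an arbitrary initial distribution on $[0,\infty)$. Let $(\beta^y,\,y\ge0)$ be a type-1 evolution, respectively a type-0 evolution, with $\beta^0\stackrel{d}{=}Z(0)\overline\beta$. Then for each fixed $y\ge0$ we have $\beta^y\stackrel{d}{=}Z(y)\overline\beta$.
   Context: **Interval partitions.** An interval partition is a set $\beta$ of disjoint open subintervals (blocks) of some finite interval $[0,M]$ covering $[0,M]$ up to a Lebesgue-null set; $\|\beta\|:=M$; $\emptyset$ is the empty interval partition. For $c>0$, $c\beta:=\{(ca,cb):(a,b)\in\beta\}$, and $0\beta:=\emptyset$. If $(\gamma_U)_{U\in\beta}$ are interval partitions with $\sum_{U\in\beta}\|\gamma_U\|<\infty$, their concatenation is $\star_{U\in\beta}\gamma_U:=\{(S(U)+x,S(U)+y):U\in\beta,(x,y)\in\gamma_U\}$, where $S(U)=\sum_{(u',v')\in\beta:\,u'<u}\|\gamma_{(u',v')}\|$ for $U=(u,v)$. Concatenation of two partitions is written $\gamma\star\gamma'$, and $(0,L)\star\gamma$ means $\{(0,L)\}\star\gamma$. **State space.** Fix $\alpha\in(0,1)$. $\mathcal I$ is the set of interval partitions $\beta$ such that $\mathscr D_\beta(t):=\Gamma(1-\alpha)\lim_{h\downarrow0}h^\alpha\#\{(a,b)\in\beta:b-a>h,\,b\le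 t\}$ exists for all $t\in[0,\|\beta\|]$. Write $\mathscr D_\beta(U)$ for the constant value on a block $U$, and $\mathscr D_\beta(\infty):=\mathscr D_\beta(\|\beta\|)$. A correspondence from $\beta$ to $\gamma$ is a finite sequence $(U_j,V_j)_{1\le j\le n}$ in $\beta\times\gamma$, $n\ge0$, with $(U_j)$ and $(V_j)$ each strictly increasing in left-to-right order. Its distortion is the maximum of $\sup_j|\mathscr D_\beta(U_j)-\mathscr D_\gamma(V_j)|$, $|\mathscr D_\beta(\infty)-\mathscr D_\gamma(\infty)|$, $\sum_j|\mathrm{Leb}(U_j)-\mathrm{Leb}(V_j)|+\|\beta\|-\sum_j\mathrm{Leb}(U_j)$, and $\sum_j|\mathrm{Leb}(U_j)-\mathrm{Leb}(V_j)|+\|\gamma\|-\sum_j\mathrm{Leb}(V_j)$. $d_{\mathcal I}(\beta,\gamma)$ is the infimum of distortions over all correspondences. **Poisson–Dirichlet interval partitions.** Let $Y$ be a stable subordinator with $\mathbf E[e^{-\lambda Y(s)}]=e^{-s\lambda^\alpha}$, $Z'$ an independent exponential variable (any rate) and $S=\inf\{s>0:Y(s)>Z'\}$. Let $\beta=\{(Y(s-),Y(s)):s\in(0,S),\,Y(s-)<Y(s)\}$ and $\beta'=\{(0,Z'-Y(S-))\}\star\beta$. The law of $\|\beta\|^{-1}\beta$ is called $\mathrm{PDIP}(\alpha,\alpha)$ and the law of $\|\beta'\|^{-1}\beta'$ is called $\mathrm{PDIP}(\alpha,0)$ (neither depends on the rate of $Z'$). **Type-1 and type-0 evolutions.** $\mathrm{Gamma}(a,r)$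 has density $r^ax^{a-1}e^{-rx}/\Gamma(a)$ on $(0,\infty)$. For $b,r>0$ let $B_r\sim\mathrm{Gamma}(\alpha,r)$, $\bar\gamma\sim\mathrm{PDIP}(\alpha,\alpha)$ and a $(0,\infty)$-valued $L_{b,r}$ with $$\mathbf E[e^{-\lambda L_{b,r}}]=\Big(\frac{r+\lambda}{r}\Big)^\alpha\frac{e^{br^2/(r+\lambda)}-1}{e^{br}-1},\quad\lambda\ge0,$$ be independent, and set $\mu^{(\alpha)}_{b,r}=e^{-br}\delta_\emptyset+(1-e^{-br})\mathbf P\{(0,L_{b,r})\star B_r\bar\gamma\in\cdot\,\}$. For $y>0$, $\kappa^{(\alpha)}_y(\beta,\cdot)$ is the law of $\star_{U\in\beta}\gamma_U$ with $\gamma_U\sim\mu^{(\alpha)}_{\mathrm{Leb}(U),1/(2y)}$ independent, and $\widetilde\kappa^{(\alpha)}_y(\beta,\cdot)$ is the law of $B\bar\gamma\star(\star_{U\in\beta}\gamma_U)$ with additionally independent $B\sim\mathrm{Gamma}(\alpha,1/(2y))$, $\bar\gamma\sim\mathrm{PDIP}(\alpha,\alpha)$; at $y=0$ both are $\delta_\beta$. A type-1 (resp. type-0) evolution is a path-continuous Hunt process on $(\mathcal I,d_{\mathcal I})$ with transition semigroup $(\kappa^{(\alpha)}_y)$ (resp. $(\widetilde\kappa^{(\alpha)}_y)$). **BESQ.** For $\delta\in\mathbb R$, $b\ge0$, $\mathrm{BESQ}(\delta)$ starting from $b$ is the $[0,\infty)$-valued diffusion $dZ(y)=\delta\,dy+2\sqrt{Z(y)}\,dB(y)$,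 $Z(0)=b$, $0<y<\zeta$, with $B$ Brownian motion, $\zeta=\infty$ if $\delta>0$ and $\zeta=\inf\{y\ge0:Z(y)=0\}$ if $\delta\le0$, and $Z(y)=0$ for $y\ge\zeta$. *)

(* Defs.v *)
From HB Require Import structures.
From mathcomp Require Import all_boot all_order all_algebra.
From mathcomp Require Import finmap.
From mathcomp Require Import all_classical all_reals all_analysis.
From mathcomp Require Import measurable_realfun.

Set Implicit Arguments.
Unset Strict Implicit.
Unset Printing Implicit Defensive.

Import Order.TTheory GRing.Theory Num.Theory numFieldNormedType.Exports.

Local Open Scope classical_set_scope.
Local Open Scope ring_scope.

Section interval_partitions.
Context {R : realType}.
Implicit Types (b : set (R * R)) (U V : R * R).

(* The pair (u, v) encodes the open interval ]u, v[. *)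
Definition block_itv U : set R := `]U.1, U.2[%classic.
Definition block_len U : R := U.2 - U.1.

Definition is_ip_of (M : R) b : Prop :=
  [/\ 0 <= M,
      forall U, b U -> [/\ 0 <= U.1, U.1 < U.2 & U.2 <= M],
      trivIset b block_itv &
      lebesgue_measure (`[0, M]%classic `\` \bigcup_(U in b) block_itv U) = 0%E].

Definition is_ip b : Prop := exists M, is_ip_of M b.

(* The total mass M; see ip_massE. Since [sup set0 = 0], the empty partition
   has mass 0. *)
Definition ip_mass b : R := sup [set U.2 | U in b].

Lemma ip_massE M b : is_ip_of M b -> ip_mass b = M.
Proof.
move=> [M0 bb _ null].
have ubM : ubound [set U.2 | U in b] M.
  by move=> _ [U bU <-]; have [] := bb U bU.
have supM : ip_mass b <= M.
  rewrite /ip_mass; have [->|ne] := eqVneq [set U.2 | U in b] set0.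
    by rewrite sup0.
  by apply: ge_sup => //; exact/set0P.
have sup0' : 0 <= ip_mass b.
  rewrite /ip_mass; have [->|/set0P[_ [U bU _]]] := eqVneq [set U.2 | U in b] set0.
    by rewrite sup0.
  have [U1 U12 U2] := bb U bU.
  apply: (@le_trans _ _ U.2); first exact: le_trans U1 (ltW U12).
  by apply: ub_le_sup; [exists M | exists U].
apply/eqP; rewrite eq_le supM /= leNgt; apply/negP => ltM.
have mD : measurable (`[0, M]%classic `\` \bigcup_(U in b) block_itv U).
  apply: measurableD; first exact: measurable_itv.
  by apply: open_measurable; apply: bigcup_open => U _; exact: interval_open.
have sD : `]ip_mass b, M]%classic `<=`
    `[0, M]%classic `\` \bigcup_(U in b) block_itv U.
  move=> x /=; rewrite in_itv /= => /andP[x1 x2]; split.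
    by rewrite /= in_itv /= x2 andbT (le_trans sup0' (ltW x1)).
  move=> [U bU]; rewrite /block_itv /= in_itv /= => /andP[_ xU].
  have : U.2 <= ip_mass b by apply: ub_le_sup; [exists M | exists U].
  by move=> /(lt_le_trans xU) /(lt_trans x1); rewrite ltxx.
have : (lebesgue_measure `]ip_mass b, M]%classic <= 0 :> \bar R)%E.
  by rewrite -null; apply: le_measure => //; rewrite inE//; exact: measurable_itv.
by rewrite lebesgue_measure_itv /= lte_fin ltM -EFinB lee_fin leNgt subr_gt0 ltM.
Qed.

Definition ip_scale (c : R) b : set (R * R) :=
  if 0 < c then [set (c * U.1, c * U.2) | U in b] else set0.

Definition ip_normalize b : set (R * R) := ip_scale (ip_mass b)^-1 b.

Definition ip_cat b b' : set (R * R) :=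
  b `|` [set (ip_mass b + V.1, ip_mass b + V.2) | V in b'].

Definition ip_concat_shift b (g : R * R -> set (R * R)) U : R :=
  fine (\esum_(U' in [set U' | b U' /\ U'.1 < U.1]) (ip_mass (g U'))%:E).

Definition ip_concat b (g : R * R -> set (R * R)) : set (R * R) :=
  \bigcup_(U in b)
    [set (ip_concat_shift b g U + V.1, ip_concat_shift b g U + V.2) | V in g U].

Definition Gamma_fun (a : R) : R :=
  \int[lebesgue_measure]_(t in `]0, +oo[) (t `^ (a - 1) * expR (- t)).

Definition scaled_count (alpha : R) b (t h : R) : R :=
  h `^ alpha * (#|` fset_set [set U | [/\ b U, h < block_len U & U.2 <= t]]|)%:R.

Definition diversity (alpha : R) b (t : R) : R :=
  Gamma_fun (1 - alpha) * lim (scaled_count alpha b t h @[h --> 0^'+]).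

(* The diversity is constant on each block, so any point of U would do. *)
Definition block_diversity (alpha : R) b U : R :=
  diversity alpha b ((U.1 + U.2) / 2).

Definition total_diversity (alpha : R) b : R := diversity alpha b (ip_mass b).

Definition has_diversity (alpha : R) b : Prop :=
  forall t, 0 <= t <= ip_mass b -> cvg (scaled_count alpha b t h @[h --> 0^'+]).

End interval_partitions.

Record ipspace (R : realType) (alpha : R) := IPSpace {
  ip_blocks :> set (R * R);
  ip_blocksP : is_ip ip_blocks;
  ip_diversityP : has_diversity alpha ip_blocks }.

Section ipspace_structure.
Context (R : realType) (alpha : R).

Lemma is_ip_set0 : is_ip (set0 : set (R * R)).
Proof.
exists 0; split => //.
by rewrite bigcup_set0 setD0 set_itv1 lebesgue_measure_set1.
Qed.

Lemma has_diversity_set0 : has_diversity alpha (set0 : set (R * R)).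
Proof.
move=> t _.
have -> : scaled_count alpha set0 t = cst 0; last exact: is_cvg_cst.
apply/funext => h; rewrite /scaled_count.
have -> : [set U : R * R | [/\ set0 U, h < block_len U & U.2 <= t]] = set0.
  by apply/seteqP; split => // U [].
by rewrite fset_set0 cardfs0 mulr0.
Qed.

Definition ip_empty : ipspace alpha := IPSpace is_ip_set0 has_diversity_set0.

HB.instance Definition _ := gen_eqMixin (ipspace alpha).
HB.instance Definition _ := gen_choiceMixin (ipspace alpha).
HB.instance Definition _ := isPointed.Build (ipspace alpha) ip_empty.

(* A correspondence is the list of its pairs (U_j, V_j), from left to right. *)
Definition correspondence (b g : set (R * R)) (s : seq ((R * R) * (R * R))) :=
  (forall p, p \in s -> b p.1 /\ g p.2) /\
  sorted (fun p q => (p.1.1 < q.1.1) && (p.2.1 < q.2.1)) s.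

Definition distortion (b g : set (R * R)) (s : seq ((R * R) * (R * R))) : R :=
  let gap := \sum_(p <- s) `|block_len p.1 - block_len p.2| in
  Num.max
    (Num.max
      (\big[Num.max/0]_(p <- s)
        `|block_diversity alpha b p.1 - block_diversity alpha g p.2|)
      `|total_diversity alpha b - total_diversity alpha g|)
    (Num.max
      (gap + (ip_mass b - \sum_(p <- s) block_len p.1))
      (gap + (ip_mass g - \sum_(p <- s) block_len p.2))).

Definition ip_dist (b g : ipspace alpha) : R :=
  inf [set distortion b g s | s in correspondence b g].

Definition ip_open (D : set (ipspace alpha)) : Prop :=
  forall b, D b ->
  exists2 e : R, 0 < e & forall g, ip_dist b g < e -> D g.

(* ipspace carries the Borel sigma-algebra of ip_dist. *)
HB.instance Definition _ := @isMeasurable.Build (sigma_display ip_open)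
  (ipspace alpha) <<s ip_open >> (@sigma_algebra0 _ setT ip_open)
  (@sigma_algebraC _ ip_open) (@sigma_algebra_bigcup _ setT ip_open).

Definition ip_continuous_path (x : R -> ipspace alpha) : Prop :=
  forall t, 0 <= t -> forall e, 0 < e -> exists2 h, 0 < h &
    forall s, 0 <= s -> `|s - t| < h -> ip_dist (x t) (x s) < e.

End ipspace_structure.

Section independence.
Context d (Om : measurableType d) (R : realType) (P : probability Om R).

Definition sigma_rv d' (T : measurableType d') (X : Om -> T) : set (set Om) :=
  preimage_set_system setT X measurable.

Definition sigma_process (I : Type) (D : set I) d' (T : measurableType d')
    (X : I -> Om -> T) : set (set Om) :=
  <<s \bigcup_(i in D) sigma_rv (X i) >>.

Definition independent2 (F G : set (set Om)) : Prop :=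
  forall A B, F A -> G B -> P (A `&` B) = (P A * P B)%E.

Definition independent3 (F G H : set (set Om)) : Prop :=
  forall A B C, F A -> G B -> H C ->
  P (A `&` B `&` C) = (P A * P B * P C)%E.

Definition independent_family (I : eqType) (D : set I)
    (F : I -> set (set Om)) : Prop :=
  forall (s : seq I) (A : I -> set Om), uniq s ->
  (forall i, i \in s -> D i /\ F i (A i)) ->
  P (\bigcap_(i in [set` s]) A i) = (\prod_(i <- s) P (A i))%E.

Definition filtration (F : R -> set (set Om)) : Prop :=
  [/\ forall t, 0 <= t -> sigma_algebra setT (F t),
      forall t, 0 <= t -> F t `<=` measurable &
      forall s t, 0 <= s -> s <= t -> F s `<=` F t].

Definition right_continuous_filtration (F : R -> set (set Om)) : Prop :=
  forall t, 0 <= t -> F t = \bigcap_(s in [set s | t < s]) F s.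

Definition adapted (F : R -> set (set Om)) d' (T : measurableType d')
    (X : R -> Om -> T) : Prop :=
  forall t, 0 <= t -> sigma_rv (X t) `<=` F t.

Definition stopping_time (F : R -> set (set Om)) (tau : Om -> \bar R) : Prop :=
  (forall w, (0 <= tau w)%E) /\
  forall t, 0 <= t -> F t [set w | (tau w <= t%:E)%E].

Definition stopped_sigma (F : R -> set (set Om)) (tau : Om -> \bar R)
    : set (set Om) :=
  [set A | measurable A /\
     forall t, 0 <= t -> F t (A `&` [set w | (tau w <= t%:E)%E])].

End independence.

(* A random interval partition X is given by its set of blocks; it need only
   lie in the state space almost surely. The set function nu matters only on
   measurable sets. *)
Definition has_law d (Om : measurableType d) (R : realType)
    (P : probability Om R) (alpha : R) (X : Om -> set (R * R))
    (nu : set (ipspace alpha) -> \bar R) : Prop :=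
  exists X' : {mfun Om >-> ipspace alpha},
    {ae P, forall w, ip_blocks (X' w) = X w} /\
    forall D, measurable D -> nu D = distribution P X' D.

Section poisson_dirichlet.
Context {R : realType}.

Definition stable_subordinator (alpha : R) d (Om : measurableType d)
    (P : probability Om R) (Y : R -> Om -> R) : Prop :=
  [/\ forall s, 0 <= s -> measurable_fun setT (Y s),
      forall w, [/\ Y 0 w = 0,
        forall s t, 0 <= s -> s <= t -> Y s w <= Y t w &
        forall s, 0 <= s -> Y r w @[r --> s^'+] --> Y s w],
      forall s t, 0 <= s -> s <= t ->
        independent2 P (sigma_process [set r | 0 <= r <= s] Y)
          (sigma_rv (fun w => Y t w - Y s w)),
      forall s t, 0 <= s -> 0 <= t -> forall A : set R, measurable A ->
        P [set w | A (Y (s + t) w - Y s w)] = P (Y t @^-1` A) &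
      forall s lambda, 0 <= s -> 0 <= lambda ->
        ('E_P[fun w => expR (- lambda * Y s w)%R]
          = (expR (- s * lambda `^ alpha))%:E)%E].

Definition left_limit (y : R -> R) (s : R) : R := lim (y r @[r --> s^'-]).

Definition passage_time (y : R -> R) (z : R) : R := inf [set s | 0 < s /\ z < y s].

(* The blocks of the jumps of y before it exceeds z. *)
Definition killed_blocks (y : R -> R) (z : R) : set (R * R) :=
  [set (left_limit y s, y s) | s in
    [set s | [/\ 0 < s, s < passage_time y z & left_limit y s < y s]]].

Definition killed_blocks0 (y : R -> R) (z : R) : set (R * R) :=
  ip_cat [set (0, z - left_limit y (passage_time y z))] (killed_blocks y z).

Definition killed_subordinator (alpha : R) d (Om : measurableType d)
    (P : probability Om R) (Y : R -> Om -> R) (Z' : Om -> R) : Prop :=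
  [/\ stable_subordinator alpha P Y,
      measurable_fun setT Z',
      exists2 r : R, 0 < r & forall A : set R, measurable A ->
        P (Z' @^-1` A) = exponential_prob r A &
      independent2 P (sigma_process [set s | 0 <= s] Y) (sigma_rv Z')].

(* These predicates on nu, like mu_law, kappa1 and kappa0 below, say that nu is
   the law in question. *)
Definition PDIP_alpha_alpha (alpha : R) (nu : set (ipspace alpha) -> \bar R)
    : Prop :=
  exists d (Om : measurableType d) (P : probability Om R) Y Z',
    killed_subordinator alpha P Y Z' /\
    has_law P (fun w => ip_normalize (killed_blocks (Y ^~ w) (Z' w))) nu.

Definition PDIP_alpha_0 (alpha : R) (nu : set (ipspace alpha) -> \bar R)
    : Prop :=
  exists d (Om : measurableType d) (P : probability Om R) Y Z',
    killed_subordinator alpha P Y Z' /\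
    has_law P (fun w => ip_normalize (killed_blocks0 (Y ^~ w) (Z' w))) nu.

End poisson_dirichlet.

Section kernels.
Context {R : realType}.

Definition gamma_pdf (a r x : R) : R :=
  r `^ a * x `^ (a - 1) * expR (- r * x) / Gamma_fun a.

Definition gamma_rv (a r : R) d (Om : measurableType d) (P : probability Om R)
    (B : Om -> R) : Prop :=
  measurable_fun setT B /\
  forall A : set R, measurable A -> P (B @^-1` A) =
    (\int[lebesgue_measure]_(x in A `&` `]0%R, +oo[) (gamma_pdf a r x)%:E)%E.

Definition left_block_rv (alpha b r : R) d (Om : measurableType d)
    (P : probability Om R) (L : Om -> R) : Prop :=
  [/\ measurable_fun setT L, forall w, 0 < L w &
      forall lambda, 0 <= lambda ->
        ('E_P[fun w => expR (- lambda * L w)%R] =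
        (((r + lambda) / r) `^ alpha *
         ((expR (b * r ^+ 2 / (r + lambda)) - 1) / (expR (b * r) - 1)))%:E)%E].

Definition mu_law (alpha b r : R) (nu : set (ipspace alpha) -> \bar R) : Prop :=
  exists d (Om : measurableType d) (P : probability Om R)
    (L B : Om -> R) (G : {mfun Om >-> ipspace alpha})
    (rho : set (ipspace alpha) -> \bar R),
  [/\ left_block_rv alpha b r P L, gamma_rv alpha r P B,
      PDIP_alpha_alpha (distribution P G),
      independent3 P (sigma_rv L) (sigma_rv B) (sigma_rv G) &
      has_law P (fun w => ip_cat [set (0, L w)] (ip_scale (B w) (G w))) rho /\
      forall D, measurable D ->
        nu D = ((expR (- b * r))%:E * \d_(ip_empty alpha) D
                + (1 - expR (- b * r))%:E * rho D)%E].

(* Independent (G U), U a block of b, with G U of law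
   mu^(alpha)_{Leb(U), 1/(2y)}; the values of G at other pairs are irrelevant. *)
Definition kappa_family (alpha y : R) (b : ipspace alpha) d
    (Om : measurableType d) (P : probability Om R)
    (G : R * R -> {mfun Om >-> ipspace alpha}) : Prop :=
  (forall U, ip_blocks b U ->
     mu_law (block_len U) (2 * y)^-1 (distribution P (G U))) /\
  independent_family P (ip_blocks b) (fun U => sigma_rv (G U)).

(* Without this condition the concatenation is undefined; ip_concat_shift then
   has a junk value. *)
Definition summable_family (alpha : R) (b : ipspace alpha) d
    (Om : measurableType d) (G : R * R -> Om -> ipspace alpha) (w : Om) : Prop :=
  (\esum_(U in ip_blocks b) (ip_mass (G U w))%:E < +oo)%E.

Definition kappa1 (alpha y : R) (b : ipspace alpha)
    (nu : set (ipspace alpha) -> \bar R) : Prop :=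
  if y == 0 then forall D, measurable D -> nu D = \d_b D else
  exists d (Om : measurableType d) (P : probability Om R)
    (G : R * R -> {mfun Om >-> ipspace alpha}),
  [/\ kappa_family y b P G,
      {ae P, forall w, summable_family b G w} &
      has_law P (fun w => ip_concat b (fun U => G U w)) nu].

Definition kappa0 (alpha y : R) (b : ipspace alpha)
    (nu : set (ipspace alpha) -> \bar R) : Prop :=
  if y == 0 then forall D, measurable D -> nu D = \d_b D else
  exists d (Om : measurableType d) (P : probability Om R)
    (G : R * R -> {mfun Om >-> ipspace alpha})
    (B : Om -> R) (G0 : {mfun Om >-> ipspace alpha}),
  [/\ kappa_family y b P G /\ {ae P, forall w, summable_family b G w},
      gamma_rv alpha (2 * y)^-1 P B, PDIP_alpha_alpha (distribution P G0),
      independent3 P (sigma_rv B) (sigma_rv G0) (sigma_process (ip_blocks b) G) &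
      has_law P (fun w => ip_cat (ip_scale (B w) (G0 w))
                            (ip_concat b (fun U => G U w))) nu].

(* Path-continuous Hunt process on the state space whose transition kernels K y
   have the laws prescribed by kappa. The strong Markov property at constant
   times is the simple one; quasi-left-continuity follows from the continuity
   of the paths. *)
Definition continuous_hunt_process (alpha : R)
    (kappa : R -> ipspace alpha -> (set (ipspace alpha) -> \bar R) -> Prop)
    d (Om : measurableType d) (P : probability Om R)
    (beta : R -> {mfun Om >-> ipspace alpha}) : Prop :=
  (forall w, ip_continuous_path (fun t => beta t w)) /\
  exists (F : R -> set (set Om))
    (K : R -> R.-pker ipspace alpha ~> ipspace alpha),
  [/\ filtration F, right_continuous_filtration F, adapted F beta,
      forall y, 0 <= y -> forall b, kappa y b (K y b) &
      forall tau, stopping_time F tau ->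
      forall A, stopped_sigma F tau A ->
      forall y, 0 <= y -> forall D, measurable D ->
        P (A `&` [set w | (tau w < +oo)%E /\ D (beta (fine (tau w) + y) w)]) =
        (\int[P]_(w in A `&` [set w | (tau w < +oo)%E])
           K y (beta (fine (tau w)) w) D)%E].

Definition type1_evolution (alpha : R) d (Om : measurableType d)
    (P : probability Om R) (beta : R -> {mfun Om >-> ipspace alpha}) : Prop :=
  continuous_hunt_process (@kappa1 alpha) P beta.

Definition type0_evolution (alpha : R) d (Om : measurableType d)
    (P : probability Om R) (beta : R -> {mfun Om >-> ipspace alpha}) : Prop :=
  continuous_hunt_process (@kappa0 alpha) P beta.

End kernels.

Section besq.
Context {R : realType}.

Definition brownian_motion d (Om : measurableType d) (P : probability Om R)
    (F : R -> set (set Om)) (B : R -> Om -> R) : Prop :=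
  [/\ adapted F B, forall w, B 0 w = 0,
      forall w, {within `[0, +oo[%classic, continuous (B ^~ w)},
      forall s t, 0 <= s -> s < t ->
        independent2 P (F s) (sigma_rv (fun w => B t w - B s w)) &
      forall s t, 0 <= s -> s < t -> forall A : set R, measurable A ->
        P [set w | A (B t w - B s w)] = normal_prob 0 (Num.sqrt (t - s)) A].

Definition left_riemann_sum (h b : R -> R) (s : seq R) : R :=
  let p := 0 :: s in
  \sum_(0 <= i < size s) h p`_i * (b p`_i.+1 - b p`_i).

(* J is the Ito integral of H with respect to B over [0, t], i.e. the limit in
   probability of the left-point Riemann sums as the mesh tends to 0; this is
   the stochastic integral for every continuous adapted integrand H. *)
Definition ito_integral d (Om : measurableType d) (P : probability Om R)
    (H B : R -> Om -> R) (t : R) (J : Om -> R) : Prop :=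
  measurable_fun setT J /\
  forall e eta : R, 0 < e -> 0 < eta -> exists2 h, 0 < h &
    forall s, itv_partition 0 t s ->
      (forall i, (i < size s)%N -> (0 :: s)`_i.+1 - (0 :: s)`_i < h) ->
      (P [set w | e <= `|left_riemann_sum (H ^~ w) (B ^~ w) s - J w| ]%R
         <= eta%:E)%E.

Definition besq_lifetime (delta : R) (z : R -> R) : \bar R :=
  if 0 < delta then +oo%E
  else ereal_inf [set y%:E | y in [set y | 0 <= y /\ z y = 0]].

(* The equation is written in integrated form on [0, t /\ zeta]; as Z vanishes
   from zeta on, the stochastic integral may be taken over [0, t]. *)
Definition besq_sde (delta : R) d (Om : measurableType d)
    (P : probability Om R) (Z : R -> Om -> R) : Prop :=
  exists (F : R -> set (set Om)) (B J : R -> Om -> R),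
  [/\ filtration F /\ brownian_motion P F B,
      adapted F Z,
      forall w, [/\ forall t, 0 <= t -> 0 <= Z t w,
        {within `[0, +oo[%classic, continuous (Z ^~ w)} &
        forall t, 0 <= t -> (besq_lifetime delta (Z ^~ w) <= t%:E)%E -> Z t w = 0],
      forall t, 0 <= t ->
        ito_integral P (fun s w => Num.sqrt (Z s w)) B t (J t) &
      forall t w, 0 <= t ->
        Z t w = Z 0 w + delta * fine (mine t%:E (besq_lifetime delta (Z ^~ w)))
                + 2 * J t w].

(* BESQ(delta), with any initial distribution: a continuous [0, +oo[-valued
   process with the law (i.e. the finite-dimensional distributions) of a
   solution of the equation, which may live on another probability space. *)
Definition besq (delta : R) d (Om : measurableType d)
    (P : probability Om R) (Z : R -> Om -> R) : Prop :=
  [/\ forall t, 0 <= t -> measurable_fun setT (Z t),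
      forall w t, 0 <= t -> 0 <= Z t w,
      forall w, {within `[0, +oo[%classic, continuous (Z ^~ w)} &
      exists d' (Om' : measurableType d') (P' : probability Om' R) Z',
        besq_sde delta P' Z' /\
        forall n (t : 'I_n -> R) (A : 'I_n -> set R),
          (forall i, 0 <= t i /\ measurable (A i)) ->
          P (\bigcap_i (Z (t i) @^-1` A i)) = P' (\bigcap_i (Z' (t i) @^-1` A i))].

End besq.

(* Main.v *)
(* For a matrix-valued exponential sum G, with G 0 = 1 and G x substochastic, let
   MG G b be the product of the matrices G (Leb U) over the blocks U of b, taken from
   left to right.  These functionals are multiplicative for concatenation, and
   they determine laws on the space of interval partitions: step functions are limits
   of exponential sums, and transfer matrices read off the lengths of the large blocks
   and the numbers of blocks between them, hence the diversities.

   The mean of MG G of c times a Poisson-Dirichlet partition, c of Gamma law, is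
   explicit because the subordinator has independent increments up to the
   exponential killing level.  The kernel at time y turns MG G into MG G' with G' again
   an exponential sum, and the explicit formulas for G and G' match.  As
   the Gamma laws of all rates are determining, the kernel identity passes from Gamma
   mass to fixed mass, with the total mass at time y in the role of BESQ(y); the
   Laplace transform of the latter comes from an exponential martingale, discretised
   because the Ito integral is only known as a limit of Riemann sums. *)
From HB Require Import structures.
From mathcomp Require Import all_boot all_order all_algebra.
From mathcomp Require Import finmap.
From mathcomp Require Import all_classical all_reals all_analysis.
From mathcomp Require Import measurable_realfun.
From mathcomp Require Import ring lra.
Require Import Defs.

Set Implicit Arguments.
Unset Strict Implicit.
Unset Printing Implicit Defensive.

Import Order.TTheory GRing.Theory Num.Theory numFieldNormedType.Exports.

Local Open Scope classical_set_scope.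
Local Open Scope ring_scope.

Local Notation mfT := (measurable_fun setT).
Local Notation mcomp := measurableT_comp.
Local Notation rge0 := (fun p => 0 <= p.1).
Local Notation mfM := measurable_funM.
Local Notation mfD := measurable_funD.
Local Notation mfB := measurable_funB.
Local Notation mcst := measurable_cst.
Local Notation mEFin := measurable_EFinP.
Local Notation mfPT := measurable_funPT.
Local Notation mtype := measurableType.
Local Notation prob := probability.
Local Notation leb := lebesgue_measure.
Local Notation gsalg := g_sigma_algebraType.
Local Notation sub_sa := sub_sigma_algebra.
Local Notation PsetT := probability_setT.
Local Notation mpair := measurable_fun_pair.
Local Notation wseq R n := (seq (R * 'M[R]_n.+1)).

Lemma mexpR d (T : measurableType d) (R : realType) (f : T -> R) : mfT f -> mfT (fun x => expR (f x)).
Proof. exact: (mcomp (@measurable_expR R)). Qed.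

(** * Bounded expectations *)

Section bounded_expectation.
Context d (T : mtype d) (R : realType).
Implicit Types (f g : T -> R).

(** Bounded measurable functions are integrable against every finite measure, so the real-valued
    [Ex] is linear and monotone on them without further conditions. *)
Definition bmf f := mfT f /\ exists C : R, forall x, `|f x| <= C.

Lemma bmf_cst (c : R) : bmf (fun _ => c).
Proof. by split; [exact: mcst | exists `|c|]. Qed.

Lemma bmfD f g : bmf f -> bmf g -> bmf (fun x => f x + g x).
Proof.
move=> [mf [C hf]] [mg [D hg]]; split; first exact: mfD.
by exists (C + D) => x; apply: (le_trans (ler_normD _ _)); exact: lerD.
Qed.

Lemma bmfM f g : bmf f -> bmf g -> bmf (fun x => f x * g x).
Proof.
move=> [mf [C hf]] [mg [D hg]]; split; first exact: mfM.
by exists (C * D) => x; rewrite normrM ler_pM.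
Qed.

Lemma bmfN f : bmf f -> bmf (fun x => - f x).
Proof.
move=> [mf [C hf]]; split; first exact: mcomp.
by exists C => x; rewrite normrN.
Qed.

Lemma bmfB f g : bmf f -> bmf g -> bmf (fun x => f x - g x).
Proof. by move=> bf bg; apply: bmfD => //; exact: bmfN. Qed.

Lemma bmf_sum I (s : seq I) (F : I -> T -> R) : (forall i, bmf (F i)) -> bmf (fun x => \sum_(i <- s) F i x).
Proof.
move=> bF; elim: s => [|i s IH].
  by under [X in bmf X]eq_fun do rewrite big_nil; exact: bmf_cst.
by under [X in bmf X]eq_fun do rewrite big_cons; exact: bmfD.
Qed.

Lemma bmf01 f : mfT f -> (forall x, 0 <= f x <= 1) -> bmf f.
Proof.
move=> mf f01; split=> //; exists 1 => x.
by case/andP: (f01 x) => f0 f1; rewrite ger0_norm.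
Qed.

Lemma bmf_lim (f_ : nat -> T -> R) f (C : R) : (forall n, mfT (f_ n)) -> (forall n x, `|f_ n x| <= C) ->
  (forall x, f_ n x @[n --> \oo] --> f x) -> bmf f.
Proof.
move=> mf hf cf; split; first exact: (measurable_fun_cvg mf).
exists C => x; have e : `|f_ n x| @[n --> \oo] --> `|f x| by apply: cvg_norm; exact: cf.
rewrite -(cvg_lim (@Rhausdorff R) e); apply: limr_le; first exact: cvgP e.
by apply: nearW => n; exact: hf.
Qed.

Variable mu : {measure set T -> \bar R}.

Definition Ex f := \int[mu]_x f x.

Lemma eq_Ex f g : (forall x, f x = g x) -> Ex f = Ex g.
Proof. by move=> h; congr Ex; apply/funext. Qed.

Hypothesis fmu : (mu setT < +oo)%E.

Lemma bmf_integrable f : bmf f -> mu.-integrable setT (EFin \o f).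
Proof.
move=> [mf [C hf]]; apply: measurable_bounded_integrable => //.
exists C; split; first exact: num_real.
by move=> x Cx y _ /=; exact: le_trans (hf y) (ltW Cx).
Qed.

Lemma ExE f : bmf f -> ((Ex f)%:E = \int[mu]_x (f x)%:E)%E.
Proof.
by move=> bf; rewrite /Ex /Rintegral fineK//; exact: integrable_fin_num (bmf_integrable bf).
Qed.

Lemma ExD f g : bmf f -> bmf g -> Ex (fun x => f x + g x) = Ex f + Ex g.
Proof. by move=> bf bg; rewrite /Ex RintegralD//; exact: bmf_integrable. Qed.

Lemma ExZ c f : bmf f -> Ex (fun x => c * f x) = c * Ex f.
Proof. by move=> bf; rewrite /Ex RintegralZl//; exact: bmf_integrable. Qed.

Lemma ExZr c f : bmf f -> Ex (fun x => f x * c) = Ex f * c.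
Proof. by move=> bf; rewrite /Ex RintegralZr//; exact: bmf_integrable. Qed.

Lemma ExN f : bmf f -> Ex (fun x => - f x) = - Ex f.
Proof.
move=> bf; have := ExZ (-1) bf; rewrite mulN1r => <-.
by apply: eq_Ex => x; rewrite mulN1r.
Qed.

Lemma ExB f g : bmf f -> bmf g -> Ex (fun x => f x - g x) = Ex f - Ex g.
Proof. by move=> bf bg; rewrite ExD// ?ExN//; exact: bmfN. Qed.

Lemma Ex_cst c : Ex (fun _ => c) = c * fine (mu setT).
Proof. by rewrite /Ex Rintegral_cst. Qed.

Lemma Ex_sum I (s : seq I) (F : I -> T -> R) : (forall i, bmf (F i)) ->
  Ex (fun x => \sum_(i <- s) F i x) = \sum_(i <- s) Ex (F i).
Proof.
move=> bF; elim: s => [|i s IH].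
  rewrite big_nil; under [X in Ex X]eq_fun do rewrite big_nil. by rewrite Ex_cst mul0r.
rewrite big_cons -IH -ExD//; last exact: bmf_sum.
by apply: eq_Ex => x; rewrite big_cons.
Qed.

Lemma le_Ex f g : bmf f -> bmf g -> (forall x, f x <= g x) -> Ex f <= Ex g.
Proof. by move=> bf bg fg; apply: le_Rintegral => //; exact: bmf_integrable. Qed.

Lemma Ex_ge0 f : (forall x, 0 <= f x) -> 0 <= Ex f.
Proof. by move=> f0; apply: Rintegral_ge0. Qed.

Lemma le_norm_Ex f g : bmf f -> bmf g -> (forall x, `|f x| <= g x) -> `|Ex f| <= Ex g.
Proof.
move=> bf bg fg; rewrite ler_norml -ExN//; apply/andP; split.
  by apply: le_Ex => //; [exact: bmfN | move=> x; move: (fg x); rewrite ler_norml => /andP[]].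
by apply: le_Ex => // x; move: (fg x); rewrite ler_norml => /andP[].
Qed.

Lemma ae_eq_Ex f g : mfT f -> mfT g ->
  {ae mu, forall x, f x = g x} -> Ex f = Ex g.
Proof.
move=> mf mg fg; rewrite /Ex /Rintegral; congr fine; apply: ae_eq_integral => //.
- exact/mEFin.
- exact/mEFin.
by apply: filterS fg => x -> _.
Qed.

Lemma Ex_cvg_ae (f_ : nat -> T -> R) f (C : R) : (forall n, mfT (f_ n)) -> bmf f -> (forall n x, `|f_ n x| <= C) ->
  {ae mu, forall x, f_ n x @[n --> \oo] --> f x} -> Ex (f_ n) @[n --> \oo] --> Ex f.
Proof.
move=> mf bf hf cf.
have bf_ n : bmf (f_ n) by split=> //; exists C.
have ig : mu.-integrable setT (EFin \o cst C) by exact: bmf_integrable (bmf_cst _).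
have /(_ _ _ _ _ _)[] := @dominated_convergence _ _ _ mu setT measurableT
  (fun n x => (f_ n x)%:E) (fun x => (f x)%:E) (EFin \o cst C).
- by move=> n; exact/mEFin.
- exact/mEFin/bf.1.
- apply: filterS cf => x cx _; apply: cvg_EFin; last exact: cx. exact: nearW.
- exact: ig.
- by apply: aeW => x n _; rewrite /= lee_fin.
move=> _ _ h; apply: (@cvg_trans _ (fine (\int[mu]_x (f_ n x)%:E)%E @[n --> \oo])); last first.
  by apply: fine_cvg; rewrite ExE.
by apply: near_eq_cvg; apply: nearW => n; rewrite -ExE.
Qed.

Lemma Ex_cvg (f_ : nat -> T -> R) f (C : R) : (forall n, mfT (f_ n)) -> (forall n x, `|f_ n x| <= C) ->
  (forall x, f_ n x @[n --> \oo] --> f x) -> Ex (f_ n) @[n --> \oo] --> Ex f.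
Proof.
move=> mf hf cf; apply: (@Ex_cvg_ae f_ f C) => //; first exact: (bmf_lim mf hf cf).
exact: aeW.
Qed.

End bounded_expectation.

Lemma bmf_comp (R : realType) d (T : mtype d) d' (U : mtype d') (X : T -> U)
  (f : U -> R) : bmf f -> mfT X -> bmf (fun w => f (X w)).
Proof. by move=> [mf [C hC]] mX; split; [exact: mcomp|exists C => w; exact: hC]. Qed.

Lemma measurable_preim d (T : mtype d) d' (U : mtype d') (X : T -> U) (A : set U) :
  mfT X -> measurable A -> measurable (X @^-1` A).
Proof. by move=> mX mA; rewrite -[X in measurable X]setTI; exact: mX. Qed.

Lemma sum_ltn_trunc (R : pzSemiRingType) (n M : nat) (F : nat -> R) : (n <= M)%N ->
  \sum_(j < M) (j < n)%N%:R * F j = \sum_(j < n) F j.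
Proof.
move=> nM; rewrite (big_ord_widen _ F nM) [RHS]big_mkcond /=.
by apply: eq_bigr => j _; case: ifP; rewrite ?mul1r ?mul0r.
Qed.

Lemma Ex_pushforward d d' (T : mtype d) (U : mtype d') (R : realType)
    (mu : {measure set T -> \bar R}) (nu : {measure set U -> \bar R}) (X : T -> U) (f : U -> R) :
  (mu setT < +oo)%E -> mfT X -> (forall A, measurable A -> nu A = mu (X @^-1` A)) -> bmf f ->
  Ex nu f = Ex mu (f \o X).
Proof.
move=> fmu mX nuE bf.
rewrite /Ex /Rintegral; congr fine.
rewrite (@eq_measure_integral _ _ _ _ (pushforward mu X)); last by move=> A mA _; exact: nuE.
rewrite integral_pushforward//; first exact/mEFin/bf.1.
rewrite preimage_setT; apply: bmf_integrable => //; exact: bmf_comp.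
Qed.

Lemma Ex_cst1 d (T : mtype d) (R : realType) (P : prob T R) (c : R) : Ex P (fun=> c) = c.
Proof.
rewrite /Ex Rintegral_cst//.
rewrite (_ : fine _ = 1) ?mulr1//.
have h := @probability_setT _ _ _ P.
exact: (congr1 fine h).
Qed.

Lemma Pfin d (T : mtype d) (R : realType) (P : prob T R) : (P setT < +oo)%E.
Proof. by rewrite PsetT ltry. Qed.

(** * Independence *)

Section sub_sigma.
Context d (Om : mtype d) (R : realType) (P : prob Om R).
Implicit Types F G H : set (set Om).

Definition mfun_in F d' (U : mtype d') (f : Om -> U) := @measurable_fun _ _ (gsalg F) U setT f.

Lemma mfun_inP F d' (U : mtype d') (f : Om -> U) : mfun_in F f <-> sigma_rv f `<=` <<s F >>.
Proof.
split=> [mf _ [B mB <-]|h _ B mB]; first exact: (mf measurableT B mB).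
by apply: h; exists B.
Qed.

Lemma mfun_in_sub F G d' (U : mtype d') (f : Om -> U) : F `<=` <<s G >> -> mfun_in F f -> mfun_in G f.
Proof.
move=> FG /mfun_inP hf; apply/mfun_inP; apply: subset_trans hf _.
by apply: smallest_sub => //; exact: smallest_sigma_algebra.
Qed.

Lemma mfun_inM F d' (U : mtype d') (f : Om -> U) : F `<=` measurable -> mfun_in F f -> mfT f.
Proof.
move=> Fm /mfun_inP hf _ B mB.
have : <<s F >> (setT `&` f @^-1` B) by apply: hf; exists B.
apply: smallest_sub => //; split; [exact: measurable0 | | exact: bigcupT_measurable].
by move=> A mA; rewrite setTD; exact: measurableC.
Qed.

Lemma independent2W F F' G G' : F' `<=` F -> G' `<=` G -> independent2 P F G -> independent2 P F' G'.
Proof. by move=> FF GG i A B /FF FA /GG GB; exact: i. Qed.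

Lemma independent2_sym F G : independent2 P F G -> independent2 P G F.
Proof. by move=> i A B GA FB; rewrite setIC muleC; exact: i. Qed.

(** For fixed B in H, the trace of P on B and the multiple of P by the probability of B are finite
    measures; agreeing on the intersection-stable class G, they agree on the sigma-algebra it
    generates. *)
Lemma independent2_gen G H : setI_closed G -> G `<=` measurable -> H `<=` measurable ->
  independent2 P G H -> independent2 P <<s G >> H.
Proof.
move=> GI Gm Hm i A B GA HB.
(* The whole space is adjoined to provide the exhausting sequence of the uniqueness theorem. *)
pose G' := G `|` [set setT].
have sGG' : <<s G >> `<=` <<s G' >> by apply: sub_sigma_algebra2 => X; left.
have mB := Hm _ HB; pose m1 := mrestr P mB.
have pB : P B \is a fin_num by apply: fin_num_measure.
pose p : {nonneg R} := NngNum (fine_ge0 (measure_ge0 P B)).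
pose m2 := mscale p P.
have m2E X : m2 X = (P X * P B)%E by rewrite /m2 /mscale /= fineK// muleC.
have key X : G' X -> P (X `&` B) = (P X * P B)%E.
  by move=> [GX|->]; [exact: i|rewrite setTI PsetT mul1e].
have h : m1 A = m2 A.
  apply: (@g_sigma_algebra_measure_unique _ _ _ G' _ (fun=> setT)) => //.
  - by move=> X [/Gm|->].
  - by move=> _; right.
  - by apply/seteqP; split=> // x _; exists 0%N.
  - move=> X Y [GX|->] [GY|->]; rewrite ?setTI ?setIT; [left|left|left|right] => //. exact: GI.
  - by move=> X /key e; exact: etrans e (esym (m2E X)).
  - move=> _; apply: (@le_lt_trans _ _ 1%E); last by rewrite ltry. by apply: probability_le1; exact: measurableI.
  - exact: sGG'.
by move: h; rewrite m2E.
Qed.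

Lemma independent3_23 F G H : F setT -> independent3 P F G H -> independent2 P G H.
Proof.
move=> FT i A B GA HB; have := i _ _ _ FT GA HB.
by rewrite setTI PsetT mul1e.
Qed.

Lemma msrv d' (U : mtype d') (X : Om -> U) : mfT X -> sigma_rv X `<=` measurable.
Proof. by move=> mX _ [A mA <-]; exact: mX. Qed.

Lemma sigma_rvT d' (U : mtype d') (X : Om -> U) : sigma_rv X setT.
Proof. by exists setT => //; rewrite preimage_setT setTI. Qed.

Lemma sigma_rvI d' (U : mtype d') (X : Om -> U) : setI_closed (sigma_rv X).
Proof.
move=> _ _ [A mA <-] [B mB <-]; exists (A `&` B); first exact: measurableI.
by rewrite !setTI preimage_setI.
Qed.

Lemma independent3_pair d1 d2 d3 (T1 : mtype d1) (T2 : mtype d2)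
    (T3 : mtype d3) (X : Om -> T1) (Y : Om -> T2) (W : Om -> T3) :
  mfT X -> mfT Y -> mfT W -> independent3 P (sigma_rv X) (sigma_rv Y) (sigma_rv W) ->
  independent2 P (sigma_rv (fun w => (X w, Y w))) (sigma_rv W).
Proof.
move=> mX mY mW i.
pose G := [set A `&` B | A in sigma_rv X & B in sigma_rv Y].
have sX : sigma_rv X `<=` G by move=> A XA; exists A => //; exists setT; [exact: sigma_rvT | rewrite setIT].
have sY : sigma_rv Y `<=` G by move=> A YA; exists setT; [exact: sigma_rvT|exists A; rewrite ?setTI].
have mG : G `<=` measurable.
  by move=> _ [A XA [B YB <-]]; apply: measurableI; [exact: (msrv mX)|exact: (msrv mY)].
have : independent2 P <<s G >> (sigma_rv W).
  apply: independent2_gen => //.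
  - move=> _ _ [A XA [B YB <-]] [A' XA' [B' YB' <-]]. exists (A `&` A'); first exact: sigma_rvI.
    by exists (B `&` B'); [exact: sigma_rvI|rewrite setIACA].
  - exact: msrv.
  - move=> _ C [A XA [B YB <-]] WC; rewrite i//. have := i A B setT XA YB (sigma_rvT _).
    by rewrite setIT PsetT mule1 => ->.
apply: independent2W => //; apply/mfun_inP.
apply: mpair; apply/mfun_inP.
  by apply: subset_trans sX _; exact: sub_sa.
by apply: subset_trans sY _; exact: sub_sa.
Qed.

Lemma independent2_integral d1 d2 (T1 : mtype d1) (T2 : mtype d2)
    (X : Om -> T1) (Y : Om -> T2) (F : T1 * T2 -> \bar R) :
  mfT X -> mfT Y -> independent2 P (sigma_rv X) (sigma_rv Y) -> mfT F -> (forall x, (0 <= F x)%E) ->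
  (\int[P]_w F (X w, Y w) = \int[P]_w \int[P]_w' F (X w, Y w'))%E.
Proof.
move=> mX mY i mF F0.
pose X' : {mfun Om >-> T1} := mfun_Sub (mem_set mX).
pose Y' : {mfun Om >-> T2} := mfun_Sub (mem_set mY).
pose m1 : prob T1 R := distribution P X'.
pose m2 : prob T2 R := distribution P Y'.
have mXY : mfT (fun w => (X w, Y w)) by exact: mpair.
pose XY : {mfun Om >-> (T1 * T2)%type} := mfun_Sub (mem_set mXY).
have h A : measurable A -> (m1 \x m2)%E A = distribution P XY A.
  move=> mA; apply: product_measure_unique => // A1 A2 mA1 mA2. rewrite /m1 /m2 /distribution /pushforward -i//.
  - by exists A1 => //; rewrite setTI.
  - by exists A2 => //; rewrite setTI.
transitivity (\int[distribution P XY]_x F x)%E.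
  by rewrite /distribution ge0_integral_pushforward// preimage_setT.
rewrite (@eq_measure_integral _ _ _ _ (m1 \x m2)%E); last by move=> A mA _; exact: esym (h A mA).
rewrite fubini_tonelli1//.
rewrite /m1 /distribution ge0_integral_pushforward//; last 2 first.
- exact: measurable_fun_fubini_tonelli_F.
- by move=> x _; apply: integral_ge0 => y _.
rewrite preimage_setT; apply: eq_integral => w _.
rewrite /= /fubini_F /m2 /distribution ge0_integral_pushforward// ?preimage_setT//.
exact: mcomp.
Qed.

Let fP : (P setT < +oo)%E := Pfin P.

Lemma independent2_Ex d1 d2 (T1 : mtype d1) (T2 : mtype d2) (X : Om -> T1) (Y : Om -> T2) (F : T1 * T2 -> R) :
  mfT X -> mfT Y -> independent2 P (sigma_rv X) (sigma_rv Y) -> bmf F ->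
  Ex P (fun w => F (X w, Y w)) = Ex P (fun w => Ex P (fun w' => F (X w, Y w'))).
Proof.
move=> mX mY i bF; have [mF [C hC]] := bF.
have C0 x : 0 <= F x + C by have := hC x; rewrite ler_norml => /andP[+ _]; rewrite -subr_ge0 opprK.
have bY w : bmf (fun w' => F (X w, Y w')).
  split; last by exists C => w'. by apply: (mcomp mF); exact: mpair.
have bXY : bmf (fun w => F (X w, Y w)).
  split; last by exists C => w'. by apply: (mcomp mF); exact: mpair.
(* Adding the bound C makes the integrand nonnegative, as Tonelli's theorem requires. *)
have := @independent2_integral _ _ T1 T2 X Y (fun x => (F x + C)%:E) mX mY i.
move=> /(_ _ _)/wrap[].
  by apply/mEFin; apply: mfD. by move=> x; rewrite lee_fin.
have bC := bmf_cst Om C.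
rewrite -(ExE fP); last exact: bmfD.
under [X in _ = X]eq_integral => w _ do rewrite -(ExE fP (bmfD (bY w) bC)) (ExD fP (bY w) bC).
have hE w : `|Ex P (fun w' => F (X w, Y w'))| <= C.
  have := le_norm_Ex fP (bY w) bC (fun w' => hC (X w, Y w')). by rewrite Ex_cst1.
have bE : bmf (fun w => Ex P (fun w' => F (X w, Y w'))).
  split; last by exists C. pose Y' : {mfun Om >-> T2} := mfun_Sub (mem_set mY).
  pose m2 : prob T2 R := distribution P Y'. have mfub : mfT (fubini_F m2 (fun x => (F x + C)%:E)).
    apply: measurable_fun_fubini_tonelli_F => [|x]; last by rewrite lee_fin. by apply/mEFin; exact: mfD.
  have -> : (fun w => Ex P (fun w' => F (X w, Y w'))) =
    (fun x => fine (fubini_F m2 (fun x => (F x + C)%:E) x) - C) \o X. apply/funext => w /=; rewrite /fubini_F /m2.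
    rewrite /distribution ge0_integral_pushforward//; last 2 first.
    - apply/mEFin; apply: mfD => //. by apply: (mcomp mF); exact: mpair.
    - by move=> y _; rewrite lee_fin. rewrite preimage_setT/= -(ExE fP (bmfD (bY w) bC)) (ExD fP (bY w) bC) /=.
    by rewrite Ex_cst1 addrK.
  apply: mcomp => //; apply: mfB => //. exact: mcomp.
rewrite -(ExE fP); last by apply: bmfD => //; exact: bmf_cst.
move=> [e]; move: e.
by rewrite (ExD fP bXY bC) (ExD fP bE (bmf_cst _ _)) !Ex_cst1 => /addIr.
Qed.

Lemma independent2_ExM d1 d2 (T1 : mtype d1) (T2 : mtype d2)
    (X : Om -> T1) (Y : Om -> T2) (f : T1 -> R) (g : T2 -> R) :
  mfT X -> mfT Y -> independent2 P (sigma_rv X) (sigma_rv Y) -> bmf f -> bmf g ->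
  Ex P (fun w => f (X w) * g (Y w)) = Ex P (fun w => f (X w)) * Ex P (fun w => g (Y w)).
Proof.
move=> mX mY i bf bg; have bgY := bmf_comp bg mY; have bfX := bmf_comp bf mX.
rewrite (@independent2_Ex _ _ _ _ X Y (fun x => f x.1 * g x.2))//; last first.
  by apply: bmfM; [exact: bmf_comp bf measurable_fst|exact: bmf_comp bg measurable_snd].
rewrite -(ExZr fP)//; apply: eq_Ex => w /=.
by rewrite (ExZ fP _ bgY).
Qed.

Lemma independent2_ExM_real (f g : Om -> R) : bmf f -> bmf g -> independent2 P (sigma_rv f) (sigma_rv g) ->
  Ex P (fun w => f w * g w) = Ex P f * Ex P g.
Proof.
move=> [mf [C hC]] [mg [D hD]] i.
(* The product rule asks for bounded test functions on the line; clipping at the bounds of f and g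
   provides them and leaves f and g unchanged. *)
pose cl (K x : R) := Num.max (- K) (Num.min x K).
have mcl K : bmf (cl K).
  split; first by apply: measurable_maxr => //; exact: measurable_minr.
  exists `|K| => x; rewrite /cl ler_norml le_max lerN2 ler_norm /=.
  by rewrite ge_max ge_min ler_norm orbT andbT (le_trans (ler_norm _))// normrN.
have clE K x : `|x| <= K -> cl K x = x by rewrite ler_norml /cl => /andP[h1 h2]; rewrite min_l// max_r.
have := independent2_ExM mf mg i (mcl C) (mcl D).
have -> : (fun w => cl C (f w)) = f by apply/funext => w; exact: clE.
have -> : (fun w => cl D (g w)) = g by apply/funext => w; exact: clE.
by under eq_fun do rewrite !clE//.
Qed.

End sub_sigma.

(** * Ordered products of substochastic matrices over blocks *)

Section substochastic.
Context (R : realType) (n : nat).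
Local Notation M := 'M[R]_n.+1.
Implicit Types (A B : M).

Definition nrm A : R := \sum_i \sum_j `|A i j|.

Lemma nrm_ge0 A : 0 <= nrm A.
Proof. by apply: sumr_ge0 => i _; apply: sumr_ge0. Qed.

Lemma nrm_entry A i j : `|A i j| <= nrm A.
Proof.
rewrite /nrm (bigD1 i)//= (bigD1 j)//= -addrA lerDl addr_ge0//.
  exact: sumr_ge0.
by apply: sumr_ge0 => k _; apply: sumr_ge0.
Qed.

Lemma nrmD A B : nrm (A + B) <= nrm A + nrm B.
Proof.
rewrite /nrm -big_split/=; apply: ler_sum => i _.
by rewrite -big_split/=; apply: ler_sum => j _; rewrite mxE ler_normD.
Qed.

Lemma nrmN A : nrm (- A) = nrm A.
Proof. by apply: eq_bigr => i _; apply: eq_bigr => j _; rewrite mxE normrN. Qed.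

Lemma nrmB A B : nrm (A - B) = nrm (B - A).
Proof. by rewrite -nrmN opprB. Qed.

Lemma nrm0 : nrm 0 = 0.
Proof. by rewrite /nrm big1// => i _; rewrite big1// => j _; rewrite mxE normr0. Qed.

Lemma nrmZ c A : nrm (c *: A) = `|c| * nrm A.
Proof.
rewrite /nrm mulr_sumr; apply: eq_bigr => i _; rewrite mulr_sumr.
by apply: eq_bigr => j _; rewrite mxE normrM.
Qed.

Lemma nrm_eq0 A : nrm A <= 0 -> A = 0.
Proof.
move=> h; apply/matrixP => i j; rewrite mxE; apply/eqP; rewrite -normr_le0.
exact: le_trans (nrm_entry A i j) h.
Qed.

Lemma nrm_le A (e : R) : (forall i j, `|A i j| <= e) -> nrm A <= n.+1%:R ^+ 2 * e.
Proof.
move=> h; apply: (@le_trans _ _ (\sum_(i < n.+1) \sum_(j < n.+1) e)).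
  by apply: ler_sum => i _; apply: ler_sum => j _.
by rewrite !sumr_const !card_ord -mulrnA -[leLHS]mulr_natl natrM expr2.
Qed.

Lemma nrmM A B : nrm (A * B) <= nrm A * nrm B.
Proof.
rewrite /nrm mulr_suml; apply: ler_sum => i _.
apply: (@le_trans _ _ (\sum_j \sum_k `|A i k| * `|B k j|)).
  apply: ler_sum => j _; rewrite mxE; apply: (le_trans (ler_norm_sum _ _ _)).
  by apply: ler_sum => k _; rewrite normrM.
rewrite exchange_big/= mulr_suml; apply: ler_sum => k _.
rewrite -mulr_sumr; apply: ler_wpM2l => //; rewrite [leRHS](bigD1 k)//= lerDl.
by apply: sumr_ge0 => l _; apply: sumr_ge0.
Qed.

Definition substoch A := (forall i j, 0 <= A i j) /\ forall i, \sum_j A i j <= 1.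

Lemma substoch1 : substoch 1.
Proof.
split=> [i j|i]; first by rewrite mxE; case: (i == j).
rewrite (bigD1 i)//= big1 => [|j /negPf ji]; first by rewrite mxE eqxx addr0.
by rewrite mxE eq_sym ji.
Qed.

Lemma substochM A B : substoch A -> substoch B -> substoch (A * B).
Proof.
move=> [A0 A1] [B0 B1]; split=> [i j|i].
  by rewrite mxE; apply: sumr_ge0 => k _; rewrite mulr_ge0.
under eq_bigr do rewrite mxE.
rewrite exchange_big/=; apply: le_trans (A1 i); apply: ler_sum => k _.
by rewrite -mulr_sumr ler_piMr.
Qed.

Lemma substoch_nrm A : substoch A -> nrm A <= n.+1%:R.
Proof.
move=> [A0 A1]; apply: (@le_trans _ _ (\sum_(i < n.+1) 1)).
  apply: ler_sum => i _; apply: le_trans (A1 i). by apply: ler_sum => j _; rewrite ger0_norm.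
by rewrite sumr_const card_ord.
Qed.

Lemma substoch_entry A i j : substoch A -> 0 <= A i j <= 1.
Proof.
move=> [A0 A1]; rewrite A0/=; apply: le_trans (A1 i).
by rewrite (bigD1 j)//= lerDl; apply: sumr_ge0.
Qed.

Lemma substoch_prod (I : eqType) (s : seq I) (F : I -> M) :
  {in s, forall i, substoch (F i)} -> substoch (\prod_(i <- s) F i).
Proof.
move=> h; rewrite big_seq; apply: big_ind => //; first exact: substoch1.
exact: substochM.
Qed.

Definition Kn : R := n.+1%:R ^+ 2.

Lemma Kn_ge0 : 0 <= Kn. Proof. exact: sqr_ge0. Qed.

(** Factors are exchanged one at a time; the bound is linear in the errors because partial products
    of substochastic matrices are substochastic. *)
Lemma nrm_prodB (I : eqType) (s : seq I) (F H : I -> M) :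
  {in s, forall i, substoch (F i)} -> {in s, forall i, substoch (H i)} ->
  nrm (\prod_(i <- s) F i - \prod_(i <- s) H i) <= Kn * \sum_(i <- s) nrm (F i - H i).
Proof.
move=> hF hH.
(* The induction carries the factors already passed as a substochastic matrix A on the left;
   estimating by [nrmM] alone would give a constant that grows with the length of the product. *)
suff h : forall A, substoch A -> nrm (A * (\prod_(i <- s) F i - \prod_(i <- s) H i)) <=
    Kn * \sum_(i <- s) nrm (F i - H i).
  by have := h _ substoch1; rewrite mul1r.
elim: s hF hH => [|i s IH] hF hH A sA.
  by rewrite !big_nil subrr mulr0 nrm0 mulr0.
rewrite !big_cons.
have -> : A * (F i * \prod_(j <- s) F j - H i * \prod_(j <- s) H j) = A * (F i - H i) * \prod_(j <- s) F j +
   (A * H i) * (\prod_(j <- s) F j - \prod_(j <- s) H j).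
  by rewrite !mulrBr mulrBl !mulrA addrA subrK.
rewrite [leRHS]mulrDr; apply: le_trans (nrmD _ _) _; apply: lerD.
  apply: le_trans (nrmM _ _) _; rewrite /Kn expr2 -mulrA mulrC. apply: ler_pM => //; try exact: nrm_ge0.
    by apply: substoch_nrm; apply: substoch_prod => j js; apply: hF; rewrite inE js orbT.
  apply: le_trans (nrmM _ _) _; apply: ler_wpM2r; first exact: nrm_ge0. exact: substoch_nrm.
apply: IH => [j js|j js|].
- by apply: hF; rewrite inE js orbT.
- by apply: hH; rewrite inE js orbT.
- by apply: substochM => //; apply: hH; rewrite mem_head.
Qed.

(** Closeness to the identity, linear in the length, makes products over infinitely many blocks
    converge; substochasticity keeps the partial products bounded. *)
Definition good (C : R) (G : R -> M) := [/\ 0 <= C, forall x, 0 <= x -> substoch (G x)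
    & forall x, 0 <= x -> nrm (G x - 1) <= C * x].

End substochastic.

Section chains.
Context {R : realType}.
Implicit Types (b : set (R * R)) (s t : seq (R * R)) (U V : R * R).

Definition ltb U V := U.1 < V.1.
Definition chain b s := sorted ltb s /\ forall U, U \in s -> b U.
Definition tl s := \sum_(U <- s) block_len U.

(* b is a set of nonoverlapping intervals of total length m; the order in
   which products over b are taken is that of the left end points. *)
Definition blocks_of (m : R) b := [/\ forall U, b U -> U.1 < U.2, forall U V, b U -> b V -> U.1 = V.1 -> U = V,
  forall s, chain b s -> tl s <= m & forall e : R, 0 < e -> exists2 s, chain b s & m - e < tl s].

Lemma ltb_trans : transitive ltb.
Proof. by move=> V U W; exact: lt_trans. Qed.

Lemma ltb_irr : irreflexive ltb.
Proof. by move=> U; rewrite /ltb ltxx. Qed.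

Lemma chain_uniq b s : chain b s -> uniq s.
Proof. by move=> [ss _]; apply: sorted_uniq ss; [exact: ltb_trans|exact: ltb_irr]. Qed.

Lemma chain_subE b b' s t : chain b s -> chain b' t -> {subset s <= t} -> s = [seq U <- t | U \in s].
Proof.
move=> [ss _] [st _] sub; apply: (irr_sorted_eq ltb_trans ltb_irr) => //.
  by apply: sorted_filter => //; exact: ltb_trans.
by move=> U; rewrite mem_filter; case: (boolP (U \in s)) => //= /sub ->.
Qed.

Lemma sort_chain b s : (forall U V, b U -> b V -> U.1 = V.1 -> U = V) -> uniq s -> (forall U, U \in s -> b U) ->
  chain b (sort (fun U V => U.1 <= V.1) s).
Proof.
move=> inj us sb; split; last by move=> U; rewrite mem_sort; exact: sb.
have tot : total (fun U V => U.1 <= V.1) by move=> U V; exact: le_total.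
have := sort_sorted tot s; set t := sort _ s => st.
have ut : uniq t by rewrite sort_uniq.
have tb : forall U, U \in t -> b U by move=> U; rewrite mem_sort; exact: sb.
move: st ut tb; case: t => // U t /=.
elim: t U => // V t IH U /= /andP[UV pt] /and3P[nU nV ut] tb.
rewrite IH//; [|by rewrite nV|by move=> W h; apply: tb; rewrite inE h orbT].
rewrite andbT /ltb lt_neqAle UV andbT; apply/eqP => e.
have bV : b V by apply: tb; rewrite !inE eqxx orbT.
have h := inj U V (tb _ (mem_head _ _)) bV e.
by move: nU; rewrite h mem_head.
Qed.

Lemma chain_merge m b s t : blocks_of m b -> chain b s -> chain b t ->
  exists u, [/\ chain b u, {subset s <= u} & {subset t <= u}].
Proof.
move=> [_ inj _ _] cs ct.
exists (sort (fun U V => U.1 <= V.1) (undup (s ++ t))); split.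
- apply: sort_chain; [exact: inj|exact: undup_uniq|]. by move=> U; rewrite mem_undup mem_cat => /orP[/cs.2|/ct.2].
- by move=> U Us; rewrite mem_sort mem_undup mem_cat Us.
- by move=> U Us; rewrite mem_sort mem_undup mem_cat Us orbT.
Qed.

Definition big_set b (k : nat) := [set U | b U /\ k.+1%:R^-1 < block_len U].

Definition bigb b (k : nat) : seq (R * R) := sort (fun U V => U.1 <= V.1) (enum_fset (fset_set (big_set b k))).

Lemma block_len_ge0 m b U : blocks_of m b -> b U -> 0 < block_len U.
Proof. by move=> [h _ _ _] /h; rewrite subr_gt0. Qed.

Lemma tl_cat s t : tl (s ++ t) = tl s + tl t.
Proof. by rewrite /tl big_cat. Qed.

Lemma tl_sub m b s t : blocks_of m b -> chain b s -> chain b t -> {subset s <= t} ->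
  tl t - tl s = \sum_(U <- t | U \notin s) block_len U.
Proof.
move=> hb cs ct st.
have -> : tl s = \sum_(U <- t | U \in s) block_len U by rewrite /tl {1}(chain_subE cs ct st) big_filter.
by rewrite /tl (bigID (mem s)) /= addrAC subrr add0r.
Qed.

Lemma finite_big_set0 (m : R) b k : (forall U V, b U -> b V -> U.1 = V.1 -> U = V) ->
  (forall s, chain b s -> tl s <= m) -> finite_set (big_set b k).
Proof.
move=> inj ub; apply: contrapT => inf.
have [B BA Bn] := infinite_set_fset (Num.trunc (m * k.+1%:R)).+1 inf.
have c : chain b (sort (fun U V => U.1 <= V.1) (enum_fset B)).
  by apply: sort_chain => // [|U UB]; [exact: fset_uniq|have [] := BA U UB].
have := ub _ c; apply/negP; rewrite -ltNge.
have : (size (enum_fset B))%:R * k.+1%:R^-1 <= tl (enum_fset B).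
  rewrite /tl big_seq -sum1_size natr_sum big_seq mulr_suml; apply: ler_sum => U UB.
  by rewrite mul1r; have [_ /ltW] := BA U UB.
rewrite {2}/tl (perm_big _ (permEl (perm_sort _ _))) -/(tl _) /=.
apply: lt_le_trans; rewrite ltr_pdivlMr ?ltr0n//.
apply: lt_le_trans (truncnS_gt _) _.
by rewrite ler_nat.
Qed.

Lemma finite_big_set m b k : blocks_of m b -> finite_set (big_set b k).
Proof. by move=> [_ inj ub _]; exact: finite_big_set0 inj ub. Qed.

Lemma mem_bigb m b k U : blocks_of m b -> (U \in bigb b k) <-> (b U /\ k.+1%:R^-1 < block_len U).
Proof.
move=> hb; rewrite mem_sort in_fset_set ?inE//; exact: finite_big_set hb.
Qed.

Lemma chain_bigb m b k : blocks_of m b -> chain b (bigb b k).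
Proof.
move=> hb; have [_ inj _ _] := hb; apply: sort_chain => // [|U]; first exact: fset_uniq.
by rewrite in_fset_set ?inE => [[]|]//; exact: finite_big_set hb.
Qed.

Lemma big_blocks_homo m b k l : blocks_of m b -> (k <= l)%N ->
  {subset bigb b k <= bigb b l}.
Proof.
move=> hb kl U /(mem_bigb _ _ hb)[bU h]; apply/(mem_bigb _ _ hb); split=> //.
by apply: le_lt_trans h; rewrite lef_pV2 ?posrE ?ltr0n// ler_nat.
Qed.

Lemma chain_in_big m b s : blocks_of m b -> chain b s -> \forall k \near \oo, {subset s <= bigb b k}.
Proof.
move=> hb [_]; elim: s => [|U s IH] sb; first by apply: nearW => k U.
have bU : b U by apply: sb; rewrite mem_head.
have hs : forall V, V \in s -> b V by move=> V Vs; apply: sb; rewrite inE Vs orbT.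
have U0 := block_len_ge0 hb bU.
near=> k => V; rewrite inE => /orP[/eqP->|]; last first.
  by move: V; near: k; exact: IH.
apply/(mem_bigb _ _ hb); split=> //; near: k.
exact: near_infty_natSinv_lt (PosNum U0).
Unshelve. all: by end_near. Qed.

Lemma near_tl_big m b e : blocks_of m b -> 0 < e -> \forall k \near \oo, m - e < tl (bigb b k).
Proof.
move=> hb e0; have [_ _ _ /(_ e e0)[s cs ms]] := hb.
have := chain_in_big hb cs; apply: filterS => k sk.
apply: lt_le_trans ms _; rewrite -subr_ge0 (tl_sub hb cs (chain_bigb k hb) sk).
rewrite big_seq_cond; apply: sumr_ge0 => U /andP[/(mem_bigb _ _ hb)[bU _] _].
exact/ltW/(block_len_ge0 hb).
Qed.

Lemma cvg_tl_big m b : blocks_of m b -> tl (bigb b k) @[k --> \oo] --> m.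
Proof.
move=> hb; apply/cvgrPdist_lt => e e0.
have := near_tl_big hb e0; apply: filterS => k h.
have [_ _ /(_ _ (chain_bigb k hb)) ub _] := hb.
by rewrite ger0_norm ?subr_ge0// ltrBlDr addrC -ltrBlDr.
Qed.

Section product.
Context (n : nat).
Implicit Types G : R -> 'M[R]_n.+1.

Definition mprod G s : 'M[R]_n.+1 := \prod_(U <- s) G (block_len U).

(** The blocks can in general not be enumerated from left to right, so the ordered product is a
    limit of finite products, over the blocks longer than [1/(k+1)]. *)
Definition MG G b : 'M[R]_n.+1 := \matrix_(i, j) limn (fun k => mprod G (bigb b k) i j).

Lemma mprod_cat G s t : mprod G (s ++ t) = mprod G s * mprod G t.
Proof. by rewrite /mprod big_cat. Qed.

Lemma substoch_mprod C G m b s : good C G -> blocks_of m b -> chain b s -> substoch (mprod G s).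
Proof.
move=> [_ hG _] hb [_ sb]; apply: substoch_prod => U Us; apply: hG.
exact/ltW/(block_len_ge0 hb)/sb.
Qed.

(** The product over s is a product over t with factor 1 at the additional blocks, and there the
    true factor is within C times the block length of 1. *)
Lemma mprod_sub C G m b s t : good C G -> blocks_of m b -> chain b s -> chain b t ->
  {subset s <= t} -> nrm (mprod G t - mprod G s) <= Kn R n * C * (tl t - tl s).
Proof.
move=> [C0 hG GL] hb cs ct st.
have -> : mprod G s = \prod_(U <- t) (if U \in s then G (block_len U) else 1).
  by rewrite /mprod [in LHS](chain_subE cs ct st) big_filter big_mkcond.
have tb U : U \in t -> 0 <= block_len U by move=> /ct.2 /(block_len_ge0 hb)/ltW.
apply: le_trans (nrm_prodB _ _) _.
- by move=> U /tb; exact: hG.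
- by move=> U /tb /hG; case: ifP => // _ _; exact: substoch1.
rewrite -mulrA ler_wpM2l ?Kn_ge0// (tl_sub hb cs ct st) mulr_sumr [leRHS]big_mkcond.
rewrite big_seq [leRHS]big_seq; apply: ler_sum => U Ut; case: ifP => Us /=.
  by rewrite subrr nrm0.
exact/GL/tb.
Qed.

Lemma MG_cvg C G m b i j : good C G -> blocks_of m b -> mprod G (bigb b k) i j @[k --> \oo] --> MG G b i j.
Proof.
move=> hG hb; rewrite mxE.
suff : cvgn (fun k => mprod G (bigb b k) i j) by [].
have [C0 _ _] := hG.
apply/cauchy_cvgP/cauchy_exP => e e0.
pose D := Kn R n * C + 1.
have D0 : 0 < D by rewrite ltr_wpDl// mulr_ge0 ?Kn_ge0.
have [N _ hN] := near_tl_big hb (divr_gt0 e0 D0).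
exists (mprod G (bigb b N) i j).
change (\forall k \near \oo, ball (mprod G (bigb b N) i j) e (mprod G (bigb b k) i j)).
near=> k.
have Nk : (N <= k)%N by near: k; exact: nbhs_infty_ge.
rewrite /ball /= distrC.
have := nrm_entry (mprod G (bigb b k) - mprod G (bigb b N)) i j.
rewrite !mxE; move=> /le_lt_trans; apply.
apply: le_lt_trans (mprod_sub hG hb _ _ (big_blocks_homo hb Nk)) _; try exact: chain_bigb hb.
have := hN _ (leqnn N); rewrite /= ltrBlDr -ltrBlDl => h.
have [_ _ /(_ _ (chain_bigb k hb)) ub _] := hb.
apply: (@le_lt_trans _ _ (Kn R n * C * (m - tl (bigb b N)))).
  by apply: ler_wpM2l; [rewrite mulr_ge0 ?Kn_ge0|rewrite lerD2r].
apply: (@le_lt_trans _ _ (D * (m - tl (bigb b N)))).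
  apply: ler_wpM2r; last by rewrite lerDl. have [_ _ /(_ _ (chain_bigb N hb)) ubN _] := hb. by rewrite subr_ge0.
by rewrite mulrC -ltr_pdivlMr.
Unshelve. all: by end_near. Qed.

Lemma nrm_cvg (F : nat -> 'M[R]_n.+1) (A : 'M[R]_n.+1) :
  (forall i j, F k i j @[k --> \oo] --> A i j) -> nrm (F k) @[k --> \oo] --> nrm A.
Proof.
move=> h; rewrite /nrm; apply: cvg_big => [|i _]; first exact: add_continuous.
by apply: cvg_big => [|j _]; [exact: add_continuous|apply: cvg_norm].
Qed.

Lemma MG_approx C G m b s : good C G -> blocks_of m b -> chain b s ->
  nrm (MG G b - mprod G s) <= Kn R n * C * (m - tl s).
Proof.
move=> hG hb cs.
have h : nrm (mprod G (bigb b k) - mprod G s) @[k --> \oo] --> nrm (MG G b - mprod G s).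
  apply: nrm_cvg => i j; rewrite !mxE; under eq_fun do rewrite !mxE.
  by apply: cvgB; [have := @MG_cvg _ _ _ _ i j hG hb; rewrite mxE|exact: cvg_cst].
rewrite -(cvg_lim (@Rhausdorff R) h); apply: limr_le; first exact: cvgP h.
near=> k.
have sk : {subset s <= bigb b k} by near: k; exact: chain_in_big hb cs.
apply: le_trans (mprod_sub hG hb cs (chain_bigb k hb) sk) _.
have [C0 _ _] := hG; apply: ler_wpM2l; first by rewrite mulr_ge0 ?Kn_ge0.
have [_ _ /(_ _ (chain_bigb k hb)) ub _] := hb.
by rewrite lerD2r.
Unshelve. all: by end_near. Qed.

Lemma substoch_lim (F : nat -> 'M[R]_n.+1) (A : 'M[R]_n.+1) :
  (forall i j, F k i j @[k --> \oo] --> A i j) -> (forall k, substoch (F k)) -> substoch A.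
Proof.
move=> h sF; split=> [i j|i].
  rewrite -(cvg_lim (@Rhausdorff R) (h i j)); apply: limr_ge; first exact: cvgP (h i j).
  by apply: nearW => k; case: (sF k).
have c : \sum_j F k i j @[k --> \oo] --> \sum_j A i j.
  by apply: cvg_big => [|j _]; [exact: add_continuous|exact: h].
rewrite -(cvg_lim (@Rhausdorff R) c); apply: limr_le; first exact: cvgP c.
by apply: nearW => k; case: (sF k).
Qed.

Lemma substoch_MG C G m b : good C G -> blocks_of m b -> substoch (MG G b).
Proof.
move=> hG hb; apply: (substoch_lim (fun i j => @MG_cvg _ _ _ _ i j hG hb)) => k.
exact: substoch_mprod hG hb (chain_bigb k hb).
Qed.

Lemma MG_unique C G m b (A : 'M[R]_n.+1) : good C G -> blocks_of m b ->
  (forall e : R, 0 < e -> exists s, [/\ chain b s, m - e < tl s & nrm (A - mprod G s) <= e]) -> A = MG G b.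
Proof.
move=> hG hb h; apply/eqP; rewrite -subr_eq0; apply/eqP/nrm_eq0.
apply/ler_addgt0Pl => e e0; rewrite addr0.
have [C0 _ _] := hG.
pose D := Kn R n * C + 1.
have D0 : 0 < D by rewrite ltr_wpDl// mulr_ge0 ?Kn_ge0.
have [s [cs ms As]] := h _ (divr_gt0 e0 D0).
have -> : A - MG G b = (A - mprod G s) - (MG G b - mprod G s) by rewrite opprB addrA subrK.
apply: le_trans (nrmD _ _) _; rewrite nrmN.
apply: (@le_trans _ _ (e / D + Kn R n * C * (e / D))).
  apply: lerD => //; apply: le_trans (MG_approx hG hb cs) _. apply: ler_wpM2l; first by rewrite mulr_ge0 ?Kn_ge0.
  by rewrite lerBlDr -lerBlDl ltW.
by rewrite -[X in X + _]mul1r -mulrDl [1 + _]addrC -/D mulrCA divff ?mulr1// gt_eqF.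
Qed.

End product.
End chains.

(** * Interval partitions as totally ordered families of blocks *)

Section ip_blocks.
Context {R : realType}.
Implicit Types (b : set (R * R)) (s t : seq (R * R)) (U V : R * R) (M : R).

Definition ipo M b := [/\ 0 <= M, forall U, b U -> [/\ 0 <= U.1, U.1 < U.2 & U.2 <= M] & trivIset b block_itv].

Lemma ipo_overlap M b U V : ipo M b -> b U -> b V -> U.1 <= V.1 -> V.1 < U.2 -> U = V.
Proof.
move=> [_ h tr] bU bV UV VU; apply: tr => //.
have [_ U12 _] := h _ bU; have [_ V12 _] := h _ bV.
exists ((V.1 + Num.min U.2 V.2) / 2); rewrite /block_itv /= !in_itv/=.
have hm : V.1 < Num.min U.2 V.2 by rewrite lt_min VU V12.
have h1 : Num.min U.2 V.2 <= U.2 by rewrite ge_min lexx.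
have h2 : Num.min U.2 V.2 <= V.2 by rewrite ge_min lexx orbT.
by split; apply/andP; split; lra.
Qed.

Lemma ipo_inj M b U V : ipo M b -> b U -> b V -> U.1 = V.1 -> U = V.
Proof.
move=> hb bU bV UV; apply: (ipo_overlap hb) => //; first by rewrite UV.
by have [_ h _] := hb; have [_ + _] := h _ bU; rewrite UV.
Qed.

Lemma ipo_sep M b U V : ipo M b -> b U -> b V -> U.1 < V.1 -> U.2 <= V.1.
Proof.
move=> hb bU bV UV; rewrite leNgt; apply/negP => VU.
by have e := ipo_overlap hb bU bV (ltW UV) VU; move: UV; rewrite e ltxx.
Qed.

Lemma ipo_tl_cons M b U s : ipo M b -> chain b (U :: s) -> tl (U :: s) <= M - U.1.
Proof.
move=> hb; have [_ h _] := hb.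
elim: s U => [|V s IH] U [/= so sb]; rewrite /tl big_cons.
  rewrite big_nil addr0 /block_len lerD2r. by have [_ _] := h U (sb _ (mem_head _ _)).
move: so => /andP[UV so].
have c : chain b (V :: s) by split=> // W Ws; apply: sb; rewrite inE Ws orbT.
apply: (@le_trans _ _ (block_len U + (M - V.1))); first by rewrite lerD2l; exact: IH.
have := @ipo_sep _ _ U V hb (sb _ (mem_head _ _)) (c.2 _ (mem_head _ _)) UV.
rewrite /block_len; lra.
Qed.

Lemma ipo_tl M b s : ipo M b -> chain b s -> tl s <= M.
Proof.
move=> hb; have [M0 h _] := hb; case: s => [|U s] c; first by rewrite /tl big_nil.
apply: le_trans (ipo_tl_cons hb c) _; rewrite gerBl.
by have [] := h U (c.2 _ (mem_head _ _)).
Qed.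

Lemma measurable_block_itv U : measurable (block_itv U).
Proof. exact: measurable_itv. Qed.

Lemma leb_chain M b s : ipo M b -> chain b s -> leb (\big[setU/set0]_(U <- s) block_itv U) = (tl s)%:E.
Proof.
move=> hb c; have us := chain_uniq c; have sb := c.2; move: us sb {c}.
have [_ h tr] := hb.
elim: s => [|U s IH] /= => [_ _|/andP[nU us] sb]; first by rewrite big_nil /tl big_nil measure0.
have bU : b U by apply: sb; exact: mem_head.
have bs V : V \in s -> b V by move=> Vs; apply: sb; rewrite inE Vs orbT.
have [_ U12 _] := h _ bU.
rewrite big_cons measureU//; first last.
- rewrite -bigcup_seq; apply/seteqP; split=> // x [Ux [V Vs Vx]].
  by have e := tr _ _ bU (bs _ Vs) (ex_intro _ x (conj Ux Vx)); move: nU; rewrite e Vs.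
- by apply: bigsetU_measurable => V _; exact: measurable_block_itv.
- exact: measurable_block_itv.
rewrite /tl big_cons EFinD; congr (_ + _)%E; last exact: IH.
have e : leb (block_itv U) = (block_len U)%:E.
  by rewrite /block_itv lebesgue_measure_itv/= lte_fin U12 -EFinB.
exact: e.
Qed.

Lemma ipo_finite_big M b k : ipo M b -> finite_set (big_set b k).
Proof.
move=> hb; apply: (@finite_big_set0 _ M) => [U V|s]; first exact: ipo_inj hb.
exact: ipo_tl hb.
Qed.

Lemma ipo_chain_big M b k : ipo M b -> chain b (bigb b k).
Proof.
move=> hb; apply: sort_chain => // [U V||U]; first exact: ipo_inj hb.
  exact: fset_uniq.
by rewrite in_fset_set ?inE => [[]|]//; exact: ipo_finite_big hb.
Qed.

(** The measure of the uncovered set is M minus the total block length, which is the supremum of the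
    lengths of finite chains. The null condition thus takes a form that is easily carried through
    scaling and concatenation. *)
Lemma ipo_nullP M b : ipo M b -> leb (`[0, M]%classic `\` \bigcup_(U in b) block_itv U) = 0%E <->
  (forall e : R, 0 < e -> exists2 s, chain b s & M - e < tl s).
Proof.
move=> hb; have [M0 h tr] := hb.
have mB : measurable (\bigcup_(U in b) block_itv U).
  by apply: open_measurable; apply: bigcup_open => U _; exact: interval_open.
have mI : measurable (`[0, M]%classic : set R) by exact: measurable_itv.
have lI : leb (`[0, M]%classic : set R) = M%:E.
  rewrite lebesgue_measure_itv/= lte_fin -EFinB subr0; case: ltP => //.
  by move=> hM; congr EFin; apply/eqP; rewrite eq_le M0 hM.
have sB : \bigcup_(U in b) block_itv U `<=` `[0, M]%classic.
  move=> x [U bU]; rewrite /block_itv /= !in_itv/= => /andP[x1 x2].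
  by have [h1 _ h2] := h _ bU; apply/andP; split; lra.
have lB : (leb (\bigcup_(U in b) block_itv U) <= M%:E)%E.
  by rewrite -lI; apply: le_measure; rewrite ?inE.
have lD : leb (`[0, M]%classic `\` \bigcup_(U in b) block_itv U) = (M%:E - leb (\bigcup_(U in b) block_itv U))%E.
  have lI' : (leb (`[0%R, M]%classic : set R) < +oo)%E by rewrite lI ltry.
  rewrite measureD//; congr (_ - _)%E; first exact: lI. by rewrite setIidr.
split=> [null e e0|hs].
  have lBM : leb (\bigcup_(U in b) block_itv U) = M%:E.
    have fB : leb (\bigcup_(U in b) block_itv U) \is a fin_num.
      by rewrite ge0_fin_numE// (le_lt_trans lB)// ltry.
    move: null; rewrite lD -(fineK fB) -EFinB => -[/eqP]; rewrite subr_eq0 => /eqP <-. by [].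
  (* The union of the blocks is exhausted by the increasing unions [F k], each of which has the
     length of a finite chain. *)
  pose F k := \bigcup_(U in big_set b k) block_itv U.
  have mF k : measurable (F k) by apply: open_measurable; apply: bigcup_open => U _; exact: interval_open.
  have FE : \bigcup_k F k = \bigcup_(U in b) block_itv U.
    apply/seteqP; split=> x; first by move=> [k _ [U [bU _] Ux]]; exists U.
    move=> [U bU Ux]; have [_ U12 _] := h _ bU. have U0 : 0 < block_len U by rewrite subr_gt0.
    have [N _ /(_ N (leqnn N)) hN] := near_infty_natSinv_lt (PosNum U0). by exists N => //; exists U.
  have ndF : {homo F : n m / (n <= m)%N >-> (n <= m)%O}.
    move=> k l kl; apply/subsetPset => x [U [bU hU] Ux]; exists U => //; split=> //.
    by apply: le_lt_trans hU; rewrite lef_pV2 ?posrE ?ltr0n// ler_nat.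
  have Flen k : leb (F k) = (tl (bigb b k))%:E.
    rewrite -(leb_chain hb (ipo_chain_big k hb)) -bigcup_seq; congr (leb _).
    suff -> : [set` bigb b k] = big_set b k by []. have fin := ipo_finite_big k hb.
    apply/seteqP; split=> U /=; rewrite mem_sort in_fset_set//.
      by move=> h1; exact: set_mem h1.
    by move=> h1; exact: mem_set h1.
  have mFU : measurable (\bigcup_k F k) by rewrite FE.
  have cF : leb (F k) @[k --> \oo] --> M%:E by rewrite -lBM -FE; exact: nondecreasing_cvg_mu.
  have : (tl (bigb b k)) @[k --> \oo] --> M.
    apply: (@cvg_trans _ (fine (leb (F k)) @[k --> \oo])); last exact: fine_cvg.
    by apply: near_eq_cvg; apply: nearW => k /=; rewrite Flen.
  move=> /cvgrPdist_lt /(_ e e0)[N _ /(_ N (leqnn N)) /=] hN. exists (bigb b N); first exact: ipo_chain_big hb.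
  rewrite ltrBlDr -ltrBlDl; apply: le_lt_trans hN; exact: ler_norm.
suff e : leb (\bigcup_(U in b) block_itv U) = M%:E by rewrite lD e subee.
apply/eqP; rewrite eq_le lB /=.
apply/lee_addgt0Pr => e e0; have [s cs ms] := hs e e0.
apply: (@le_trans _ _ ((tl s)%:E + e%:E)%E).
  by rewrite -EFinD lee_fin -lerBlDr ltW.
rewrite leeD2r// -(leb_chain hb cs); apply: le_measure; rewrite ?inE//.
  by apply: bigsetU_measurable => V _; exact: measurable_block_itv.
by rewrite -bigcup_seq => x [U Us Ux]; exists U => //; exact: cs.2.
Qed.

Lemma is_ip_ofP M b : is_ip_of M b <-> ipo M b /\ (forall e : R, 0 < e -> exists2 s, chain b s & M - e < tl s).
Proof.
split=> [[M0 h tr null]|[hb hs]].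
  by have hb : ipo M b by []; split=> //; apply/ipo_nullP.
by have [M0 h tr] := hb; split=> //; apply/(ipo_nullP hb).
Qed.

Lemma is_ip_mass b : is_ip b -> is_ip_of (ip_mass b) b.
Proof. by move=> [M hM]; rewrite (ip_massE hM). Qed.

Lemma ipo_mass b : is_ip b -> ipo (ip_mass b) b.
Proof. by move=> /is_ip_mass/is_ip_ofP[]. Qed.

Lemma ip_blocks_of b : is_ip b -> blocks_of (ip_mass b) b.
Proof.
move=> /is_ip_mass/is_ip_ofP[hb hs]; have [_ h _] := hb; split=> //.
- by move=> U /h[].
- by move=> U V; exact: ipo_inj hb.
- by move=> s; exact: ipo_tl hb.
Qed.

Lemma ip_mass_ge0 b : is_ip b -> 0 <= ip_mass b.
Proof. by move=> /ipo_mass[]. Qed.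

Definition sc (c : R) U := (c * U.1, c * U.2).

Lemma sc_len c U : block_len (sc c U) = c * block_len U.
Proof. by rewrite /block_len mulrBr. Qed.

Lemma sc_inj c : 0 < c -> injective (sc c).
Proof.
move=> c0 [u1 u2] [v1 v2] [] /(mulfI (lt0r_neq0 c0)) -> /(mulfI (lt0r_neq0 c0)) ->.
by [].
Qed.

Lemma ip_scaleE c b : 0 < c -> ip_scale c b = sc c @` b.
Proof. by rewrite /ip_scale => ->. Qed.

Lemma chain_scale c b s : 0 < c -> chain b s -> chain (sc c @` b) (map (sc c) s).
Proof.
move=> c0 [ss sb]; split.
  rewrite sorted_map; apply: sub_sorted ss => U V. by rewrite /ltb /relpre /= ltr_pM2l.
by move=> _ /mapP[U /sb bU ->]; exists U.
Qed.

Lemma tl_scale c s : tl (map (sc c) s) = c * tl s.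
Proof. by rewrite /tl big_map mulr_sumr; apply: eq_bigr => U _; rewrite sc_len. Qed.

Lemma chain_scaleV c b s : 0 < c -> chain (sc c @` b) s -> exists2 t, chain b t & s = map (sc c) t.
Proof.
move=> c0 [ss sb]; exists (map (sc c^-1) s); last first.
  rewrite -map_comp map_id_in// => U _; case: U => u1 u2 /=. by rewrite /sc/= !mulVKf// gt_eqF.
split; last first.
  move=> _ /mapP[U /sb[V bV <-] ->]; case: V bV => v1 v2 bV. by rewrite /sc/= !mulKf// gt_eqF.
rewrite sorted_map; apply: sub_sorted ss => U V.
by rewrite /ltb /relpre /= ltr_pM2l// invr_gt0.
Qed.

Lemma is_ip_of_scale M c b : 0 < c -> is_ip_of M b -> is_ip_of (c * M) (ip_scale c b).
Proof.
move=> c0 /is_ip_ofP[[M0 h tr] hs]; rewrite ip_scaleE//; apply/is_ip_ofP; split.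
  split; first by rewrite mulr_ge0// ltW.
    move=> _ [U bU <-]; have [h1 h2 h3] := h _ bU; split.
    - by rewrite mulr_ge0// ltW.
    - by rewrite /= ltr_pM2l.
    - by rewrite /= ler_pM2l.
  move=> _ _ [U bU <-] [V bV <-] [x]; rewrite /block_itv /= !in_itv/=.
  move=> [/andP[x1 x2] /andP[x3 x4]]; congr sc; apply: tr => //. exists (c^-1 * x); rewrite /block_itv /= !in_itv/=.
  by rewrite !ltr_pdivrMl// !ltr_pdivlMl// x1 x2 x3 x4.
move=> e e0; have [s cs ms] := hs _ (divr_gt0 e0 c0).
exists (map (sc c) s); first exact: chain_scale.
rewrite tl_scale; have := ms; rewrite -(ltr_pM2l c0) mulrBr.
by rewrite [c * (e / c)]mulrCA divff ?mulr1// gt_eqF.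
Qed.

Lemma is_ip_scale c b : is_ip b -> is_ip (ip_scale c b).
Proof.
move=> [M hM]; have [c0|c0] := ltP 0 c; first by exists (c * M); exact: is_ip_of_scale.
by rewrite /ip_scale ltNge c0; exact: is_ip_set0.
Qed.

Lemma ip_mass_set0 : ip_mass (set0 : set (R * R)) = 0.
Proof. by rewrite /ip_mass image_set0 sup0. Qed.

Lemma ip_mass_scale c b : 0 <= c -> is_ip b -> ip_mass (ip_scale c b) = c * ip_mass b.
Proof.
rewrite le_eqVlt => /predU1P[<-|c0] hb.
  by rewrite /ip_scale ltxx mul0r ip_mass_set0.
exact/ip_massE/is_ip_of_scale/is_ip_mass.
Qed.

Lemma finite_scaled_count M b (h t : R) : ipo M b -> 0 < h ->
  finite_set [set U | [/\ b U, h < block_len U & U.2 <= t]].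
Proof.
move=> hb h0; have [N _ /(_ N (leqnn N)) hN] := near_infty_natSinv_lt (PosNum h0).
apply: sub_finite_set (ipo_finite_big N hb) => U [bU hU _]; split=> //.
exact: lt_trans hU.
Qed.

Lemma scaled_count_scale (alpha : R) M b (c t h : R) : ipo M b -> 0 < c -> 0 < h ->
  scaled_count alpha (ip_scale c b) t h = c `^ alpha * scaled_count alpha b (t / c) (h / c).
Proof.
move=> hb c0 h0; rewrite /scaled_count mulrA; congr (_ * _%:R).
  by rewrite -powRM ?(ltW c0) ?divr_ge0 ?ltW// mulrCA divff ?mulr1// gt_eqF.
have -> : [set U | [/\ ip_scale c b U, h < block_len U & U.2 <= t]] =
    sc c @` [set U | [/\ b U, h / c < block_len U & U.2 <= t / c]].
  rewrite ip_scaleE//; apply/seteqP; split=> [_ [[U bU <-] h1 h2]|_ [U [bU h1 h2] <-]].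
    exists U => //; split=> //.
      by rewrite ltr_pdivrMr// mulrC -sc_len.
    by rewrite ler_pdivlMr// mulrC.
  split; first by exists U.
    by rewrite sc_len mulrC -ltr_pdivrMr.
  by rewrite /= mulrC -ler_pdivlMr.
rewrite fset_set_image; last by apply: finite_scaled_count hb _; exact: divr_gt0.
by rewrite card_imfset//; exact: sc_inj.
Qed.

Lemma has_diversity_scale (alpha : R) c b : is_ip b -> has_diversity alpha b -> has_diversity alpha (ip_scale c b).
Proof.
move=> hb hd; have [c0|c0] := ltP 0 c; last first.
  by rewrite /ip_scale ltNge c0; exact: has_diversity_set0.
move=> t; rewrite (ip_mass_scale (ltW c0) hb) => /andP[t0 tm].
have /hd cd : 0 <= t / c <= ip_mass b.
  by rewrite divr_ge0 ?(ltW c0)//= ler_pdivrMr// mulrC.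
set l := lim (scaled_count alpha b (t / c) h @[h --> 0^'+]) in cd.
apply: (cvgP (c `^ alpha * l)); apply/cvg_at_rightP => u [u0 ul].
under eq_fun do rewrite (scaled_count_scale alpha t (ipo_mass hb) c0 (u0 _)).
apply: cvgMr; move: cd => /cvg_at_rightP /(_ (fun n => u n / c)); apply.
split; first by move=> n; rewrite divr_gt0.
by rewrite -(mul0r c^-1); apply: cvgMl.
Qed.

Lemma is_ip_single (x : R) : 0 < x -> is_ip_of x [set (0, x)].
Proof.
move=> x0; apply/is_ip_ofP; split.
  split; first exact: ltW.
    by move=> _ ->.
  by move=> _ _ -> ->.
move=> e e0; exists [:: (0, x)].
  by split=> // U; rewrite inE => /eqP ->.
by rewrite /tl big_seq1 /block_len/= subr0 gtrBl.
Qed.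

(** At most one block is counted, and [h^alpha] tends to 0 for positive alpha. *)
Lemma has_diversity_single (alpha x : R) : 0 < alpha -> 0 < x -> has_diversity alpha [set (0, x)].
Proof.
move=> a0 x0 t _; apply: (cvgP 0); apply/cvgrPdist_lt => e e0.
near=> h; have h0 : 0 < h by near: h; exact: nbhs_right_gt.
rewrite sub0r normrN /scaled_count ger0_norm ?mulr_ge0 ?powR_ge0//.
apply: (@le_lt_trans _ _ (h `^ alpha)).
  rewrite -[leRHS]mulr1 ler_wpM2l ?powR_ge0// -[1]/(1%:R) ler_nat.
  have fin1 : finite_set [set ((0 : R), x)] by exact: finite_set1.
  apply: (@leq_trans #|` fset_set [set ((0 : R), x)]|).
    apply: fsubset_leq_card; rewrite -fset_set_sub//.
      by move=> U [].
    by apply: sub_finite_set fin1 => U [].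
  by rewrite fset_set1 cardfs1.
have : h < e `^ alpha^-1 by near: h; apply: nbhs_right_lt; rewrite powR_gt0.
move=> /(gt0_ltr_powR a0) h1; have := h1 _ _; rewrite !nnegrE powR_ge0 ltW//= -powRrM.
by rewrite mulVf ?gt_eqF// powRr1 ?ltW//; apply.
Unshelve. all: by end_near. Qed.

End ip_blocks.

(** * The Borel sigma-algebra of the space of interval partitions *)

Section measurable_helpers.
Context d (T : mtype d) (R : realType).

Lemma measurable_set_lt (f : T -> R) (q : R) : mfT f -> measurable [set x | f x < q].
Proof.
move=> mf; rewrite -[X in measurable X]setTI; apply: (mf measurableT `]-oo, q[%classic).
exact: measurable_itv.
Qed.

Lemma measurable_set_gt (f : T -> R) (q : R) : mfT f -> measurable [set x | q < f x].
Proof.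
move=> mf; rewrite (_ : mkset _ = setT `&` f @^-1` `]q, +oo[%classic); last first.
  by apply/seteqP; split=> x /=; rewrite in_itv/= andbT; [|case].
by apply: (mf measurableT); exact: measurable_itv.
Qed.

Lemma measurable_fun_gt (f : T -> R) : (forall q, measurable [set x | q < f x]) -> mfT f.
Proof.
move=> h; apply: (measurability _ (RGenOInfty.measurableE R)) => _ [_ [q ->] <-].
rewrite (_ : setT `&` _ = [set x | q < f x])//.
by apply/seteqP; split=> x /=; rewrite in_itv/= andbT; [case|].
Qed.

Lemma measurable_fun_natbool (p : pred T) : measurable [set x | p x] -> mfT (fun x => (p x)%:R : R).
Proof.
move=> mp; rewrite (_ : (fun x => _) = \1_[set x | p x]); first exact: measurable_indic.
apply/funext => x; rewrite indicE; case: (boolP (p x)) => px; first by rewrite mem_set.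
by rewrite memNset//=; exact/negP.
Qed.

Lemma measurable_fun_eventually (f_ : nat -> T -> R) (f : T -> R) : (forall n, mfT (f_ n)) ->
  (forall x, \forall n \near \oo, f_ n x = f x) -> mfT f.
Proof.
move=> mf h; apply: (measurable_fun_cvg mf) => x _.
by apply: cvg_near_cst; exact: h.
Qed.

End measurable_helpers.

(** The positions before the element in question are those whose prefix, the position included,
    contains at most i elements satisfying p. In this form the index is a sum of indicators, hence
    measurable in the data. *)
Lemma index_filter_count (T : eqType) (x0 : T) (p : pred T) (s : seq T) i : uniq s -> (i < count p s)%N ->
  index (nth x0 (seq.filter p s) i) s = (\sum_(j < size s) (count p (take j.+1 s) <= i))%N.
Proof.
elim: s i => [|x s IH] i //= /andP[nx us].
rewrite big_ord_recl /= take0 /= addn0; case: (boolP (p x)) => px /=.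
  case: i => [|i] hi /=.
    rewrite eqxx big1 ?addn0// => j _; by rewrite /bump/= add1n.
  have hi' : (i < count p s)%N by rewrite -ltnS -add1n. have : nth x0 (seq.filter p s) i \in s.
    by have := @mem_nth _ x0 (seq.filter p s) i; rewrite size_filter => /(_ hi'); rewrite mem_filter => /andP[].
  move=> h; have /negPf -> : x != nth x0 (seq.filter p s) i.
    by apply: contraNneq nx => ->.
  by rewrite IH// addn1; congr (_.+1); apply: eq_bigr => j _; rewrite /bump/= add1n ltnS.
rewrite add0n => hi.
have : nth x0 (seq.filter p s) i \in s.
  by have := @mem_nth _ x0 (seq.filter p s) i; rewrite size_filter => /(_ hi); rewrite mem_filter => /andP[].
move=> h; have /negPf -> : x != nth x0 (seq.filter p s) i.
  by apply: contraNneq nx => ->.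
by rewrite IH//= add1n; congr (_.+1); apply: eq_bigr => j _; rewrite /bump/= add1n.
Qed.

Lemma sub_all2 (S T : Type) (r1 r2 : S -> T -> bool) s t :
  (forall x y, r1 x y -> r2 x y) -> all2 r1 s t -> all2 r2 s t.
Proof.
move=> h; elim: s t => [|x s IH] [|y t] //= /andP[/h -> /IH]; exact.
Qed.

Section ipspace_borel.
Context (R : realType) (alpha : R).
Local Notation I := (ipspace alpha).
Implicit Types (a : seq R) (b g : I) (s t : seq (R * R)).

(** These sets speak only of the lengths of finitely many blocks in their order; they are open, and
    they turn out to generate the Borel sets although the distance also involves diversities. *)
Definition Oset a : set I := [set b | exists2 s, chain b s & all2 (fun U c => c < block_len U) s a].

Definition Ogen : set (set I) := [set Oset a | a in [set a | all (fun c => 0 < c) a]].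

Definition cut (k : nat) : R := k.+1%:R^-1.

Lemma cut_gt0 k : 0 < cut k. Proof. by rewrite invr_gt0 ltr0n. Qed.

Definition nblk k b : nat := size (bigb b k).
Definition blk k i b := nth (0, 0) (bigb b k) i.
Definition xlen k i b : R := block_len (blk k i b).

Lemma ib b : blocks_of (ip_mass b) b. Proof. exact/ip_blocks_of/ip_blocksP. Qed.

Lemma chain_cat_single (b : set (R * R)) m U s : blocks_of m b -> b U -> chain b s ->
  U \notin s -> block_len U <= m - tl s.
Proof.
move=> hb bU cs Us.
have cU : chain b [:: U] by split=> // V; rewrite inE => /eqP ->.
have [u [cu su Uu]] := chain_merge hb cs cU.
have [_ _ /(_ _ cu) um _] := hb.
apply: (@le_trans _ _ (tl u - tl s)); last by rewrite lerD2r.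
rewrite (tl_sub hb cs cu su) big_mkcond (bigD1_seq U)//=; last 2 first.
- by apply: Uu; rewrite mem_head.
- exact: chain_uniq cu.
rewrite Us /= lerDl big_seq_cond; apply: sumr_ge0 => V /andP[Vu _].
by case: ifP => // _; apply/ltW/(block_len_ge0 hb); exact: cu.2.
Qed.

Lemma distortion_ge0 (b g : set (R * R)) p : 0 <= distortion alpha b g p.
Proof. by rewrite /distortion !le_max; rewrite normr_ge0 !orbT. Qed.

Lemma ip_dist_lt b g (e : R) : ip_dist b g < e -> exists2 p, correspondence b g p & distortion alpha b g p < e.
Proof.
move=> /inf_lt; case.
  by exists (distortion alpha b g [::]); exists [::] => //; split=> // p; rewrite in_nil.
by move=> _ [p cp <-] h; exists p.
Qed.

Lemma ip_dist_le b g p : correspondence b g p -> ip_dist b g <= distortion alpha b g p.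
Proof.
move=> cp; apply: ge_inf; last by exists p.
by exists 0 => _ [q _ <-]; exact: distortion_ge0.
Qed.

Lemma correspondence_chain (b g : set (R * R)) p : correspondence b g p -> chain b (map fst p) /\ chain g (map snd p).
Proof.
move=> [pbg sp]; split; split.
- by rewrite sorted_map; apply: sub_sorted sp => x y /andP[].
- by move=> _ /mapP[x /pbg[+ _] ->].
- by rewrite sorted_map; apply: sub_sorted sp => x y /andP[].
- by move=> _ /mapP[x /pbg[_ +] ->].
Qed.

Lemma ip_open_Oset a : all (fun c => 0 < c) a -> ip_open (Oset a).
Proof.
move=> a0 b [s cs sa].
(* The slack e serves twice: a change of lengths by less than e keeps the inequalities, and since
   every block of s is at least e long, none of them can be missing from a correspondence of
   distortion below e. *)
have [e e0 he] : exists2 e : R, 0 < e & all2 (fun U c => e <= block_len U - c) s a.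
  elim: s a a0 sa {cs} => [|U s IH] [|c a] //=; first by exists 1.
  move=> /andP[c0 a0] /andP[Uc sa]; have [e e0 he] := IH _ a0 sa.
  exists (Num.min e (block_len U - c)); first by rewrite lt_min e0 subr_gt0.
  rewrite ge_min lexx orbT /=; apply: sub_all2 he => V x. by apply: le_trans; rewrite ge_min lexx.
exists e => // g /ip_dist_lt[p cp].
rewrite /distortion !gt_max => /andP[_ /andP[h1 _]].
have [c1 c2] := correspondence_chain cp.
have gap0 : 0 <= \sum_(q <- p) `|block_len q.1 - block_len q.2| by exact: sumr_ge0.
have h1' : ip_mass b - tl (map fst p) < e by apply: le_lt_trans h1; rewrite /tl big_map lerDr.
have h1'' : \sum_(q <- p) `|block_len q.1 - block_len q.2| < e.
  apply: le_lt_trans h1; rewrite lerDl subr_ge0. by have [_ _ /(_ _ c1) + _] := ib b; rewrite /tl big_map.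
have sub : {subset s <= map fst p}.
  have : all (fun U => e <= block_len U) s.
    elim: s a a0 he {sa cs} => [|U s IH] [|c a] //= /andP[c0 a0] /andP[Uc sa].
    by rewrite (IH _ a0 sa) andbT (le_trans Uc)// gerBl ltW.
  move=> /allP hs U Us; apply: contraT => Up. have := chain_cat_single (ib b) (cs.2 _ Us) c1 Up.
  by move=> /le_lt_trans /(_ h1'); rewrite ltNge hs.
pose q := [seq x <- p | x.1 \in s].
have qs : map fst q = s by rewrite (chain_subE cs c1 sub) filter_map.
exists (map snd q).
  have [pbg sp] := cp; split.
    rewrite sorted_map; apply: (@sub_sorted _ (fun x y => (x.1.1 < y.1.1) && (x.2.1 < y.2.1))).
      by move=> x y /andP[].
    apply: sorted_filter sp => x y z /andP[h2 h3] /andP[h4 h5]. by rewrite (lt_trans h2 h4) (lt_trans h3 h5).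
  by move=> _ /mapP[x + ->]; rewrite mem_filter => /andP[_ /pbg[]].
have : all (fun x => `|block_len x.1 - block_len x.2| < e) q.
  apply/allP => x; rewrite mem_filter => /andP[_ xp]; apply: le_lt_trans h1''.
  rewrite (big_rem x)//= lerDl; exact: sumr_ge0.
move: he; rewrite -qs; elim: q a {qs sa a0} => [|x q IH] [|c a] //= /andP[h2 h3] /andP[h4 h5].
rewrite IH// andbT; move: h4; rewrite ltr_norml => /andP[h6 h7]; lra.
Qed.

(** Thresholds of at least [cut k] force the blocks of a witness to be among the [nblk k b] large
    ones; being equally many they are all of them, and the order fixes the matching. *)
Lemma OsetP b k a : size a = nblk k b -> all (fun c => cut k <= c) a ->
  Oset a b <-> forall j, (j < nblk k b)%N -> nth 0 a j < xlen k j b.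
Proof.
move=> sa ha; have hc := chain_bigb k (ib b); split; last first.
  move=> h; exists (bigb b k) => //. rewrite all2E -/(nblk k b) sa eqxx /=; apply/(all_nthP ((0,0), 0)) => j.
  rewrite size_zip -/(nblk k b) sa minnn => jn. by rewrite nth_zip ?sa//=; exact: h.
move=> [s cs hs].
have ss : size s = nblk k b by move: hs; rewrite all2E -sa => /andP[/eqP].
have sub : {subset s <= bigb b k}.
  move=> U Us; apply/(mem_bigb _ _ (ib b)); split; first exact: cs.2.
  elim: s a hs ha Us {cs ss sa} => [|V s IH] [|c a] //= /andP[Vc sa] /andP[kc ha].
  rewrite inE => /predU1P[->|]; last exact: IH sa ha. exact: le_lt_trans Vc.
have es : s = bigb b k.
  rewrite (chain_subE cs hc sub); apply/all_filterP. have := chain_subE cs hc sub => e.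
  rewrite all_count eqn_leq count_size /= -/(nblk k b) -ss {1}e size_filter. exact: leqnn.
move=> j jn; move: hs; rewrite es all2E => /andP[_ /(all_nthP ((0,0), 0))/(_ j)].
by rewrite size_zip -/(nblk k b) sa minnn => /(_ jn); rewrite nth_zip ?sa.
Qed.

Lemma leq_nblkP b k m : (m <= nblk k b)%N <-> Oset (nseq m (cut k)) b.
Proof.
have hc := chain_bigb k (ib b); split=> [mn|[s cs hs]].
  exists (take m (bigb b k)).
    split; first by apply: take_sorted; case: hc. by move=> U /mem_take; exact: hc.2.
  rewrite all2E size_takel// size_nseq eqxx /=; apply/(all_nthP ((0,0),0)) => j.
  rewrite size_zip size_nseq size_takel// minnn => jm.
  rewrite nth_zip ?size_nseq ?size_takel//= nth_nseq jm nth_take//.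
  have := @mem_nth _ (0,0) (bigb b k) j (leq_trans jm mn). by move=> /(mem_bigb _ _ (ib b))[].
have ss : size s = m by move: hs; rewrite all2E size_nseq => /andP[/eqP].
rewrite -ss; apply: uniq_leq_size; first exact: chain_uniq cs.
move=> U Us; apply/(mem_bigb _ _ (ib b)); split; first exact: cs.2.
elim: s m hs Us {cs ss} => [|V s IH] [|m] //= /andP[Vc sa].
by rewrite inE => /predU1P[->//|]; exact: IH sa.
Qed.

Local Notation T0 := (gsalg Ogen).

Lemma measurable_Oset a : all (fun c => 0 < c) a -> @measurable _ T0 (Oset a).
Proof. by move=> a0; apply: sub_sa; exists a. Qed.

Lemma measurable_nblk k m : @measurable _ T0 [set b | nblk k b = m].
Proof.
rewrite (_ : mkset _ = Oset (nseq m (cut k)) `\` Oset (nseq m.+1 (cut k))).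
  by apply: measurableD; apply: measurable_Oset; rewrite all_nseq cut_gt0 orbT.
apply/seteqP; split=> b /=.
  move=> <-; split; first exact/leq_nblkP. by move=> /(leq_nblkP b k (nblk k b).+1); rewrite ltnn.
move=> [/(leq_nblkP b k m) h1 h2]; apply/eqP; rewrite eqn_leq h1 leqNgt andbT; apply/negP => h3.
by apply: h2; exact/(leq_nblkP b k m.+1).
Qed.

Lemma measurable_nblk_gt k m : @measurable _ T0 [set b | (m < nblk k b)%N].
Proof.
rewrite (_ : mkset _ = Oset (nseq m.+1 (cut k))).
  by apply: measurable_Oset; rewrite all_nseq cut_gt0 orbT.
by apply/seteqP; split=> b /leq_nblkP.
Qed.

Lemma xlen_default k i b : (nblk k b <= i)%N -> xlen k i b = 0.
Proof. by move=> h; rewrite /xlen /blk nth_default// /block_len subrr. Qed.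

Lemma xlen_gt k i b : (i < nblk k b)%N -> cut k < xlen k i b.
Proof. by move=> h; have /(mem_bigb _ _ (ib b))[] := mem_nth (0,0) h. Qed.

Lemma xlen_ge0 k i b : 0 <= xlen k i b.
Proof.
have [h|h] := ltnP i (nblk k b); last by rewrite xlen_default.
by apply: le_trans (ltW (xlen_gt h)); exact/ltW/cut_gt0.
Qed.

Lemma measurable_xlen k i : mfT (xlen k i : T0 -> R).
Proof.
apply: measurable_fun_gt => q; have [q0|q0] := ltP q 0.
  rewrite (_ : mkset _ = setT)//; apply/seteqP; split=> // b _ /=. exact: lt_le_trans (xlen_ge0 _ _ _).
(* When exactly m blocks exceed [cut k], raising the threshold to q at place i tests the i-th length
   alone. *)
pose a m := mkseq (fun j => if j == i then Num.max q (cut k) else cut k) m.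
rewrite (_ : mkset _ = \bigcup_(m in [set m | (i < m)%N]) ([set b | nblk k b = m] `&` Oset (a m))).
  apply: bigcup_measurable => m _; apply: measurableI; first exact: measurable_nblk.
  apply: measurable_Oset; apply/(all_nthP 0) => j; rewrite size_mkseq => jm.
  by rewrite nth_mkseq//; case: ifP => _; rewrite ?lt_max cut_gt0 ?orbT.
have ha m : all (fun c => cut k <= c) (a m).
  apply/(all_nthP 0) => j; rewrite size_mkseq => jm.
  by rewrite nth_mkseq//; case: ifP => _; rewrite ?le_max lexx ?orbT.
apply/seteqP; split=> b /=.
  move=> h; have [ib'|/xlen_default e] := ltnP i (nblk k b); last first.
    by move: h; rewrite e ltNge q0.
  exists (nblk k b) => //; split=> //; apply/OsetP; [by rewrite size_mkseq|exact: ha|].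
  move=> j jn; rewrite nth_mkseq//; case: eqP => [->|_]; last exact: xlen_gt. by rewrite gt_max h xlen_gt.
move=> [m im [nm]]; move=> /OsetP -/(_ k) h.
have := h _ (ha m); rewrite size_mkseq nm => /(_ erefl).
move=> /(_ i im); rewrite nth_mkseq// eqxx gt_max; by move=> /andP[].
Qed.

End ipspace_borel.

Lemma measurable_all d (T : mtype d) (I : Type) (l : seq I) (P : I -> T -> bool) :
  (forall i, measurable [set x | P i x]) -> measurable [set x | all (P^~ x) l].
Proof.
move=> h; elim: l => [|i l IH] /=; first by rewrite (_ : mkset _ = setT)//; exact/seteqP.
rewrite (_ : mkset _ = [set x | P i x] `&` [set x | all (P^~ x) l]); first exact: measurableI.
by apply/seteqP; split=> x /= => [/andP[]|[-> ->]].
Qed.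

Lemma count_take_nth (T : Type) (x0 : T) (p : pred T) (s : seq T) n : ~~ p x0 ->
  count p (take n s) = (\sum_(q < n) p (nth x0 s q))%N.
Proof.
move=> px0; elim: s n => [|x s IH] [|n] /=; rewrite ?big_ord0//.
  by rewrite big1// => q _; rewrite nth_nil (negPf px0).
by rewrite big_ord_recl IH.
Qed.

Lemma mem_take_index (R : realType) (s : seq (R * R)) U V : sorted (@ltb R) s -> V \in s ->
  (U \in take (index V s) s) = (U \in s) && (U.1 < V.1).
Proof.
elim: s => [|W s IH] //= ps; have so := path_sorted ps.
have hmin := order_path_min (@ltb_trans R) ps.
rewrite !inE [V == W]eq_sym; case: eqVneq => [{IH}e _|WV /= Vs] /=; first subst V.
  rewrite in_nil; case: eqVneq => [->|_] /=; first by rewrite ltxx. case: (boolP (U \in s)) => //= Us.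
  by have /allP/(_ U Us) h := hmin; rewrite ltNge (ltW (h : W.1 < U.1)).
rewrite inE IH//; case: eqVneq => [->|] //=.
by have /allP/(_ V Vs) := hmin.
Qed.

Section ipspace_borel2.
Context (R : realType) (alpha : R).
Local Notation I := (ipspace alpha).
Local Notation T0 := (gsalg (@Ogen R alpha)).
Local Notation cut := (@cut R).
Implicit Types (a : seq R) (b g : I) (s t : seq (R * R)).

Lemma sum_xlen k b M : (nblk k b <= M)%N -> \sum_(i < M) xlen k i b = tl (bigb b k).
Proof.
move=> h; rewrite -(big_mkord xpredT (fun i => xlen k i b)) (big_cat_nat (leq0n _) h)//=.
rewrite [X in _ + X]big_nat_cond [X in _ + X]big1 ?addr0; last first.
  by move=> i /andP[/andP[hi _] _]; rewrite xlen_default.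
by rewrite /tl (big_nth (0, 0)).
Qed.

Lemma measurable_tl_big k : mfT ((fun b => tl (bigb b k)) : T0 -> R).
Proof.
apply: (@measurable_fun_eventually _ T0 R (fun M b => \sum_(i < M) xlen k i b)).
  by move=> M; apply: measurable_sum => i; exact: measurable_xlen.
by move=> b; exists (nblk k b) => // M; exact: sum_xlen.
Qed.

Lemma measurable_mass0 : mfT ((fun b => ip_mass b) : T0 -> R).
Proof.
apply: (measurable_fun_cvg measurable_tl_big) => b _.
exact: cvg_tl_big (ib b).
Qed.

Definition cnt l k j b : R := \sum_(q < j.+1) (cut k < xlen l q b)%R%:R.
(** For k <= l and i in range, this is the position of the i-th block of level k in the list of
    level l (see [idxE]), expressed by lengths alone so that it is measurable. *)
Definition idx l k i b : R := \sum_(j < nblk l b) (cnt l k j b <= i%:R)%R%:R.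

Lemma measurable_idx l k i : mfT (idx l k i : T0 -> R).
Proof.
have mc j : mfT (cnt l k j : T0 -> R).
  apply: measurable_sum => q; apply: (@measurable_fun_natbool _ T0 _ (fun b => cut k < xlen l q b)).
  apply: measurable_set_gt; exact: measurable_xlen.
apply: (@measurable_fun_eventually _ T0 R (fun M b =>
  \sum_(j < M) ((j < nblk l b)%N)%:R * (cnt l k j b <= i%:R)%R%:R)). move=> M; apply: measurable_sum => j; apply: mfM.
    exact: (@measurable_fun_natbool _ T0 _ (fun b => (j < nblk l b)%N)) (measurable_nblk_gt _ _).
  apply: (@measurable_fun_natbool _ T0 _ (fun b => cnt l k j b <= i%:R)).
  rewrite (_ : mkset _ = ~` [set b | i%:R < cnt l k j b]).
    by apply: measurableC; exact: measurable_set_gt.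
  by apply/seteqP; split=> b /=; [rewrite leNgt => /negP|move=> /negP; rewrite -leNgt].
move=> b; exists (nblk l b) => // M /= hM.
exact: (sum_ltn_trunc (fun j => (cnt l k j b <= i%:R)%R%:R)) hM.
Qed.

Lemma big_blocks_filter k l b : (k <= l)%N -> bigb b k = [seq U <- bigb b l | cut k < block_len U].
Proof.
move=> kl; have h := big_blocks_homo (ib b) kl.
rewrite {1}(chain_subE (chain_bigb k (ib b)) (chain_bigb l (ib b)) h).
apply: eq_in_filter => U /(mem_bigb _ _ (ib b))[bU _].
by apply/idP/idP => [/(mem_bigb _ _ (ib b))[]//|hU]; apply/(mem_bigb _ _ (ib b)).
Qed.

Lemma idxE l k i b : (k <= l)%N -> (i < nblk k b)%N -> idx l k i b = (index (blk k i b) (bigb b l))%:R.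
Proof.
move=> kl ik; rewrite /blk (big_blocks_filter _ kl) index_filter_count.
- rewrite natr_sum; apply: eq_bigr => j _; congr (_ : bool)%:R. rewrite (count_take_nth (x0 := (0, 0))); last first.
    by rewrite /block_len subrr -leNgt; exact/ltW/cut_gt0.
  by rewrite /cnt -natr_sum ler_nat.
- exact: chain_uniq (chain_bigb l (ib b)).
- by rewrite -size_filter -(big_blocks_filter _ kl).
Qed.

Lemma card_fset_set_seq (A : set (R * R)) (s : seq (R * R)) : uniq s -> finite_set A ->
  (forall U, U \in s <-> A U) -> #|` fset_set A| = size s.
Proof.
move=> us fA h; apply: perm_size; apply: uniq_perm => //.
move=> U; rewrite in_fset_set//; apply/idP/idP => [hU|/h hU]; last exact: mem_set.
by apply/h; exact: set_mem hU.
Qed.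

(** The blocks longer than [cut l] that end before the midpoint of a block V are those preceding V,
    V itself being excluded by its right end point; their number is the position of V at level l.
    Block diversities are thus limits of rescaled positions, hence measurable for the sigma-algebra
    of lengths. *)
Lemma scaled_count_blk l k i b : (k <= l)%N -> (i < nblk k b)%N ->
  scaled_count alpha b (((blk k i b).1 + (blk k i b).2) / 2) (cut l) = cut l `^ alpha * idx l k i b.
Proof.
move=> kl ik; rewrite idxE//; congr (_ * _%:R).
have Vk : blk k i b \in bigb b k by exact: mem_nth.
set V := blk k i b in Vk *.
have Vl : V \in bigb b l by exact: (big_blocks_homo (ib b) kl).
have hip := ipo_mass (ip_blocksP b); have [_ hbd _] := hip.
have [bV _] : ip_blocks b V /\ cut l < block_len V by apply/(mem_bigb _ _ (ib b)).
rewrite (card_fset_set_seq (s := take (index V (bigb b l)) (bigb b l))).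
- by rewrite size_takel// index_size.
- by apply: take_uniq; exact: chain_uniq (chain_bigb l (ib b)).
- exact: finite_scaled_count hip (cut_gt0 R l).
move=> U; rewrite mem_take_index//; last by case: (chain_bigb l (ib b)).
have [_ V12 _] := hbd _ bV.
split=> [/andP[/(mem_bigb _ _ (ib b))[bU hU] UV]|[bU hU UV]].
  split=> //; have := ipo_sep hip bU bV UV; lra.
apply/andP; split; first exact/(mem_bigb _ _ (ib b)).
have [_ U12 _] := hbd _ bU.
rewrite ltNge; apply/negP; rewrite le_eqVlt => /predU1P[e|VU].
  by move: UV; rewrite (ipo_inj hip bV bU e); lra.
have := ipo_sep hip bV bU VU; lra.
Qed.

Lemma cut_cvg : cut l @[l --> \oo] --> (0 : R).
Proof.
apply/cvgrPdist_lt => e e0; near=> l; rewrite sub0r normrN ger0_norm; last exact/ltW/cut_gt0.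
by near: l; exact: near_infty_natSinv_lt (PosNum e0).
Unshelve. all: by end_near. Qed.

Lemma diversity_cut b (t : R) : 0 <= t <= ip_mass b ->
  Gamma_fun (1 - alpha) * scaled_count alpha b t (cut l) @[l --> \oo] --> diversity alpha b t.
Proof.
move=> /(@ip_diversityP _ _ b) hc; apply: cvgMr.
have /cvg_at_rightP := hc; apply; split; last exact: cut_cvg.
by move=> l; exact: cut_gt0.
Qed.

Definition Dv k i b : R := (i < nblk k b)%N%:R * block_diversity alpha b (blk k i b).

Lemma measurable_Dv k i : mfT (Dv k i : T0 -> R).
Proof.
have mi : mfT ((fun b => (i < nblk k b)%N%:R) : T0 -> R).
  exact: (@measurable_fun_natbool _ T0 _ (fun b => (i < nblk k b)%N)) (measurable_nblk_gt _ _).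
apply: (@measurable_fun_cvg _ T0 R _ (fun l b =>
  (i < nblk k b)%N%:R * (Gamma_fun (1 - alpha) * (cut l `^ alpha * idx l k i b)))).
  move=> l; apply: mfM => //; apply: mfM => //. by apply: mfM => //; exact: measurable_idx.
move=> b _; rewrite /Dv.
have [ik|ik] := ltnP i (nblk k b); last first.
  by under eq_fun do rewrite mul0r; rewrite mul0r; exact: cvg_cst.
rewrite mul1r; under eq_fun do rewrite mul1r.
have bV : ip_blocks b (blk k i b) by have /(mem_bigb _ _ (ib b))[] : blk k i b \in bigb b k by exact: mem_nth.
have hip := ipo_mass (ip_blocksP b); have [_ hbd _] := hip.
have [V0 V12 V2] := hbd _ bV.
have := @diversity_cut b (((blk k i b).1 + (blk k i b).2) / 2).
move=> /(_ _)/wrap[]; first by apply/andP; split; lra.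
apply: cvg_trans; apply: near_eq_cvg; near=> l.
rewrite scaled_count_blk//; near: l; exact: nbhs_infty_ge.
Unshelve. all: by end_near. Qed.

Lemma measurable_Dtot : mfT ((fun b => total_diversity alpha b) : T0 -> R).
Proof.
apply: (@measurable_fun_cvg _ T0 R _ (fun l b => Gamma_fun (1 - alpha) * (cut l `^ alpha * (nblk l b)%:R))).
  move=> l; apply: mfM => //; apply: mfM => //.
  apply: (@measurable_fun_eventually _ T0 R (fun M b => \sum_(i < M) (i < nblk l b)%N%:R)).
    move=> M; apply: measurable_sum => j.
    exact: (@measurable_fun_natbool _ T0 _ (fun b => (j < nblk l b)%N)) (measurable_nblk_gt _ _).
  move=> b; exists (nblk l b) => // M /= hM.
  have -> : (nblk l b)%:R = \sum_(j < nblk l b) 1 :> R by rewrite sumr_const card_ord.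
  rewrite -(sum_ltn_trunc (fun=> 1) hM). by apply: eq_bigr => i _; rewrite mulr1.
move=> b _; have m0 := ip_mass_ge0 (ip_blocksP b).
have := @diversity_cut b (ip_mass b); rewrite m0 lexx => /(_ isT).
apply: cvg_trans; apply: near_eq_cvg; apply: nearW => l; congr (_ * (_ * _%:R)).
have hip := ipo_mass (ip_blocksP b); have [_ hbd _] := hip.
rewrite (card_fset_set_seq (s := bigb b l))//.
- exact: chain_uniq (chain_bigb l (ib b)).
- exact: finite_scaled_count hip (cut_gt0 R l).
move=> U; split=> [/(mem_bigb _ _ (ib b))[bU hU]|[bU hU UV]].
  by split=> //; have [] := hbd _ bU.
exact/(mem_bigb _ _ (ib b)).
Qed.

End ipspace_borel2.

Lemma dist_lt2 (R : realType) (x y z q : R) : `|x - z| < q -> `|y - z| < q -> `|x - y| < 2 * q.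
Proof.
rewrite !ltr_norml => /andP[h1 h2] /andP[h3 h4].
by apply/andP; split; lra.
Qed.

Lemma gap_lt2 (R : realType) (g A B u v q : R) : g <= A + B -> 0 <= v -> A + u < q -> B + v < q -> g + u < 2 * q.
Proof. lra. Qed.

Section ipspace_borel3.
Context (R : realType) (alpha : R).
Local Notation I := (ipspace alpha).
Local Notation T0 := (gsalg (@Ogen R alpha)).
Local Notation cut := (@cut R).
Implicit Types (a : seq R) (b g : I) (s t : seq (R * R)).

(* Two partitions meeting the same skeleton (lengths p.1 and diversities p.2 of
   finitely many blocks, total diversity E, up to q) are 2q-close. *)
Definition skel (sk : seq (R * R)) (E q : R) (k : nat) (js : seq nat) : set I :=
  [set b | [/\ all (fun j => (j < nblk k b)%N) js, \sum_(p <- zip js sk) `|xlen k p.1 b - p.2.1| +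
      (ip_mass b - \sum_(j <- js) xlen k j b) < q,
    all (fun p => `|Dv k p.1 b - p.2.2| < q) (zip js sk) & `|total_diversity alpha b - E| < q]].

Lemma measurable_skel sk E q k js : @measurable _ T0 (skel sk E q k js).
Proof.
have mn (f : I -> R) : mfT (f : T0 -> R) -> mfT ((fun b => `|f b|) : T0 -> R).
  by move=> mf; exact: (mcomp (@normr_measurable R setT) mf).
rewrite (_ : skel _ _ _ _ _ = [set b | all (fun j => (j < nblk k b)%N) js] `&`
  [set b | \sum_(p <- zip js sk) `|xlen k p.1 b - p.2.1| + (ip_mass b - \sum_(j <- js) xlen k j b) < q] `&`
  [set b | all (fun p => `|Dv k p.1 b - p.2.2| < q) (zip js sk)] `&`
  [set b | `|total_diversity alpha b - E| < q]); last first.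
  by apply/seteqP; split=> b /= [] => [? ? ? ?|[[? ?] ?] ?].
apply: measurableI; first apply: measurableI; first apply: measurableI.
- apply: (@measurable_all _ T0 _ js (fun j b => (j < nblk k b)%N)) => j. exact: measurable_nblk_gt.
- apply: (@measurable_set_lt _ T0 R); apply: mfD.
    apply: measurable_sum => p; apply: mn; apply: mfB => //. exact: measurable_xlen.
  apply: mfB; first exact: measurable_mass0. by apply: measurable_sum => j; exact: measurable_xlen.
- apply: (@measurable_all _ T0 _ (zip js sk) (fun p b => `|Dv k p.1 b - p.2.2| < q)) => p.
  apply: (@measurable_set_lt _ T0 R); apply: mn; apply: mfB => //. exact: measurable_Dv.
- apply: (@measurable_set_lt _ T0 R); apply: mn; apply: mfB => //. exact: measurable_Dtot.
Qed.

Lemma sorted_map_blk k b js : sorted ltn js -> all (fun j => (j < nblk k b)%N) js ->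
  sorted (@ltb R) (map (fun j => blk k j b) js).
Proof.
move=> sj aj; have [ss _] := chain_bigb k (ib b).
rewrite sorted_map; apply: (sub_in_sorted (P := fun j => (j < nblk k b)%N) _ aj sj).
move=> i j /= ik jk ij; rewrite /relpre /=.
exact: (sorted_ltn_nth (@ltb_trans R) (0, 0) ss).
Qed.

Lemma skel_dist sk (E q : R) k l js is' b g : 0 < q -> size js = size sk -> size is' = size sk ->
  sorted ltn js -> sorted ltn is' -> skel sk E q k js b -> skel sk E q l is' g -> ip_dist b g < 2 * q.
Proof.
move=> q0 sj si soj soi [aj hj dj tj] [ai hi di ti].
pose p := zip (map (fun j => blk k j b) js) (map (fun i => blk l i g) is').
have p1 : map fst p = map (fun j => blk k j b) js by apply: unzip1_zip; rewrite !size_map sj si.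
have p2 : map snd p = map (fun i => blk l i g) is' by apply: unzip2_zip; rewrite !size_map sj si.
have bb U : U \in map fst p -> ip_blocks b U.
  rewrite p1 => /mapP[j jj ->]; have /allP/(_ j jj) jn := aj. by have /(mem_bigb _ _ (ib b))[] := mem_nth (0, 0) jn.
have gg U : U \in map snd p -> ip_blocks g U.
  rewrite p2 => /mapP[j jj ->]; have /allP/(_ j jj) jn := ai. by have /(mem_bigb _ _ (ib g))[] := mem_nth (0, 0) jn.
have cp : correspondence b g p.
  split.
    by move=> x xp; split; [apply: bb|apply: gg]; apply/mapP; exists x.
  have := sorted_map_blk soj aj; rewrite -p1 sorted_map => s1.
  have := sorted_map_blk soi ai; rewrite -p2 sorted_map => s2. elim: p s1 s2 {p1 p2 bb gg} => [|x p IH] //=.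
  case: p IH => [|y p] IH //= /andP[h1 h2] /andP[h3 h4]. by apply/andP; split; [apply/andP|exact: IH].
apply: (le_lt_trans (ip_dist_le cp)).
have S1 : \sum_(x <- p) block_len x.1 = \sum_(j <- js) xlen k j b.
  by rewrite -(big_map fst xpredT (@block_len R)) p1 big_map.
have S2 : \sum_(x <- p) block_len x.2 = \sum_(j <- is') xlen l j g.
  by rewrite -(big_map snd xpredT (@block_len R)) p2 big_map.
have gap : \sum_(x <- p) `|block_len x.1 - block_len x.2| <= \sum_(x <- zip js sk) `|xlen k x.1 b - x.2.1| +
    \sum_(x <- zip is' sk) `|xlen l x.1 g - x.2.1|.
  rewrite /p; elim: js is' sk sj si {soj soi aj hj dj ai hi di p p1 p2 bb gg cp S1 S2}
    => [|j js IH] [|i is'] [|x sk] //=; first by rewrite !big_nil addr0.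
  move=> [sj] [si]; rewrite !big_cons /= addrACA; apply: lerD; last exact: IH.
  rewrite -/(xlen k j b) -/(xlen l i g) [X in _ <= _ + X]distrC.
  by apply: le_trans (ler_normD _ _); rewrite addrA subrK.
have U1 : 0 <= ip_mass b - \sum_(j <- js) xlen k j b.
  rewrite subr_ge0 -S1; have [_ _ /(_ _ (correspondence_chain cp).1) + _] := ib b. by rewrite /tl big_map.
have U2 : 0 <= ip_mass g - \sum_(j <- is') xlen l j g.
  rewrite subr_ge0 -S2; have [_ _ /(_ _ (correspondence_chain cp).2) + _] := ib g. by rewrite /tl big_map.
rewrite /distortion !gt_max S1 S2; apply/andP; split; apply/andP; split.
- have ap : all (fun x => `|block_diversity alpha b x.1 - block_diversity alpha g x.2| < 2 * q) p.
    rewrite /p. elim: js is' sk sj si aj ai dj di {soj soi hj hi p p1 p2 bb gg cp S1 S2 gap U1 U2}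
      => [|j js IH] [|i is'] [|y sk] //= [sj] [si] /andP[jn aj] /andP[in' ai] /andP[yj dj] /andP[yi di].
    rewrite (IH is' sk sj si aj ai dj di) andbT. by move: yj yi; rewrite /Dv jn in' !mul1r; exact: dist_lt2.
  rewrite big_seq; apply: bigmax_lt; first by rewrite mulr_gt0. by move=> x xp; move/allP: ap; exact.
- exact: dist_lt2 tj ti.
- exact: gap_lt2 gap U2 hj hi.
- by rewrite addrC in gap; exact: gap_lt2 gap U1 hi hj.
Qed.

Lemma skel_exists b (q : R) : 0 < q -> exists (sk : seq (rat * rat)) (E : rat) k js,
  [/\ size js = size sk, sorted ltn js & skel (map (fun p => (ratr p.1, ratr p.2)) sk) (ratr E) q k js b].
Proof.
move=> q0; have q2 : 0 < q / 2 by lra.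
have [k _ /(_ k (leqnn k)) hk] := near_tl_big (ib b) q2.
have app (x e : R) : 0 < e -> exists r : rat, `|x - ratr r| < e.
  move=> e0; have [|r] := @rat_in_itvoo R (x - e) (x + e); first lra.
  by rewrite in_itv/= => /andP[h1 h2]; exists r; rewrite ltr_norml; apply/andP; split; lra.
(* One half of q pays for the mass outside the n large blocks, the other half for the rational
   approximation of their lengths, with error e each. *)
pose n := nblk k b; pose e := q / 2 / n.+1%:R.
have e0 : 0 < e by rewrite divr_gt0// ltr0n.
have [E hE] := app (total_diversity alpha b) q q0.
have /choice[f hf] : forall i, exists r : rat, `|xlen k i b - ratr r| < e.
  by move=> i; exact: app.
have /choice[h hh] : forall i, exists r : rat, `|Dv k i b - ratr r| < q.
  by move=> i; exact: app.
exists (map (fun i => (f i, h i)) (iota 0 n)), E, k, (iota 0 n); split.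
- by rewrite size_map.
- exact: iota_ltn_sorted.
have zE : zip (iota 0 n) (map (fun p : rat * rat => (ratr p.1, ratr p.2) : R * R)
    (map (fun i => (f i, h i)) (iota 0 n))) = map (fun i => (i, (ratr (f i), ratr (h i)))) (iota 0 n).
  by rewrite -map_comp -{1}[iota 0 n]map_id zip_map.
split => //.
- by apply/allP => j; rewrite mem_iota.
- rewrite zE big_map /=. have -> : \sum_(j <- iota 0 n) xlen k j b = tl (bigb b k).
    by rewrite -(sum_xlen (leqnn _)) -(big_mkord xpredT (fun j => xlen k j b)) /index_iota subn0.
  apply: (@lt_le_trans _ _ (n%:R * e + q / 2)); last first.
    suff : n%:R * e <= q / 2 by lra. rewrite /e mulrA ler_pdivrMr ?ltr0n// mulrC ler_wpM2l ?(ltW q2)// ler_nat.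
    exact: leqnSn.
  apply: ler_ltD; last lra. apply: (@le_trans _ _ (\sum_(j <- iota 0 n) e)).
    by apply: ler_sum => j _; exact: ltW.
  by rewrite big_const_seq count_predT size_iota iter_addr_0 mulr_natl.
- by rewrite zE all_map; apply/allP => j _ /=.
Qed.

(** Separability: every point of D lies in a skeleton set with rational data contained in D, and
    there are only countably many of those. *)
Lemma ip_open_gen (D : set I) : ip_open D -> @measurable _ T0 D.
Proof.
move=> oD.
pose S (x : seq (rat * rat) * rat * rat * nat * seq nat) : set I := let: (sk, E, q, k, js) := x in
  skel (map (fun p => (ratr p.1, ratr p.2)) sk) (ratr E) (ratr q) k js.
pose ok (x : seq (rat * rat) * rat * rat * nat * seq nat) := let: (sk, E, q, k, js) := x in
  [/\ size js = size sk, sorted ltn js & S x `<=` D].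
have -> : D = \bigcup_(x in ok) S x.
  apply/seteqP; split=> [b /oD[e e0 he]|b [[[[[sk E] q] k] js]]]; last first.
    by move=> [_ _ h] /h. have [|q] := @rat_in_itvoo R 0 (e / 2); first lra. rewrite in_itv/= => /andP[q0 qe].
    have [sk [E [k [js [h1 h2 h3]]]]] := skel_exists b q0. exists (sk, E, q, k, js) => //; split=> // g hg; apply: he.
    have := @skel_dist _ _ _ _ _ _ _ _ _ q0 _ _ h2 h2 h3 hg. rewrite size_map => /(_ h1 h1); lra.
rewrite bigcup_mkcond; apply: countable_bigcupT_measurable => [|[[[[sk E] q] k] js]].
  exact: countableP.
case: ifP => _; last exact: measurable0.
exact: measurable_skel.
Qed.

Lemma borel_gen (D : set I) : measurable D <-> @measurable _ T0 D.
Proof.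
split; last first.
  apply: smallest_sub; first exact: smallest_sigma_algebra. move=> _ [a a0 <-]; apply: sub_sa; exact: ip_open_Oset.
apply: smallest_sub; first exact: smallest_sigma_algebra.
exact: ip_open_gen.
Qed.

Lemma measurable_of_gen d (U : mtype d) (f : I -> U) : mfT (f : T0 -> U) -> mfT f.
Proof. by move=> mf _ A mA; apply/borel_gen; exact: mf. Qed.

Lemma measurable_ip_mass : mfT (fun b => ip_mass b).
Proof. by apply: measurable_of_gen; exact: measurable_mass0. Qed.

Lemma measurable_to_ipspace d (Om : mtype d) (X : Om -> I) :
  (forall a, all (fun c => 0 < c) a -> measurable (X @^-1` Oset a)) -> mfT X.
Proof.
move=> h; apply: (@measurability _ _ _ _ _ X (@Ogen R alpha)).
  apply/seteqP; split=> A; first by move=> /borel_gen. by move=> hA; apply/borel_gen.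
by move=> _ [_ [a a0 <-] <-]; rewrite setTI; exact: h.
Qed.

End ipspace_borel3.

Section measurable_product.
Context d (T : mtype d) (R : realType) (n : nat).
Local Notation M := 'M[R]_n.+1.

Definition mmeas (F : T -> M) := forall i j, mfT (fun w => F w i j).

Lemma mmeas_cst (A : M) : mmeas (fun=> A).
Proof. by move=> i j; exact: mcst. Qed.

Lemma mmeasM (F H : T -> M) : mmeas F -> mmeas H -> mmeas (fun w => F w * H w).
Proof.
move=> mF mH i j; under eq_fun do rewrite mxE.
by apply: measurable_sum => k; apply: mfM.
Qed.

Lemma mmeas_if (p : pred T) (F H : T -> M) : measurable [set x | p x] ->
  mmeas F -> mmeas H -> mmeas (fun w => if p w then F w else H w).
Proof.
move=> mp mF mH i j.
rewrite (_ : (fun w => _) = (fun w => (p w)%:R * F w i j + (1 - (p w)%:R) * H w i j)).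
  have mpw : mfT (fun w => (p w)%:R : R) := measurable_fun_natbool mp. by apply: mfD; apply: mfM => //; apply: mfB.
by apply/funext => w; case: (p w); rewrite /= ?subrr ?subr0 ?mul1r ?mul0r ?addr0 ?add0r.
Qed.

Lemma mmeas_prod (F : nat -> T -> M) N : (forall k, mmeas (F k)) -> mmeas (fun w => \prod_(k < N) F k w).
Proof.
move=> mF; elim: N => [|N IH].
  by under [X in mmeas X]eq_fun do rewrite big_ord0; exact: mmeas_cst.
by under [X in mmeas X]eq_fun do rewrite big_ord_recr /=; exact: mmeasM.
Qed.

End measurable_product.

Section ipspace_functionals.
Context (R : realType) (alpha : R).
Local Notation I := (ipspace alpha).
Local Notation cut := (@cut R).
Implicit Types (a : seq R) (b : I) (s t : seq (R * R)).

Definition ipscale (c : R) (b : I) : I := IPSpace (@is_ip_scale R c b (ip_blocksP b))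
    (@has_diversity_scale R alpha c b (ip_blocksP b) (@ip_diversityP _ _ b)).

Lemma measurable_xlenI k i : mfT (fun b : I => xlen k i b).
Proof. by apply: measurable_of_gen; exact: measurable_xlen. Qed.

Lemma measurable_nblkI k i : measurable [set b : I | (i < nblk k b)%N].
Proof. by apply/borel_gen; exact: measurable_nblk_gt. Qed.

Lemma chain_js k b t : chain b t -> {subset t <= bigb b k} ->
  exists js, [/\ sorted ltn js, all (fun j => (j < nblk k b)%N) js & t = map (fun j => blk k j b) js].
Proof.
move=> ct sub; exists [seq j <- iota 0 (nblk k b) | blk k j b \in t]; split.
- by apply: sorted_filter; [exact: ltn_trans|exact: iota_ltn_sorted].
- by apply/allP => j; rewrite mem_filter mem_iota => /andP[].
rewrite {1}(chain_subE ct (chain_bigb k (ib b)) sub).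
rewrite -{1}(mkseq_nth (0, 0) (bigb b k)) /mkseq filter_map.
by [].
Qed.

Lemma Oset_js k b js a : sorted ltn js -> all (fun j => (j < nblk k b)%N) js ->
  all2 (fun j c => c < xlen k j b) js a -> Oset a b.
Proof.
move=> sj aj ha; exists (map (fun j => blk k j b) js); last first.
  by elim: js a ha {sj aj} => [|j js IH] [|c a] //= /andP[-> /IH].
split; first exact: sorted_map_blk.
move=> _ /mapP[j jj ->]; have /allP/(_ j jj) jn := aj.
by have /(mem_bigb _ _ (ib b))[] := mem_nth (0, 0) jn.
Qed.

Lemma measurable_all2 d (Om : mtype d) (k : nat) (X : Om -> I) (c : Om -> R) js a : mfT c -> mfT X ->
  measurable [set w | all2 (fun j x => x < c w * xlen k j (X w)) js a].
Proof.
move=> mc mX; elim: js a => [|j js IH] [|x a] /=.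
- by rewrite (_ : mkset _ = setT)//; apply/seteqP; split.
- by rewrite (_ : mkset _ = set0)//; apply/seteqP; split.
- by rewrite (_ : mkset _ = set0)//; apply/seteqP; split.
rewrite (_ : mkset _ = [set w | x < c w * xlen k j (X w)] `&`
    [set w | all2 (fun j x => x < c w * xlen k j (X w)) js a]).
  apply: measurableI => //; apply: measurable_set_gt; apply: mfM => //.
  by apply: (mcomp _ mX); exact: measurable_xlenI.
by apply/seteqP; split=> w /= => [/andP[]|[-> ->]].
Qed.

(** A chain of the scaled partition comes from a chain of X, which is named by a level k and
    positions js; the preimage of an [Oset] is therefore a countable union of conditions on
    lengths. *)
Lemma mipscale d (Om : mtype d) (c : Om -> R) (X : Om -> I) : mfT c -> mfT X -> mfT (fun w => ipscale (c w) (X w)).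
Proof.
(* The empty list of thresholds is set apart: it also admits the empty partition, which results from
   nonpositive c. *)
move=> mc mX; apply: measurable_to_ipspace => -[_|x a xa].
  rewrite (_ : _ @^-1` _ = setT)//; apply/seteqP; split=> // w _. by exists [::] => //; split.
pose E (p : nat * seq nat) : set Om := if sorted ltn p.2 then
  [set w | 0 < c w] `&` [set w | all (fun j => (j < nblk p.1 (X w))%N) p.2] `&`
  [set w | all2 (fun j x => x < c w * xlen p.1 j (X w)) p.2 (x :: a)] else set0.
rewrite (_ : _ @^-1` _ = \bigcup_p E p).
  apply: countable_bigcupT_measurable => [|[k js]]; first exact: countableP.
  rewrite /E; case: ifP => _ //; apply: measurableI; last exact: measurable_all2.
  apply: measurableI; first exact: measurable_set_gt.
  apply: (@measurable_all _ Om _ js (fun j w => (j < nblk k (X w))%N)) => j.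
  exact: measurable_preim mX (measurable_nblkI k j).
apply/seteqP; split=> [w [s cs hs]|w [[k js] _]].
  have c0 : 0 < c w.
    rewrite ltNge; apply/negP => c0; move: cs => [_]. rewrite /= /ip_scale ltNge c0 /=.
    by case: s hs => [|U s] //= _ /(_ U (mem_head _ _)).
  move: cs; rewrite /= ip_scaleE// => /(chain_scaleV c0)[t ct st].
  have [k _ /(_ k (leqnn k)) hk] := chain_in_big (ib (X w)) ct. have [js [sj aj tj]] := chain_js ct hk.
  exists (k, js) => //; rewrite /E sj; split=> //. move: hs; rewrite st tj -map_comp.
  elim: js (x :: a) {sj aj tj} => [|j js IH] [|y a'] //= /andP[h /IH ->]. by rewrite andbT -sc_len.
rewrite /E; case: ifP => // sj [[/= c0 aj] h].
exists (map (sc (c w)) (map (fun j => blk k j (X w)) js)).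
  rewrite /= ip_scaleE//; apply: chain_scale => //; split; first exact: sorted_map_blk.
  move=> _ /mapP[j jj ->]; have /allP/(_ j jj) jn := aj. by have /(mem_bigb _ _ (ib (X w)))[] := mem_nth (0, 0) jn.
rewrite -map_comp.
elim: js (x :: a) h {sj aj} => [|j js IH] [|y a'] //= /andP[h /IH ->].
by rewrite andbT sc_len.
Qed.

Section MG.
Context (n : nat) (G : R -> 'M[R]_n.+1) (C : R).
Hypotheses (hG : good C G) (mG : mmeas G).

Lemma measurable_MG : mmeas (fun b : I => MG G b).
Proof.
have mk k : mmeas (fun b : I => mprod G (bigb b k)).
  move=> i j; apply: (@measurable_fun_eventually _ I R (fun N b =>
    (\prod_(q < N) (if (q < nblk k b)%N then G (xlen k q b) else 1)) i j)).
    move=> N; apply: (mmeas_prod (F := fun q b => if (q < nblk k b)%N then G (xlen k q b) else 1)).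
    move=> q; apply: mmeas_if; first exact: measurable_nblkI.
      move=> i' j'; apply: (mcomp (mG i' j')); exact: measurable_xlenI.
    exact: mmeas_cst.
  move=> b; exists (nblk k b) => // N /= hN; congr (_ i j).
  rewrite -(big_mkord xpredT (fun q => if (q < nblk k b)%N then G (xlen k q b) else 1)).
  rewrite (big_cat_nat (leq0n _) hN)//= [X in _ * X]big_nat_cond [X in _ * X]big1 ?mulr1; last first.
    by move=> q /andP[/andP[hq _] _]; rewrite ltnNge hq.
  transitivity (\prod_(0 <= q < nblk k b) G (xlen k q b)); last by rewrite /mprod (big_nth (0, 0)).
  by congr fun_of_matrix; apply: eq_big_nat => q /andP[_ ->].
move=> i j; apply: (measurable_fun_cvg (fun k => mk k i j)) => b _.
exact: MG_cvg hG (ib b).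
Qed.

Lemma bmf_MG i j : bmf (fun b : I => MG G b i j).
Proof.
apply: bmf01; first exact: measurable_MG.
by move=> b; apply: substoch_entry; exact: substoch_MG hG (ib b).
Qed.

End MG.

End ipspace_functionals.

(** * Exponential test functions determine laws on the space of interval partitions *)

Section exponential_sums.
Context (R : realType).

Definition sexp (f : R -> R) := exists2 s : seq (R * R), all rge0 s &
  forall x, f x = \sum_(p <- s) expR (- p.1 * x) * p.2.

Lemma sexp_exp (l c : R) : 0 <= l -> sexp (fun x => expR (- l * x) * c).
Proof.
by move=> l0; exists [:: (l, c)]; [rewrite /= l0|move=> x; rewrite big_seq1].
Qed.

Lemma sexp_ext (f g : R -> R) : (forall x, f x = g x) -> sexp g -> sexp f.
Proof. by move=> fg [s s0 h]; exists s => // x; rewrite fg. Qed.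

Lemma sexp_cst (c : R) : sexp (fun=> c).
Proof. by apply: sexp_ext (sexp_exp c (lexx 0)) => x; rewrite oppr0 mul0r expR0 mul1r. Qed.

Lemma sexpD (f g : R -> R) : sexp f -> sexp g -> sexp (fun x => f x + g x).
Proof.
move=> [s s0 hs] [t t0 ht]; exists (s ++ t); first by rewrite all_cat s0.
by move=> x; rewrite big_cat hs ht.
Qed.

Lemma sexpM (f g : R -> R) : sexp f -> sexp g -> sexp (fun x => f x * g x).
Proof.
move=> [s s0 hs] [t t0 ht].
exists [seq (p.1 + q.1, p.2 * q.2) | p <- s, q <- t].
  apply/all_allpairsP => p q ps qt /=.
  by move/allP: s0 => /(_ _ ps) p0; move/allP: t0 => /(_ _ qt) q0; exact: addr_ge0.
move=> x; rewrite hs ht big_allpairs_dep mulr_suml; apply: eq_bigr => p _.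
rewrite mulr_sumr; apply: eq_bigr => q _ /=.
by rewrite opprD mulrDl expRD mulrACA.
Qed.

Lemma sexpX (f : R -> R) N : sexp f -> sexp (fun x => f x ^+ N).
Proof.
move=> hf; elim: N => [|N IH]; first exact: sexp_cst.
by apply: sexp_ext (sexpM hf IH) => x; rewrite exprS.
Qed.

Lemma sexpB (f g : R -> R) : sexp f -> sexp g -> sexp (fun x => f x - g x).
Proof.
move=> hf hg; apply: sexpD => //.
by apply: sexp_ext (sexpM (sexp_cst (-1)) hg) => x; rewrite mulN1r.
Qed.

Lemma expR_lip (l x y : R) : 0 <= l -> 0 <= x -> 0 <= y -> `|expR (- l * x) - expR (- l * y)| <= l * `|x - y|.
Proof.
move=> l0; wlog xy : x y / x <= y => [h x0 y0|x0 y0].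
  have [/h|/ltW/h] := leP x y; first exact. by move=> /(_ y0 x0); rewrite distrC => /le_trans; apply; rewrite distrC.
have -> : `|x - y| = y - x by rewrite distrC ger0_norm ?subr_ge0.
rewrite distrC ler0_norm; last by rewrite subr_le0 ler_expR !mulNr lerN2 ler_wpM2l.
rewrite opprB; have -> : expR (- l * y) = expR (- l * x) * expR (- (l * (y - x))).
  by rewrite -expRD; congr expR; ring.
rewrite -[X in X - _]mulr1 -mulrBr.
have h1 : 1 - expR (- (l * (y - x))) <= l * (y - x) by have := expR_ge1Dx (- (l * (y - x))); lra.
have h2 : expR (- l * x) <= 1 by rewrite -[leRHS]expR0 ler_expR mulNr oppr_le0 mulr_ge0.
have h3 : 0 <= 1 - expR (- (l * (y - x))).
  by rewrite subr_ge0 -[leRHS]expR0 ler_expR oppr_le0 mulr_ge0// subr_ge0.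
by apply: le_trans h1; rewrite ler_piMl.
Qed.

Section matrix.
Context (n : nat).
Local Notation M := 'M[R]_n.+1.

Definition ef (s : seq (R * M)) (x : R) : M := \sum_(p <- s) expR (- p.1 * x) *: p.2.

Definition is_exp (G : R -> M) := exists2 s, all rge0 s & forall x, G x = ef s x.

(* The test functions G; b |-> MG G b is then multiplicative for concatenation. *)
Definition tst (G : R -> M) := [/\ is_exp G, G 0 = 1 & forall x, 0 <= x -> substoch (G x)].

Lemma is_exp_entries (G : R -> M) : (forall i j, sexp (fun x => G x i j)) -> is_exp G.
Proof.
move=> h.
suff H (l : seq ('I_n.+1 * 'I_n.+1)) : is_exp (fun x => \sum_(p <- l) G x p.1 p.2 *: delta_mx p.1 p.2).
  have [s s0 hs] := H (enum {: 'I_n.+1 * 'I_n.+1}); exists s => // x; rewrite -hs.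
  rewrite [LHS]matrix_sum_delta pair_bigA /= big_enum. by apply: eq_bigr => p _.
elim: l => [|[i j] l [s s0 IH]].
  by exists [::] => // x; rewrite /ef !big_nil.
have [t t0 ht] := h i j.
exists (map (fun p => (p.1, p.2 *: delta_mx i j)) t ++ s).
  by rewrite all_cat s0 andbT all_map.
move=> x; rewrite big_cons /= IH /ef big_cat big_map /=; congr (_ + _).
by rewrite ht scaler_suml; apply: eq_bigr => p _; rewrite scalerA.
Qed.

Lemma ef_entry s x i j : ef s x i j = \sum_(p <- s) expR (- p.1 * x) * p.2 i j.
Proof. by rewrite /ef summxE; apply: eq_bigr => p _; rewrite mxE. Qed.

Lemma tst_lip (G : R -> M) : tst G -> exists2 C : R, 0 <= C &
  forall x y, 0 <= x -> 0 <= y -> nrm (G x - G y) <= C * `|x - y|.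
Proof.
move=> [[s s0 h] _ _]; exists (\sum_(p <- s) p.1 * nrm p.2).
  rewrite big_seq; apply: sumr_ge0 => p ps; rewrite mulr_ge0 ?nrm_ge0//. by move/allP: s0; exact.
move=> x y x0 y0; rewrite !h /ef -sumrB mulr_suml.
elim: s s0 {h} => [|p s IH] /=; first by rewrite !big_nil nrm0.
move=> /andP[p0 /IH{}IH]; rewrite !big_cons; apply: le_trans (nrmD _ _) _.
apply: lerD => //; rewrite -scalerBl nrmZ mulrAC.
by apply: ler_wpM2r; [exact: nrm_ge0|exact: expR_lip].
Qed.

Lemma lip_good (G : R -> M) (C : R) : tst G -> 0 <= C ->
  (forall x y, 0 <= x -> 0 <= y -> nrm (G x - G y) <= C * `|x - y|) -> good C G.
Proof.
move=> [_ G0 sG] C0 h; split=> // x x0.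
by have := h x 0 x0 (lexx 0); rewrite G0 subr0 ger0_norm.
Qed.

Lemma tst_good (G : R -> M) : tst G -> exists C, good C G.
Proof. by move=> hG; have [C C0 h] := tst_lip hG; exists C; exact: lip_good. Qed.

Lemma tst_mmeas (G : R -> M) : tst G -> mmeas G.
Proof.
move=> [[s s0 h] _ _] i j; under eq_fun do rewrite h ef_entry.
apply: measurable_sum => p; apply: mfM => //.
by apply: mexpR; exact: mfM.
Qed.

End matrix.

(* [expstep a N] is an exponential sum tending to the indicator of ]a, +oo[ *)
Definition expstep (a : R) (N : nat) (x : R) : R :=
  (1 - expR (- N%:R * x)) ^+ (Num.truncn (N%:R * expR (N%:R * a))).+1.

Lemma sexp_expstep a N : sexp (expstep a N).
Proof.
apply: sexpX; apply: sexpB; first exact: sexp_cst.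
by apply: sexp_ext (sexp_exp 1 (ler0n R N)) => x; rewrite mulr1.
Qed.

Lemma expR_le_1 (x : R) : x <= 0 -> expR x <= 1.
Proof. by move=> x0; rewrite -[leRHS]expR0 ler_expR. Qed.

Lemma expR_ge_1 (x : R) : 0 <= x -> 1 <= expR x.
Proof. by move=> x0; rewrite -[leLHS]expR0 ler_expR. Qed.

Lemma expN_le1 (N : nat) (x : R) : 0 <= x -> expR (- N%:R * x) <= 1.
Proof. by move=> x0; apply: expR_le_1; rewrite mulNr oppr_le0 mulr_ge0. Qed.

Lemma expstep_base (N : nat) (x : R) : 0 <= x -> 0 <= 1 - expR (- N%:R * x) <= 1.
Proof.
by move=> x0; rewrite subr_ge0 expN_le1// gerBl expR_ge0.
Qed.

Lemma expstep01 a N x : 0 <= x -> 0 <= expstep a N x <= 1.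
Proof.
move=> x0; have /andP[h0 h1] := expstep_base N x0.
by rewrite exprn_ge0//= exprn_ile1.
Qed.

Lemma expstep0 a N : expstep a N 0 = 0.
Proof. by rewrite /expstep mulr0 expR0 subrr exprS mul0r. Qed.

Lemma expstep_le a a' N x : 0 <= x -> a <= a' -> expstep a' N x <= expstep a N x.
Proof.
move=> x0 aa; have /andP[h0 h1] := expstep_base N x0.
apply: ler_wiXn2l => //; rewrite ltnS; apply: le_truncn.
by rewrite ler_wpM2l// ler_expR ler_wpM2l.
Qed.

(** All factors but one are estimated by [1 - u <= exp(- u)]; the remaining one keeps the bound of
    order x near 0. *)
Lemma expstep_ub a N x : 0 <= x ->
  expstep a N x <= (1 - expR (- N%:R * x)) * expR (- (N%:R * expR (N%:R * (a - x)) - expR (- N%:R * x))).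
Proof.
move=> x0; have /andP[h0 h1] := expstep_base N x0.
rewrite /expstep exprS; apply: ler_wpM2l => //.
set p := Num.truncn _; set u := expR (- N%:R * x).
have hu : 1 - u <= expR (- u) by exact: expR_ge1Dx.
apply: (@le_trans _ _ (expR (- u) ^+ p)); first by apply: lerXn2r; rewrite ?nnegrE ?expR_ge0.
rewrite -expRM_natl ler_expR mulrN lerN2.
have hp : N%:R * expR (N%:R * a) <= p%:R + 1 by rewrite natr1 ltW// truncnS_gt.
have -> : N%:R * expR (N%:R * (a - x)) = (N%:R * expR (N%:R * a)) * u.
  by rewrite /u -mulrA -expRD; congr (_ * expR _); ring.
have := ler_wpM2r (expR_ge0 (- N%:R * x)) hp; rewrite -/u mulrDl mul1r.
by rewrite lerBlDr.
Qed.

(** The constant does not depend on N. This gives the uniform bound of [good_Gst], by which the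
    limit in N may be exchanged with the limit over the blocks. *)
Lemma expstep_lin a : 0 < a -> exists2 C : R, 0 <= C & forall N x, 0 <= x -> expstep a N x <= C * x.
Proof.
move=> a0; exists (expR 2 + 2 / a); first by rewrite addr_ge0 ?expR_ge0// divr_ge0// ltW.
move=> N x x0; have /andP[h0 h1] := expstep_base N x0.
(* Beyond a/2 the trivial bound 1 is at most [2 x / a]; below a/2 the base is at most [N x], and
   [N exp(- (N - 1))] is bounded. *)
have [xa|xa] := leP (a / 2) x.
  have /andP[_ h] := expstep01 a N x0; apply: le_trans h _. rewrite [leRHS]mulrDl ler_wpDl ?mulr_ge0 ?expR_ge0//.
  by rewrite mulrAC ler_pdivlMr// mul1r; lra.
apply: le_trans (expstep_ub a N x0) _.
have q0 : 0 <= 2 / a * x by rewrite mulr_ge0// divr_ge0// ltW.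
rewrite [leRHS]mulrDl; apply: ler_wpDr => //.
have hN : 1 - expR (- N%:R * x) <= N%:R * x by have := expR_ge1Dx (- N%:R * x); lra.
have N0 : 0 <= N%:R :> R by [].
have e1 : 1 <= expR (N%:R * (a - x)) by apply: expR_ge_1; rewrite mulr_ge0// subr_ge0; lra.
have e2 := expN_le1 N x0.
have e3 : N%:R - 1 <= N%:R * expR (N%:R * (a - x)) - expR (- N%:R * x).
  by apply: lerB => //; rewrite -{1}[N%:R]mulr1 ler_wpM2l.
apply: (@le_trans _ _ ((N%:R * x) * expR (- (N%:R - 1)))).
  apply: ler_pM; rewrite ?expR_ge0//; rewrite ler_expR lerN2//.
rewrite mulrAC; apply: ler_wpM2r => //.
have := expR_ge1Dx (N%:R - 1 : R); rewrite addrC subrK => h.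
apply: (@le_trans _ _ (expR (N%:R - 1) * expR (- (N%:R - 1)))).
  by apply: ler_wpM2r; rewrite ?expR_ge0.
by rewrite -expRD subrr expR0; apply: expR_ge_1.
Qed.

Lemma cvg_expN1 (e : R) : 0 < e -> expR (- (N%:R * e)) @[N --> \oo] --> (0 : R).
Proof.
move=> e0; apply/cvgrPdist_lt => d d0; near=> N.
rewrite sub0r normrN ger0_norm ?expR_ge0//.
have hN : d^-1 / e < N%:R by near: N; exact: nbhs_infty_gtr.
rewrite ltr_pdivrMr// in hN.
rewrite expRN -[d]invrK ltf_pV2 ?posrE ?expR_gt0 ?invr_gt0//.
by apply: lt_le_trans hN _; have := expR_ge1Dx (N%:R * e : R); lra.
Unshelve. all: by end_near. Qed.

Lemma cvg_expN (e : R) : 0 < e -> N%:R * expR (- (N%:R * e)) @[N --> \oo] --> (0 : R).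
Proof.
move=> e0; have e2 : 0 < e / 2 by rewrite divr_gt0.
apply: (@squeeze_cvgr _ _ _ _ (fun=> 0) (fun N => 2 / e * expR (- (N%:R * (e / 2))))).
- apply: nearW => N; rewrite mulr_ge0 ?expR_ge0//=; set u := N%:R * (e / 2).
  have -> : - (N%:R * e) = - u + - u by rewrite /u; field.
  have -> : N%:R = 2 / e * u by rewrite /u; field; rewrite gt_eqF.
  rewrite expRD mulrA; apply: ler_wpM2r; first exact: expR_ge0.
  rewrite -(mulrA _ u) ler_piMr ?divr_ge0 ?(ltW e0)// expRN ler_pdivrMr ?expR_gt0// mul1r.
  by have := expR_ge1Dx u; lra.
- exact: cvg_cst.
- by rewrite -[X in _ --> X](mulr0 (2 / e)); apply: cvgMr; exact: cvg_expN1.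
Qed.

(** With [u = exp(- N x)] and an exponent p of order [N exp(N a)], the product [p u] is of order
    [N exp(N (a - x))]. It tends to infinity for x <= a, the factor N deciding the case x = a, and
    to 0 for x > a; accordingly [(1 - u)^p] tends to 0 or to 1. *)
Lemma cvg_expstep a x : 0 <= a -> 0 <= x -> expstep a N x @[N --> \oo] --> ((a < x)%R%:R : R).
Proof.
move=> a0 x0; have [ax|xa] := ltP a x; last first.
  apply: (@squeeze_cvgr _ _ _ _ (fun=> 0) (fun N => expR 1 * expR (- N%:R))).
  - apply: nearW => N; have /andP[-> _] := expstep01 a N x0 => /=.
    apply: le_trans (expstep_ub a N x0) _; have /andP[h0 h1] := expstep_base N x0. have e2 := expN_le1 N x0.
    have e1 : 1 <= expR (N%:R * (a - x)) by apply: expR_ge_1; rewrite mulr_ge0// subr_ge0.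
    apply: le_trans (ler_piMl (expR_ge0 _) h1) _. rewrite -expRD ler_expR opprB lerD// lerN2 -{1}[N%:R]mulr1.
    by rewrite ler_wpM2l.
  - exact: cvg_cst.
  - rewrite [X in _ --> X](_ : _ = expR 1 * 0); last by rewrite mulr0.
    apply: cvgMr; have := @cvg_expN1 1 ltr01; by under eq_fun do rewrite mulr1.
have d0 : 0 < x - a by rewrite subr_gt0.
apply: (@squeeze_cvgr _ _ _ _ (fun N => 1 - (N%:R * expR (- (N%:R * (x - a))) + expR (- (N%:R * x)))) (fun=> 1)).
- apply: nearW => N; have /andP[_ ->] := expstep01 a N x0; rewrite andbT.
  rewrite /expstep; set p := (Num.truncn _).+1; set u := expR (- N%:R * x).
  have /andP[h0 h1] := expstep_base N x0; rewrite -/u in h0 h1. have bern : 1 - p%:R * u <= (1 - u) ^+ p.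
    elim: p => [|p IH]; first by rewrite mul0r subr0 expr0.
    rewrite exprS -natr1; apply: le_trans (_ : (1 - u) * (1 - p%:R * u) <= _).
      by have := mulr_ge0 (ler0n R p) (sqr_ge0 u); rewrite expr2; lra.
    by apply: ler_wpM2l.
  apply: le_trans bern; rewrite lerD2l lerN2 /p -natr1 mulrDl mul1r.
  have -> : expR (- (N%:R * x)) = u by rewrite /u mulNr.
  rewrite lerD2r -[N%:R * (x - a)]opprK -mulrN opprB opprK mulrBr expRD mulrA.
  rewrite -mulNr -/u; apply: ler_wpM2r; first exact: expR_ge0. by rewrite truncn_le mulr_ge0 ?expR_ge0.
- rewrite -[X in _ --> X]subr0; apply: cvgB; first exact: cvg_cst.
  rewrite -[X in _ --> X](addr0 0); apply: cvgD; first exact: cvg_expN. exact: cvg_expN1 (le_lt_trans a0 ax).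
- exact: cvg_cst.
Qed.

End exponential_sums.

Section determination.
Context (R : realType) (alpha : R).
Local Notation I := (ipspace alpha).
Local Notation cut := (@cut R).
Implicit Types (a : seq R) (b : I).

Lemma mx_prod_cvg (n : nat) (J : eqType) (s : seq J) (F : nat -> J -> 'M[R]_n.+1) (L : J -> 'M[R]_n.+1) :
  (forall x, x \in s -> forall i j, F k x i j @[k --> \oo] --> L x i j) ->
  forall i j, (\prod_(x <- s) F k x) i j @[k --> \oo] --> (\prod_(x <- s) L x) i j.
Proof.
elim: s => [|x s IH] h i j.
  by rewrite big_nil; under eq_fun do rewrite big_nil; exact: cvg_cst.
rewrite big_cons mxE; under eq_fun do rewrite big_cons mxE.
apply: cvg_big => [|l _]; [exact: add_continuous|apply: cvgM].
  by apply: h; rewrite mem_head.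
by apply: IH => y ys; apply: h; rewrite inE ys orbT.
Qed.

Section step_matrix.
Context (k : nat) (a : seq R).
Hypothesis ha : all (fun c => cut k <= c) a.
Local Notation m := (size a).

(** Smoothed transfer matrix of a counter with states 0 to m: a block of length at most [cut k]
    leaves the state unchanged, a longer one moves i to i + 1 if it exceeds the i-th threshold and
    is otherwise absorbed by a zero row. [Glim] has the sharp steps. *)
Definition Gst (N : nat) (x : R) : 'M[R]_m.+1 := \matrix_(i, j)
  ((i == j)%:R * (1 - expstep (cut k) N x) + (j == i.+1 :> nat)%:R * expstep (nth 0 a i) N x).

Definition Glim (x : R) : 'M[R]_m.+1 := \matrix_(i, j)
  ((i == j)%:R * (x <= cut k)%R%:R + (j == i.+1 :> nat)%:R * (nth 0 a i < x)%R%:R).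

Lemma nth_cut i : (i < m)%N -> cut k <= nth 0 a i.
Proof. by move=> im; move/(all_nthP 0): ha => /(_ i im). Qed.

Lemma expstep_nth (i j : 'I_m.+1) N x : 0 <= x ->
  0 <= (j == i.+1 :> nat)%:R * expstep (nth 0 a i) N x <= expstep (cut k) N x.
Proof.
move=> x0; have /andP[h0 _] := expstep01 (cut k) N x0.
case: eqP => [e|_]; last by rewrite mul0r lexx.
have im : (i < m)%N by rewrite -ltnS -e.
rewrite mul1r; have /andP[-> _] := expstep01 (nth 0 a i) N x0.
by apply: expstep_le => //; exact: nth_cut.
Qed.

Lemma substoch_Gst N x : 0 <= x -> substoch (Gst N x).
Proof.
move=> x0; have /andP[h0 h1] := expstep01 (cut k) N x0; split=> [i j|i].
  rewrite mxE addr_ge0//; last by have /andP[] := expstep_nth i j N x0. by rewrite mulr_ge0// subr_ge0.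
under eq_bigr do rewrite mxE.
rewrite big_split /= (bigD1 i)//= eqxx mul1r [X in _ + X + _]big1; last first.
  by move=> j /negPf ji; rewrite eq_sym ji mul0r.
rewrite addr0 -[leRHS](subrK (expstep (cut k) N x)) lerD2l.
have [lt|ge] := ltnP i.+1 m.+1.
  rewrite (bigD1 (Ordinal lt))//= [X in _ + X]big1 ?addr0; last first.
    move=> j ji; suff /negPf -> : j != i.+1 :> nat by rewrite mul0r. by apply: contraNneq ji => e; apply/eqP/val_inj.
  by have /andP[] := expstep_nth i (Ordinal lt) N x0.
rewrite big1 // => j _; suff /negPf -> : j != i.+1 :> nat by rewrite mul0r.
by rewrite neq_ltn (leq_trans (ltn_ord j) ge).
Qed.

Lemma tst_Gst N : tst (Gst N).
Proof.
split; last by move=> x; exact: substoch_Gst.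
  apply: is_exp_entries => i j. apply: (sexp_ext (g := fun x => (i == j)%:R * (1 - expstep (cut k) N x) +
    (j == i.+1 :> nat)%:R * expstep (nth 0 a i) N x)); first by move=> x; rewrite mxE.
  apply: sexpD; apply: sexpM; try exact: sexp_cst; last exact: sexp_expstep.
  by apply: sexpB; [exact: sexp_cst|exact: sexp_expstep].
by apply/matrixP => i j; rewrite !mxE !expstep0 subr0 mulr1 mulr0 addr0.
Qed.

Lemma good_Gst : exists C, forall N, good C (Gst N).
Proof.
have [C C0 hC] := expstep_lin (cut_gt0 R k).
exists (m.+1%:R ^+ 2 * (2 * C)) => N; split; first by rewrite !mulr_ge0 ?sqr_ge0.
  by move=> x; exact: substoch_Gst.
move=> x x0; rewrite -mulrA; apply: nrm_le => i j.
have /andP[h1 h2] := expstep_nth i j N x0.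
have /andP[h0 _] := expstep01 (cut k) N x0.
have -> : (Gst N x - 1) i j = - ((i == j)%:R * expstep (cut k) N x) +
    (j == i.+1 :> nat)%:R * expstep (nth 0 a i) N x by rewrite !mxE; ring.
have hx := hC N x x0.
apply: le_trans (ler_normD _ _) _; rewrite normrN ger0_norm ?mulr_ge0// (ger0_norm h1).
have : (i == j)%:R * expstep (cut k) N x <= expstep (cut k) N x.
  by case: (i == j); rewrite ?mul1r ?mul0r.
by lra.
Qed.

Lemma Gst_cvg x i j : 0 <= x -> Gst N x i j @[N --> \oo] --> Glim x i j.
Proof.
move=> x0; rewrite mxE; under eq_fun do rewrite mxE.
have [e|ne] := eqVneq (j : nat) i.+1; last first.
  rewrite !mul0r addr0; under eq_fun do rewrite mul0r addr0. apply: cvgMr; rewrite leNgt.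
  have -> : (~~ (cut k < x)%R)%:R = 1 - (cut k < x)%R%:R :> R by case: (cut k < x); rewrite ?subrr ?subr0.
  apply: cvgB; first exact: cvg_cst. by apply: cvg_expstep => //; exact/ltW/cut_gt0.
have im : (i < m)%N by rewrite -ltnS -e.
have ij : i != j by apply/eqP => ij; move: e; rewrite ij => /eqP; rewrite eqn_leq ltnn andbF.
rewrite (negPf ij) !mul0r !add0r !mul1r; under eq_fun do rewrite mul0r add0r mul1r.
apply: cvg_expstep => //; apply: le_trans (nth_cut im); exact/ltW/cut_gt0.
Qed.

Lemma Glim1 x : x <= cut k -> Glim x = 1.
Proof.
move=> xk; apply/matrixP => i j; rewrite !mxE xk mulr1.
have [e|ne] := eqVneq (j : nat) i.+1; last by rewrite mul0r addr0.
have im : (i < m)%N by rewrite -ltnS -e.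
by rewrite ltNge (le_trans xk (nth_cut im)) mulr0 addr0.
Qed.

Lemma prod_Glim (ys : seq R) (i : 'I_m.+1) : all (fun y => cut k < y) ys -> (\prod_(y <- ys) Glim y) i ord_max =
  ((size ys + i == m)%N && all2 (fun y c => c < y) ys (drop i a))%:R.
Proof.
elim: ys i => [|y ys IH] i /=.
  rewrite big_nil mxE -val_eqE /= add0n => _; case: eqP => //= ->. by rewrite drop_size.
move=> /andP[ky kys]; rewrite big_cons mxE.
have [im|im] := ltnP i m; last first.
  have ei : i = m :> nat by apply/eqP; rewrite eqn_leq im andbT -ltnS. rewrite big1 => [|j _]; last first.
    rewrite mxE leNgt ky mulr0 add0r; suff /negPf -> : j != i.+1 :> nat by rewrite !mul0r.
    by rewrite ei neq_ltn ltn_ord.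
  by rewrite addSn ei gtn_eqF// ltnS leq_addl.
have im1 : (i.+1 < m.+1)%N by [].
rewrite (bigD1 (Ordinal im1))//= [X in _ + X]big1 ?addr0; last first.
  move=> j ji; rewrite mxE leNgt ky mulr0 add0r. suff /negPf -> : j != i.+1 :> nat by rewrite !mul0r.
  by apply: contraNneq ji => e; apply/eqP/val_inj.
rewrite IH// mxE leNgt ky mulr0 add0r /= eqxx mul1r (drop_nth 0 im) /=.
by rewrite addnS addSn; case: (_ < y); rewrite ?mul1r ?mul0r ?andbF.
Qed.

Definition Eset : set I := Oset a `\` Oset (nseq m.+1 (cut k)).

Lemma EsetP b : Eset b <-> nblk k b = m /\ forall j, (j < m)%N -> nth 0 a j < xlen k j b.
Proof.
split=> [[h1 h2]|[e h]].
  have mn : (m <= nblk k b)%N.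
    apply/leq_nblkP; have [s cs hs] := h1; exists s => //.
    elim: s a ha hs {cs h1 h2} => [|U s IH] [|c a'] //= /andP[kc ka] /andP[cU hs].
    by rewrite (le_lt_trans kc cU)/= (IH _ ka hs).
  have e : nblk k b = m.
    apply/eqP; rewrite eqn_leq mn andbT leqNgt; apply/negP => h; apply: h2. exact/leq_nblkP.
  split=> //; have /OsetP := h1; rewrite -e; exact.
split; first by apply/(OsetP (esym e) ha); rewrite e.
by move=> /(leq_nblkP b k m.+1); rewrite e ltnn.
Qed.

(** Short blocks have limit factor 1, so the product of [Glim] over a finer level l equals the one
    over level k. By the bound of [good_Gst], uniform in N, a fine enough l leaves finitely many
    factors in which N tends to infinity. *)
Lemma MG_Gst_cvg b : MG (Gst N) b ord0 ord_max @[N --> \oo] --> (\1_Eset b : R).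
Proof.
have [C hC] := good_Gst.
have hk := chain_bigb k (ib b).
have -> : \1_Eset b = (mprod Glim (bigb b k)) ord0 ord_max.
  have -> : mprod Glim (bigb b k) = \prod_(y <- map (@block_len R) (bigb b k)) Glim y by rewrite big_map.
  rewrite prod_Glim; last first.
    by rewrite all_map; apply/allP => U /(mem_bigb _ _ (ib b))[].
  rewrite addn0 drop0 size_map indicE; congr (_ : bool)%:R; apply/idP/idP.
    move=> /set_mem/EsetP[e h]; rewrite -/(nblk k b) e eqxx /= all2E size_map -/(nblk k b) e eqxx /=.
    apply/(all_nthP (0, 0)) => j; rewrite size_zip size_map -/(nblk k b) e minnn => jm.
    rewrite nth_zip ?size_map//=; rewrite (nth_map (0, 0)) -/(nblk k b) ?e//. exact: h.
  move=> /andP[/eqP e]; rewrite all2E => /andP[_ /(all_nthP (0, 0)) h]; apply/mem_set/EsetP.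
  split=> // j jm; have := h j; rewrite size_zip size_map e minnn => /(_ jm).
  by rewrite nth_zip ?size_map//= (nth_map (0, 0)) ?e.
apply/cvgrPdist_lt => e e0.
have [C0 _ _] := hC 0%N.
pose D := Kn R m * C + 1.
have D0 : 0 < D by rewrite ltr_wpDl// mulr_ge0 ?Kn_ge0.
have eD : 0 < e / 2 / D by rewrite divr_gt0// divr_gt0.
have [l [kl hl]] : exists l, (k <= l)%N /\ ip_mass b - e / 2 / D < tl (bigb b l).
  have [l0 _ h] := near_tl_big (ib b) eD; exists (maxn k l0).
  by rewrite leq_maxl; split=> //; apply: h; rewrite /= leq_maxr.
have -> : mprod Glim (bigb b k) = mprod Glim (bigb b l).
  rewrite (big_blocks_filter _ kl) /mprod big_filter big_mkcond; apply: eq_bigr => U _. by case: ltP => // /Glim1.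
have hs := chain_bigb l (ib b).
have : mprod (Gst N) (bigb b l) ord0 ord_max @[N --> \oo] --> mprod Glim (bigb b l) ord0 ord_max.
  apply: mx_prod_cvg => U Us i j; apply: Gst_cvg. by apply/ltW/(block_len_ge0 (ib b)); exact: hs.2.
move=> /cvgrPdist_lt/(_ (e / 2)) h; have e2 : 0 < e / 2 by rewrite divr_gt0.
have := h e2; apply: filterS => N hN.
have := MG_approx (hC N) (ib b) hs.
have := nrm_entry (MG (Gst N) b - mprod (Gst N) (bigb b l)) ord0 ord_max.
rewrite !mxE => h1 h2.
have h3 : Kn R m * C * (ip_mass b - tl (bigb b l)) <= e / 2.
  apply: (@le_trans _ _ (D * (e / 2 / D))); last first.
    by rewrite mulrC divfK// gt_eqF.
  apply: ler_pM.
  - by rewrite mulr_ge0 ?Kn_ge0.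
  - by rewrite subr_ge0; have [_ _ /(_ _ hs)] := ib b.
  - by rewrite lerDl.
  - by rewrite lerBlDr -lerBlDl ltW.
have {h1 h2 h3} := le_trans h1 (le_trans h2 h3).
move: hN; rewrite ltr_norml ler_norml ltr_norml => /andP[? ?] /andP[? ?].
by apply/andP; split; lra.
Qed.

End step_matrix.

Lemma measurable_OsetI a : all (fun c => 0 < c) a -> measurable (Oset a : set I).
Proof. by move=> a0; apply/borel_gen; exact: measurable_Oset. Qed.

Lemma cut_pos k a : all (fun c => cut k <= c) a -> all (fun c => 0 < c) a.
Proof. by apply: sub_all => c; apply: lt_le_trans; exact: cut_gt0. Qed.

Lemma measurable_Eset k a : all (fun c => cut k <= c) a -> measurable (Eset k a).
Proof.
move=> ha; apply: measurableD; apply: measurable_OsetI; first exact: cut_pos ha.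
by rewrite all_nseq cut_gt0 orbT.
Qed.

Lemma Ex_indic (mu : prob I R) (A : set I) : measurable A -> Ex mu (\1_A) = fine (mu A).
Proof. by move=> mA; rewrite /Ex /Rintegral integral_indic// setIT. Qed.

Definition Ck k : set (set I) := [set Eset k a | a in [set a | all (fun c => cut k <= c) a]].

(** For different numbers of large blocks the sets are disjoint, whence the adjoined empty set; for
    equal numbers the thresholds combine by maxima. *)
Lemma Ck_setI k : setI_closed (Ck k `|` [set setT; set0]).
Proof.
move=> A B [[a ha <-]|[->|->]]; last 2 first.
- by rewrite setTI.
- by rewrite set0I => _; right; right.
move=> [[a' ha' <-]|[->|->]]; last 2 first.
- by rewrite setIT; left; exists a.
- by rewrite setI0; right; right.
have [e|ne] := eqVneq (size a) (size a'); last first.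
  right; right; apply/seteqP; split=> // b [/(EsetP ha)[h1 _] /(EsetP ha')[h2 _]]. by move: ne; rewrite -h1 -h2 eqxx.
left; pose a2 := mkseq (fun i => Num.max (nth 0 a i) (nth 0 a' i)) (size a).
have h2 : all (fun c => cut k <= c) a2.
  apply/(all_nthP 0) => i; rewrite size_mkseq => ia; rewrite nth_mkseq// le_max. by rewrite (nth_cut ha).
exists a2 => //; apply/seteqP; split=> b.
  move=> /(EsetP h2); rewrite size_mkseq => -[n1 n2].
  split; [apply/(EsetP ha)|apply/(EsetP ha')]; rewrite -?e; split=> // j jm; have := n2 j jm;
    by rewrite nth_mkseq// gt_max => /andP[].
move=> [/(EsetP ha)[n1 n2] /(EsetP ha')[_ n3]]; apply/(EsetP h2); rewrite size_mkseq.
by split=> // j jm; rewrite nth_mkseq// gt_max n2// n3// -e.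
Qed.

(** An [Oset] is split according to the number m of blocks above [cut k] and the positions js of a
    chain among them; with m fixed, the unselected blocks get the threshold [cut k]. *)
Lemma Oset_Ck k a : all (fun c => cut k <= c) a -> <<s Ck k >> (Oset a).
Proof.
move=> ha.
pose thr (js : seq nat) m := mkseq (fun i => if i \in js then nth 0 a (index i js) else cut k) m.
pose S (p : nat * seq nat) : set I := if [&& sorted ltn p.2, size p.2 == size a & all (fun j => (j < p.1)%N) p.2]
  then Eset k (thr p.2 p.1) else set0.
have hthr (p : nat * seq nat) : size p.2 = size a -> all (fun c => cut k <= c) (thr p.2 p.1).
  move=> e; apply/(all_nthP 0) => i; rewrite size_mkseq => im; rewrite nth_mkseq//.
  case: ifP => // ij; apply: (nth_cut ha); by rewrite -e index_mem.
have -> : Oset a = \bigcup_p S p.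
  apply/seteqP; split=> [b [s cs hs]|b [[m js] _]].
    have sub : {subset s <= bigb b k}.
      move=> U Us; apply/(mem_bigb _ _ (ib b)); split; first exact: cs.2.
      elim: s a ha hs Us {cs thr S hthr} => [|V s IH] [|c a'] //= /andP[kc ka] /andP[cV hs].
      by rewrite inE => /predU1P[->|]; [exact: le_lt_trans cV|exact: IH ka hs].
    have [js [sj aj sE]] := chain_js cs sub.
    have sz : size js = size a by move: hs; rewrite all2E sE size_map => /andP[/eqP].
    exists (nblk k b, js) => //; rewrite /S /= sj sz eqxx aj /=.
    apply/(EsetP (hthr (nblk k b, js) sz)); rewrite size_mkseq; split=> // i im.
    rewrite nth_mkseq//; case: ifP => [ij|_]; last exact: xlen_gt.
    move: hs; rewrite all2E => /andP[_ /(all_nthP ((0,0), 0))/(_ (index i js))].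
    rewrite size_zip sE size_map sz minnn -{1}sz index_mem => /(_ ij).
    rewrite nth_zip ?size_map//= (nth_map 0%N) ?index_mem// nth_index//.
  rewrite /S /=; case: ifP => // /and3P[sj /eqP sz aj].
  move=> /(EsetP (hthr (m, js) sz)); rewrite size_mkseq => -[nm h].
  apply: (@Oset_js _ _ k b js) => //; first by rewrite nm. rewrite all2E sz eqxx /=; apply/(all_nthP (0%N, 0)) => q.
  rewrite size_zip sz minnn => qa; rewrite nth_zip//=. have qj : nth 0%N js q \in js by apply: mem_nth; rewrite sz.
  have /allP/(_ _ qj) jm := aj; have := h _ jm; rewrite nth_mkseq// qj.
  by rewrite index_uniq ?sz//; apply: (sorted_uniq ltn_trans ltnn).
apply: (@countable_bigcupT_measurable _ (gsalg (Ck k))); first exact: countableP.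
move=> [m js]; rewrite /S; case: ifP => [/and3P[_ /eqP sz _]|_]; last exact: measurable0.
by apply: sub_sa; exists (thr js m) => //; exact: (hthr (m, js)).
Qed.

Lemma Ck_mono k l : (k <= l)%N -> <<s Ck k >> `<=` <<s Ck l >>.
Proof.
move=> kl; apply: smallest_sub; first exact: smallest_sigma_algebra.
have clk : cut l <= cut k by rewrite lef_pV2 ?posrE ?ltr0n// ler_nat.
move=> _ [a ha <-]; apply: (@measurableD _ (gsalg (Ck l))); apply: Oset_Ck.
  by apply: sub_all ha => c; exact: le_trans.
by rewrite all_nseq clk orbT.
Qed.

(** Equality of the means of [Gst] passes to the limit as equality of the probabilities of the sets
    [Eset], which generate the Borel sets as k varies. *)
Lemma ip_law_unique (mu nu : prob I R) : (forall n (G : R -> 'M[R]_n.+1), tst G ->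
    forall i j, Ex mu (fun b => MG G b i j) = Ex nu (fun b => MG G b i j)) ->
  forall A, measurable A -> mu A = nu A.
Proof.
move=> h.
have hE k a : all (fun c => cut k <= c) a -> mu (Eset k a) = nu (Eset k a).
  move=> ha; have mE := measurable_Eset ha.
  have hc (m : prob I R) : Ex m (fun b => MG (Gst k a N) b ord0 ord_max) @[N --> \oo] --> fine (m (Eset k a)).
    rewrite -(Ex_indic m mE); have [C hC] := good_Gst ha.
    have bN N := @bmf_MG R alpha _ _ C (hC N) (tst_mmeas (tst_Gst ha N)) ord0 ord_max.
    apply: (@Ex_cvg _ _ _ m (Pfin m) _ _ 1).
    - by move=> N; case: (bN N).
    - move=> N b; have /andP[h0 h1] := substoch_entry ord0 ord_max (substoch_MG (hC N) (ib b)). by rewrite ger0_norm.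
    - by move=> b; exact: MG_Gst_cvg.
  have e : fine (mu (Eset k a)) = fine (nu (Eset k a)).
    have e2 : (fun N => Ex mu (fun b => MG (Gst k a N) b ord0 ord_max)) =
        (fun N => Ex nu (fun b => MG (Gst k a N) b ord0 ord_max)).
      by apply/funext => N; exact: h (tst_Gst ha N) _ _.
    have c1 := hc mu; rewrite e2 in c1. exact: (@cvg_unique _ (@Rhausdorff R) _ _ _ _ c1 (hc nu)).
  by rewrite -[LHS]fineK ?fin_num_measure// e fineK// fin_num_measure.
have hk k A : <<s Ck k >> A -> mu A = nu A.
  move=> kA; apply: (@g_sigma_algebra_measure_unique _ _ _ (Ck k `|` [set setT; set0]) _ (fun=> setT)).
  - move=> B [[a ha <-]|[->|->]]; [exact: measurable_Eset ha|exact: measurableT|exact: measurable0].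
  - by move=> _; right; left.
  - by apply/seteqP; split=> // b _; exists 0%N.
  - exact: Ck_setI.
  - move=> B [[a ha <-]|[->|->]]; first exact: hE.
      exact: (etrans (@probability_setT _ _ _ mu) (esym (@probability_setT _ _ _ nu))).
    by rewrite !measure0.
  - by move=> _; exact: Pfin.
  - by apply: sub_sigma_algebra2 kA => B CB; left.
(* The sets of one level are stable under intersection up to trivial sets, but not those of
   different levels together. The generated sigma-algebras increase with k, so their union is
   stable, and the uniqueness theorem is applied a second time. *)
pose CC : set (set I) := \bigcup_k <<s Ck k >>.
have mCk k : <<s Ck k >> `<=` @measurable _ I.
  apply: smallest_sub; first by split; [exact: measurable0|move=> B mB; rewrite setTD; exact: measurableC|exact: bigcupT_measurable].
  by move=> _ [a ha <-]; exact: measurable_Eset ha.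
move=> A mA; apply: (@g_sigma_algebra_measure_unique _ _ _ CC _ (fun=> setT)).
- by move=> B [k _ /mCk].
- by move=> _; exists 0%N => //; exact: (@measurableT _ (gsalg (Ck 0))).
- by apply/seteqP; split=> // b _; exists 0%N.
- move=> B B' [k _ kB] [k' _ kB']; exists (maxn k k') => //. apply: (@measurableI _ (gsalg (Ck (maxn k k')))).
    by apply: Ck_mono kB; exact: leq_maxl.
  by apply: Ck_mono kB'; exact: leq_maxr.
- by move=> B [k _ /hk].
- by move=> _; exact: Pfin.
move/borel_gen: mA; apply: sub_sigma_algebra2 => _ [a a0 <-].
have [k hk'] : exists k, all (fun c => cut k <= c) a.
  elim: a a0 => [_|c a IH /= /andP[c0 /IH[k hk']]]; first by exists 0%N.
  have [k' _ /(_ k' (leqnn k')) hc] := near_infty_natSinv_lt (PosNum c0).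
  have mono i j : (i <= j)%N -> cut j <= cut i by move=> ij; rewrite lef_pV2 ?posrE ?ltr0n// ler_nat.
  exists (maxn k k'); rewrite /= (le_trans (mono _ _ (leq_maxr k k')) (ltW hc)).
  by apply: sub_all hk' => x; apply: le_trans; exact: mono (leq_maxl _ _).
by exists k => //; exact: Oset_Ck.
Qed.

End determination.

(** * Jumps of nondecreasing right-continuous paths *)

Section path.
Context (R : realType) (y : R -> R).
Hypotheses (y0 : y 0 = 0) (ymono : forall s t : R, 0 <= s -> s <= t -> y s <= y t).
Hypotheses (yrc : forall s : R, 0 <= s -> y r @[r --> s^'+] --> y s).

Lemma left_cvg s : 0 < s -> y r @[r --> s^'-] --> left_limit y s.
Proof.
move=> s0; suff : cvg (y r @[r --> s^'-]) by [].
apply: nondecreasing_at_left_is_cvgr.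
  near=> x => u v; rewrite !in_itv/= => /andP[xu _] /andP[xv _] uv.
  by apply: ymono => //; apply: le_trans (ltW xu); near: x; exact: nbhs_left_ge.
apply: filterS (nbhs_left_ge s0) => x x0.
exists (y s) => _ [u + <-]; rewrite /= in_itv/= => /andP[xu us].
exact: ymono (le_trans x0 (ltW xu)) (ltW us).
Unshelve. all: by end_near. Qed.

Lemma left_le r s : 0 <= r -> r < s -> y r <= left_limit y s.
Proof.
move=> r0 rs; have s0 := le_lt_trans r0 rs.
apply: limr_ge; first exact: cvgP (left_cvg s0).
by near=> u; apply: ymono => //; near: u; exact: nbhs_left_ge.
Unshelve. all: by end_near. Qed.

Lemma left_ge s : 0 < s -> left_limit y s <= y s.
Proof.
move=> s0; apply: limr_le; first exact: cvgP (left_cvg s0).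
near=> u; apply: ymono; last by near: u; exact: nbhs_left_le.
by near: u; exact: nbhs_left_ge.
Unshelve. all: by end_near. Qed.

Lemma left_ge0 s : 0 < s -> 0 <= left_limit y s.
Proof. by move=> s0; rewrite -y0; exact: left_le. Qed.

Lemma left_approx s (e : R) : 0 < s -> 0 < e -> exists r, [/\ 0 <= r, r < s & left_limit y s - e < y r].
Proof.
move=> s0 e0; have /cvgrPdist_lt/(_ e e0) h := left_cvg s0.
near s^'- => r; exists r; split.
- by near: r; exact: nbhs_left_ge.
- by near: r; exact: nbhs_left_lt.
have : `|left_limit y s - y r| < e by near: r; exact: h.
by rewrite ltr_norml => /andP[_]; lra.
Unshelve. all: by end_near. Qed.

Lemma right_approx s (e : R) : 0 <= s -> 0 < e -> exists2 r, s < r & y r < y s + e.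
Proof.
move=> s0 e0; have /cvgrPdist_lt/(_ e e0) h := yrc s0.
near s^'+ => r; exists r; first by near: r; exact: nbhs_right_gt.
have : `|y s - y r| < e by near: r; exact: h.
by rewrite ltr_norml => /andP[+ _]; lra.
Unshelve. all: by end_near. Qed.

Lemma left_mono s t : 0 < s -> s < t -> y s <= left_limit y t.
Proof. by move=> s0; apply: left_le; exact: ltW. Qed.

Definition jump t := y t - left_limit y t.

Lemma jump_ge0 t : 0 < t -> 0 <= jump t.
Proof. by move=> t0; rewrite subr_ge0; exact: left_ge. Qed.

(** No continuous part: finitely many jumps in []0, T]] exhaust y T up to e. This makes the jump
    intervals cover the range up to a null set. *)
Definition pure_jump := forall T e : R, 0 < T -> 0 < e ->
  exists ts : seq R, [/\ sorted <%R ts, forall t, t \in ts -> 0 < t <= T /\ 0 < jump t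
    & y T - \sum_(t <- ts) jump t <= e].

Section passage.
Context (z : R).
Hypotheses (z0 : 0 < z) (zhit : exists2 s : R, 0 < s & z < y s).
Local Notation S := (passage_time y z).

Lemma passage_has_inf : has_inf [set s | 0 < s /\ z < y s].
Proof. by split; [have [s ? ?] := zhit; exists s|exists 0 => s [/ltW]]. Qed.

Lemma passage_gt0 : 0 < S.
Proof.
have [r r0] := right_approx (lexx 0) z0; rewrite y0 add0r => yr.
apply: lt_le_trans r0 _; apply: lb_le_inf; first by case: passage_has_inf.
move=> s [s0 zs]; rewrite leNgt; apply/negP => sr.
by have := ymono (ltW s0) (ltW sr); rewrite leNgt (lt_trans yr).
Qed.

Lemma lt_passage t : 0 <= t -> t < S -> y t <= z.
Proof.
rewrite le_eqVlt => /predU1P[<-|t0] tS; first by rewrite y0 ltW.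
rewrite leNgt; apply/negP => zt; move: tS; rewrite ltNge => /negP; apply.
by apply: ge_inf => //; case: passage_has_inf.
Qed.

Lemma gt_passage t : S < t -> z < y t.
Proof.
move=> /inf_lt; case; first by case: passage_has_inf.
by move=> s [s0 zs] st; apply: lt_le_trans zs _; exact: ymono (ltW s0) (ltW st).
Qed.

Lemma left_passage_le : left_limit y S <= z.
Proof.
apply: limr_le; first exact: cvgP (left_cvg passage_gt0).
near=> u; apply: lt_passage; last by near: u; exact: nbhs_left_lt.
by near: u; exact: nbhs_left_ge passage_gt0.
Unshelve. all: by end_near. Qed.

Lemma passage_ge k (h : R) : 0 < h -> y (k%:R * h) <= z -> k%:R * h <= S.
Proof.
move=> h0 hk; rewrite leNgt; apply/negP => /gt_passage.
by rewrite ltNge hk.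
Qed.

Lemma passage_le k (h : R) : 0 < h -> z < y (k.+1%:R * h) -> S <= k.+1%:R * h.
Proof.
move=> h0 hk; rewrite leNgt; apply/negP => kS.
have k0 : 0 <= k.+1%:R * h by rewrite mulr_ge0// ltW.
by have := lt_passage k0 kS; rewrite leNgt hk.
Qed.

Lemma killed_blocksP U : killed_blocks y z U <->
  exists t, [/\ 0 < t, t < S, left_limit y t < y t & U = (left_limit y t, y t)].
Proof.
split=> [[t [t0 tS jt] <-]|[t [t0 tS jt ->]]]; first by exists t.
by exists t.
Qed.

Lemma ipo_killed : ipo (left_limit y S) (killed_blocks y z).
Proof.
split; first exact: left_ge0 passage_gt0.
  move=> _ /killed_blocksP[t [t0 tS jt ->]]; split => //=; first exact: left_ge0. exact: left_mono.
move=> _ _ /killed_blocksP[s [s0 sS js ->]] /killed_blocksP[t [t0 tS jt ->]].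
move=> [x]; rewrite /block_itv /= !in_itv/= => -[/andP[x1 x2] /andP[x3 x4]].
have [st|ts|->//] := ltgtP s t.
  by have := left_mono s0 st; rewrite leNgt => /negP[]; exact: lt_trans x2.
by have := left_mono t0 ts; rewrite leNgt => /negP[]; exact: lt_trans x4.
Qed.

Definition jblock t := (left_limit y t, y t).

Lemma jblock_chain ts : sorted <%R ts -> (forall t : R, t \in ts -> [/\ 0 < t, t < S & 0 < jump t]) ->
  chain (killed_blocks y z) (map jblock ts).
Proof.
move=> st ht; split; last first.
  move=> _ /mapP[t /ht[t0 tS jt] ->]; apply/killed_blocksP; exists t; split=> //. by rewrite -subr_gt0.
elim: ts st ht => //= t [|t' ts] IH //= /andP[tt st] ht.
have ht' u : u \in t' :: ts -> [/\ 0 < u, u < S & 0 < jump u] by move=> h; apply: ht; rewrite inE h orbT.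
have := IH st ht'; move=> /= ->; rewrite andbT /ltb /=.
have [t0 _ jt] := ht _ (mem_head _ _); have [t'0 _ _] := ht' _ (mem_head _ _).
by rewrite subr_gt0 in jt; apply: lt_le_trans jt _; exact: left_mono.
Qed.

Lemma tl_jblock ts : tl (map jblock ts) = \sum_(t <- ts) jump t.
Proof. by rewrite /tl big_map. Qed.

Lemma killed_is_ip : pure_jump -> is_ip_of (left_limit y S) (killed_blocks y z).
Proof.
move=> pj; apply/is_ip_ofP; split; first exact: ipo_killed.
move=> e e0; have e2 : 0 < e / 2 by rewrite divr_gt0.
have [r [r0 rS hr]] := left_approx passage_gt0 e2.
have [r' r'0 [r'S hr']] : exists2 r', 0 < r' & r' < S /\ left_limit y S - e / 2 < y r'.
  exists ((r + S) / 2); first by have := passage_gt0; lra.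
  by split; [lra|apply: lt_le_trans hr _; apply: ymono => //; lra].
have e4 : 0 < e / 4 by rewrite divr_gt0.
have [ts [st ht hs]] := pj r' (e / 4) r'0 e4.
exists (map jblock ts).
  apply: jblock_chain => // t /ht[/andP[t0 tr] jt]; split=> //; exact: le_lt_trans r'S.
rewrite tl_jblock; lra.
Qed.

End passage.

Lemma sorted_gap (ts : seq R) : exists2 d : R, 0 < d & forall t t', t \in ts -> t' \in ts -> t < t' -> t + d < t'.
Proof.
have H (s : seq R) : (forall x, x \in s -> 0 < x) -> exists2 d : R, 0 < d & forall x, x \in s -> d < x.
  elim: s => [_|x s IH h]; first by exists 1. have [d d0 hd] : exists2 d : R, 0 < d & forall x, x \in s -> d < x.
    by apply: IH => v vs; apply: h; rewrite inE vs orbT.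
  have x0 := h x (mem_head _ _). exists (Num.min d (x / 2)); first by rewrite lt_min d0 divr_gt0.
  move=> v; rewrite inE => /predU1P[->|/hd dv]; rewrite gt_min ?dv//.
  by apply/orP; right; rewrite ltr_pdivrMr// ltr_pMr// ltr1n.
have [|d d0 hd] := H [seq x <- [seq t' - t | t <- ts, t' <- ts] | 0 < x].
  by move=> x; rewrite mem_filter => /andP[].
exists d => // t t' tt tt' h; rewrite addrC -ltrBrDr; apply: hd.
by rewrite mem_filter subr_gt0 h; apply/allpairsP; exists (t, t').
Qed.

Lemma grid_arith (K e L s b u v : R) : 0 <= K -> 0 < e -> L - s < 2 * (e / (4 * (K + 1))) ->
  b <= L -> u <= K * (b - s) -> v <= K * (L - s) -> u + v < e.
Proof.
move=> K0 e0 h bL hu hv.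
have K1 : 0 < K + 1 by rewrite ltr_wpDl.
have : K * (b - s) + K * (L - s) <= K * (4 * (e / (4 * (K + 1)))).
  by rewrite -mulrDr ler_wpM2l//; lra.
have -> : K * (4 * (e / (4 * (K + 1)))) = e * (K / (K + 1)) by field; rewrite gt_eqF.
have : e * (K / (K + 1)) < e by rewrite gtr_pMr// ltr_pdivrMr// mul1r ltrDl.
lra.
Qed.

Section grid.
Context (n : nat) (G : R -> 'M[R]_n.+1) (C : R).
Hypotheses (hG : good C G) (GL : forall u v : R, 0 <= u -> 0 <= v -> nrm (G u - G v) <= C * `|u - v|).

Definition dy (h : R) (i : nat) := y (i.+1%:R * h) - y (i%:R * h).

Definition gridprod h k : 'M[R]_n.+1 := \prod_(i < k) G (dy h i).

Lemma dy_ge0 h i : 0 < h -> 0 <= dy h i.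
Proof.
move=> h0; rewrite subr_ge0; apply: ymono; first by rewrite mulr_ge0// ltW.
by rewrite ler_pM2r// ler_nat.
Qed.

Lemma sum_dy h k : \sum_(i < k) dy h i = y (k%:R * h).
Proof.
elim: k => [|k IH]; first by rewrite big_ord0 mul0r y0.
by rewrite big_ord_recr /= IH /dy addrC subrK.
Qed.

Lemma filter_sorted_le (ts : seq R) (a b : R) : sorted <%R ts -> a <= b ->
  [seq t <- ts | t <= b] = [seq t <- ts | t <= a] ++ [seq t <- ts | a < t <= b].
Proof.
move=> st ab; elim: ts st => //= t ts IH pt; rewrite (IH (path_sorted pt)).
have [ta|ta] := leP t a; first by rewrite (le_trans ta ab) /=.
case: ifP => // tb.
suff -> : [seq u <- ts | u <= a] = [::] by [].
apply/eqP; rewrite -(negbK (_ == _)) -has_filter; apply/hasPn => u ut.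
have /allP/(_ u ut) tu := order_path_min lt_trans pt.
by rewrite -ltNge (lt_trans ta tu).
Qed.

Lemma prod_grid_split (ts : seq R) (h : R) k (F : R -> 'M[R]_n.+1) : 0 < h -> sorted <%R ts ->
  (forall t, t \in ts -> 0 < t) -> \prod_(t <- ts | t <= k%:R * h) F t =
  \prod_(i < k) \prod_(t <- ts | i%:R * h < t <= i.+1%:R * h) F t.
Proof.
move=> h0 st ht; elim: k => [|k IH].
  rewrite big_ord0 big_seq_cond big1// => t /andP[/ht t0]; rewrite mul0r. by rewrite leNgt t0.
rewrite big_ord_recr /= -IH -big_filter.
have le : k%:R * h <= k.+1%:R * h by rewrite ler_pM2r// ler_nat.
by rewrite (filter_sorted_le st le) big_cat !big_filter.
Qed.

Lemma sum_grid_split (ts : seq R) (h : R) k (F : R -> R) : 0 < h -> sorted <%R ts -> (forall t, t \in ts -> 0 < t) ->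
  \sum_(t <- ts | t <= k%:R * h) F t = \sum_(i < k) \sum_(t <- ts | i%:R * h < t <= i.+1%:R * h) F t.
Proof.
move=> h0 st ht; elim: k => [|k IH].
  rewrite big_ord0 big_seq_cond big1// => t /andP[/ht t0]; rewrite mul0r. by rewrite leNgt t0.
rewrite big_ord_recr /= -IH -big_filter.
have le : k%:R * h <= k.+1%:R * h by rewrite ler_pM2r// ler_nat.
by rewrite (filter_sorted_le st le) big_cat !big_filter.
Qed.

(** Jump times more than h apart share no cell of mesh h, so l has at most one element; the
    Lipschitz bound compares the increment with that jump, or with 0. *)
Lemma grid_step (h : R) (i : nat) (l : seq R) : 0 < h -> uniq l ->
  (forall t, t \in l -> [/\ 0 < t, i%:R * h < t & t <= i.+1%:R * h]) ->
  (forall t t', t \in l -> t' \in l -> t < t' -> t + h < t') ->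
  nrm (G (dy h i) - \prod_(t <- l) G (jump t)) <= C * (dy h i - \sum_(t <- l) jump t).
Proof.
move=> h0; have [C0 sG G1] := hG.
case: l => [_ _ _|t [|t' l]].
- by rewrite !big_nil subr0; exact/G1/dy_ge0.
- move=> _ /(_ t (mem_head _ _))[tp t1 t2] _; rewrite !big_seq1. have i0 : 0 <= i%:R * h by rewrite mulr_ge0// ltW.
  apply: le_trans (GL (dy_ge0 _ h0) (jump_ge0 tp)) _. rewrite ger0_norm// /jump /dy.
  have := left_le i0 t1; have := ymono (ltW tp) t2; lra.
- rewrite /= => /andP[]; rewrite inE negb_or => /andP[tt' _] _ ht' gap.
  have m1 : t \in [:: t, t' & l] by rewrite mem_head. have m2 : t' \in [:: t, t' & l] by rewrite !inE eqxx orbT.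
  have [_ h2 h3] := ht' t m1; have [_ h5 h6] := ht' t' m2.
  have e : i.+1%:R * h = i%:R * h + h by rewrite -natr1 mulrDl mul1r.
  exfalso; have [lt|lt|e'] := ltgtP t t'; last by rewrite e' eqxx in tt'.
    by have := lt_le_trans (gap _ _ m1 m2 lt) h6; rewrite e ltrD2r ltNge (ltW h2).
  by have := lt_le_trans (gap _ _ m2 m1 lt) h3; rewrite e ltrD2r ltNge (ltW h5).
Qed.

Lemma grid_compare (ts : seq R) (h : R) k : 0 < h -> sorted <%R ts -> (forall t, t \in ts -> 0 < t <= k%:R * h) ->
  (forall t t', t \in ts -> t' \in ts -> t < t' -> t + h < t') -> nrm (gridprod h k - \prod_(t <- ts) G (jump t)) <=
    Kn R n * C * (y (k%:R * h) - \sum_(t <- ts) jump t).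
Proof.
move=> h0 st ht gap; have [C0 sG G1] := hG.
have t0 t : t \in ts -> 0 < t by move=> /ht/andP[].
have allk : [seq t <- ts | t <= k%:R * h] = ts by apply/all_filterP/allP => t /ht/andP[].
have -> : \prod_(t <- ts) G (jump t) = \prod_(i < k) \prod_(t <- ts | i%:R * h < t <= i.+1%:R * h) G (jump t).
  by rewrite -(prod_grid_split k (fun t => G (jump t)) h0 st t0) -[RHS]big_filter allk.
have sumE : \sum_(t <- ts) jump t = \sum_(i < k) \sum_(t <- ts | i%:R * h < t <= i.+1%:R * h) jump t.
  by rewrite -(sum_grid_split k jump h0 st t0) -[RHS]big_filter allk.
apply: le_trans (nrm_prodB _ _) _.
- by move=> i _; apply: sG; exact: dy_ge0.
- by move=> i _; rewrite -big_filter; apply: substoch_prod => t;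
    rewrite mem_filter => /andP[_ /t0 tt]; apply: sG; exact: jump_ge0.
rewrite -mulrA ler_wpM2l ?Kn_ge0//.
have -> : y (k%:R * h) - \sum_(t <- ts) jump t =
    \sum_(i < k) (dy h i - \sum_(t <- ts | i%:R * h < t <= i.+1%:R * h) jump t).
  by rewrite [RHS]sumrB [in LHS]sumE sum_dy.
rewrite mulr_sumr; apply: ler_sum => i _.
have := @grid_step h i [seq t <- ts | i%:R * h < t <= i.+1%:R * h] h0.
rewrite !big_filter; apply.
- by apply: filter_uniq; apply: sorted_uniq st; [exact: lt_trans|exact: ltxx].
- by move=> t; rewrite mem_filter => /andP[/andP[? ?] /t0].
- by move=> t t'; rewrite !mem_filter => /andP[_ ?] /andP[_ ?]; exact: gap.
Qed.

Lemma mprod_jblock ts : mprod G (map jblock ts) = \prod_(t <- ts) G (jump t).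
Proof. by rewrite /mprod big_map. Qed.

Section convergence.
Context (z : R).
Hypotheses (z0 : 0 < z) (zhit : exists2 s : R, 0 < s & z < y s).
Local Notation S := (passage_time y z).
Hypothesis pj : pure_jump.
Variables (h_ : nat -> R) (k_ : nat -> nat).
Hypotheses (h_gt0 : forall l, 0 < h_ l) (h_cvg : h_ l @[l --> \oo] --> (0 : R)).
Hypotheses (hk1 : forall l, y ((k_ l)%:R * h_ l) <= z) (hk2 : forall l, z < y ((k_ l).+1%:R * h_ l)).
Hypotheses (hS : forall l k, k%:R * h_ l != S).

(** If the last grid time at or below level z were the passage time itself, the grid product would
    include the jump at passage, which [killed_blocks] leaves out. *)
Let kS l : (k_ l)%:R * h_ l < S.
Proof. by rewrite lt_neqAle hS passage_ge. Qed.

Let k0 l : 0 <= (k_ l)%:R * h_ l.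
Proof. by rewrite mulr_ge0// ltW. Qed.

Let near_k r : r < S -> \forall l \near \oo, r < (k_ l)%:R * h_ l.
Proof.
move=> rS; have d0 : 0 < S - r by rewrite subr_gt0.
have /cvgrPdist_lt/(_ _ d0) := h_cvg; apply: filterS => l.
rewrite sub0r normrN ger0_norm ?ltW// => hl.
have := passage_le z0 zhit (h_gt0 l) (hk2 l); rewrite -natr1 mulrDl mul1r; lra.
Qed.

Lemma grid_left_cvg : y ((k_ l)%:R * h_ l) @[l --> \oo] --> left_limit y S.
Proof.
apply/cvgrPdist_lt => e e0.
have [r [r0 rS hr]] := left_approx (passage_gt0 z0 zhit) e0.
apply: filterS (near_k rS) => l rk.
have h1 := left_le (k0 l) (kS l); have h2 := ymono r0 (ltW rk).
by rewrite ger0_norm ?subr_ge0//; lra.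
Qed.

(** Both matrices are compared with the finite product over jumps ts that miss less than [2 e1] of
    the length: [grid_compare] handles the grid, [MG_approx] the infinite product, and e1 is chosen
    so that the two errors stay below e. *)
Lemma grid_MG_cvg : nrm (gridprod (h_ l) (k_ l) - MG G (killed_blocks y z)) @[l --> \oo] --> (0 : R).
Proof.
have [C0 _ _] := hG.
have KC : 0 <= Kn R n * C by rewrite mulr_ge0// Kn_ge0.
have bK : blocks_of (left_limit y S) (killed_blocks y z).
  have h := killed_is_ip z0 zhit pj; rewrite -(ip_massE h). by apply: ip_blocks_of; exists (left_limit y S).
apply/cvgrPdist_lt => e e0.
pose e1 := e / (4 * (Kn R n * C + 1)).
have e10 : 0 < e1 by rewrite divr_gt0// mulr_gt0// ltr_wpDl.
have [ts [st ht hs]] : exists ts : seq R, [/\ sorted <%R ts, forall t, t \in ts -> [/\ 0 < t, t < S & 0 < jump t] &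
    left_limit y S - \sum_(t <- ts) jump t < 2 * e1].
  have [r [r0 rS hr]] := left_approx (passage_gt0 z0 zhit) e10.
  have [ts [st ht hs]] : exists ts : seq R, [/\ sorted <%R ts, forall t, t \in ts -> 0 < t <= r /\ 0 < jump t
    & y r - \sum_(t <- ts) jump t <= e1]. move: r0; rewrite le_eqVlt => /predU1P[r0|r0]; last exact: pj.
    by exists [::]; split=> //; rewrite big_nil -r0 y0 subr0 ltW.
  exists ts; split=> //; last lra. by move=> t /ht[/andP[t0 tr] jt]; split=> //; exact: le_lt_trans rS.
have [d d0 hd] := sorted_gap ts.
have [r r0 [rS hr]] : exists2 r, 0 <= r & r < S /\ forall t, t \in ts -> t <= r.
  move: (passage_gt0 z0 zhit) => Sp. elim: ts ht {st hs hd} => [_|t ts IH ht]; first by exists 0.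
  have [u u0 [uS hu]] : exists2 r, 0 <= r & r < S /\ forall t, t \in ts -> t <= r.
    by apply: IH => v vt; apply: ht; rewrite inE vt orbT.
  have [t0 tS _] := ht _ (mem_head _ _). exists (Num.max t u); first by rewrite le_max u0 orbT.
  split; first by rewrite gt_max tS.
  by move=> v; rewrite inE => /predU1P[->|/hu]; rewrite le_max ?lexx// => ->; rewrite orbT.
have cs := jblock_chain st ht.
have := MG_approx hG bK cs; rewrite tl_jblock mprod_jblock => hM.
have /cvgrPdist_lt/(_ _ d0) hh := h_cvg.
near=> l.
have rk : r < (k_ l)%:R * h_ l by near: l; exact: near_k.
have hl : h_ l < d.
  have : `|0 - h_ l| < d by near: l; exact: hh. by rewrite sub0r normrN ger0_norm ?ltW.
have hg := @grid_compare ts (h_ l) (k_ l) (h_gt0 l) st _ _.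
have {}hg : nrm (gridprod (h_ l) (k_ l) - \prod_(t <- ts) G (jump t)) <=
    Kn R n * C * (y ((k_ l)%:R * h_ l) - \sum_(t <- ts) jump t).
  apply: hg.
    move=> t tt; have [t0 _ _] := ht _ tt; rewrite t0 (le_trans (hr _ tt))// ltW//.
  move=> t t' tt tt' h; apply: lt_trans (hd _ _ tt tt' h); rewrite ltrD2l//.
rewrite sub0r normrN ger0_norm ?nrm_ge0//.
have -> : gridprod (h_ l) (k_ l) - MG G (killed_blocks y z) = (gridprod (h_ l) (k_ l) - \prod_(t <- ts) G (jump t)) +
    (\prod_(t <- ts) G (jump t) - MG G (killed_blocks y z)) by rewrite addrA subrK.
apply: le_lt_trans (nrmD _ _) _.
rewrite [X in _ + X < _]nrmB.
have hb := left_le (k0 l) (kS l).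
apply: grid_arith KC e0 hs hb hg hM.
Unshelve. all: by end_near. Qed.

End convergence.

End grid.

End path.

(** * Bounded functionals, densities and Laplace transforms *)

Import HBNNSimple.

Section bounded_functionals.
Context d (T : mtype d) (R : realType).
Implicit Types f g : T -> R.

(** Functionals that behave like integration against a finite signed measure: linear, and continuous
    under bounded convergence. Equality of two laws becomes the vanishing of a difference. *)
Definition bfun (Phi : (T -> R) -> R) := [/\ forall f g, bmf f -> bmf g -> Phi (fun x => f x + g x) = Phi f + Phi g,
      forall c f, bmf f -> Phi (fun x => c * f x) = c * Phi f &
      forall (f_ : nat -> T -> R) f (C : R), (forall n, mfT (f_ n)) ->
        (forall n x, `|f_ n x| <= C) -> (forall x, f_ n x @[n --> \oo] --> f x) -> Phi (f_ n) @[n --> \oo] --> Phi f].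

Variable Phi : (T -> R) -> R.
Hypothesis bPhi : bfun Phi.

Lemma bmf_indic A : measurable A -> bmf (\1_A : T -> R).
Proof.
by move=> mA; apply: bmf01 => // x; rewrite indicE; case: (_ \in _); rewrite /= lexx ler01.
Qed.

Lemma bfun_lin (I : Type) (s : seq I) (c : I -> R) (A : I -> set T) :
  (forall k, measurable (A k)) -> (forall k, Phi \1_(A k) = 0) -> Phi (fun x => \sum_(k <- s) c k * \1_(A k) x) = 0.
Proof.
have [PD PZ _] := bPhi; move=> mA h.
have b k : bmf (fun x => c k * \1_(A k) x) by apply: bmfM; [exact: bmf_cst|exact: bmf_indic].
elim: s => [|k s IH].
  under eq_fun do rewrite big_nil. by have := PZ 0 _ (bmf_cst T (0 : R)); rewrite !mul0r.
under eq_fun do rewrite big_cons.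
by rewrite PD ?PZ ?h ?mulr0 ?IH ?addr0//; [exact: bmf_indic|exact: bmf_sum].
Qed.

Lemma bfun_ext : (forall A, measurable A -> Phi \1_A = 0) -> forall f, bmf f -> Phi f = 0.
Proof.
have [PD PZ PC] := bPhi; move=> h.
suff H f C : mfT f -> (forall x, 0 <= f x <= C) -> Phi f = 0.
  move=> f [mf [C hC]].
  have hg x : 0 <= f x + C <= C + C by have := hC x; rewrite ler_norml => /andP[? ?]; apply/andP; split; lra.
  have mg : mfT (fun x => f x + C) by exact: mfD. have bg : bmf (fun x => f x + C).
    by split=> //; exists (C + C) => x; have /andP[? ?] := hg x; rewrite ger0_norm.
  have b1 : bmf (\1_(setT : set T) : T -> R) by exact: bmf_indic.
  have -> : f = (fun x => (f x + C) + - C * \1_setT x) by apply/funext => x; rewrite indicT mulr1 addrK.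
  by rewrite PD ?PZ ?(H _ _ mg hg) ?h ?mulr0 ?addr0//; apply: bmfM => //; exact: bmf_cst.
move=> mf fC; have mF : mfT (EFin \o f) by exact/mEFin.
have f0 x : [set: T] x -> (0 <= (EFin \o f) x)%E by rewrite lee_fin; case/andP: (fC x).
pose g n := nnsfun_approx measurableT mF n.
have P0 n : Phi (g n) = 0.
  rewrite (_ : (g n : T -> R) = (fun x => \sum_(y <- fset_set (range (g n))) y * \1_(g n @^-1` [set y]) x)).
    by apply: bfun_lin => y; [|apply: h]; exact: measurable_funPTI.
  by apply/funext => x; rewrite fimfunE fsbig_finite.
have := PC (fun n => g n) f C.
rewrite (_ : (fun n => Phi (g n)) = (fun=> 0)); last exact/funext.
move=> /(_ _ _ _)/wrap[n||x|].
- exact: mfPT.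
- move=> n x; rewrite ger0_norm//; have /andP[_] := fC x; apply: le_trans.
  by rewrite -lee_fin nnsfun_approxE; exact: le_approx.
- by have /fine_cvg := @cvg_nnsfun_approx _ _ _ _ measurableT _ mF f0 x Logic.I.
- by move=> /(cvg_lim (@Rhausdorff R)) <-; rewrite lim_cst//; exact: Rhausdorff.
Qed.

(* The pi-lambda theorem for functionals. *)
Lemma bfun_gen (G : set (set T)) : @measurable _ T = <<s G >> -> setI_closed G ->
  Phi (fun=> 1) = 0 -> (forall A, G A -> Phi \1_A = 0) -> forall f, bmf f -> Phi f = 0.
Proof.
have [PD PZ PC] := bPhi; move=> mG GI P1 PG.
apply: bfun_ext => A mA.
have b1 : bmf (fun _ : T => 1 : R) by exact: bmf_cst.
move: (mA); rewrite mG; apply: (@dynkin_induction _ T G (fun A => Phi \1_A = 0)) => //.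
- by rewrite indicT.
- move=> S mS PS. have -> : \1_(~` S) = (fun x => 1 + -1 * \1_S x) :> (T -> R).
    by apply/funext => x; rewrite !indicE in_setC; case: (_ \in _) => /=; lra.
  have bS := bmf_indic mS. rewrite PD//; last by apply: bmfM => //; exact: bmf_cst. by rewrite PZ// PS P1 mulr0 addr0.
- move=> F mF tF PF. have := PC (fun n x => \sum_(k < n) \1_(F k) x) (\1_(\bigcup_k F k)) 1.
  have -> : (fun n => Phi (fun x => \sum_(k < n) \1_(F k) x)) = (fun=> 0).
    apply/funext => n; rewrite -[RHS](bfun_lin (index_enum 'I_n) (fun=> 1) (fun k => mF (val k)) (fun k => PF (val k))).
    by congr Phi; apply/funext => x; apply: eq_bigr => k _; rewrite mul1r.
  have E x : (exists k0, forall n, \sum_(k < n) (\1_(F k) x : R) = (k0 < n)%N%:R) \/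
      (~ (\bigcup_k F k) x /\ forall n, \sum_(k < n) (\1_(F k) x : R) = 0).
    have [[k0 _ Fk0]|nF] := pselect ((\bigcup_k F k) x).
      left; exists k0; elim=> [|n IH]; first by rewrite big_ord0.
      rewrite big_ord_recr /= IH indicE -natrD; congr _%:R. have -> : (x \in F n) = (n == k0).
        apply/idP/eqP => [|->]; last by rewrite inE. rewrite inE => Fn; apply: (tF n k0 I I); by exists x.
      by rewrite ltnS [in RHS]leq_eqVlt eq_sym; case: ltngtP.
    right; split=> // n; apply: big1 => k _; rewrite indicE. by rewrite memNset// => Fk; apply: nF; exists (val k).
  move=> /(_ _ _ _)/wrap[].
  + by move=> n; apply: measurable_sum => k; exact: (bmf_indic (mF k)).1.
  + move=> n x; have [[k0 ->]|[_ ->]] := E x; last by rewrite normr0. by case: (_ < _)%N; rewrite ?normr1 ?normr0.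
  + move=> x; have [[k0 hk]|[nF hk]] := E x; last first.
      by under eq_fun do rewrite hk; rewrite indicE memNset//; exact: cvg_cst.
    have -> : \1_(\bigcup_k F k) x = 1 :> R.
      rewrite indicE mem_set//; apply: contrapT => nF.
      have := hk k0.+1; rewrite ltnSn big1 => [/esym/eqP|k _]; first by rewrite oner_eq0.
      by rewrite indicE memNset// => Fk; apply: nF; exists (val k).
    apply: cvg_near_cst; exists k0.+1 => // n /= kn; rewrite hk kn//.
  + by move=> /(cvg_lim (@Rhausdorff R)) <-; rewrite lim_cst//; exact: Rhausdorff.
Qed.

End bounded_functionals.

Lemma Ex_indicX d d' (T : mtype d) (U : mtype d') (R : realType)
    (mu : {measure set T -> \bar R}) (X : T -> U) A : mfT X -> measurable A ->
  Ex mu (fun w => \1_A (X w)) = fine (mu (X @^-1` A)).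
Proof.
move=> mX mA; rewrite /Ex /Rintegral; congr fine.
rewrite (_ : (fun w => _) = EFin \o \1_(X @^-1` A)); last by apply/funext => w; rewrite /= !indicE.
by rewrite integral_indic ?setIT//; exact: measurable_preim.
Qed.

Section functional_examples.
Context (R : realType).

Lemma bfunctionalB d (T : mtype d) (Phi Psi : (T -> R) -> R) : bfun Phi -> bfun Psi -> bfun (fun g => Phi g - Psi g).
Proof.
move=> [a1 a2 a3] [b1 b2 b3]; split.
- by move=> f g bf bg; rewrite a1// b1//; ring.
- by move=> c f bf; rewrite a2// b2//; ring.
- by move=> f_ f C mf hf cf; apply: cvgB; [exact: a3 cf|exact: b3 cf].
Qed.

Lemma bfun_eq d (T : mtype d) (Phi Psi : (T -> R) -> R) :
  bfun Phi -> bfun Psi -> (forall A, measurable A -> Phi \1_A = Psi \1_A) -> forall f, bmf f -> Phi f = Psi f.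
Proof.
move=> h1 h2 h f bf; apply/subr0_eq; apply: (bfun_ext (bfunctionalB h1 h2)) bf => A mA.
by rewrite h// subrr.
Qed.

Lemma bfun_comp d d' (T : mtype d) (U : mtype d') (Phi : (T -> R) -> R) (X : T -> U) : mfT X -> bfun Phi ->
  bfun (fun g => Phi (fun w => g (X w))).
Proof.
move=> mX [a1 a2 a3].
have bX g (bg : bmf g) : bmf (fun w => g (X w)) by exact: bmf_comp.
split.
- by move=> f g bf bg; rewrite a1//; exact: bX.
- by move=> c f bf; rewrite a2//; exact: bX.
- by move=> f_ f C mf hf cf; apply: (a3 _ _ C) => // n; exact: mcomp.
Qed.

Lemma bfun_mul d (T : mtype d) (Phi : (T -> R) -> R) (h : T -> R) :
  bmf h -> bfun Phi -> bfun (fun g => Phi (fun w => h w * g w)).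
Proof.
move=> bh [a1 a2 a3]; have [mh [K hK]] := bh; split.
- move=> f g bf bg; rewrite -a1; [|exact: bmfM..]. by congr Phi; apply/funext => w; rewrite mulrDr.
- move=> c f bf; rewrite -a2; last exact: bmfM. by congr Phi; apply/funext => w; rewrite mulrCA.
- move=> f_ f C mf hf cf; apply: (a3 _ _ (K * C)).
  + by move=> n; exact: mfM.
  + by move=> n x; rewrite normrM ler_pM.
  + by move=> x; apply: cvgMr; exact: cf.
Qed.

Section expectation.
Context d d' (T : mtype d) (U : mtype d') (mu : {measure set T -> \bar R}) (X : T -> U).
Hypotheses (fmu : (mu setT < +oo)%E) (mX : mfT X).

Let bE : bfun (Ex mu).
Proof.
split; [by move=> *; exact: ExD|by move=> *; exact: ExZ|by move=> f_ f C; exact: Ex_cvg].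
Qed.

Lemma bfun_Ex : bfun (fun g => Ex mu (fun w => g (X w))).
Proof. exact: bfun_comp. Qed.

Lemma bfun_wEx (h : T -> R) : bmf h -> bfun (fun g => Ex mu (fun w => h w * g (X w))).
Proof. by move=> bh; exact: (bfun_comp mX (bfun_mul bh bE)). Qed.

End expectation.

(** The function [exp(- l x)] is bounded only for x >= 0; with the positive part it can be applied
    to real variables that are nonnegative merely almost surely. *)
Definition pos (x : R) := Num.max x 0.

Lemma mpos : mfT pos.
Proof. exact: measurable_maxr. Qed.

Lemma pos_ge0 x : 0 <= pos x.
Proof. by rewrite le_max lexx orbT. Qed.

Lemma pos_id x : 0 <= x -> pos x = x.
Proof. by move=> x0; rewrite /pos max_l. Qed.

Lemma bmf_exppos (l : R) : 0 <= l -> bmf (fun x => expR (- l * pos x)).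
Proof.
move=> l0; apply: bmf01 => [|x].
  by apply: mexpR; apply: mfM => //; exact: mpos.
by rewrite expR_ge0 expR_le_1// mulNr oppr_le0 mulr_ge0 ?pos_ge0.
Qed.

(** By linearity Phi vanishes on exponential sums, hence, through [expstep], on the indicators of
    the half-lines []a, +oo[], which generate the Borel sets. *)
Lemma bfun_laplace0 (Phi : (R -> R) -> R) : bfun Phi -> (forall l, 0 <= l -> Phi (fun x => expR (- l * pos x)) = 0) ->
  forall f, bmf f -> Phi (fun x => f (pos x)) = 0.
Proof.
move=> bP hl.
have [PD PZ PC] := bP.
have P1 : Phi (fun=> 1) = 0.
  by rewrite -[RHS](hl 0 (lexx _)); congr Phi; apply/funext => x; rewrite oppr0 mul0r expR0.
have hs (s : R -> R) : sexp s -> Phi (fun x => s (pos x)) = 0.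
  move=> [l l0 sE]; have -> : (fun x => s (pos x)) =
      (fun x => \sum_(p <- l) expR (- p.1 * pos x) * p.2) by apply/funext.
  suff [_ ->] : bmf (fun x => \sum_(p <- l) expR (- p.1 * pos x) * p.2) /\
    Phi (fun x => \sum_(p <- l) expR (- p.1 * pos x) * p.2) = 0 by [].
  elim: l l0 {sE} => [_|p l IH /= /andP[p0 /IH[b1 e1]]].
    have -> : (fun x => \sum_(p <- [::]) expR (- p.1 * pos x) * p.2) = (fun=> 0 * 1).
      by apply/funext => x; rewrite big_nil mul0r.
    split; first exact: bmf_cst. by rewrite (PZ 0 (fun=> 1)) ?P1 ?mulr0//; exact: bmf_cst.
  have -> : (fun x => \sum_(j <- p :: l) expR (- j.1 * pos x) * j.2) =
    (fun x => p.2 * expR (- p.1 * pos x) + \sum_(j <- l) expR (- j.1 * pos x) * j.2).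
    by apply/funext => x; rewrite big_cons mulrC.
  have b2 : bmf (fun x => p.2 * expR (- p.1 * pos x)) by apply: bmfM; [exact: bmf_cst|exact: bmf_exppos].
  split; first exact: bmfD. by rewrite PD// PZ ?hl ?mulr0 ?e1 ?addr0//; exact: bmf_exppos.
have bP' := bfun_comp mpos bP.
apply: (@bfun_gen _ _ _ _ bP' (@RGenOInfty.G R)).
- exact: RGenOInfty.measurableE.
- move=> _ _ [x ->] [y ->]; exists (Num.max x y); apply/seteqP.
  split=> z /=; rewrite !in_itv/= !andbT gt_max; first by move=> [-> ->]. by move=> /andP[].
- exact: P1.
- move=> _ [a ->]; have [a0|a0] := ltP a 0.
    rewrite -[RHS]P1; congr Phi; apply/funext => x; rewrite indicE mem_set//=.
    by rewrite in_itv/= andbT (lt_le_trans a0)// pos_ge0.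
  have := PC (fun N x => expstep a N (pos x)) (fun x => \1_(`]a, +oo[%classic) (pos x)) 1.
  have -> : (fun N => Phi (fun x => expstep a N (pos x))) = (fun=> 0).
    by apply/funext => N; apply: hs; exact: sexp_expstep.
  move=> /(_ _ _ _)/wrap[].
  + move=> N; apply: mcomp mpos. have [s _ sE] := sexp_expstep a N; rewrite (funext sE).
    apply: measurable_sum => p; apply: mfM => //. by apply: mexpR; exact: mfM.
  + by move=> N x; have /andP[h0 h1] := expstep01 a N (pos_ge0 x); rewrite ger0_norm.
  + move=> x; have := cvg_expstep a0 (pos_ge0 x); congr (_ --> _).
    rewrite indicE; congr _%:R; congr nat_of_bool; apply/idP/idP.
      by move=> h; rewrite inE /= in_itv/= h.
    by rewrite inE /= in_itv/= andbT.
  + by move=> /(cvg_lim (@Rhausdorff R)) <-; rewrite lim_cst//; exact: Rhausdorff.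
Qed.

Lemma bfun_laplace (Phi Psi : (R -> R) -> R) : bfun Phi -> bfun Psi ->
  (forall l, 0 <= l -> Phi (fun x => expR (- l * pos x)) = Psi (fun x => expR (- l * pos x))) ->
  forall f, bmf f -> Phi (fun x => f (pos x)) = Psi (fun x => f (pos x)).
Proof.
move=> h1 h2 h f bf; apply/subr0_eq; apply: (bfun_laplace0 (bfunctionalB h1 h2)) bf => l l0.
by rewrite h// subrr.
Qed.

Lemma laplace_Ex d1 d2 (T1 : mtype d1) (T2 : mtype d2)
    (m1 : {measure set T1 -> \bar R}) (m2 : {measure set T2 -> \bar R})
    (X1 : T1 -> R) (X2 : T2 -> R) : (m1 setT < +oo)%E -> (m2 setT < +oo)%E ->
  mfT X1 -> mfT X2 ->
  {ae m1, forall w, 0 <= X1 w} -> {ae m2, forall w, 0 <= X2 w} ->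
  (forall l, 0 <= l -> Ex m1 (fun w => expR (- l * X1 w)) = Ex m2 (fun w => expR (- l * X2 w))) ->
  forall f, bmf f -> Ex m1 (fun w => f (X1 w)) = Ex m2 (fun w => f (X2 w)).
Proof.
move=> f1 f2 mX1 mX2 p1 p2 h f bf.
have posE d (T : mtype d) (m : {measure set T -> \bar R}) (X : T -> R) (g : R -> R) :
    mfT X -> {ae m, forall w, 0 <= X w} -> mfT g -> Ex m (fun w => g (pos (X w))) = Ex m (fun w => g (X w)).
  move=> mX p mg; apply: ae_eq_Ex.
  - by apply: mcomp => //; exact: mcomp mpos _.
  - exact: mcomp.
  - by apply: filterS p => w w0; rewrite pos_id.
have mE (l : R) : mfT (fun x : R => expR (l * x)).
  by apply: mexpR; exact: mfM.
rewrite -(posE _ _ m1 X1 f mX1 p1 bf.1) -(posE _ _ m2 X2 f mX2 p2 bf.1).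
apply: (bfun_laplace (bfun_Ex f1 mX1) (bfun_Ex f2 mX2)) bf => l l0.
by rewrite (posE _ _ m1 X1 _ mX1 p1 (mE (- l))) (posE _ _ m2 X2 _ mX2 p2 (mE (- l))) h.
Qed.

End functional_examples.

Local Notation Lap P m l := (Ex P (fun w => expR (- l * pos (m w)))).

Section densities.
Context d (T : mtype d) (R : realType) (m : {measure set T -> \bar R}).
Variables (p : T -> R).
Hypotheses (mp : mfT p) (p0 : forall x, 0 <= p x).
Hypothesis ip : m.-integrable setT (EFin \o p).

Lemma density_integrable g : bmf g -> m.-integrable setT (fun x => (g x * p x)%:E).
Proof.
move=> [mg [C hC]].
apply: (@le_integrable _ _ _ m setT measurableT _ (fun x => (`|C| * p x)%:E)).
- by apply/mEFin; exact: mfM.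
- move=> x _; rewrite /= lee_fin !normrM normr_id ler_wpM2r//. by rewrite (le_trans (hC x))// ler_norm.
- by have := integrableZl measurableT `|C| ip.
Qed.

Lemma Ex_density d' (U : mtype d') (nu : {measure set U -> \bar R}) (X : U -> T) : (nu setT < +oo)%E -> mfT X ->
  (forall A, measurable A -> nu (X @^-1` A) = (\int[m]_(x in A) (p x)%:E)%E) ->
  forall g, bmf g -> Ex nu (fun w => g (X w)) = \int[m]_x (g x * p x).
Proof.
move=> fnu mX h g bg.
apply: (bfun_eq (bfun_Ex fnu mX) (Psi := fun g => \int[m]_x (g x * p x))) bg => [|A mA].
  split.
  - move=> f k bf bk; rewrite -RintegralD//; try exact: density_integrable.
    by apply: eq_Rintegral => x _; rewrite mulrDl.
  - move=> c f bf; rewrite -RintegralZl//; last exact: density_integrable.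
    by apply: eq_Rintegral => x _; rewrite mulrA.
  - move=> f_ f C mf hf cf. have bf : bmf f by exact: (bmf_lim mf hf cf).
    have /(_ _ _ _ _ _)[] := @dominated_convergence _ _ _ m setT measurableT
      (fun n x => (f_ n x * p x)%:E) (fun x => (f x * p x)%:E) (fun x => (`|C| * p x)%:E).
    + by move=> n; apply/mEFin; exact: mfM.
    + by apply/mEFin; apply: mfM => //; exact: bf.1.
    + by apply: aeW => x _; apply: cvg_EFin; [exact: nearW|exact: cvgMl (cf x)].
    + by have := integrableZl measurableT `|C| ip.
    + apply: aeW => x n _; rewrite /= lee_fin normrM (ger0_norm (p0 x)) ler_wpM2r//.
      by rewrite (le_trans (hf n x))// ler_norm.
    move=> _ _ H; apply: fine_cvg; rewrite /Rintegral fineK//.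
    exact: (integrable_fin_num measurableT (density_integrable bf)).
rewrite Ex_indicX// h// -(setTI A) integral_mkcondr setTI; congr fine.
apply: eq_integral => x _; rewrite /patch indicE.
by case: (x \in A); rewrite ?mul1r ?mul0r.
Qed.

Definition dens (A : set T) : \bar R := (\int[m]_(x in A) (p x)%:E)%E.

Let dens0 : dens set0 = 0%E. Proof. by rewrite /dens integral_set0. Qed.

Let dens_ge0 A : (0 <= dens A)%E.
Proof. by apply: integral_ge0 => x _; rewrite lee_fin. Qed.

Let dens_sigma : semi_sigma_additive dens.
Proof.
move=> /= F mF tF mUF; rewrite /dens; apply: cvg_toP.
  apply: ereal_nondecreasing_is_cvgn => k n kn. apply: lee_sum_nneg_natr => // l _ _; apply: integral_ge0 => /= x Fkx.
  by rewrite lee_fin.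
rewrite ge0_integral_bigcup//=; first exact/measurable_funTS/mcomp.
by move=> x _; rewrite lee_fin.
Qed.

Definition tilt : {measure set T -> \bar R} := HB.pack_for {measure set T -> \bar R} dens
    (isMeasure.Build _ _ _ dens dens0 dens_ge0 dens_sigma).

End densities.

(** * Exponential killing and the increments of the subordinator *)

Section same_law.
Context d1 d2 d' (T1 : mtype d1) (T2 : mtype d2) (U : mtype d')
  (R : realType) (P1 : {measure set T1 -> \bar R}) (P2 : {measure set T2 -> \bar R}).

Lemma Ex_law (X1 : T1 -> U) (X2 : T2 -> U) : (P1 setT < +oo)%E -> (P2 setT < +oo)%E -> mfT X1 -> mfT X2 ->
  (forall A, measurable A -> P1 (X1 @^-1` A) = P2 (X2 @^-1` A)) ->
  forall f : U -> R, bmf f -> Ex P1 (fun w => f (X1 w)) = Ex P2 (fun w => f (X2 w)).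
Proof.
move=> f1 f2 m1 m2 h f bf.
apply: (bfun_eq (bfun_Ex f1 m1) (bfun_Ex f2 m2)) bf => A mA.
by rewrite !Ex_indicX// h.
Qed.

End same_law.

Section exponential_variable.
Context d (Om : mtype d) (R : realType) (P : prob Om R) (Z : Om -> R) (rho : R).
Hypotheses (mZ : mfT Z) (rho0 : 0 < rho).
Hypothesis hZ : forall A : set R, measurable A -> P (Z @^-1` A) = exponential_prob rho A.

Lemma exponential_itv (r a b : R) : 0 < r -> 0 <= a -> a <= b ->
  \int[leb]_(x in `[a, b[) exponential_pdf r x = expR (- r * a) - expR (- r * b).
Proof.
move=> r0 a0 ab; have b0 := le_trans a0 ab.
have mp : mfT (fun x => (exponential_pdf r x)%:E).
  by apply/mEFin; exact: measurable_exponential_pdf.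
have E c : 0 <= c -> (\int[leb]_(x in `[0%R, c[) (exponential_pdf r x)%:E = (1 - expR (- r * c))%:E)%E.
  move=> c0; rewrite integral_itv_bndo_bndc; last exact: measurable_funTS.
  move: c0; rewrite le_eqVlt => /predU1P[<-|c0].
    by rewrite set_itv1 integral_set1 mulr0 expR0 subrr.
  by have := exponential_prob_itv0c r c0.
have Eb := E b b0; have Ea := E a a0.
have split : `[0, b[%classic = `[0, a[%classic `|` `[a, b[%classic.
  apply/seteqP; split=> x /=; rewrite !in_itv/=.
    by move=> /andP[x0 xb]; case: (ltP x a) => h; [left; rewrite x0|right; rewrite xb].
  move=> [/andP[-> xa]|/andP[ax ->]] /=; first exact: lt_le_trans ab. by rewrite (le_trans a0).
rewrite /Rintegral; move: Eb; rewrite split ge0_integral_setU//=; last 3 first.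
- exact: measurable_funTS.
- by move=> x _; rewrite lee_fin exponential_pdf_ge0// ltW.
- apply/disj_setPS => x [] /=; rewrite !in_itv/= => /andP[_ xa] /andP[ax _].
  by move: (lt_le_trans xa ax); rewrite ltxx.
rewrite Ea; set I := (X in (_ + X)%E); rewrite -/I; case: I => //= t.
by rewrite -EFinD => -[e]; apply: (addrI (1 - expR (- r * a))); rewrite e; ring.
Qed.

Lemma Ex_exponential g : bmf g -> Ex P (fun w => g (Z w)) = \int[leb]_x (g x * exponential_pdf rho x).
Proof.
apply: (@Ex_density _ _ _ leb (exponential_pdf rho)) => //.
- exact: measurable_exponential_pdf.
- by move=> x; rewrite exponential_pdf_ge0// ltW.
- exact: integrable_exponential_pdf.
- exact: Pfin.
Qed.

(** To be read with a and b successive values of the subordinator and z the killing level: it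
    selects the cell in which the level is passed and weights the residual [z - a]. *)
Definition window (mu a b z : R) : R := ((a <= z)%R && (z < b)%R)%:R * expR (- mu * pos (z - a)).

Lemma bmf_window mu a b : 0 <= mu -> bmf (window mu a b).
Proof.
move=> mu0; apply: bmfM.
  have -> : (fun x : R => ((a <= x)%R && (x < b)%R)%:R : R) = \1_(`[a, b[%classic).
    apply/funext => x; rewrite indicE; congr (nat_of_bool _)%:R. by apply/idP/idP; rewrite inE /= in_itv/=.
  exact: bmf_indic.
have := bmf_exppos mu0 => -[m [C hC]]; split; last by exists C => x; exact: (hC (x - a)).
by apply: (mcomp m); exact: mfB.
Qed.

Lemma Ex_window mu a b : 0 <= mu -> 0 <= a -> a <= b -> Ex P (fun w => window mu a b (Z w)) =
  rho / (rho + mu) * (expR (- rho * a) * (1 - expR (- (rho + mu) * (b - a)))).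
Proof.
move=> mu0 a0 ab; have rm : 0 < rho + mu by rewrite ltr_wpDr.
rewrite Ex_exponential; last exact: bmf_window.
pose c := rho / (rho + mu) * expR (mu * a).
rewrite (_ : (fun x => _) = (fun x => c * (exponential_pdf (rho + mu) \_ `[a, b[) x)); last first.
  apply/funext => x; rewrite /window patchE mem_setE in_itv/=.
  case: (boolP (_ && _)) => [/andP[ax xb]|_]; last by rewrite !mul0r mulr0.
  rewrite pos_id ?subr_ge0// mul1r /exponential_pdf !patchE mem_set//=; last first.
    by rewrite in_itv/= (le_trans a0).
  have e : expR (- mu * (x - a)) * expR (- rho * x) = expR (mu * a) * expR (- (rho + mu) * x).
    by rewrite -!expRD; congr expR; ring.
  by rewrite mulrCA e /c; field; rewrite gt_eqF.
rewrite RintegralZl//; last first.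
  have := @density_integrable _ _ _ leb _ (measurable_exponential_pdf _)
    (integrable_exponential_pdf rm) _ (bmf_indic R (measurable_itv `[a, b[)).
  congr (integrable _ _); apply/funext => x; rewrite /= patchE indicE. by case: (x \in _); rewrite ?mul1r ?mul0r.
have := @exponential_itv (rho + mu) a b rm a0 ab.
rewrite Rintegral_mkcond => ->; rewrite /c -mulrA; congr (_ * _).
rewrite mulrBr mulrBr mulr1 -!expRD; congr (expR _ - expR _); ring.
Qed.

Lemma exponential_gt0 : {ae P, forall w, 0 < Z w}.
Proof.
exists (Z @^-1` `]-oo, 0]%classic); split.
- exact: measurable_preim.
- rewrite hZ// /exponential_prob -integral_itv_bndo_bndc; last first.
    by apply: measurable_funTS; apply/mEFin; exact: measurable_exponential_pdf.
  by apply: integral0_eq => x /=; rewrite in_itv/= => x0; rewrite lt0_exponential_pdf.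
- by move=> w /=; rewrite in_itv/= => /negP; rewrite -leNgt.
Qed.

End exponential_variable.

Section mean.
Context d (Om : mtype d) (R : realType) (P : {measure set Om -> \bar R}) (n : nat).
Local Notation M := 'M[R]_n.+1.
Hypothesis fP : (P setT < +oo)%E.

Definition bmm (F : Om -> M) := forall i j, bmf (fun w => F w i j).
Definition Emx (F : Om -> M) : M := \matrix_(i, j) Ex P (fun w => F w i j).

Lemma bmm_cst A : bmm (fun=> A).
Proof. by move=> i j; exact: bmf_cst. Qed.

Lemma bmmM F H : bmm F -> bmm H -> bmm (fun w => F w * H w).
Proof.
move=> bF bH i j.
rewrite (_ : (fun w => _) = (fun w => \sum_k F w i k * H w k j)); last by apply/funext => w; rewrite !mxE.
by apply: bmf_sum => k; exact: bmfM.
Qed.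

Lemma bmmZ f F : bmf f -> bmm F -> bmm (fun w => f w *: F w).
Proof. by move=> bf bF i j; under eq_fun do rewrite mxE; exact: bmfM. Qed.

Lemma EmxMl F A : bmm F -> Emx (fun w => A * F w) = A * Emx F.
Proof.
move=> bF; apply/matrixP => i j; rewrite !mxE.
rewrite (_ : (fun w => _) = (fun w => \sum_k A i k * F w k j)); last by apply/funext => w; rewrite !mxE.
rewrite (Ex_sum fP); last by move=> k; apply: bmfM => //; exact: bmf_cst.
by apply: eq_bigr => k _; rewrite (ExZ fP)// mxE.
Qed.

Lemma Emx_sum I (s : seq I) (F : I -> Om -> M) : (forall k, bmm (F k)) ->
  Emx (fun w => \sum_(k <- s) F k w) = \sum_(k <- s) Emx (F k).
Proof.
move=> bF; apply/matrixP => i j; rewrite !mxE summxE.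
rewrite (_ : (fun w => _) = (fun w => \sum_(k <- s) F k w i j)); last by apply/funext => w; rewrite summxE.
rewrite (Ex_sum fP); last by move=> k; exact: bF.
by apply: eq_bigr => k _; rewrite mxE.
Qed.

Lemma bmm_sum I (s : seq I) (F : I -> Om -> M) : (forall k, bmm (F k)) -> bmm (fun w => \sum_(k <- s) F k w).
Proof. by move=> bF i j; under eq_fun do rewrite summxE; apply: bmf_sum => k; exact: bF. Qed.

End mean.

Section independent_product.
Context d (Om : mtype d) (R : realType) (P : prob Om R) (n : nat).
Local Notation M := 'M[R]_n.+1.
Let fP := Pfin P.

Lemma Emx_indepM (F H : Om -> M) (A B : set (set Om)) : independent2 P <<s A >> B ->
  bmm F -> bmm H -> (forall i j, mfun_in A (fun w => F w i j)) -> (forall i j, sigma_rv (fun w => H w i j) `<=` B) ->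
  Emx P (fun w => F w * H w) = Emx P F * Emx P H.
Proof.
move=> i2 bF bH FA HB; apply/matrixP => i j; rewrite !mxE.
rewrite (_ : (fun w => _) = (fun w => \sum_k F w i k * H w k j)); last by apply/funext => w; rewrite !mxE.
rewrite (Ex_sum fP); last by move=> k; exact: bmfM.
apply: eq_bigr => k _; rewrite !mxE; apply: independent2_ExM_real => //.
by apply: independent2W i2 => //; exact/mfun_inP.
Qed.

End independent_product.

Section subordinator.
Context d (Om : mtype d) (R : realType) (P : prob Om R) (alpha : R) (Y : R -> Om -> R).
Hypotheses (a01 : 0 < alpha < 1) (sY : stable_subordinator alpha P Y).
Let fP := Pfin P.

Lemma sub_meas s : 0 <= s -> mfT (Y s).
Proof. by case: sY => h _ _ _ _; exact: h. Qed.

Lemma sub_0 w : Y 0 w = 0.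
Proof. by case: sY => _ h _ _ _; case: (h w). Qed.

Lemma sub_mono w s t : 0 <= s -> s <= t -> Y s w <= Y t w.
Proof. by case: sY => _ h _ _ _; case: (h w) => _ m _; exact: m. Qed.

Lemma sub_rc w s : 0 <= s -> Y r w @[r --> s^'+] --> Y s w.
Proof. by case: sY => _ h _ _ _; case: (h w) => _ _ m; exact: m. Qed.

Lemma sub_ge0 s w : 0 <= s -> 0 <= Y s w.
Proof. by move=> s0; rewrite -(sub_0 w); exact: sub_mono. Qed.

Lemma bmf_exp (l s : R) : 0 <= l -> 0 <= s -> bmf (fun w => expR (- l * Y s w)).
Proof.
move=> l0 s0; apply: bmf01 => [|w].
  by apply: mexpR; apply: mfM => //; exact: sub_meas.
by rewrite expR_ge0 expR_le_1// mulNr oppr_le0 mulr_ge0// sub_ge0.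
Qed.

Lemma Ex_sub (l s : R) : 0 <= l -> 0 <= s -> Ex P (fun w => expR (- l * Y s w)) = expR (- s * l `^ alpha).
Proof.
move=> l0 s0; case: sY => _ _ _ _ /(_ s l s0 l0); rewrite unlock -(ExE fP) => [[]//|].
exact: bmf_exp.
Qed.

Definition incr (h : R) (k : nat) w := Y (k.+1%:R * h) w - Y (k%:R * h) w.

Lemma Ex_incr (h : R) k g : 0 < h -> bmf g -> Ex P (fun w => g (incr h k w)) = Ex P (fun w => g (Y h w)).
Proof.
move=> h0 bg; have k0 : 0 <= k%:R * h by rewrite mulr_ge0// ltW.
have k1 : 0 <= k.+1%:R * h by rewrite mulr_ge0// ltW.
apply: Ex_law => //.
- by apply: mfB; exact: sub_meas.
- exact: sub_meas (ltW h0).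
- move=> A mA; case: sY => _ _ _ st _. have := st (k%:R * h) h k0 (ltW h0) A mA; congr (_ = _).
  by congr (P _); apply/funext => w; rewrite /incr /= -natr1 mulrDl mul1r.
Qed.

Lemma incr_ge0 h k w : 0 < h -> 0 <= incr h k w.
Proof.
move=> h0; rewrite subr_ge0; apply: sub_mono; first by rewrite mulr_ge0// ltW.
by rewrite ler_pM2r// ler_nat.
Qed.

Definition past (t : R) := sigma_process [set r | 0 <= r <= t] Y.

Lemma past_measurable t : past t `<=` measurable.
Proof.
apply: smallest_sub; first exact: sigma_algebra_measurable.
move=> A [s /andP[s0 _] hA]; exact: (msrv (sub_meas s0)) hA.
Qed.

Lemma past_meas s t : 0 <= s -> s <= t -> @measurable_fun _ _ (gsalg (past t)) R setT (Y s).
Proof.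
move=> s0 st; apply/mfun_inP; apply: subset_trans (@sub_sigma_algebra _ _ _).
move=> A hA; apply: sub_sa; exists s => //=.
by rewrite s0 st.
Qed.

Lemma past_indep (h : R) k : 0 < h -> independent2 P <<s past (k%:R * h) >> (sigma_rv (incr h k)).
Proof.
move=> h0; have k0 : 0 <= k%:R * h by rewrite mulr_ge0// ltW.
case: sY => _ _ /(_ (k%:R * h) (k.+1%:R * h) k0) i _ _.
apply: independent2W (i _) => //; last by rewrite ler_pM2r// ler_nat.
by apply: smallest_sub => //; exact: smallest_sigma_algebra.
Qed.

Section exp_functional.
Context (n : nat) (s : wseq R n).
Local Notation M := 'M[R]_n.+1.
Hypothesis s0 : all rge0 s.

(** For a = alpha this is a matrix analogue of the Laplace exponent: the limit of
    [(1 - Qh rho h) / h] as h decreases to 0, when the coefficients add up to the identity. *)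
Definition hat (a rho : R) : M := \sum_(p <- s) (rho + p.1) `^ a *: p.2.

(** The mean of [exp(- rho Y h) G(Y h)]; see [Emx_expG]. *)
Definition Qh (rho h : R) : M := \sum_(p <- s) expR (- h * (rho + p.1) `^ alpha) *: p.2.

Hypothesis hG : tst (ef s).

Let G := ef s.

Lemma bmm_G (c : Om -> R) : mfT c -> (forall w, 0 <= c w) -> bmm (fun w => G (c w)).
Proof.
move=> mc c0 i j; apply: bmf01 => [|w].
  by apply: (mcomp (tst_mmeas hG i j)).
by have [_ _ sG] := hG; exact: substoch_entry (sG _ (c0 w)).
Qed.

Definition Tk (rho h : R) (k : nat) w : M := expR (- rho * Y (k%:R * h) w) *: gridprod (Y ^~ w) G h k.

Lemma substoch_grid h k w : 0 < h -> substoch (gridprod (Y ^~ w) G h k).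
Proof.
move=> h0; apply: substoch_prod => i _; have [_ _ sG] := hG; apply: sG.
exact: incr_ge0.
Qed.

Lemma mmeas_grid (h : R) k : 0 < h -> @mmeas _ (gsalg (past (k%:R * h))) _ _ (fun w => gridprod (Y ^~ w) G h k).
Proof.
move=> h0 i j; pose F i w : M := if (i < k)%N then G (dy (Y ^~ w) h i) else 1.
have E w : gridprod (Y ^~ w) G h k = \prod_(i < k) F i w by apply: eq_bigr => l _; rewrite /F ltn_ord.
under eq_fun do rewrite E.
apply: mmeas_prod => l; rewrite /F; case: ltnP => lk; last exact: mmeas_cst.
move=> a b; apply: (mcomp (tst_mmeas hG a b)); apply: mfB.
- apply: past_meas; first by rewrite mulr_ge0// ltW. by rewrite ler_pM2r// ler_nat.
- apply: past_meas; first by rewrite mulr_ge0// ltW. by rewrite ler_pM2r// ler_nat ltnW.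
Qed.

Lemma mfun_Tk rho (h : R) k i j : 0 < h -> mfun_in (past (k%:R * h)) (fun w => Tk rho h k w i j).
Proof.
move=> h0; have k0 : 0 <= k%:R * h by rewrite mulr_ge0// ltW.
rewrite /mfun_in /Tk; under eq_fun do rewrite mxE.
apply: mfM; last exact: mmeas_grid.
apply: mexpR; apply: mfM => //.
exact: past_meas.
Qed.

Lemma Tk01 rho h k w i j : 0 <= rho -> 0 < h -> 0 <= Tk rho h k w i j <= expR (- rho * Y (k%:R * h) w).
Proof.
move=> r0 h0; rewrite mxE; have /andP[g0 g1] := substoch_entry i j (substoch_grid k w h0).
by rewrite mulr_ge0 ?expR_ge0//= ler_piMr// expR_ge0.
Qed.

Lemma bmm_Tk rho h k : 0 <= rho -> 0 < h -> bmm (Tk rho h k).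
Proof.
move=> r0 h0 i j; have k0 : 0 <= k%:R * h by rewrite mulr_ge0// ltW.
apply: bmf01 => [|w]; first by apply: (mfun_inM (@past_measurable (k%:R * h))); exact: mfun_Tk.
have /andP[-> h1] := Tk01 k w i j r0 h0; apply: le_trans h1 _.
by rewrite expR_le_1// mulNr oppr_le0 mulr_ge0// sub_ge0.
Qed.

Lemma bmm_expG rho (c : Om -> R) : 0 <= rho -> mfT c -> (forall w, 0 <= c w) ->
  bmm (fun w => expR (- rho * c w) *: G (c w)).
Proof.
move=> r0 mc c0; apply: bmmZ; last exact: bmm_G.
apply: bmf01 => [|w].
  by apply: mexpR; exact: mfM.
by rewrite expR_ge0 expR_le_1// mulNr oppr_le0 mulr_ge0.
Qed.

Lemma measurable_incr h k : 0 < h -> mfT (incr h k).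
Proof. by move=> h0; apply: mfB; apply: sub_meas; rewrite mulr_ge0// ltW. Qed.

Lemma Emx_expG rho h k : 0 <= rho -> 0 < h -> Emx P (fun w => expR (- rho * incr h k w) *: G (incr h k w)) = Qh rho h.
Proof.
move=> r0 h0.
have pE (x : R) : 0 <= x -> expR (- rho * x) *: G x = \sum_(p <- s) expR (- (rho + p.1) * pos x) *: p.2.
  move=> x0; rewrite /G /ef scaler_sumr; apply: eq_bigr => p _.
  by rewrite scalerA -expRD pos_id//; congr (expR _ *: _); ring.
rewrite (_ : (fun w => _) = (fun w => \sum_(p <- s) expR (- (rho + p.1) * pos (incr h k w)) *: p.2)); last first.
  by apply/funext => w; rewrite pE// incr_ge0.
have bE p : 0 <= rho + p -> bmf (fun w => expR (- (rho + p) * pos (incr h k w))).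
  by move=> p0; apply: (bmf_comp (bmf_exppos p0)); exact: measurable_incr.
rewrite /Qh; elim: {pE} s s0 => [_|p l IH /andP[p0 l0]].
  by apply/matrixP => i j; rewrite big_nil !mxE; under eq_fun do rewrite big_nil mxE; exact: Ex_cst1.
have rp : 0 <= rho + p.1 by rewrite addr_ge0.
rewrite (_ : (fun w => _) = (fun w => expR (- (rho + p.1) * pos (incr h k w)) *: p.2 +
    \sum_(p <- l) expR (- (rho + p.1) * pos (incr h k w)) *: p.2)); last first.
  by apply/funext => w; rewrite big_cons.
rewrite big_cons -(IH l0); apply/matrixP => i j; rewrite !mxE.
have bl : bmf (fun w => (\sum_(q <- l) expR (- (rho + q.1) * pos (incr h k w)) *: q.2) i j).
  rewrite (_ : (fun w => _) = (fun w => \sum_(q <- l) (if 0 <= q.1 then expR (- (rho + q.1) * pos (incr h k w)) else 0) * q.2 i j)).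
    apply: bmf_sum => q; apply: bmfM; last exact: bmf_cst. have [q0|q0] := boolP (0 <= q.1); last exact: bmf_cst.
    by apply: bE; rewrite addr_ge0.
  apply/funext => w; rewrite summxE; apply: eq_big_seq => q ql; rewrite mxE. by move/allP: l0 => ->.
rewrite (_ : (fun w => _) = (fun w => expR (- (rho + p.1) * pos (incr h k w)) * p.2 i j +
    (\sum_(q <- l) expR (- (rho + q.1) * pos (incr h k w)) *: q.2) i j)); last first.
  by apply/funext => w; rewrite !mxE.
rewrite (ExD fP)//; last by apply: bmfM; [exact: bE|exact: bmf_cst].
congr (_ + _); rewrite (ExZr fP _ (bE _ rp)); congr (_ * _).
rewrite (@Ex_incr h k (fun x => expR (- (rho + p.1) * pos x)) h0 (bmf_exppos rp)).
rewrite -(Ex_sub rp (ltW h0)); apply: eq_Ex => w.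
by rewrite pos_id// sub_ge0// ltW.
Qed.

Lemma grid_succ h k w : gridprod (Y ^~ w) G h k.+1 = gridprod (Y ^~ w) G h k * G (incr h k w).
Proof. by rewrite /gridprod big_ord_recr. Qed.

Lemma Emx_Tk_mul rho h k (F : R -> M) : 0 <= rho -> 0 < h ->
  (forall i j, mfT (fun x => F x i j)) -> bmm (fun w => F (incr h k w)) ->
  Emx P (fun w => Tk rho h k w * F (incr h k w)) = Emx P (Tk rho h k) * Emx P (fun w => F (incr h k w)).
Proof.
move=> r0 h0 mF bF.
apply: (@Emx_indepM _ _ _ P n (Tk rho h k) (fun w => F (incr h k w)) _ _ (@past_indep h k h0)) => //.
- exact: bmm_Tk.
- by move=> i j; exact: mfun_Tk.
- move=> i j _ [B mB <-]; exists ((fun x => F x i j) @^-1` B).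
    exact: measurable_preim.
  by rewrite setTI.
Qed.

Lemma Emx_Tk rho h k : 0 <= rho -> 0 < h -> Emx P (Tk rho h k) = Qh rho h ^+ k.
Proof.
move=> r0 h0; elim: k => [|k IH].
  apply/matrixP => i j; rewrite mxE expr0 -[RHS](Ex_cst1 P); apply: eq_Ex => w.
  by rewrite /Tk mul0r sub_0 mulr0 expR0 scale1r /gridprod big_ord0.
rewrite exprSr -IH -(Emx_expG k r0 h0).
rewrite -(@Emx_Tk_mul rho h k (fun x => expR (- rho * x) *: G x))//.
- congr Emx; apply/funext => w; rewrite /Tk grid_succ -scalerAl -scalerAr scalerA -expRD.
  by congr (expR _ *: _); rewrite /incr; ring.
- move=> i j; under eq_fun do rewrite mxE. apply: mfM; last exact: tst_mmeas. by apply: mexpR; exact: mfM.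
- by apply: bmm_expG => //; [exact: measurable_incr|move=> w; exact: incr_ge0].
Qed.

Lemma Qh_pow_le rho h k i j : 0 <= rho -> 0 < h -> 0 <= (Qh rho h ^+ k) i j <= expR (- (k%:R * h) * rho `^ alpha).
Proof.
move=> r0 h0; have k0 : 0 <= k%:R * h by rewrite mulr_ge0// ltW.
rewrite -Emx_Tk// mxE -(Ex_sub r0 k0); apply/andP; split.
  by apply: Ex_ge0 => w; have /andP[] := Tk01 k w i j r0 h0.
apply: le_Ex => //; [exact: bmm_Tk|exact: bmf_exp|].
by move=> w; have /andP[] := Tk01 k w i j r0 h0.
Qed.

End exp_functional.

End subordinator.

(** * The subordinator increases by jumps only *)

Section small_increments.
Context (R : realType) (y : R -> R).
Hypotheses (y0 : y 0 = 0) (ymono : forall s t : R, 0 <= s -> s <= t -> y s <= y t).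
Hypotheses (yrc : forall s : R, 0 <= s -> y r @[r --> s^'+] --> y s).

(** Dyadic meshes make the grids nested, so that [small_sum] grows under refinement. *)
Definition hn (n : nat) : R := 2^-1 ^+ n.

Lemma hn_gt0 n : 0 < hn n. Proof. by rewrite exprn_gt0// invr_gt0. Qed.

Lemma hn_cvg : hn n @[n --> \oo] --> (0 : R).
Proof. by apply: cvg_expr; rewrite ger0_norm ?invr_ge0// invf_lt1// ltr1n. Qed.

Lemma hn_mul N n : (N * 2 ^ n)%N%:R * hn n = N%:R.
Proof. by rewrite natrM natrX /hn exprVn -mulrA divff ?mulr1// expf_neq0. Qed.

Definition small_sum (dl : R) (N n : nat) : R := \sum_(i < (N * 2 ^ n)%N) Num.min (dy y (hn n) i) dl.

Lemma sum_double (F : nat -> R) k : \sum_(i < k.*2) F i = \sum_(i < k) (F i.*2 + F i.*2.+1).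
Proof.
elim: k => [|k IH]; first by rewrite !big_ord0.
by rewrite doubleS !big_ord_recr /= IH addrA.
Qed.

(** Truncation at dl is subadditive on nonnegative numbers. *)
Lemma small_sum_mono dl N n : 0 <= dl -> small_sum dl N n <= small_sum dl N n.+1.
Proof.
move=> dl0; rewrite /small_sum expnS mulnCA mul2n.
rewrite (sum_double (fun i => Num.min (dy y (hn n.+1) i) dl)); apply: ler_sum => i _.
have hE : hn n = 2 * hn n.+1 by rewrite /hn exprS mulrA divff ?mul1r.
have E (k : nat) : k%:R * hn n = k.*2%:R * hn n.+1.
  by rewrite hE mulrA -natrM muln2.
have a0 := dy_ge0 ymono i.*2 (hn_gt0 n.+1); have b0 := dy_ge0 ymono i.*2.+1 (hn_gt0 n.+1).
have -> : dy y (hn n) i = dy y (hn n.+1) i.*2 + dy y (hn n.+1) i.*2.+1 by rewrite /dy !E doubleS; ring.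
set a := dy _ _ _ in a0 *; set b := dy _ _ _ in b0 *.
rewrite !minElt; case: ltP => h1; case: ltP => h2; case: ltP => h3; lra.
Qed.

Section level.
Context (l N : R).
Hypotheses (l0 : 0 < l) (N0 : 0 <= N) (lN : l <= y N).

Definition level := inf [set s : R | 0 <= s /\ l <= y s].

Lemma level_inf : has_inf [set s : R | 0 <= s /\ l <= y s].
Proof. by split; [exists N|exists 0 => s []]. Qed.

Lemma level_ge0 : 0 <= level.
Proof. by apply: lb_le_inf; [case: level_inf|move=> s []]. Qed.

Lemma level_leN : level <= N.
Proof. by apply: ge_inf => //; case: level_inf. Qed.

Lemma le_level : l <= y level.
Proof.
rewrite leNgt; apply/negP => h.
have e0 : 0 < l - y level by rewrite subr_gt0.
have [r lr yr] := right_approx yrc level_ge0 e0.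
have [s [s0 ls] sr] := inf_lt (proj1 level_inf) lr.
by have := ymono s0 (ltW sr); rewrite leNgt (lt_le_trans _ ls)//; lra.
Qed.

Lemma lt_level s : 0 <= s -> y s < l -> s < level.
Proof.
move=> s0 h; rewrite ltNge; apply/negP => /(ymono level_ge0).
by rewrite leNgt (lt_le_trans h le_level).
Qed.

Lemma level_le s : 0 <= s -> l <= y s -> level <= s.
Proof. by move=> s0 h; apply: ge_inf => //; case: level_inf. Qed.

Lemma level_gt0 : 0 < level.
Proof. by apply: lt_level => //; rewrite y0. Qed.

End level.

Lemma two_sided t e : 0 < t -> 0 < e -> \forall n \near \oo, hn n < t /\ y (t + hn n) - y (t - hn n) <= jump y t + e.
Proof.
move=> t0 e0; have e2 : 0 < e / 2 by rewrite divr_gt0.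
have [r tr yr] := right_approx yrc (ltW t0) e2.
have [r' [r'0 r't yr']] := left_approx ymono t0 e2.
have m0 : 0 < Num.min (r - t) (t - r') by rewrite lt_min !subr_gt0 tr.
have /cvgrPdist_lt/(_ _ m0) := hn_cvg; apply: filterS => n.
rewrite sub0r normrN ger0_norm ?(ltW (hn_gt0 _))// lt_min => /andP[h1 h2].
have h0 := hn_gt0 n.
split; first lra.
have u1 : y (t + hn n) <= y r by apply: ymono; lra.
have u2 : y r' <= y (t - hn n) by apply: ymono; lra.
by rewrite /jump; lra.
Qed.

Lemma sum_hit (h t c : R) k : 0 < h -> 0 < t -> 0 <= c -> (forall i, i%:R * h < t <= i.+1%:R * h -> dy y h i <= c) ->
  \sum_(i < k) (if i%:R * h < t <= i.+1%:R * h then dy y h i else 0) <= (t <= k%:R * h)%R%:R * c.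
Proof.
move=> h0 t0 c0 hc; elim: k => [|k IH].
  by rewrite big_ord0 mulr_ge0.
rewrite big_ord_recr /=; apply: le_trans (lerD IH (lexx _)) _.
have le : k%:R * h <= k.+1%:R * h by rewrite ler_pM2r// ler_nat.
have := hc k; have [t1|t1] := leP t (k%:R * h) => /=.
  by rewrite (le_trans t1 le) addr0.
case: (t <= _) => /=; rewrite ?mul0r ?add0r ?mul1r// => H; exact: H.
Qed.

Lemma jumps_le (a b : R) (ts : seq R) : 0 <= a -> a <= b -> sorted <%R ts ->
  (forall t, t \in ts -> a < t <= b) -> \sum_(t <- ts) jump y t <= y b - y a.
Proof.
elim: ts a => [|t ts IH] a a0 ab st ht; first by rewrite big_nil subr_ge0; exact: ymono.
have /andP[at_ tb] := ht _ (mem_head _ _); have t0 := le_lt_trans a0 at_.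
have h : \sum_(t <- ts) jump y t <= y b - y t.
  apply: IH (ltW t0) tb (path_sorted st) _ => u ut. have /andP[_ ->] : a < u <= b by apply: ht; rewrite inE ut orbT.
  rewrite andbT. by have /allP/(_ _ ut) := order_path_min lt_trans st.
rewrite big_cons; have := left_le ymono a0 at_; rewrite /jump; lra.
Qed.

(* With levels k dl, an interval without a level crossing has increment at most dl. *)
Lemma pure_jump_small : (forall N m : nat, exists2 dl : R, 0 < dl & forall n, small_sum dl N n <= m.+1%:R^-1) ->
  pure_jump y.
Proof.
move=> H T e T0 e0.
pose N := (Num.truncn T).+1; have TN : T <= N%:R by rewrite ltW// truncnS_gt.
have N0 : 0 <= N%:R :> R by [].
have e4 : 0 < e / 2 by rewrite divr_gt0.
have [m hm] : exists m : nat, m.+1%:R^-1 < e / 2.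
  by have [m _ hm] := near_infty_natSinv_lt (PosNum e4); exists m; exact: (hm m (leqnn _)).
have [dl dl0 hdl] := H N m.
pose lv k := level (k%:R * dl).
pose D := undup [seq lv k | k <- iota 1 (Num.truncn (y N%:R / dl))].
have lvP k : k \in iota 1 (Num.truncn (y N%:R / dl)) -> 0 < k%:R * dl /\ k%:R * dl <= y N%:R.
  rewrite mem_iota add1n ltnS => /andP[k1 kK]; split; first by rewrite mulr_gt0// ltr0n.
  rewrite -ler_pdivlMr// (le_trans (_ : _ <= (Num.truncn (y N%:R / dl))%:R)) ?ler_nat//.
  have := truncn_le (y N%:R / dl); rewrite divr_ge0 ?(ltW dl0)//. by rewrite -y0; exact: ymono.
have DP t : t \in D -> 0 < t <= N%:R.
  rewrite mem_undup => /mapP[k /lvP[k0 kN] ->]. by rewrite (level_gt0 k0 N0 kN) (level_leN N0 kN).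
have small n i : (i < N * 2 ^ n)%N -> (forall t, t \in D -> ~ (i%:R * hn n < t <= i.+1%:R * hn n)) ->
    dy y (hn n) i <= dl.
  move=> iN nD; rewrite leNgt; apply/negP => h.
  have h0 := hn_gt0 n; have i0 : 0 <= i%:R * hn n by rewrite mulr_ge0// ltW.
  have i1 : 0 <= i.+1%:R * hn n by rewrite mulr_ge0// ltW.
  have yi0 : 0 <= y (i%:R * hn n) by rewrite -y0; exact: ymono.
  have i1N : i.+1%:R * hn n <= N%:R by rewrite -(hn_mul N n) ler_pM2r// ler_nat.
  pose k := (Num.truncn (y (i%:R * hn n) / dl)).+1.
  have k1 : y (i%:R * hn n) < k%:R * dl by rewrite -ltr_pdivrMr// truncnS_gt.
  have k2 : k%:R * dl <= y (i.+1%:R * hn n).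
    rewrite /k -natr1 mulrDl mul1r. have := truncn_le (y (i%:R * hn n) / dl); rewrite divr_ge0 ?(ltW dl0)// => hh.
    have : (Num.truncn (y (i%:R * hn n) / dl))%:R * dl <= y (i%:R * hn n) by rewrite -ler_pdivlMr.
    by move: h; rewrite /dy; lra.
  have kN : k%:R * dl <= y N%:R by apply: le_trans k2 _; exact: ymono. have k0 : 0 < k%:R * dl by rewrite mulr_gt0.
  apply: (nD (lv k)).
    rewrite mem_undup; apply: map_f; rewrite mem_iota add1n ltnS /=.
    by rewrite truncn_ge_nat ?divr_ge0 ?(ltW dl0)// ?ler_pdivlMr// -y0; apply: ymono.
  by rewrite (lt_level N0 kN i0 k1) (level_le N0 kN i1 k2).
(* One tolerance c for each time in D; together they amount to at most e/2. *)
pose c := e / 2 / (size D).+1%:R.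
have c0 : 0 < c by rewrite divr_gt0.
have [n hn1] : exists n, forall t, t \in D -> hn n < t /\ y (t + hn n) - y (t - hn n) <= jump y t + c.
  suff : \forall n \near \oo, forall t, t \in D -> hn n < t /\ y (t + hn n) - y (t - hn n) <= jump y t + c.
    by case=> n _ /(_ n (leqnn _)) h; exists n.
  clearbody c; clearbody D; clear small. elim: D DP => [|t D IH] DP; first by apply: nearW.
  have /andP[t0 _] := DP _ (mem_head _ _).
  near=> n => u; rewrite inE => /predU1P[->|uD]; first by near: n; exact: two_sided.
  by move: u uD; near: n; apply: IH => u uD; apply: DP; rewrite inE uD orbT.
have h0 := hn_gt0 n.
(* A cell containing a time t of D has an increment of at most the jump at t plus c; any other cell
   has an increment of at most dl and is fully counted in [small_sum]. *)
have key : y N%:R <= e / 2 + \sum_(t <- D) (jump y t + c).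
  rewrite -(hn_mul N n) -(sum_dy y0); apply: (@le_trans _ _ (small_sum dl N n +
    \sum_(i < (N * 2 ^ n)%N) \sum_(t <- D) (if i%:R * hn n < t <= i.+1%:R * hn n then dy y (hn n) i else 0))).
    rewrite -big_split /=; apply: ler_sum => i _. have d0 := dy_ge0 ymono i h0.
    have [/hasP[t tD ti]|/hasPn nD] := boolP (has (fun t => i%:R * hn n < t <= i.+1%:R * hn n) D).
      rewrite (big_rem t tD) /= ti ler_wpDl//; first by rewrite le_min d0 ltW.
      by rewrite lerDl sumr_ge0// => u _; case: ifP.
    rewrite ler_wpDr//; first by apply: sumr_ge0 => u _; case: ifP. by rewrite le_min lexx small// => t /nD /negP.
  apply: lerD; first by rewrite (le_trans (hdl n))// ltW.
  rewrite exchange_big /= big_seq [leRHS]big_seq; apply: ler_sum => t tD.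
  have [ht1 ht2] := hn1 t tD; have /andP[t0 _] := DP t tD.
  have jc : 0 <= jump y t + c by rewrite addr_ge0 ?(ltW c0)//; exact: jump_ge0.
  apply: le_trans (sum_hit _ h0 t0 jc _) _.
    move=> i /andP[i1 i2]; apply: le_trans ht2. have i0 : 0 <= i%:R * hn n by rewrite mulr_ge0// ltW.
    have e1 : i.+1%:R * hn n = i%:R * hn n + hn n by rewrite -natr1 mulrDl mul1r.
    have u1 : y (i.+1%:R * hn n) <= y (t + hn n) by apply: ymono; lra.
    have u2 : y (t - hn n) <= y (i%:R * hn n) by apply: ymono; lra. by rewrite /dy; lra.
  by case: (t <= _) => /=; rewrite ?mul1r ?mul0r.
have DE : \sum_(t <- D) (jump y t + c) <= \sum_(t <- D) jump y t + e / 2.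
  rewrite big_split /= lerD2l big_const_seq count_predT iter_addr_0 -[leLHS]mulr_natr /c.
  by rewrite -mulrA ler_piMr ?(ltW e4)// ler_pdivrMl ?mulr1 ?ler_nat.
pose Ds := sort <=%R D.
have st : sorted <%R Ds by rewrite lt_sorted_uniq_le sort_uniq undup_uniq sort_le_sorted.
have DsE : \sum_(t <- D) jump y t = \sum_(t <- Ds) jump y t by apply: perm_big; rewrite perm_sym perm_sort.
exists [seq t <- Ds | (t <= T) && (0 < jump y t)]; split.
- by apply: sorted_filter => //; exact: lt_trans.
- move=> t; rewrite mem_filter mem_sort => /andP[/andP[tT jt] /DP/andP[t0 _]]. by rewrite t0.
have h1 : \sum_(t <- [seq t <- Ds | T < t]) jump y t <= y N%:R - y T.
  apply: jumps_le => //; [exact: ltW|by apply: sorted_filter => //; exact: lt_trans|].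
  by move=> t; rewrite mem_filter mem_sort => /andP[-> /DP/andP[]].
have h2 : \sum_(t <- Ds) jump y t = \sum_(t <- [seq t <- Ds | (t <= T) && (0 < jump y t)]) jump y t +
    \sum_(t <- [seq t <- Ds | T < t]) jump y t.
  rewrite !big_filter (bigID (fun t => t <= T)) /=; congr (_ + _); last first.
    by apply: eq_bigl => t; rewrite ltNge.
  rewrite (bigID (fun t => 0 < jump y t)) /= [X in _ + X]big_seq_cond [X in _ + X]big1 ?addr0//.
  move=> t /andP[]; rewrite mem_sort => /DP/andP[t0 _] /andP[_ jt].
  by apply/eqP; rewrite eq_le (jump_ge0 ymono t0) leNgt jt.
move: key DE h1 h2; rewrite DsE; lra.
Unshelve. all: by end_near. Qed.

End small_increments.

Section comparison.
Context d (T : mtype d) (R : realType) (f g : T -> R).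
Hypotheses (mf : mfT f) (mg : mfT g).

Lemma measurable_le2 : measurable [set x | f x <= g x].
Proof. by rewrite -[X in measurable X]setTI; exact: measurable_fun_le. Qed.

Lemma measurable_lt2 : measurable [set x | g x < f x].
Proof.
rewrite (_ : mkset _ = ~` [set x | f x <= g x]); first exact/measurableC/measurable_le2.
by apply/seteqP; split=> x /=; [move=> h; apply/negP; rewrite -ltNge|move/negP; rewrite -ltNge].
Qed.

End comparison.

Section almost_sure.
Context d (Om : mtype d) (R : realType) (P : prob Om R).
Let fP := Pfin P.

Lemma ae_small (Q : Om -> Prop) :
  (forall e : R, 0 < e -> exists A, [/\ measurable A, (P A <= e%:E)%E & forall w, ~ A w -> Q w]) ->
  {ae P, forall w, Q w}.
Proof.
move=> H; have H' (j : nat) : exists A, [/\ measurable A, (P A <= (j.+1%:R^-1 : R)%:E)%E &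
  forall w, ~ A w -> Q w] by apply: H; rewrite invr_gt0.
have [A hA] := choice H'.
have mA j : measurable (A j) by case: (hA j).
exists (\bigcap_j A j); split; first exact: bigcapT_measurable.
- apply/eqP; rewrite eq_le measure_ge0 andbT; apply/lee_addgt0Pr => e e0; rewrite add0e.
  have [j _ hj] := near_infty_natSinv_lt (PosNum e0). have {}hj := hj j (leqnn _).
  have [_ h _] := hA j; apply: le_trans (_ : (P (A j) <= _)%E); last first.
    by apply: le_trans h _; rewrite lee_fin ltW.
  by apply: le_measure; rewrite ?inE//; [exact: bigcapT_measurable|exact: bigcap_inf].
- move=> w /= nQ j _; apply: contrapT => nA; apply: nQ. by have [_ _ h] := hA j; exact: h.
Qed.

Lemma markov_Ex (f : Om -> R) (c : R) : bmf f -> (forall w, 0 <= f w) -> 0 < c ->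
  (P [set w | (c < f w)%R] <= (Ex P f / c)%:E)%E.
Proof.
move=> bf f0 c0; have mA : measurable [set w | c < f w].
  by apply: measurable_lt2 => //; exact: bf.1.
have -> : P [set w | c < f w] = (Ex P (\1_[set w | c < f w]))%:E.
  by rewrite ExE ?integral_indic ?setIT//; exact: bmf_indic.
rewrite lee_fin ler_pdivlMr// -(ExZr fP); last exact: bmf_indic.
apply: (le_Ex fP) => //; first by apply: bmfM; [exact: bmf_indic|exact: bmf_cst].
move=> w; rewrite indicE; case: (boolP (_ \in _)); rewrite ?mul0r// ?mul1r.
by rewrite inE => /ltW.
Qed.

Lemma le_bigcup_nd (A : nat -> set Om) (e : R) : (forall n, measurable (A n)) ->
  nondecreasing_seq A -> (forall n, (P (A n) <= e%:E)%E) -> (P (\bigcup_n A n) <= e%:E)%E.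
Proof.
move=> mA nd hA; have h := @nondecreasing_cvg_mu _ _ _ P A mA (bigcupT_measurable A mA) nd.
rewrite -(cvg_lim _ h)//; apply: lime_le; first exact: cvgP h.
exact: nearW.
Qed.

End almost_sure.

Section subordinator_paths.
Context d (Om : mtype d) (R : realType) (P : prob Om R) (alpha : R) (Y : R -> Om -> R).
Hypotheses (a01 : 0 < alpha < 1) (sY : stable_subordinator alpha P Y).
Let fP := Pfin P.

(** The choice is [dl = e^(1/(1 - alpha))]. Since alpha < 1, the increments truncated at dl, whose
    mean per unit of time is of order [dl^(1 - alpha)], leave no room for a continuous part. *)
Lemma small_delta (e : R) : 0 < e -> exists2 dl : R, 0 < dl & dl * (dl^-1) `^ alpha <= e.
Proof.
have /andP[a0 a1] := a01.
move=> e0; exists (e `^ (1 - alpha)^-1); first exact: powR_gt0.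
set x := e `^ _; have x0 : 0 < x by exact: powR_gt0.
rewrite /x -powRN -powRrM -powRD; last by rewrite (gt_eqF e0) implybT.
have -> : (1 - alpha)^-1 + - (1 - alpha)^-1 * alpha = 1 by field; rewrite gt_eqF// subr_gt0.
by rewrite powRr1// ltW.
Qed.

Lemma min_exp (dl x : R) : 0 < dl -> 0 <= x -> Num.min x dl <= 2 * dl * (1 - expR (- dl^-1 * x)).
Proof.
move=> dl0 x0.
wlog xd : x x0 / x <= dl.
  move=> H; have [h|h] := leP x dl.
    by have := H x x0 h; rewrite min_l.
  have := H dl (ltW dl0) (lexx _); rewrite minxx => /le_trans; apply.
  rewrite ler_wpM2l ?mulr_ge0 ?(ltW dl0)// lerB// ler_expR !mulNr lerN2. by rewrite ler_wpM2l ?invr_ge0// ltW.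
rewrite min_l//; set v := dl^-1 * x.
have xE : x = dl * v by rewrite /v mulVKf// gt_eqF.
have v0 : 0 <= v by rewrite mulr_ge0// invr_ge0 ltW.
have v1 : v <= 1 by rewrite /v mulrC ler_pdivrMr// mul1r.
have h : expR (- v) * (1 + v) <= 1 by rewrite expRN mulrC ler_pdivrMr ?expR_gt0// mul1r expR_ge1Dx.
rewrite mulNr -/v xE.
have -> : 2 * dl * (1 - expR (- v)) = dl * (2 * (1 - expR (- v))) by ring.
rewrite ler_wpM2l ?(ltW dl0)//.
have e0 := expR_ge0 (- v); have : expR (- v) <= 1 by rewrite expR_le_1// oppr_le0.
nra.
Qed.

(** By [min_exp] a truncated increment x is at most a multiple of [1 - exp(- x / dl)], whose mean
    the Laplace transform gives; the sum over the cells is then bounded independently of the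
    mesh. *)
Lemma Ex_small_sum (dl : R) N n : 0 < dl ->
  Ex P (fun w => small_sum (Y ^~ w) dl N n) <= 2 * N%:R * (dl * (dl^-1) `^ alpha).
Proof.
move=> dl0; have h0 := hn_gt0 R n; have dl1 : 0 <= dl^-1 by rewrite invr_ge0 ltW.
have bmin : bmf (fun x : R => Num.min (pos x) dl).
  split; first by apply: measurable_minr => //; exact: mpos.
  by exists dl => x; rewrite ger0_norm ?ge_min ?lexx ?orbT// le_min pos_ge0 ltW.
have E (i : nat) w : Num.min (dy (Y ^~ w) (hn R n) i) dl = Num.min (pos (incr Y (hn R n) i w)) dl.
  by rewrite pos_id// (incr_ge0 sY).
have b1 i : bmf (fun w => Num.min (pos (incr Y (hn R n) i w)) dl).
  exact: bmf_comp bmin (measurable_incr sY i h0).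
rewrite (_ : (fun w => _) = (fun w => \sum_(i < (N * 2 ^ n)%N) Num.min (pos (incr Y (hn R n) i w)) dl)); last first.
  by apply/funext => w; apply: eq_bigr => i _; exact: E.
rewrite (Ex_sum fP)//.
apply: (@le_trans _ _ (\sum_(i < (N * 2 ^ n)%N) 2 * dl * (hn R n * (dl^-1) `^ alpha))); last first.
  rewrite sumr_const card_ord -[leLHS]mulr_natr -(hn_mul R N n).
  by rewrite le_eqVlt; apply/orP; left; apply/eqP; ring.
apply: ler_sum => i _.
rewrite (Ex_incr sY _ h0 bmin).
have bY := bmf_exp sY dl1 (ltW h0).
apply: (@le_trans _ _ (Ex P (fun w => 2 * dl * (1 - expR (- dl^-1 * Y (hn R n) w))))).
  apply: (le_Ex fP).
  - exact: bmf_comp bmin (sub_meas sY (ltW h0)).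
  - by apply: bmfM; [exact: bmf_cst|apply: bmfB => //; exact: bmf_cst].
  - by move=> w; rewrite pos_id ?(sub_ge0 sY _ (ltW h0))// min_exp// (sub_ge0 sY _ (ltW h0)).
rewrite (ExZ fP); last by apply: bmfB => //; exact: bmf_cst.
rewrite (ExB fP)//; last exact: bmf_cst.
rewrite Ex_cst1 (Ex_sub sY)// ?(ltW h0)// ler_wpM2l ?mulr_ge0 ?(ltW dl0)//.
by have := expR_ge1Dx (- hn R n * dl^-1 `^ alpha); rewrite mulNr; lra.
Qed.

Lemma bmf_small_sum dl N n : 0 < dl -> bmf (fun w => small_sum (Y ^~ w) dl N n).
Proof.
move=> dl0; apply: bmf_sum => i; split.
  apply: measurable_minr => //; exact: (measurable_incr sY i (hn_gt0 R n)).
exists dl => w; rewrite ger0_norm ?ge_min ?lexx ?orbT// le_min (ltW dl0) andbT.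
exact: (incr_ge0 sY i w (hn_gt0 R n)).
Qed.

(** As [small_sum] increases with n, Markov's inequality at every fixed n bounds the probability
    that it is ever large, uniformly over the grids. *)
Lemma ae_pure_jump : {ae P, forall w, pure_jump (Y ^~ w)}.
Proof.
suff H : {ae P, forall w, forall N m : nat, exists2 dl : R, 0 < dl &
    forall n, small_sum (Y ^~ w) dl N n <= m.+1%:R^-1}.
  apply: filterS H => w; apply: pure_jump_small.
  - exact: sub_0 sY _.
  - by move=> s t; exact: sub_mono sY _ _ _.
  - by move=> s; exact: sub_rc sY _ _.
apply: ae_foralln => N; apply: ae_foralln => m; apply: ae_small => e e0.
have c0 : 0 < m.+1%:R^-1 :> R by rewrite invr_gt0.
have e1 : 0 < e / (2 * N.+1%:R * m.+1%:R) by rewrite divr_gt0// !mulr_gt0.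
have [dl dl0 hdl] := small_delta e1.
pose A n := [set w | m.+1%:R^-1 < small_sum (Y ^~ w) dl N n].
have mA n : measurable (A n) by apply: measurable_lt2 => //; case: (bmf_small_sum N n dl0).
exists (\bigcup_n A n); split.
- exact: bigcupT_measurable.
- apply: le_bigcup_nd => // [n k nk|n].
    apply/subsetPset => w /lt_le_trans; apply. elim: k nk => [|k IH]; first by rewrite leqn0 => /eqP ->.
    rewrite leq_eqVlt => /predU1P[->//|/IH h]; apply: le_trans h _. apply: small_sum_mono; last exact: ltW.
    by move=> s t; exact: sub_mono sY _ _ _.
  have := markov_Ex P (bmf_small_sum N n dl0) _ c0. move=> /(_ _)/wrap[].
    move=> w; apply: sumr_ge0 => i _; rewrite le_min (ltW dl0) andbT. exact: (incr_ge0 sY i w (hn_gt0 R n)).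
  move=> h; apply: le_trans h _; rewrite lee_fin invrK. apply: le_trans (ler_wpM2r _ (Ex_small_sum N n dl0)) _ => //.
  apply: (@le_trans _ _ (2 * N.+1%:R * (dl * dl^-1 `^ alpha) * m.+1%:R)).
    rewrite !ler_wpM2r//; first by rewrite mulr_ge0 ?powR_ge0// ltW. by rewrite ler_wpM2l// ler_nat.
  rewrite mulrAC -ler_pdivlMl ?mulr_gt0// mulrC. by rewrite mulrC [leRHS]mulrC.
- move=> w nA; exists dl => // n; rewrite leNgt; apply/negP => h; apply: nA. by exists n.
Qed.

Section killing.
Context (Z : Om -> R) (rho : R).
Hypotheses (mZ : mfT Z) (rho0 : 0 < rho).
Hypotheses (hZ : forall A : set R, measurable A -> P (Z @^-1` A) = exponential_prob rho A).
Hypotheses (iYZ : independent2 P (sigma_process [set s | 0 <= s] Y) (sigma_rv Z)).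

Let AY := sigma_process [set s : R | 0 <= s] Y.

Let YM : AY `<=` measurable.
Proof.
apply: smallest_sub; first exact: sigma_algebra_measurable.
move=> A [s s0 hA]; exact: (msrv (sub_meas sY s0)) hA.
Qed.

Let idY : Om -> gsalg AY := fun w => w.

Let AYs : <<s AY >> `<=` AY.
Proof. by apply: smallest_sub => //; exact: smallest_sigma_algebra. Qed.

Lemma process_meas s : 0 <= s -> @measurable_fun _ _ (gsalg AY) R setT (Y s).
Proof.
move=> s0; apply/mfun_inP; apply: subset_trans (@sub_sigma_algebra _ _ _).
by move=> A hA; apply: sub_sa; exists s.
Qed.

(* Conditioning on the path, Z being independent of it. *)
Lemma Ex_killed (F : Om -> R) (a b : R) mu : 0 <= a -> a <= b -> 0 <= mu ->
  @measurable_fun _ _ (gsalg AY) R setT F -> (forall w, 0 <= F w <= 1) ->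
  Ex P (fun w => F w * window mu (Y a w) (Y b w) (Z w)) = rho / (rho + mu) *
    Ex P (fun w => F w * (expR (- rho * Y a w) * (1 - expR (- (rho + mu) * (Y b w - Y a w))))).
Proof.
move=> a0 ab mu0 mF F01; have b0 := le_trans a0 ab.
have rm : 0 < rho + mu by rewrite ltr_wpDr.
pose H (x : gsalg AY * R) := F x.1 * window mu (Y a x.1) (Y b x.1) x.2.
have bH : bmf H.
  have mf1 s : 0 <= s -> mfT (fun x : gsalg AY * R => Y s x.1).
    by move=> s0; apply: (mcomp (process_meas s0)); exact: measurable_fst.
  apply: bmf01 => [|x].
    apply: mfM; first by apply: (mcomp mF); exact: measurable_fst. apply: mfM.
      have -> : (fun x : gsalg AY * R => ((Y a x.1 <= x.2)%R && (x.2 < Y b x.1)%R)%:R : R) =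
          \1_([set x | (Y a x.1 <= x.2)%R] `&` [set x | (x.2 < Y b x.1)%R]).
        apply/funext => x; rewrite indicE; congr (nat_of_bool _)%:R.
        apply/idP/idP; first by move=> /andP[h1 h2]; rewrite inE. by rewrite inE => -[/= -> ->].
      apply: measurable_indic; apply: measurableI.
        by apply: measurable_le2 => //; exact: mf1.
      by apply: measurable_lt2 => //; exact: mf1.
    apply: mexpR; apply: mfM => //. apply: (mcomp (@mpos R)); apply: mfB => //; exact: mf1.
  have /andP[f0 f1] := F01 x.1; rewrite /H /window.
  have e1 : expR (- mu * pos (x.2 - Y a x.1)) <= 1 by rewrite expR_le_1// mulNr oppr_le0 mulr_ge0// pos_ge0.
  case: (boolP (Y a x.1 <= x.2 < Y b x.1)) => _ /=; rewrite ?mul0r ?mulr0 ?lexx ?ler01 ?mul1r// mulr_ge0 ?expR_ge0//=.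
  by rewrite mulr_ile1// expR_ge0.
have := @independent2_Ex _ Om R P _ _ (gsalg AY) R idY Z H.
move=> /(_ _ mZ _ bH)/wrap[].
- by move=> _ A mA; have h := @YM _ (@AYs _ mA); rewrite setTI.
- apply: independent2W iYZ => // _ [A mA <-]; rewrite setTI; exact: AYs.
move=> ->; rewrite -(ExZ fP).
  apply: eq_Ex => w; rewrite /H /= (ExZ fP); last first.
    exact: bmf_comp (bmf_window (Y a w) (Y b w) mu0) _.
  by rewrite (Ex_window mZ rho0 hZ mu0) ?(sub_ge0 sY)// ?(sub_mono sY)//; ring.
have FM : mfT F by apply: (mfun_inM (F := AY)).
apply: bmfM; first exact: bmf01.
apply: bmfM; first exact: (bmf_exp sY (ltW rho0) a0).
apply: bmf01.
  apply: mfB => //; apply: mexpR. by apply: mfM => //; apply: mfB; exact: (sub_meas sY).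
move=> w; have h : 0 <= Y b w - Y a w by rewrite subr_ge0 (sub_mono sY).
rewrite subr_ge0 expR_le_1 ?gerBl ?expR_ge0// mulNr oppr_le0 mulr_ge0// ltW//.
Qed.

Lemma prob_window a b : 0 <= a -> a <= b -> P [set w | (Y a w <= Z w)%R /\ (Z w < Y b w)%R] =
  (expR (- a * rho `^ alpha) - expR (- b * rho `^ alpha))%:E.
Proof.
move=> a0 ab; have b0 := le_trans a0 ab.
have ma := sub_meas sY a0; have mb := sub_meas sY b0.
set A := [set w | _]; have mA : measurable A.
  by apply: measurableI; [exact: measurable_le2|exact: measurable_lt2].
have -> : P A = (Ex P (\1_A))%:E by rewrite ExE ?integral_indic ?setIT//; exact: bmf_indic.
congr _%:E.
have := @Ex_killed (fun=> 1) a b 0 a0 ab (lexx 0) (mcst _).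
move=> /(_ _)/wrap[]; first by move=> w; rewrite lexx ler01.
have -> : (fun w => 1 * window 0 (Y a w) (Y b w) (Z w)) = \1_A.
  apply/funext => w; rewrite mul1r /window oppr0 mul0r expR0 mulr1 indicE; congr (nat_of_bool _)%:R.
  by apply/idP/idP => [/andP[h1 h2]|]; rewrite inE//= => -[-> ->].
move=> ->; rewrite addr0 divff ?gt_eqF// mul1r.
rewrite -!(Ex_sub sY (ltW rho0))// -(ExB fP (bmf_exp sY (ltW rho0) a0) (bmf_exp sY (ltW rho0) b0)).
apply: eq_Ex => w; rewrite mul1r mulrBr mulr1 -expRD; congr (_ - expR _); ring.
Qed.

Lemma rho_pow_gt0 : 0 < rho `^ alpha. Proof. exact: powR_gt0. Qed.

Lemma ae_hit : {ae P, forall w, exists2 s : R, 0 < s & Z w < Y s w}.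
Proof.
have p0 := rho_pow_gt0.
have : {ae P, forall w, 0 < Z w} by exact: exponential_gt0 mZ hZ.
have H : {ae P, forall w, (exists2 s : R, 0 < s & Z w < Y s w) \/ Z w <= 0}.
  apply: ae_small => e e0. have : expR (- (N%:R * rho `^ alpha)) @[N --> \oo] --> (0 : R) by exact: cvg_expN1.
  move=> /cvgrPdist_lt/(_ e e0) [N _ hN]; have {hN} := hN N.+1 (leqnSn _).
  rewrite /= sub0r normrN ger0_norm ?expR_ge0// => hN. have N0 : 0 <= N.+1%:R :> R by [].
  have mA : measurable [set w | (Y 0 w <= Z w)%R /\ (Z w < Y N.+1%:R w)%R].
    apply: measurableI; first by apply: measurable_le2 => //; exact: (sub_meas sY (lexx 0)).
    by apply: measurable_lt2 => //; exact: (sub_meas sY N0).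
  exists (~` [set w | (Y 0 w <= Z w)%R /\ (Z w < Y N.+1%:R w)%R]); split.
  - exact: measurableC.
  - rewrite probability_setC//. rewrite prob_window// oppr0 mul0r expR0 -EFinB lee_fin opprB addrCA subrr addr0.
    by rewrite mulNr ltW.
  - move=> w /contrapT[_ h]; left; exists N.+1%:R => //; by rewrite ltr0n.
move=> h; near=> w.
have [//|] : (exists2 s : R, 0 < s & Z w < Y s w) \/ Z w <= 0 by near: w.
have : 0 < Z w by near: w.
by move=> /lt_le_trans h1 /h1; rewrite ltxx.
Unshelve. all: by end_near. Qed.

(** Passage at time t > 0 puts the level between [Y (t - u)] and [Y (t + u)], an event of small
    probability for small u by [prob_window]. *)
Lemma ae_passage_ne (t : R) : 0 <= t -> {ae P, forall w, 0 < Z w ->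
  (exists2 s : R, 0 < s & Z w < Y s w) -> t != passage_time (Y ^~ w) (Z w)}.
Proof.
have pa := rho_pow_gt0.
have y0 := sub_0 sY; have ym w (s u : R) := @sub_mono _ _ _ _ _ _ sY w s u.
have yr w (s : R) := @sub_rc _ _ _ _ _ _ sY w s.
rewrite le_eqVlt => /predU1P[<-|t0].
  by apply: aeW => w z0 zh; rewrite lt_eqF// (passage_gt0 (y0 w) (ym w) (yr w)).
apply: ae_small => e e0.
have h : (fun u => expR (- (t - u) * rho `^ alpha) - expR (- (t + u) * rho `^ alpha)) @ 0^'+ --> (0 : R).
  rewrite [X in _ --> X](_ : _ = expR (- (t - 0) * rho `^ alpha) - expR (- (t + 0) * rho `^ alpha)); last first.
    by rewrite subr0 addr0 subrr.
  apply: cvg_at_right_filter; apply: cvgB.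
    apply: continuous_cvg; first exact: continuous_expR.
    by apply: cvgMl; apply: cvgN; apply: cvgB; [exact: cvg_cst|exact: cvg_id].
  apply: continuous_cvg; first exact: continuous_expR.
  by apply: cvgMl; apply: cvgN; apply: cvgD; [exact: cvg_cst|exact: cvg_id].
move/cvgrPdist_lt : h => /(_ e e0) h.
near (0 : R)^'+ => u.
have u0 : 0 < u by near: u; exact: nbhs_right_gt.
have ut : u < t by near: u; exact: nbhs_right_lt.
have hu : `|0 - (expR (- (t - u) * rho `^ alpha) - expR (- (t + u) * rho `^ alpha))| < e by near: u; exact: h.
have tu : 0 <= t - u by rewrite subr_ge0 ltW.
have mA : measurable [set w | (Y (t - u) w <= Z w)%R /\ (Z w < Y (t + u) w)%R].
  have tu' : 0 <= t + u by rewrite addr_ge0// ltW.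
  apply: measurableI; first by apply: measurable_le2 => //; exact: (sub_meas sY tu).
  by apply: measurable_lt2 => //; exact: (sub_meas sY tu').
exists [set w | (Y (t - u) w <= Z w)%R /\ (Z w < Y (t + u) w)%R]; split => //.
- rewrite prob_window//; last lra. rewrite lee_fin; apply: le_trans (ltW hu); rewrite sub0r normrN; exact: ler_norm.
- move=> w nA z0 zh; apply/eqP => tS; apply: nA; split.
    by apply: (lt_passage (y0 w) z0 zh) => //; rewrite -tS gtrBl.
  by apply: (gt_passage (ym w) zh); rewrite -tS ltrDl.
Unshelve. all: by end_near. Qed.

End killing.

End subordinator_paths.

(** * The mean of a product functional of the killed subordinator *)

Section limits.
Context (R : realType) (n : nat).
Local Notation M := 'M[R]_n.+1.

Lemma mxM_cvg (A B : nat -> M) (a b : M) :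
  (forall i j, A l i j @[l --> \oo] --> a i j) -> (forall i j, B l i j @[l --> \oo] --> b i j) ->
  forall i j, (A l * B l) i j @[l --> \oo] --> (a * b) i j.
Proof.
move=> hA hB i j; rewrite mxE.
rewrite (_ : (fun l => _) = (fun l => \sum_k A l i k * B l k j)); last by apply/funext => l; rewrite mxE.
by apply: cvg_big => [|k _]; [exact: add_continuous|exact: cvgM].
Qed.

Lemma one_sub_exp (h x : R) : 0 < h -> 0 <= x -> x - h * x ^+ 2 <= h^-1 * (1 - expR (- h * x)) <= x.
Proof.
move=> h0 x0; set u := h * x; have u0 : 0 <= u by rewrite mulr_ge0// ltW.
have hx : h^-1 * u = x by rewrite /u mulKf// gt_eqF.
have -> : x - h * x ^+ 2 = h^-1 * (u - u ^+ 2) by rewrite /u; field; rewrite gt_eqF.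
rewrite mulNr -/u; apply/andP; split; last first.
  by rewrite -[leRHS]hx ler_pM2l ?invr_gt0//; have := expR_ge1Dx (- u); lra.
rewrite ler_pM2l ?invr_gt0//.
have h1 : expR (- u) * (1 + u) <= 1 by rewrite expRN mulrC ler_pdivrMr ?expR_gt0// mul1r expR_ge1Dx.
have e0 := expR_ge0 (- u); nra.
Qed.

Lemma one_sub_exp_cvg (x : R) : 0 <= x -> (hn R l)^-1 * (1 - expR (- hn R l * x)) @[l --> \oo] --> x.
Proof.
move=> x0; apply: (@squeeze_cvgr _ _ _ _ (fun l => x - hn R l * x ^+ 2) (fun=> x)).
- by apply: nearW => l; apply: one_sub_exp => //; exact: hn_gt0.
- rewrite [X in _ --> X](_ : _ = x - 0 * x ^+ 2); last by rewrite mul0r subr0. apply: cvgB; first exact: cvg_cst.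
  by apply: cvgMl; exact: hn_cvg.
- exact: cvg_cst.
Qed.

End limits.

Section killed_mean.
Context d (Om : mtype d) (R : realType) (P : prob Om R) (alpha : R) (Y : R -> Om -> R).
Hypotheses (a01 : 0 < alpha < 1) (sY : stable_subordinator alpha P Y).
Let fP := Pfin P.
Context (Z : Om -> R) (rho : R).
Hypotheses (mZ : mfT Z) (rho0 : 0 < rho).
Hypotheses (hZ : forall A : set R, measurable A -> P (Z @^-1` A) = exponential_prob rho A).
Hypotheses (iYZ : independent2 P (sigma_process [set s | 0 <= s] Y) (sigma_rv Z)).
Context (n : nat) (s : wseq R n).
Local Notation M := 'M[R]_n.+1.
Hypotheses (s0 : all rge0 s) (hG : tst (ef s)).
Let G := ef s.
Variable mu : R.
Hypothesis mu0 : 0 <= mu.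
Let rm : 0 < rho + mu. Proof. by rewrite ltr_wpDr. Qed.

Local Notation h_ := (hn R).
(** There are [2^l] cells per unit of time, up to time [2^l]: the mesh shrinks while the horizon
    grows, so the passage eventually takes place within the grid. *)
Let Kl l := (2 ^ l * 2 ^ l)%N.
Let yk l k w := Y (k%:R * h_ l) w.
Let wd l k w := window mu (yk l k w) (yk l k.+1 w) (Z w).

Let kh l k : 0 <= k%:R * h_ l.
Proof. by rewrite mulr_ge0// ltW// hn_gt0. Qed.

Let yk_le l k k' w : (k <= k')%N -> yk l k w <= yk l k' w.
Proof. by move=> kk; apply: (sub_mono sY) => //; rewrite ler_pM2r ?hn_gt0// ler_nat. Qed.

Let wd_ge0 l k w : 0 <= wd l k w.
Proof. by rewrite mulr_ge0// expR_ge0. Qed.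

Let wd_le l k w : wd l k w <= ((yk l k w <= Z w)%R && (Z w < yk l k.+1 w)%R)%:R.
Proof.
by rewrite ler_piMr// expR_le_1// mulNr oppr_le0 mulr_ge0// pos_ge0.
Qed.

(** Only the cell of passage contributes, together with the product over the earlier cells: a
    discretisation of the functional in [killed_mean] whose terms have explicit means. *)
Definition approx_mean l w : M := \sum_(k < Kl l) wd l k w *: gridprod (Y ^~ w) G (h_ l) k.

Let sum_wd l K w : \sum_(k < K) wd l k w <= (Z w < yk l K w)%R%:R.
Proof.
elim: K => [|K IH]; first by rewrite big_ord0.
rewrite big_ord_recr /=; apply: le_trans (lerD IH (wd_le l K w)) _.
have := yk_le l w (leqnSn K).
by case: (ltP (Z w) (yk l K w)) => h1; case: (ltP (Z w) (yk l K.+1 w)) => h2 h3 //=;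
  rewrite ?addr0 ?add0r//; have := lt_le_trans h1 (le_trans h3 h2); rewrite ltxx.
Qed.

Let approx_bound l w i j : `|approx_mean l w i j| <= 1.
Proof.
have g k := substoch_entry i j (substoch_grid sY hG k w (hn_gt0 R l)).
rewrite summxE ger0_norm; last first.
  by apply: sumr_ge0 => k _; rewrite mxE mulr_ge0//; case/andP: (g k).
apply: (@le_trans _ _ (\sum_(k < Kl l) wd l k w)).
  by apply: ler_sum => k _; rewrite mxE ler_piMr//; case/andP: (g k).
by apply: le_trans (sum_wd _ _ _) _; case: (_ < _).
Qed.

Let past_process t : 0 <= t -> past Y t `<=` <<s sigma_process [set s : R | 0 <= s] Y >>.
Proof.
move=> t0; apply: subset_trans (@sub_sigma_algebra _ _ _).
apply: smallest_sub; first exact: smallest_sigma_algebra.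
by move=> A [r /andP[r0 _] hA]; apply: sub_sa; exists r.
Qed.

Let grid_process l k i j : @measurable_fun _ _ (gsalg (sigma_process [set s : R | 0 <= s] Y)) R setT
  (fun w => gridprod (Y ^~ w) G (h_ l) k i j).
Proof.
have := mmeas_grid (Y := Y) (k := k) hG (hn_gt0 R l) i j.
exact: (mfun_in_sub (past_process (kh l k))).
Qed.

Let proc_meas : sigma_process [set s : R | 0 <= s] Y `<=` measurable.
Proof.
apply: smallest_sub; first exact: sigma_algebra_measurable.
move=> A [r r0 hA]; exact: (msrv (sub_meas sY r0)) hA.
Qed.

Let mwd l k : mfT (wd l k).
Proof.
have ma := sub_meas sY (kh l k); have mb := sub_meas sY (kh l k.+1).
apply: mfM; last first.
  apply: mexpR; apply: mfM => //. by apply: (mcomp (@mpos R)); exact: mfB.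
have -> : (fun w => ((yk l k w <= Z w)%R && (Z w < yk l k.+1 w)%R)%:R : R) =
    \1_([set w | (yk l k w <= Z w)%R] `&` [set w | (Z w < yk l k.+1 w)%R]).
  apply/funext => x; rewrite indicE; congr (nat_of_bool _)%:R.
  apply/idP/idP; first by move=> /andP[h1 h2]; rewrite inE. by rewrite inE => -[/= -> ->].
by apply: measurable_indic; apply: measurableI; [exact: measurable_le2|exact: measurable_lt2].
Qed.

Let bmm_term l k : bmm (fun w => wd l k w *: gridprod (Y ^~ w) G (h_ l) k).
Proof.
move=> i j; apply: bmf01 => [|w].
  under eq_fun do rewrite mxE; apply: mfM; first exact: mwd. exact: mfun_inM proc_meas (grid_process l k i j).
have /andP[g0 g1] := substoch_entry i j (substoch_grid sY hG k w (hn_gt0 R l)).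
rewrite mxE mulr_ge0//= mulr_ile1//.
by apply: le_trans (wd_le l k w) _; case: (_ && _).
Qed.

Definition cl l := rho / (rho + mu) * (1 - expR (- h_ l * (rho + mu) `^ alpha)).

Let Emx_term l k : Emx P (fun w => wd l k w *: gridprod (Y ^~ w) G (h_ l) k) = cl l *: Qh alpha s rho (h_ l) ^+ k.
Proof.
have hl0 := hn_gt0 R l.
have bE : bmf (fun w => 1 - expR (- (rho + mu) * incr Y (h_ l) k w)).
  apply: bmf01 => [|w].
    apply: mfB => //; apply: mexpR. by apply: mfM => //; exact: (measurable_incr sY).
  have i0 := incr_ge0 sY k w hl0. by rewrite subr_ge0 gerBl expR_ge0 expR_le_1// mulNr oppr_le0 mulr_ge0// ltW.
have E : Emx P (fun w => (1 - expR (- (rho + mu) * incr Y (h_ l) k w))%:M) =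
    (1 - expR (- h_ l * (rho + mu) `^ alpha))%:M :> M.
  apply/matrixP => i j; rewrite !mxE; have [->|ij] := eqVneq i j; last first.
    rewrite mulr0n -[RHS](Ex_cst1 P); apply: eq_Ex => w. by rewrite mxE (negbTE ij).
  rewrite mulr1n -(Ex_sub sY (ltW rm) (ltW hl0)).
  transitivity (Ex P (fun w => 1 - expR (- (rho + mu) * pos (incr Y (h_ l) k w)))).
    by apply: eq_Ex => w; rewrite mxE eqxx mulr1n pos_id// (incr_ge0 sY).
  have bp := bmf_exppos (ltW rm).
  rewrite (@Ex_incr _ _ _ _ _ _ sY (h_ l) k (fun x => 1 - expR (- (rho + mu) * pos x)) hl0); last first.
    by apply: bmfB => //; exact: bmf_cst.
  rewrite -[X in X - _](Ex_cst1 P) -(ExB fP); last 2 first.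
  - exact: bmf_cst.
  - exact: (bmf_exp sY (ltW rm) (ltW hl0)). by apply: eq_Ex => w; rewrite pos_id// (sub_ge0 sY)// ltW.
have -> : cl l *: Qh alpha s rho (h_ l) ^+ k = rho / (rho + mu) *:
    (Qh alpha s rho (h_ l) ^+ k *m (1 - expR (- h_ l * (rho + mu) `^ alpha))%:M).
  by rewrite mul_mx_scalar scalerA.
rewrite -E -(Emx_Tk sY s0 hG k (ltW rho0) hl0).
rewrite -[Emx P _ *m _]/(Emx P _ * _).
rewrite -(@Emx_Tk_mul _ _ _ _ _ _ sY n s hG rho (h_ l) k
  (fun x => (1 - expR (- (rho + mu) * x))%:M) (ltW rho0) hl0); last 2 first.
- move=> i j; under eq_fun do rewrite mxE.
  rewrite (_ : (fun x => _) = (fun x => (1 - expR (- (rho + mu) * x)) * (i == j)%:R)); last first.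
    by apply/funext => x; rewrite mulr_natr.
  apply: mfM => //; apply: mfB => //. by apply: mexpR; exact: mfM.
- move=> i j; under eq_fun do rewrite mxE -mulr_natr. by apply: bmfM => //; exact: bmf_cst.
apply/matrixP => i j; rewrite !mxE.
have := @Ex_killed _ _ _ _ _ _ sY Z rho mZ rho0 hZ iYZ
  (fun w => gridprod (Y ^~ w) G (h_ l) k i j) (k%:R * h_ l) (k.+1%:R * h_ l) mu (kh l k) _ mu0 (grid_process l k i j).
move=> /(_ _ _)/wrap[].
- by rewrite ler_pM2r// ler_nat.
- by move=> w; exact: substoch_entry i j (substoch_grid sY hG k w hl0).
move=> e; transitivity (Ex P (fun w => gridprod (Y ^~ w) G (h_ l) k i j *
    window mu (Y (k%:R * h_ l) w) (Y (k.+1%:R * h_ l) w) (Z w))).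
  by apply: eq_Ex => w; rewrite mxE mulrC.
rewrite e; congr (_ * _); apply: eq_Ex => w.
have -> : Tk Y s rho (h_ l) k w * (1 - expR (- (rho + mu) * incr Y (h_ l) k w))%:M =
    (1 - expR (- (rho + mu) * incr Y (h_ l) k w)) *: Tk Y s rho (h_ l) k w by exact: mul_mx_scalar.
by rewrite /Tk !mxE /incr; ring.
Qed.

Lemma bmm_approx l : bmm (approx_mean l).
Proof.
exact: (@bmm_sum _ _ _ _ _ (index_enum 'I_(Kl l)) _ (fun k : 'I_(Kl l) => bmm_term l k)).
Qed.

(** The means of the terms form a geometric series in [Qh]. *)
Lemma Emx_approx l : Emx P (approx_mean l) * (1 - Qh alpha s rho (h_ l)) =
  cl l *: (1 - Qh alpha s rho (h_ l) ^+ Kl l).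
Proof.
rewrite /approx_mean (Emx_sum fP); last by move=> k; exact: bmm_term.
under eq_bigr do rewrite Emx_term.
rewrite -scaler_sumr -scalerAl; congr (_ *: _).
set Q := Qh _ _ _ _; elim: (Kl l) => [|K IH]; first by rewrite big_ord0 mul0r expr0 subrr.
by rewrite big_ord_recr /= mulrDl IH mulrBr mulr1 -exprSr addrA subrK.
Qed.

Let sum1 : \sum_(p <- s) p.2 = 1.
Proof.
have [_ h _] := hG; rewrite -h /ef; apply: eq_bigr => p _.
by rewrite mulr0 expR0 scale1r.
Qed.

Let hat_cvg i j : ((h_ l)^-1 *: (1 - Qh alpha s rho (h_ l))) i j @[l --> \oo] --> hat s alpha rho i j.
Proof.
rewrite (_ : (fun l => _) = (fun l => \sum_(p <- s)
    ((h_ l)^-1 * (1 - expR (- h_ l * (rho + p.1) `^ alpha))) * p.2 i j)); last first.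
  apply/funext => l; rewrite -sum1 /Qh -sumrB scaler_sumr summxE. by apply: eq_bigr => p _; rewrite !mxE; ring.
rewrite /hat summxE.
under [X in _ --> X]eq_bigr do rewrite mxE.
by apply: cvg_big => [|p _]; [exact: add_continuous|apply: cvgMl; exact/one_sub_exp_cvg/powR_ge0].
Qed.

Let QK_cvg i j : (Qh alpha s rho (h_ l) ^+ Kl l) i j @[l --> \oo] --> (0 : R).
Proof.
have pa := rho_pow_gt0 alpha rho0.
apply: (@squeeze_cvgr _ _ _ _ (fun=> 0) (fun l => expR (- (l%:R * rho `^ alpha)))).
- apply: nearW => l; have /andP[-> h] := Qh_pow_le sY s0 hG (Kl l) i j (ltW rho0) (hn_gt0 R l).
  apply: le_trans h _; rewrite ler_expR mulNr lerN2 ler_wpM2r ?powR_ge0//.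
  by rewrite /Kl hn_mul ler_nat ltnW// ltn_expl.
- exact: cvg_cst.
- exact: cvg_expN1.
Qed.

Section pathwise.
Context (w : Om).
Let y := Y ^~ w.
Hypotheses (z0 : 0 < Z w) (zhit : exists2 r : R, 0 < r & Z w < Y r w) (pj : pure_jump y).
Hypotheses (hS : forall l k : nat, k%:R * h_ l != passage_time y (Z w)).

Let y0 : y 0 = 0. Proof. exact: (sub_0 sY). Qed.
Let ym (a b : R) : 0 <= a -> a <= b -> y a <= y b. Proof. exact: (sub_mono sY). Qed.
Let yr (a : R) : 0 <= a -> y r @[r --> a^'+] --> y a. Proof. exact: (sub_rc sY). Qed.

Let exk l : exists k : nat, y (k%:R * h_ l) <= Z w /\ Z w < y (k.+1%:R * h_ l).
Proof.
have [r r0 zr] := zhit; have hl := hn_gt0 R l.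
have ex : exists k : nat, Z w < y (k%:R * h_ l).
  exists (Num.truncn (r / h_ l)).+1; apply: lt_le_trans zr _; apply: ym; first exact: ltW.
  by rewrite -ler_pdivrMr// ltW// truncnS_gt.
case: (ex_minnP ex) => -[|k] hk mk.
  by move: hk; rewrite mul0r y0 ltNge ltW.
exists k; split=> //; rewrite leNgt; apply/negP => /mk.
by rewrite ltnn.
Qed.

(** For large l all terms vanish except that of the cell of passage, to which the convergence of the
    grid products applies. *)
Lemma approx_path i j : approx_mean l w i j @[l --> \oo] -->
  (expR (- mu * (Z w - left_limit y (passage_time y (Z w)))) *: MG G (killed_blocks y (Z w))) i j.
Proof.
have [k_ hk] := choice exk.
have [C C0 GL] := tst_lip hG; have gG := lip_good hG C0 GL.
have hl l := hn_gt0 R l.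
have hk1 l : y ((k_ l)%:R * h_ l) <= Z w by case: (hk l).
have hk2 l : Z w < y ((k_ l).+1%:R * h_ l) by case: (hk l).
have c1 := grid_left_cvg y0 ym yr z0 zhit hl (@hn_cvg R) hk1 hk2 hS.
have c2 := grid_MG_cvg y0 ym yr gG GL z0 zhit pj hl (@hn_cvg R) hk1 hk2 hS.
have c3 : gridprod y G (h_ l) (k_ l) i j @[l --> \oo] --> MG G (killed_blocks y (Z w)) i j.
  apply/cvgrPdist_lt => e e0; have /cvgrPdist_lt/(_ e e0) := c2; apply: filterS => l.
  rewrite sub0r normrN ger0_norm ?nrm_ge0//; apply: le_lt_trans; rewrite distrC.
  by apply: le_trans _ (nrm_entry _ i j); rewrite !mxE.
rewrite mxE; apply: cvg_trans (_ : (fun l => expR (- mu * (Z w - y ((k_ l)%:R * h_ l))) *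
    gridprod y G (h_ l) (k_ l) i j) @ \oo --> _); last first.
  apply: cvgM => //; apply: continuous_cvg; first exact: continuous_expR.
  by apply: cvgMr; apply: cvgB => //; exact: cvg_cst.
apply: near_eq_cvg.
have [N _ hN] := nbhs_infty_gtr (passage_time y (Z w)).
exists N => // l /= Nl.
have kK : (k_ l < Kl l)%N.
  rewrite -(ltr_nat R) -(ltr_pM2r (hl l)) /Kl hn_mul. apply: le_lt_trans (passage_ge ym zhit (hl l) (hk1 l)) _.
  by apply: lt_le_trans (hN l Nl) _; rewrite ler_nat ltnW// ltn_expl.
rewrite /approx_mean summxE (bigD1 (Ordinal kK))//= big1 ?addr0.
  by rewrite mxE /wd /window /yk hk1 hk2 mul1r pos_id// subr_ge0; exact: hk1.
move=> k /eqP kk; rewrite mxE /wd /window.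
suff -> : (yk l k w <= Z w < yk l k.+1 w)%R = false by rewrite !mul0r.
apply/negP => /andP[h1 h2].
have [lt|lt|e] := ltngtP k (k_ l).
- by have := lt_le_trans h2 (le_trans (yk_le l w lt) (hk1 l)); rewrite ltxx.
- by have := lt_le_trans (hk2 l) (le_trans (yk_le l w lt) h1); rewrite ltxx.
- by apply: kk; apply: val_inj.
Qed.

End pathwise.

Lemma ae_good_path : {ae P, forall w, [/\ 0 < Z w, exists2 r : R, 0 < r & Z w < Y r w,
  pure_jump (Y ^~ w) & forall l k : nat, k%:R * h_ l != passage_time (Y ^~ w) (Z w)]}.
Proof.
have h1 := exponential_gt0 mZ hZ.
have h2 := ae_hit sY mZ rho0 hZ iYZ.
have h3 := ae_pure_jump a01 sY.
have h4 : {ae P, forall w, forall l k : nat, 0 < Z w -> (exists2 r : R, 0 < r & Z w < Y r w) ->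
    k%:R * h_ l != passage_time (Y ^~ w) (Z w)}.
  by apply: ae_foralln => l; apply: ae_foralln => k; exact: (ae_passage_ne sY mZ rho0 hZ iYZ (kh l k)).
near=> w.
have z0 : 0 < Z w by near: w.
have zh : exists2 r : R, 0 < r & Z w < Y r w by near: w.
split=> //; first by near: w.
have h : forall l k : nat, 0 < Z w -> (exists2 r : R, 0 < r & Z w < Y r w) ->
    k%:R * h_ l != passage_time (Y ^~ w) (Z w) by near: w.
by move=> l k; exact: h.
Unshelve. all: by end_near. Qed.

Lemma approx_le1 l w i j : `|approx_mean l w i j| <= 1.
Proof. exact: approx_bound. Qed.

(** After division of [Emx_approx] by the mesh, [1 - Qh] tends to [hat], the power of [Qh] to 0 and
    the scalar [cl] to the one on the right; the left side converges by dominated convergence along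
    almost every path. F is any bounded measurable version of the functional. *)
Lemma killed_mean (F : Om -> M) : bmm F ->
  {ae P, forall w, F w = expR (- mu * (Z w - left_limit (Y ^~ w) (passage_time (Y ^~ w) (Z w)))) *:
    MG G (killed_blocks (Y ^~ w) (Z w))} ->
  Emx P F * hat s alpha rho = (rho * (rho + mu) `^ (alpha - 1)) *: 1.
Proof.
move=> bF hF.
have cA i j : Emx P (approx_mean l) i j @[l --> \oo] --> Emx P F i j.
  rewrite mxE; under eq_fun do rewrite mxE. apply: (@Ex_cvg_ae _ _ _ _ fP _ _ 1) => //.
  - by move=> l; case: (bmm_approx l i j).
  - apply: filterS2 hF ae_good_path => w -> [z0 zh pj hS]. exact: approx_path.
have := mxM_cvg cA hat_cvg => H.
apply/matrixP => i j; apply: (cvg_unique _ (H i j)); first exact: Rhausdorff.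
rewrite (_ : (fun l => _) = (fun l => ((h_ l)^-1 * cl l) * ((1 - Qh alpha s rho (h_ l) ^+ Kl l) : M) i j)); last first.
  by apply/funext => l; rewrite -scalerAr Emx_approx scalerA !mxE.
rewrite mxE; apply: cvgM; last first.
  rewrite (_ : (fun l => _) = (fun l => (1 : M) i j - (Qh alpha s rho (h_ l) ^+ Kl l) i j)); last first.
    by apply/funext => l; rewrite !mxE.
  rewrite [X in _ --> X](_ : _ = (1 : M) i j - 0); last by rewrite subr0.
  by apply: cvgB; [exact: cvg_cst|exact: QK_cvg].
have -> : rho * (rho + mu) `^ (alpha - 1) = rho / (rho + mu) * (rho + mu) `^ alpha.
  have : (rho + mu) `^ alpha = (rho + mu) `^ (alpha - 1) * (rho + mu) `^ 1.
    by rewrite -powRD ?subrK// (gt_eqF rm) implybT.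
  by rewrite powRr1 ?(ltW rm)// => ->; field; rewrite (gt_eqF rm).
rewrite (_ : (fun l => _) = (fun l => rho / (rho + mu) * ((h_ l)^-1 * (1 - expR (- h_ l * (rho + mu) `^ alpha))))).
  by apply: cvgMr; exact/one_sub_exp_cvg/powR_ge0.
by apply/funext => l; rewrite /cl mulrCA.
Qed.

End killed_mean.

(** * Product functionals of concatenated and scaled partitions *)

Section product_functional.
Context (R : realType) (n : nat).
Local Notation M := 'M[R]_n.+1.
Implicit Types (b : set (R * R)) (G : R -> M) (m c : R).

(** Any chains that exhaust the length compute [MG]; for concatenated and scaled partitions these
    are taken from the constituents. *)
Lemma MG_cvg_chain C G m b (s : nat -> seq (R * R)) i j : good C G -> blocks_of m b ->
  (forall k, chain b (s k)) -> tl (s k) @[k --> \oo] --> m -> mprod G (s k) i j @[k --> \oo] --> MG G b i j.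
Proof.
move=> gG hb cs hm; have [C0 _ _] := gG.
have KC : 0 <= Kn R n * C by rewrite mulr_ge0// Kn_ge0.
apply/cvgrPdist_le => e e0.
have e1 : 0 < e / (Kn R n * C + 1) by rewrite divr_gt0// ltr_wpDl.
have /cvgrPdist_le/(_ _ e1) := hm; apply: filterS => k hk.
apply: (@le_trans _ _ (nrm (MG G b - mprod G (s k)))).
  by apply: le_trans _ (nrm_entry _ i j); rewrite !mxE.
apply: le_trans (MG_approx gG hb (cs k)) _.
apply: (@le_trans _ _ ((Kn R n * C + 1) * (e / (Kn R n * C + 1)))); last first.
  by rewrite mulrC divfK// gt_eqF// ltr_wpDl.
apply: ler_pM => //; last exact: le_trans (ler_norm _) hk.
  by rewrite subr_ge0; case: hb => _ _ + _; exact.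
by rewrite lerDl.
Qed.

Lemma blocks_of_ip m b : is_ip_of m b -> blocks_of m b.
Proof. by move=> h; rewrite -(ip_massE h); apply: ip_blocks_of; exists m. Qed.

Definition shift m (V : R * R) := (m + V.1, m + V.2).

Lemma ip_catE m b b' : is_ip_of m b -> ip_cat b b' = b `|` (shift m @` b').
Proof. by move=> h; rewrite /ip_cat (ip_massE h). Qed.

Lemma chain_cat m b b' s t : is_ip_of m b -> is_ip b' -> chain b s -> chain b' t ->
  chain (ip_cat b b') (s ++ map (shift m) t).
Proof.
move=> hb [m' hb'] [ss sb] [st tb]; rewrite (ip_catE _ hb); split; last first.
  move=> U; rewrite mem_cat => /orP[/sb|/mapP[V /tb V' ->]]; first by left. by right; exists V.
rewrite (sorted_pairwise (@ltb_trans R)) pairwise_cat -!(sorted_pairwise (@ltb_trans R)) ss /=.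
apply/andP; split.
  apply/allrelP => U _ /sb bU /mapP[V /tb bV ->]; rewrite /ltb /shift /=.
  have [_ h _ _] := hb; have [_ h' _ _] := hb'. have [_ h1 h2] := h _ bU; have [h3 _ _] := h' _ bV.
  by apply: lt_le_trans h1 _; apply: le_trans h2 _; rewrite lerDl.
rewrite sorted_map; apply: sub_sorted st => U V; rewrite /ltb /shift /relpre /=.
by rewrite ltrD2l.
Qed.

Lemma tl_shift m s : tl (map (shift m) s) = tl s.
Proof.
rewrite /tl big_map; apply: eq_bigr => U _; rewrite /block_len /shift /=; ring.
Qed.

Lemma mprod_shift G m s : mprod G (map (shift m) s) = mprod G s.
Proof.
rewrite /mprod big_map; apply: eq_bigr => U _; congr G; rewrite /block_len /shift /=; ring.
Qed.

Lemma is_ip_of_cat m m' b b' : is_ip_of m b -> is_ip_of m' b' -> is_ip_of (m + m') (ip_cat b b').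
Proof.
move=> hb hb'; have [[m0 h tr] hs] := (is_ip_ofP _ _).1 hb.
have [[m0' h' tr'] hs'] := (is_ip_ofP _ _).1 hb'.
apply/is_ip_ofP; split; last first.
  move=> e e0; have e2 : 0 < e / 2 by rewrite divr_gt0. have [s cs ls] := hs _ e2; have [t ct lt] := hs' _ e2.
  exists (s ++ map (shift m) t); first by apply: chain_cat => //; exists m'. by rewrite tl_cat tl_shift; lra.
rewrite (ip_catE _ hb); split; first exact: addr_ge0.
  move=> U [/h[h1 h2 h3]|[V /h'[h1 h2 h3] <-]]; first by split=> //; rewrite ler_wpDr.
  by rewrite /shift /=; split; [exact: addr_ge0|rewrite ltrD2l|rewrite lerD2l].
have disj U V x : b U -> b' V -> block_itv U x -> block_itv (shift m V) x -> False.
  move=> /h[_ _ h3] /h'[h1 _ _]; rewrite /block_itv /= !in_itv/= => /andP[_ x2] /andP[x3 _]. lra.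
move=> U V [bU|[U' bU <-]] [bV|[V' bV <-]] [x [xU xV]].
- by apply: tr => //; exists x.
- by exfalso; exact: disj bU bV xU xV.
- by exfalso; exact: disj bV bU xV xU.
- congr shift; apply: tr' => //; exists (x - m).
  move: xU xV; rewrite /block_itv /shift /= !in_itv/= => /andP[x1 x2] /andP[x3 x4]. by split; apply/andP; split; lra.
Qed.

Lemma MG_cat C G m b b' : good C G -> is_ip_of m b -> is_ip b' -> MG G (ip_cat b b') = MG G b * MG G b'.
Proof.
move=> gG hb ib'; have [m' hb'] := ib'.
have B := blocks_of_ip hb; have B' := blocks_of_ip hb'.
have BC := blocks_of_ip (is_ip_of_cat hb hb').
apply/matrixP => i j.
have H := @MG_cvg_chain C G _ _ (fun k => bigb b k ++ map (shift m) (bigb b' k)) i j gG BC.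
have {H} := H _ _; move=> /(_ _ _)/wrap[].
- by move=> k; apply: chain_cat => //; [exact: chain_bigb B|exact: chain_bigb B'].
- under eq_fun do rewrite tl_cat tl_shift. by apply: cvgD; [exact: cvg_tl_big B|exact: cvg_tl_big B'].
move=> H; apply: (cvg_unique _ H); first exact: Rhausdorff.
rewrite (_ : (fun k => _) = (fun k => (mprod G (bigb b k) * mprod G (bigb b' k)) i j)); last first.
  by apply/funext => k; rewrite mprod_cat mprod_shift.
by apply: mxM_cvg => i' j'; [exact: MG_cvg gG B|exact: MG_cvg gG B'].
Qed.

Lemma MG_scale C G m b c : 0 < c -> good C G -> is_ip_of m b -> MG G (ip_scale c b) = MG (fun x => G (c * x)) b.
Proof.
move=> c0 gG hb; have [C0 sG G1] := gG.
have gG' : good (C * c) (fun x => G (c * x)).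
  split; first by rewrite mulr_ge0// ltW.
    by move=> x x0; apply: sG; rewrite mulr_ge0// ltW.
  by move=> x x0; rewrite -mulrA; apply: G1; rewrite mulr_ge0// ltW.
have B := blocks_of_ip hb; have BC := blocks_of_ip (is_ip_of_scale c0 hb).
apply/matrixP => i j.
have H := @MG_cvg_chain C G _ _ (fun k => map (sc c) (bigb b k)) i j gG BC.
have {H} := H _ _; move=> /(_ _ _)/wrap[].
- by move=> k; rewrite ip_scaleE//; apply: chain_scale => //; exact: chain_bigb B.
- under eq_fun do rewrite tl_scale. by apply: cvgMr; exact: cvg_tl_big B.
move=> H; apply: (cvg_unique _ H); first exact: Rhausdorff.
rewrite (_ : (fun k => _) = (fun k => mprod (fun x => G (c * x)) (bigb b k) i j)).
  exact: MG_cvg gG' B.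
by apply/funext => k; rewrite /mprod big_map; congr fun_of_matrix; apply: eq_bigr => U _; rewrite sc_len.
Qed.

Lemma MG_single C G x : 0 < x -> good C G -> MG G [set (0, x)] = G x.
Proof.
move=> x0 gG; have hb := is_ip_single x0; have B := blocks_of_ip hb.
apply/esym; apply: (MG_unique gG B) => e e0; exists [:: (0, x)]; split.
- by split=> // U; rewrite inE => /eqP ->.
- by rewrite /tl big_seq1 /block_len/= subr0 gtrBl.
- by rewrite /mprod big_seq1 /block_len /= subr0 subrr nrm0 ltW.
Qed.

Lemma MG_set0 C G : good C G -> MG G set0 = 1.
Proof.
move=> gG; have B := ip_blocks_of (is_ip_set0 R).
apply/esym; apply: (MG_unique gG B) => e e0; exists [::]; split => //.
- by rewrite /tl big_nil ip_mass_set0 sub0r oppr_lt0.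
- by rewrite /mprod big_nil subrr nrm0 ltW.
Qed.

Lemma MG_tilt C C' G l m b : good C G -> good C' (fun x => expR (- l * x) *: G x) -> is_ip_of m b ->
  MG (fun x => expR (- l * x) *: G x) b = expR (- l * m) *: MG G b.
Proof.
move=> gG gG' hb; have B := blocks_of_ip hb; apply/matrixP => i j.
have H := MG_cvg (i := i) (j := j) gG' B; apply: (cvg_unique _ H); first exact: Rhausdorff.
have E s : mprod (fun x => expR (- l * x) *: G x) s = expR (- l * tl s) *: mprod G s.
  elim: s => [|U s IH]; first by rewrite /mprod /tl !big_nil mulr0 expR0 scale1r.
  rewrite /mprod /tl !big_cons -/(tl s) -/(mprod G s); move: IH; rewrite {1}/mprod => ->.
  rewrite -scalerAl -scalerAr [LHS]scalerA -expRD -mulrDr; done.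
rewrite (_ : (fun k => _) = (fun k => expR (- l * tl (bigb b k)) * mprod G (bigb b k) i j)); last first.
  by apply/funext => k; rewrite E mxE.
rewrite mxE; apply: cvgM; last exact: MG_cvg gG B.
apply: continuous_cvg; first exact: continuous_expR.
by apply: cvgMr; exact: cvg_tl_big B.
Qed.

Lemma ip_scale_comp c c' b : 0 < c -> 0 < c' -> ip_scale c (ip_scale c' b) = ip_scale (c * c') b.
Proof.
move=> c0 c'0; rewrite !ip_scaleE ?mulr_gt0// image_comp; congr image.
by apply/funext => U; rewrite /sc /= !mulrA.
Qed.

Lemma ip_scale1 b : ip_scale 1 b = b.
Proof.
rewrite ip_scaleE//; apply/seteqP; split=> [_ [U bU <-]|U bU].
  by rewrite /sc !mul1r -surjective_pairing.
by exists U => //; rewrite /sc !mul1r -surjective_pairing.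
Qed.

(* Exponents of [x |-> exp(- l x) G (u x)]. *)
Definition sl (l u : R) (s : seq (R * M)) := [seq (l + u * p.1, p.2) | p <- s].

Lemma efE_sl l u s x : ef (sl l u s) x = expR (- l * x) *: ef s (u * x).
Proof.
rewrite /ef /sl big_map scaler_sumr; apply: eq_bigr => p _ /=.
by rewrite scalerA -expRD; congr (expR _ *: _); ring.
Qed.

Lemma sl_ge0 l u s : 0 <= l -> 0 <= u -> all rge0 s -> all rge0 (sl l u s).
Proof.
move=> l0 u0 s0; rewrite all_map; apply: sub_all s0 => p p0 /=.
by rewrite addr_ge0// mulr_ge0.
Qed.

Lemma substochZ (c : R) (A : M) : 0 <= c <= 1 -> substoch A -> substoch (c *: A).
Proof.
move=> /andP[c0 c1] [A0 A1]; split=> [i j|i]; first by rewrite mxE mulr_ge0.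
under eq_bigr do rewrite mxE; rewrite -mulr_sumr mulr_ile1//; exact: sumr_ge0.
Qed.

Lemma tst_sl l u s : 0 <= l -> 0 <= u -> all rge0 s -> tst (ef s) -> tst (ef (sl l u s)).
Proof.
move=> l0 u0 s0 [_ G0 sG]; split.
- by exists (sl l u s) => //; exact: sl_ge0.
- by rewrite efE_sl !mulr0 expR0 scale1r.
- move=> x x0; rewrite efE_sl; apply: substochZ; last by apply: sG; rewrite mulr_ge0.
  by rewrite expR_ge0 expR_le_1// mulNr oppr_le0 mulr_ge0.
Qed.

Lemma hat_sl a l u rho s : 0 < u -> 0 <= l -> 0 < rho -> all rge0 s ->
  hat (sl l u s) a rho = u `^ a *: hat s a ((rho + l) / u).
Proof.
move=> u0 l0 r0 s0; rewrite /hat /sl big_map scaler_sumr big_seq [RHS]big_seq.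
apply: eq_bigr => p ps; rewrite scalerA; congr (_ *: _) => /=.
have p0 : 0 <= p.1 by move/allP: s0; exact.
rewrite -powRM ?(ltW u0)//; last by rewrite addr_ge0// divr_ge0 ?addr_ge0 ?(ltW u0)// ltW.
by congr (_ `^ _); field; rewrite gt_eqF.
Qed.

Lemma tst_ef (G : R -> M) : tst G -> exists s, all rge0 s /\ G = ef s.
Proof. by move=> [[s s0 h] _ _]; exists s; split=> //; exact/funext. Qed.

(** An exponential weight on the mass and a scaling of the partition are both absorbed into the test
    function, so that one formula yields the joint transform of mass and partition. *)
Lemma MG_sl s l u m b : 0 <= l -> 0 < u -> all rge0 s -> tst (ef s) ->
  is_ip_of m b -> MG (ef (sl l u s)) b = expR (- l * m) *: MG (ef s) (ip_scale u b).
Proof.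
move=> l0 u0 s0 hs hb; have [C gC] := tst_good hs.
have [C1 g1] := tst_good (tst_sl l0 (ltW u0) s0 hs).
have [C2 g2] := tst_good (tst_sl (lexx 0) (ltW u0) s0 hs).
rewrite (MG_scale u0 gC hb).
have e2 : ef (sl 0 u s) = (fun x => ef s (u * x)).
  by apply/funext => x; rewrite efE_sl oppr0 mul0r expR0 scale1r.
have e1 : ef (sl l u s) = (fun x => expR (- l * x) *: ef (sl 0 u s) x).
  by apply/funext => x; rewrite !efE_sl oppr0 mul0r expR0 scale1r.
rewrite e1 in g1 *; by rewrite (@MG_tilt C2 C1 _ l m b g2 g1 hb) e2.
Qed.

End product_functional.

Section measurable_versions.
Context d (Om : mtype d) (R : realType) (P : prob Om R).
Let fP := Pfin P.

(** The upper limit is measurable whether or not the sequence converges. This supplies measurable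
    versions of functionals obtained as almost sure limits. *)
Lemma ae_lim_measurable (f_ : nat -> Om -> R) (l : Om -> R) :
  (forall k, mfT (f_ k)) -> {ae P, forall w, f_ k w @[k --> \oo] --> l w} ->
  exists2 g, mfT g & {ae P, forall w, g w = l w}.
Proof.
move=> mf hl; exists (fun w => fine (limn_esup (fun k => (f_ k w)%:E))).
  apply: mcomp => //; apply: (@measurable_fun_limn_esup _ _ _ _ (fun k w => (f_ k w)%:E)). by move=> k; exact/mEFin.
apply: filterS hl => w hw.
have h : (f_ k w)%:E @[k --> \oo] --> (l w)%:E by apply: cvg_EFin; [exact: nearW|exact: hw].
by rewrite is_cvg_limn_esupE ?(cvg_lim _ h)//; exact: cvgP h.
Qed.

Lemma Emx_ae n (F H : Om -> 'M[R]_n.+1) : bmm F -> bmm H -> {ae P, forall w, F w = H w} -> Emx P F = Emx P H.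
Proof.
move=> bF bH e; apply/matrixP => i j; rewrite !mxE.
by apply: ae_eq_Ex; [exact: (bF i j).1|exact: (bH i j).1|apply: filterS e => w ->].
Qed.

(** The Laplace transform at k dominates the probability that X vanishes. *)
Lemma ae_pos (X : Om -> R) : mfT X -> {ae P, forall w, 0 <= X w} ->
  Ex P (fun w => expR (- (k%:R) * pos (X w))) @[k --> \oo] --> (0 : R) -> {ae P, forall w, 0 < X w}.
Proof.
move=> mX X0 hl.
suff H : {ae P, forall w, pos (X w) != 0}.
  by apply: filterS2 X0 H => w w0; rewrite pos_id// lt_neqAle eq_sym w0 andbT.
apply: ae_small => e e0.
have /cvgrPdist_lt/(_ e e0) [N _ hN] := hl; have {}hN := hN N (leqnn _).
have mp : mfT (fun w => pos (X w)) by exact: mcomp (@mpos R) mX.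
have mA : measurable [set w | pos (X w) <= 0] by exact: measurable_le2.
have bE : bmf (fun w => expR (- N%:R * pos (X w))).
  exact: bmf_comp (bmf_exppos (ler0n R N)) mX.
exists [set w | pos (X w) <= 0]; split=> //.
  have -> : P [set w | pos (X w) <= 0] = (Ex P (\1_[set w | pos (X w) <= 0]))%:E.
    by rewrite ExE ?integral_indic ?setIT//; exact: bmf_indic.
  rewrite lee_fin; apply: le_trans (_ : Ex P (fun w => expR (- N%:R * pos (X w))) <= _).
    apply: (le_Ex fP) => //; first exact: bmf_indic.
    move=> w; rewrite indicE; case: (boolP (_ \in _)); rewrite ?expR_ge0// inE /= => h.
    have -> : pos (X w) = 0 by apply/eqP; rewrite eq_le h pos_ge0. by rewrite mulr0 expR0.
  by move: hN; rewrite /= sub0r normrN => /ltW; apply: le_trans; exact: ler_norm.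
by move=> w nA; apply/eqP => h; apply: nA; rewrite /= h.
Qed.

End measurable_versions.

(** * Mixing over the mass of a Poisson-Dirichlet partition *)

Section finite_ae.
Context d (Om : mtype d) (R : realType) (P : prob Om R).

Lemma ae_forall_fin (T : finType) (Q : T -> Om -> Prop) :
  (forall t, {ae P, forall w, Q t w}) -> {ae P, forall w, forall t, Q t w}.
Proof.
move=> h; suff : {ae P, forall w, forall (k : nat) (t : T), enum_rank t = k :> nat -> Q t w}.
  by apply: filterS => w H t; exact: H erefl.
apply: ae_foralln => k.
have [[t tk]|no] := pselect (exists t : T, enum_rank t = k :> nat).
  apply: filterS (h t) => w e t' tk'. by have -> : t' = t by apply: enum_rank_inj; apply: val_inj; rewrite /= tk tk'.
by apply: aeW => w t tk; exfalso; apply: no; exists t.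
Qed.

End finite_ae.

Lemma powR_pred (R : realType) (x a : R) : 0 < x -> x * x `^ (a - 1) = x `^ a.
Proof.
move=> x0; rewrite -[X in X * _](powRr1 (ltW x0)).
rewrite -powRD; last by rewrite (gt_eqF x0) implybT.
by rewrite addrC subrK.
Qed.

(** * Measurable versions and Gamma laws of the killed subordinator *)

Section killed_laws.
Context d (Om : mtype d) (R : realType) (P : prob Om R) (alpha : R) (Y : R -> Om -> R).
Hypotheses (a01 : 0 < alpha < 1) (sY : stable_subordinator alpha P Y).
Let fP := Pfin P.
Context (Z : Om -> R) (rho : R).
Hypotheses (mZ : mfT Z) (rho0 : 0 < rho).
Hypotheses (hZ : forall A : set R, measurable A -> P (Z @^-1` A) = exponential_prob rho A).
Hypotheses (iYZ : independent2 P (sigma_process [set s | 0 <= s] Y) (sigma_rv Z)).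

Section version.
Context (n : nat) (s : wseq R n) (mu : R).
Local Notation M := 'M[R]_n.+1.
Hypotheses (s0 : all rge0 s) (hG : tst (ef s)) (mu0 : 0 <= mu).
Let G := ef s.

Lemma killed_version : exists2 F : Om -> M, bmm F &
  {ae P, forall w, F w = expR (- mu * (Z w - left_limit (Y ^~ w) (passage_time (Y ^~ w) (Z w)))) *:
    MG G (killed_blocks (Y ^~ w) (Z w))}.
Proof.
pose L w : M := expR (- mu * (Z w - left_limit (Y ^~ w) (passage_time (Y ^~ w) (Z w)))) *:
    MG G (killed_blocks (Y ^~ w) (Z w)).
have hL : {ae P, forall w, forall i j, approx_mean Y Z s mu l w i j @[l --> \oo] --> L w i j}.
  by apply: filterS (ae_good_path a01 sY mZ rho0 hZ iYZ) => w [z0 zh pj hS] i j; exact: (approx_path sY hG z0 zh pj hS).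
have H (ij : 'I_n.+1 * 'I_n.+1) : exists g : Om -> R, mfT g /\
    {ae P, forall w, g w = L w ij.1 ij.2}.
  have := @ae_lim_measurable _ _ _ P (fun l w => approx_mean Y Z s mu l w ij.1 ij.2) (fun w => L w ij.1 ij.2).
  move=> /(_ _ _)/wrap[].
  - by move=> l; case: (bmm_approx sY mZ hG mu0 l ij.1 ij.2).
  - by apply: filterS hL => w; exact.
  - by move=> [g mg hg]; exists g.
have [g hg] := choice H.
(* Clipping makes the version bounded everywhere and almost surely changes nothing, the entries of
   the limit having modulus at most 1. *)
pose cl (x : R) := Num.max (-1) (Num.min x 1).
exists (fun w => \matrix_(i, j) cl (g (i, j) w)).
  move=> i j; under eq_fun do rewrite mxE; split.
    apply: measurable_maxr => //; apply: measurable_minr => //; exact: (hg (i, j)).1.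
  exists 1 => w; rewrite ler_norml le_max lexx /= ge_max ge_min lexx orbT andbT. by lra.
have hg' : {ae P, forall w, forall ij, g ij w = L w ij.1 ij.2}.
  by apply: ae_forall_fin => ij; exact: (hg ij).2.
apply: filterS2 hL hg' => w h1 h2; apply/matrixP => i j; rewrite mxE (h2 (i, j)) /cl /=.
have bb : `|L w i j| <= 1.
  apply: (ler_cvg_to (cvg_norm (h1 i j)) (cvg_cst (1 : R))); apply: nearW => l. by apply: (@approx_le1 _ _ _ P alpha).
by move: bb; rewrite ler_norml => /andP[b1 b2]; rewrite min_l// max_r.
Qed.

End version.

Let kb w := killed_blocks (Y ^~ w) (Z w).
Let ml w := left_limit (Y ^~ w) (passage_time (Y ^~ w) (Z w)).

Lemma ae_killed_ip : {ae P, forall w, [/\ is_ip_of (ml w) (kb w), 0 < Z w & ml w <= Z w]}.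
Proof.
apply: filterS (ae_good_path a01 sY mZ rho0 hZ iYZ) => w [z0 zh pj _].
have y0 := sub_0 sY w; have ym a b := @sub_mono _ _ _ _ _ _ sY w a b.
have yr a := @sub_rc _ _ _ _ _ _ sY w a.
by split=> //; [exact: (killed_is_ip y0 ym yr)|exact: (left_passage_le y0 ym yr)].
Qed.

(** The 1 by 1 test function equal to 1; combined with an exponential weight it turns matrix
    formulas into Laplace transforms of the mass. *)
Definition s_one : seq (R * 'M[R]_1) := [:: (0, 1)].

Lemma efE_one x : ef s_one x = 1.
Proof. by rewrite /ef /s_one big_seq1 /= oppr0 mul0r expR0 scale1r. Qed.

Lemma one_ge0 : all (fun p : R * 'M[R]_1 => 0 <= p.1) s_one.
Proof. by rewrite /= lexx. Qed.

Lemma tst_one : tst (ef s_one).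
Proof.
split; [by exists s_one; rewrite ?one_ge0|exact: efE_one|].
by move=> x _; rewrite efE_one; exact: substoch1.
Qed.

Lemma MG_one m b : is_ip_of m b -> MG (ef s_one) b = 1.
Proof.
move=> hb; have [C gC] := tst_good tst_one; have B := blocks_of_ip hb.
apply/esym; apply: (MG_unique gC B) => e e0.
have [_ hs] := (is_ip_ofP _ _).1 hb; have [t ct lt] := hs _ e0; exists t; split=> //.
rewrite /mprod big1 ?subrr ?nrm0 ?ltW// => U _; exact: efE_one.
Qed.

Lemma hat_one a r : hat s_one a r = (r `^ a) *: 1.
Proof. by rewrite /hat /s_one big_seq1 /= addr0. Qed.

Lemma MG_exp l m b : 0 <= l -> is_ip_of m b -> MG (ef (sl l 1 s_one)) b = expR (- l * m) *: 1.
Proof.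
by move=> l0 hb; rewrite (MG_sl l0 ltr01 one_ge0 tst_one hb) ip_scale1 (MG_one hb).
Qed.

Lemma expR_mean_one (F : Om -> R) : bmf F -> Emx P (fun w => F w *: (1 : 'M[R]_1)) = Ex P F *: 1.
Proof.
move=> bF; apply/matrixP => i j; rewrite !mxE !ord1 eqxx mulr1n mulr1.
by apply: eq_Ex => w; rewrite !mxE eqxx mulr1n mulr1.
Qed.

Lemma scale1_inj (a b : R) : a *: (1 : 'M[R]_1) = b *: 1 -> a = b.
Proof. by move=> /matrixP/(_ 0 0); rewrite !mxE eqxx !mulr1. Qed.

(** The mass is recovered as minus the logarithm of a measurable version of [exp(- mass)]. *)
Lemma mass_version : exists2 m : Om -> R, mfT m & {ae P, forall w, m w = ml w}.
Proof.
have t1 := tst_sl ler01 ler01 one_ge0 tst_one.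
have [F bF hF] := killed_version t1 (lexx 0).
exists (fun w => - ln (F w 0 0)).
  by apply: measurable_funN; apply: (mcomp (@measurable_ln R)); exact: (bF 0 0).1.
apply: filterS2 hF ae_killed_ip => w -> [hb _ _].
by rewrite oppr0 mul0r expR0 scale1r (MG_exp ler01 hb) !mxE eqxx mulr1 expRK mulN1r opprK.
Qed.

(** The right side is the transform of the Gamma law of parameter 1 - alpha and rate rho, the law of
    the leftmost block in the case PDIP(alpha, 0). *)
Lemma Ex_residual (F : Om -> R) (mu : R) : 0 <= mu -> bmf F ->
  {ae P, forall w, F w = expR (- mu * (Z w - ml w))} -> Ex P F = rho * (rho + mu) `^ (alpha - 1) / rho `^ alpha.
Proof.
move=> mu0 bF hF.
have b1 : bmm (fun w => F w *: (1 : 'M[R]_1)) by apply: bmmZ => //; exact: bmm_cst.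
have := killed_mean a01 sY mZ rho0 hZ iYZ one_ge0 tst_one mu0 b1.
move=> /(_ _)/wrap[].
  by apply: filterS2 hF ae_killed_ip => w -> [hb _ _]; rewrite (MG_one hb).
rewrite (expR_mean_one bF) hat_one -scalerAl -scalerAr scalerA mulr1 => /scale1_inj <-.
by rewrite mulfK// gt_eqF// powR_gt0.
Qed.

Lemma Ex_mass (F : Om -> R) (l : R) : 0 <= l -> bmf F ->
  {ae P, forall w, F w = expR (- l * ml w)} -> Ex P F = rho `^ alpha / (rho + l) `^ alpha.
Proof.
move=> l0 bF hF; have t1 := tst_sl l0 ler01 one_ge0 tst_one.
have b1 : bmm (fun w => F w *: (1 : 'M[R]_1)) by apply: bmmZ => //; exact: bmm_cst.
have := killed_mean a01 sY mZ rho0 hZ iYZ (sl_ge0 l0 ler01 one_ge0) t1 (lexx 0) b1.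
move=> /(_ _)/wrap[].
  apply: filterS2 hF ae_killed_ip => w -> [hb _ _]. by rewrite oppr0 mul0r expR0 scale1r (MG_exp l0 hb).
rewrite (expR_mean_one bF) hat_sl ?one_ge0// powR1 scale1r divr1 hat_one.
rewrite -scalerAl -scalerAr scalerA mulr1 => /scale1_inj e.
have rl : 0 < rho + l by rewrite ltr_wpDr.
rewrite -[LHS](mulfK (lt0r_neq0 (powR_gt0 alpha rl))) e addr0; congr (_ / _).
exact: powR_pred.
Qed.

End killed_laws.

Section case_numerator.
Context (R : realType) (alpha : R).

(* [c] tells PDIP(alpha, alpha) (true) from PDIP(alpha, 0) (false); the mass of the
   unnormalised partition then has a Gamma law of parameter [shape c]. *)
Definition shape (c : bool) : R := if c then alpha else 1.

(** For PDIP(alpha, 0), [hat s (alpha - 1) r] is up to the scalar [r^(1 - alpha)] the mean of the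
    test function at the leftmost block, whose length is Gamma of parameter 1 - alpha. *)
Definition numer (c : bool) n (s : wseq R n) (r : R) : 'M[R]_n.+1 := if c then 1 else hat s (alpha - 1) r.

End case_numerator.

Definition kblocks (R : realType) (c : bool) (y : R -> R) (z : R) :=
  if c then killed_blocks y z else killed_blocks0 y z.

Lemma powRN_cvg (R : realType) (x b : R) : 0 < x -> 0 < b -> (x + k%:R) `^ (- b) @[k --> \oo] --> (0 : R).
Proof.
move=> x0 b0; apply/cvgrPdist_le => e e0.
pose M := e `^ (- b^-1); have M0 : 0 < M by exact: powR_gt0.
have [N _ hN] := nbhs_infty_gtr M.
exists N => // k /= Nk; have hk := hN k Nk.
rewrite sub0r normrN ger0_norm ?powR_ge0//.
have h1 : M < x + k%:R by rewrite (lt_le_trans hk)// lerDr ltW.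
have h0 := lt_trans M0 h1.
have h2 : M `^ b <= (x + k%:R) `^ b by apply: ge0_ler_powR; rewrite ?nnegrE ltW.
have ME : M `^ b = e^-1 by rewrite /M -powRrM mulNr mulVf ?gt_eqF// powR_inv1// ltW.
rewrite powRN invf_ple ?posrE ?powR_gt0//.
by rewrite -ME.
Qed.

Section killed_pd.
Context d (Om : mtype d) (R : realType) (P : prob Om R) (alpha : R) (Y : R -> Om -> R).
Hypotheses (a01 : 0 < alpha < 1) (sY : stable_subordinator alpha P Y).
Let fP := Pfin P.
Context (Z : Om -> R) (rho : R).
Hypotheses (mZ : mfT Z) (rho0 : 0 < rho).
Hypotheses (hZ : forall A : set R, measurable A -> P (Z @^-1` A) = exponential_prob rho A).
Hypotheses (iYZ : independent2 P (sigma_process [set s | 0 <= s] Y) (sigma_rv Z)).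
Let ml w := left_limit (Y ^~ w) (passage_time (Y ^~ w) (Z w)).
Let kb c w := kblocks c (Y ^~ w) (Z w).

Let alpha0 : 0 < alpha. Proof. by case/andP: a01. Qed.

Let bmf_pos (k : nat) (m : Om -> R) : mfT m -> bmf (fun w => expR (- k%:R * pos (m w))).
Proof. exact: bmf_comp (bmf_exppos (ler0n R k)). Qed.

Lemma kb_version c : exists2 m : Om -> R, mfT m &
  {ae P, forall w, is_ip_of (m w) (kb c w) /\ 0 < m w}.
Proof.
have ki := ae_killed_ip a01 sY mZ rho0 hZ iYZ.
have [m mm hm] := mass_version a01 sY mZ rho0 hZ iYZ.
case: c; rewrite /kb /kblocks.
  have m0 : {ae P, forall w, 0 < m w}.
    apply: ae_pos => //.
      by apply: filterS2 hm ki => w -> [[h _ _ _] _ _].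
    rewrite (_ : (fun k => _) = (fun k : nat => rho `^ alpha * (rho + k%:R) `^ (- alpha))); last first.
      apply/funext => k; rewrite (Ex_mass a01 sY mZ rho0 hZ iYZ (ler0n R k) (bmf_pos k mm)).
        by rewrite powRN.
      by apply: filterS2 hm ki => w -> [[h _ _ _] _ _]; rewrite pos_id.
    by rewrite -[X in _ --> X](mulr0 (rho `^ alpha)); apply: cvgMr; exact: powRN_cvg.
  exists m => //; apply: filterS3 hm ki m0 => w <- [h _ _] ?. by split.
have mr : mfT (fun w => Z w - m w) by exact: mfB.
have r0 : {ae P, forall w, 0 < Z w - m w}.
  apply: ae_pos => //.
    by apply: filterS2 hm ki => w -> [_ _ h]; rewrite subr_ge0.
  rewrite (_ : (fun k => _) = (fun k : nat => (rho / rho `^ alpha) * (rho + k%:R) `^ (- (1 - alpha)))); last first.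
    apply/funext => k; rewrite (Ex_residual a01 sY mZ rho0 hZ iYZ (ler0n R k) (bmf_pos k mr)).
      by rewrite opprB mulrAC.
    by apply: filterS2 hm ki => w -> [_ _ h]; rewrite pos_id ?subr_ge0.
  rewrite -[X in _ --> X](mulr0 (rho / rho `^ alpha)); apply: cvgMr; apply: powRN_cvg => //.
  by rewrite subr_gt0; case/andP: a01.
exists Z => //; apply: filterS3 hm ki r0 => w e [h z0 _]; rewrite e => r0; split=> //.
by have := is_ip_of_cat (is_ip_single r0) h; rewrite subrK.
Qed.

Section functional.
Context (n : nat) (s : wseq R n).
Local Notation M := 'M[R]_n.+1.
Hypotheses (s0 : all rge0 s) (hs : tst (ef s)).

Lemma kb_mean c (F : Om -> M) : bmm F -> {ae P, forall w, F w = MG (ef s) (kb c w)} ->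
  Emx P F * hat s alpha rho = (rho `^ shape alpha c) *: numer alpha c s rho.
Proof.
move=> bF; case: c => hF.
  rewrite (killed_mean a01 sY mZ rho0 hZ iYZ s0 hs (lexx 0) bF) ?addr0 ?powR_pred//.
  by apply: filterS hF => w ->; rewrite oppr0 mul0r expR0 scale1r.
(* The factor of the leftmost block is expanded as an exponential sum in the residual; each term is
   an instance of [killed_mean] with the exponent in the place of mu. *)
have H (p : R * M) : exists F : Om -> M, bmm F /\ (0 <= p.1 ->
    {ae P, forall w, F w = expR (- p.1 * (Z w - ml w)) *: MG (ef s) (killed_blocks (Y ^~ w) (Z w))}).
  have [p0|p0] := leP 0 p.1; last by exists (fun=> 0); split; [exact: bmm_cst|].
  by have [H bH hH] := killed_version a01 sY mZ rho0 hZ iYZ hs p0; exists H.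
have {H} [H hH] := choice H.
have bH p : bmm (fun w => p.2 * H p w) by apply: bmmM; [exact: bmm_cst|case: (hH p)].
have [C gC] := tst_good hs.
have eF : {ae P, forall w, F w = \sum_(p <- s) p.2 * H p w}.
  have hall (q : seq (R * M)) : all rge0 q -> {ae P, forall w, forall p, p \in q ->
      H p w = expR (- p.1 * (Z w - ml w)) *: MG (ef s) (killed_blocks (Y ^~ w) (Z w))}.
    elim: q => [_|p l IH /= /andP[p0 /IH{}IH]]; first exact: aeW.
    apply: filterS2 IH ((hH p).2 p0) => w h1 h2 q; rewrite inE => /predU1P[->//|/h1]. by [].
  have {}hall := hall s s0; have [m mm hm] := kb_version false. have ki := ae_killed_ip a01 sY mZ rho0 hZ iYZ.
  near=> w. have -> : F w = MG (ef s) (kb false w) by near: w. have hw : forall p, p \in s ->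
      H p w = expR (- p.1 * (Z w - ml w)) *: MG (ef s) (killed_blocks (Y ^~ w) (Z w)) by near: w.
  have [h _ zz] : [/\ is_ip_of (ml w) (killed_blocks (Y ^~ w) (Z w)), 0 < Z w & ml w <= Z w] by near: w.
  have r0 : 0 < Z w - ml w.
    have [hc _] : is_ip_of (m w) (kb false w) /\ 0 < m w by near: w.
    have [_ hb _ _] := hc; have [|_ /= + _] := hb (0, Z w - ml w); last by []. by left.
  rewrite /kb /kblocks /killed_blocks0 (MG_cat gC (is_ip_single r0)); last by exists (ml w).
  rewrite (MG_single r0 gC) /ef mulr_suml big_seq [RHS]big_seq.
  by apply: eq_bigr => p /hw ->; rewrite -scalerAl -scalerAr.
rewrite (Emx_ae bF _ eF); last exact: bmm_sum.
rewrite (Emx_sum fP)// mulr_suml /numer /shape /hat powRr1 ?(ltW rho0)// scaler_sumr.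
apply: eq_big_seq => p ps.
have p0 : 0 <= p.1 by move/allP: s0; exact.
have [b1 e1] := hH p.
rewrite (EmxMl fP)// -mulrA (killed_mean a01 sY mZ rho0 hZ iYZ s0 hs p0 b1 (e1 p0)).
by rewrite -scalerAr mulr1 scalerA.
Unshelve. all: by end_near. Qed.

(** At mu = 0, [killed_mean] exhibits a left inverse up to a positive scalar. *)
Lemma hat_unit_rho : hat s alpha rho \is a GRing.unit.
Proof.
have [F bF hF] := killed_version a01 sY mZ rho0 hZ iYZ hs (lexx 0).
have := killed_mean a01 sY mZ rho0 hZ iYZ s0 hs (lexx 0) bF hF.
rewrite addr0 powR_pred// => e.
have e1 : ((rho `^ alpha)^-1 *: Emx P F) *m hat s alpha rho = 1%:M.
  rewrite -[_ *m _]/(_ * _) -scalerAl e scalerA mulVf ?scale1r//. by rewrite gt_eqF// powR_gt0.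
by have /mulmx1_unit[_] := e1.
Qed.

End functional.

Lemma hat_unit n (s : wseq R n) r : all rge0 s -> tst (ef s) -> 0 < r -> hat s alpha r \is a GRing.unit.
Proof.
move=> s0 hs r0; have u0 : 0 < rho / r by rewrite divr_gt0.
have := hat_unit_rho (sl_ge0 (lexx 0) (ltW u0) s0) (tst_sl (lexx 0) (ltW u0) s0 hs).
rewrite hat_sl// addr0 invf_div mulrCA divff ?gt_eqF// mulr1 => h.
have ua : (rho / r) `^ alpha \is a GRing.unit by rewrite unitfE gt_eqF// powR_gt0.
by move: h; rewrite -![_ \is a GRing.unit]/(_ \in unitmx) unitmxZ.
Qed.

Section normalised.
Variables (c : bool) (X : {mfun Om >-> ipspace alpha}) (m : Om -> R).
Hypotheses (hX : {ae P, forall w, ip_blocks (X w) = ip_normalize (kb c w)}) (mm : mfT m).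
Hypotheses (hm : {ae P, forall w, is_ip_of (m w) (kb c w) /\ 0 < m w}).

Lemma ae_scaled : {ae P, forall w, forall u : R, 0 < u -> ip_blocks (ipscale (u * m w) (X w)) = ip_scale u (kb c w)}.
Proof.
apply: filterS2 hX hm => w e [h m0] u u0.
rewrite /ipscale /= e /ip_normalize (ip_massE h) ip_scale_comp ?invr_gt0 ?mulr_gt0//.
by rewrite mulfK// gt_eqF.
Qed.

Lemma measurable_scaled (u : R) : mfT (fun w => ipscale (u * m w) (X w)).
Proof. by apply: mipscale => //; exact: mfM. Qed.

Lemma joint_mean n (s : wseq R n) (l u : R) : all rge0 s -> tst (ef s) -> 0 <= l -> 0 < u ->
  Emx P (fun w => expR (- l * pos (m w)) *: MG (ef s) (ipscale (u * m w) (X w))) * hat s alpha ((rho + l) / u) =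
  (rho `^ shape alpha c * u `^ (- shape alpha c)) *: numer alpha c s ((rho + l) / u).
Proof.
move=> s0 hs l0 u0; have [C gC] := tst_good hs.
set F := fun w => _.
have bF : bmm F.
  apply: bmmZ.
    have [mE [K hK]] := bmf_exppos l0. by split; [exact: (mcomp mE mm)|exists K => w; exact: hK].
  move=> i j; have [mb [K hK]] := @bmf_MG R alpha n _ C gC (tst_mmeas hs) i j.
  by split; [exact: (mcomp mb (measurable_scaled u))|exists K => w; exact: hK].
have hF : {ae P, forall w, F w = MG (ef (sl l u s)) (kb c w)}.
  apply: filterS2 ae_scaled hm => w e [h m0]. by rewrite /F e// pos_id ?(ltW m0)// (MG_sl l0 u0 s0 hs h).
have ua : 0 < u `^ alpha by exact: powR_gt0.
have := kb_mean (sl_ge0 l0 (ltW u0) s0) (tst_sl l0 (ltW u0) s0 hs) bF hF.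
rewrite hat_sl// -scalerAr => e.
apply: (scalerI (lt0r_neq0 ua)); rewrite e scalerA mulrCA.
rewrite -powRD; last by rewrite (gt_eqF u0) implybT.
rewrite /numer /shape; case: (c); first by rewrite subrr powRr0 mulr1.
by rewrite hat_sl// scalerA.
Qed.

Lemma Ex_laplace (l : R) : 0 <= l -> Lap P m l = (rho / (rho + l)) `^ shape alpha c.
Proof.
move=> l0; have := joint_mean (one_ge0 R) (tst_one R) l0 ltr01.
have rl : 0 < rho + l by rewrite ltr_wpDr.
have bE : bmf (fun w => expR (- l * pos (m w))).
  have [mE [K hK]] := bmf_exppos l0. by split; [exact: (mcomp mE mm)|exists K => w; exact: hK].
rewrite (_ : Emx P _ = Emx P (fun w => expR (- l * pos (m w)) *: 1)); last first.
  by congr Emx; apply/funext => w; rewrite (MG_one (is_ip_mass (ip_blocksP _))).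
rewrite expR_mean_one// divr1 powR1 mulr1 hat_one -scalerAl -scalerAr scalerA mulr1.
have ra : (rho + l) `^ alpha != 0 by rewrite gt_eqF// powR_gt0.
have rE a : (rho / (rho + l)) `^ a = rho `^ a * (rho + l) `^ (- a).
  by rewrite powRM ?invr_ge0 ?(ltW rl) ?(ltW rho0)// -powR_inv1 ?(ltW rl)// -powRrM mulN1r.
rewrite /numer /shape; case: (c).
  by move=> /scale1_inj e; rewrite rE powRN -e mulfK.
rewrite hat_one scalerA => /scale1_inj e.
apply: (mulIf ra); rewrite e rE -!mulrA; congr (_ * _).
by rewrite -powRD ?(gt_eqF rl) ?implybT//; congr (_ `^ _); ring.
Qed.

End normalised.

End killed_pd.

(** * Independence of the Gamma mass and the normalised partition *)

Section independence_of_mass.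
Context d (Om : mtype d) (R : realType) (P : prob Om R) (alpha : R).
Local Notation I := (ipspace alpha).
Let fP := Pfin P.

Lemma ipspace_inj (b b' : I) : ip_blocks b = ip_blocks b' -> b = b'.
Proof.
case: b b' => [b ib db] [b' ib' db'] /= e; subst b'.
by rewrite (Prop_irrelevance ib ib') (Prop_irrelevance db db').
Qed.

Lemma prob_Ex (A : set Om) : measurable A -> P A = (Ex P (\1_A))%:E.
Proof. by move=> mA; rewrite ExE ?integral_indic ?setIT//; exact: bmf_indic. Qed.

Variables (X : {mfun Om >-> I}) (m : Om -> R) (rho a : R).
Hypotheses (mm : mfT m) (m0 : {ae P, forall w, 0 < m w}) (rho0 : 0 < rho).
Hypothesis X1 : {ae P, forall w, ip_mass (X w) = 1}.
Variable N : forall n, wseq R n -> R -> 'M[R]_n.+1.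
Hypothesis joint : forall n (s : wseq R n) (l u : R), all rge0 s -> tst (ef s) -> 0 <= l -> 0 < u ->
  Emx P (fun w => expR (- l * pos (m w)) *: MG (ef s) (ipscale (u * m w) (X w))) *
    hat s alpha ((rho + l) / u) = (rho `^ a * u `^ (- a)) *: N s ((rho + l) / u).
Hypothesis hunit : forall n (s : wseq R n) r, all rge0 s -> tst (ef s) -> 0 < r -> hat s alpha r \is a GRing.unit.
Hypothesis lap : forall l, 0 <= l -> Lap P m l = (rho / (rho + l)) `^ a.

Let mscaled (u : R) : mfT (fun w => ipscale (u * m w) (X w)).
Proof. by apply: mipscale => //; exact: mfM. Qed.

Let bmm_MG n (s : wseq R n) (V : Om -> I) : tst (ef s) -> mfT V -> bmm (fun w => MG (ef s) (V w)).
Proof.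
move=> hs mV i j; have [C gC] := tst_good hs.
exact: bmf_comp (@bmf_MG R alpha n _ C gC (tst_mmeas hs) i j) mV.
Qed.

Let bE l : 0 <= l -> bmf (fun w => expR (- l * pos (m w))).
Proof. by move=> l0; exact: bmf_comp (bmf_exppos l0) mm. Qed.

Section tilting.
Variable l : R.
Hypothesis l0 : 0 <= l.
Let c := (rho / (rho + l)) `^ a.
Let u := rho / (rho + l).
Let rl : 0 < rho + l. Proof. by rewrite ltr_wpDr. Qed.
Let u0 : 0 < u. Proof. exact: divr_gt0. Qed.
Let c0 : 0 < c. Proof. exact: powR_gt0. Qed.

(** Weighting by [exp(- l m)] raises the rate of a Gamma mass from rho to rho + l, which amounts to
    multiplying the mass by u; in [joint] the partition cannot tell the two apart. *)
Let tilt_MG n (s : wseq R n) : all rge0 s -> tst (ef s) ->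
  Emx P (fun w => expR (- l * pos (m w)) *: MG (ef s) (ipscale (1 * m w) (X w))) =
  c *: Emx P (fun w => MG (ef s) (ipscale (u * m w) (X w))).
Proof.
move=> s0 hs; apply: (mulIr (hunit s0 hs rl)).
have := joint s0 hs l0 ltr01; rewrite divr1 powR1 mulr1 => ->.
have := joint s0 hs (lexx 0) u0.
have -> : (rho + 0) / u = rho + l by rewrite /u addr0 invf_div mulrCA divff ?mulr1// gt_eqF.
rewrite (_ : Emx P (fun w => expR _ *: _) = Emx P (fun w => MG (ef s) (ipscale (u * m w) (X w)))); last first.
  by congr Emx; apply/funext => w; rewrite oppr0 mul0r expR0 scale1r.
rewrite -scalerAl => ->; rewrite scalerA; congr (_ *: _).
by rewrite mulrCA /c -/u -powRD ?subrr ?powRr0 ?mulr1// (gt_eqF u0) implybT.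
Qed.

Let p w := expR (- l * pos (m w)) / c.

Let mp : mfT p.
Proof. by apply: mfM => //; exact: (bE l0).1. Qed.

Let p0 w : 0 <= p w.
Proof. by rewrite divr_ge0 ?expR_ge0// ltW. Qed.

Let bp : bmf p.
Proof. by apply: bmfM; [exact: bE|exact: bmf_cst]. Qed.

Let ip : P.-integrable setT (EFin \o p).
Proof. exact: bmf_integrable. Qed.

Let Ep : Ex P p = 1.
Proof. by rewrite (ExZr fP); [rewrite lap// divff// gt_eqF|exact: bE]. Qed.

Let QT : tilt P mp p0 setT = 1%E.
Proof. by rewrite /tilt /= /dens -(ExE fP bp) Ep. Qed.

(** The tilted measure has total mass 1 already, by [lap]; normalising it makes it a probability by
    construction. *)
Let Q : prob Om R := mnormalize (tilt P mp p0) P.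

Let QE A : Q A = tilt P mp p0 A.
Proof. by rewrite /Q /= /mnormalize QT /= onee_eq0 /= invr1 mule1. Qed.

Let Ex_tilt f : bmf f -> Ex Q f = Ex P (fun w => f w * p w).
Proof.
apply: (@Ex_density _ _ _ P p mp p0 ip _ _ Q id) => //; last first.
  by move=> A mA; rewrite preimage_id; exact: QE.
by apply: (le_lt_trans (probability_le1 Q measurableT)); rewrite ltry.
Qed.

Let V1 : {mfun Om >-> I} := mfun_Sub (mem_set (mscaled 1)).
Let V2 : {mfun Om >-> I} := mfun_Sub (mem_set (mscaled u)).

Let tilt_law A : measurable A -> Q (V1 @^-1` A) = P (V2 @^-1` A).
Proof.
apply: (ip_law_unique (mu := distribution Q V1) (nu := distribution P V2)) => n G hG i j.
have [C gC] := tst_good hG; have bG := @bmf_MG R alpha n _ C gC (tst_mmeas hG) i j.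
have [s [s0 sE]] := tst_ef hG; rewrite sE in hG bG *.
rewrite (Ex_pushforward (mu := Q) (X := V1))//; last exact: Pfin.
rewrite (Ex_pushforward (mu := P) (X := V2))// Ex_tilt; last exact: bmf_comp bG (mscaled 1).
have /matrixP/(_ i j) := tilt_MG s0 hG; rewrite !mxE => e.
apply: (mulfI (lt0r_neq0 c0)); rewrite -e -(ExZ fP); last first.
  by apply: bmfM => //; exact: bmf_comp bG (mscaled 1).
apply: eq_Ex => w; rewrite mxE /p /V1 /=; field.
by rewrite gt_eqF.
Qed.

(** Rescaling to mass 1 for nonempty partitions, the factor [exp(- ln x)] being [1/x] for x > 0. *)
Let nf (b : I) : I := ipscale (expR (- ln (ip_mass b))) b.

Let mnf : mfT nf.
Proof.
apply: mipscale => //; apply: mexpR.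
apply: measurable_funN; apply: (mcomp (@measurable_ln R)); exact: measurable_ip_mass.
Qed.

Let nfE : {ae P, forall w, forall v, 0 < v -> nf (ipscale (v * m w) (X w)) = X w}.
Proof.
apply: filterS2 m0 X1 => w w0 e v v0; apply: ipspace_inj; rewrite /nf /=.
have vm : 0 < v * m w by exact: mulr_gt0.
rewrite ip_mass_scale ?(ltW vm)//; last exact: ip_blocksP.
by rewrite e mulr1 expRN lnK ?posrE// ip_scale_comp ?invr_gt0// mulVf ?ip_scale1// gt_eqF.
Qed.

(** Normalising both partitions in [tilt_law] removes the change of scale: X has the same law under
    Q as under P. *)
Lemma tilt_indep D : measurable D ->
  Ex P (fun w => expR (- l * pos (m w)) * \1_D (X w)) = c * Ex P (fun w => \1_D (X w)).
Proof.
move=> mD; have b1 : bmf (\1_D : I -> R) by exact: bmf_indic.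
have b2 : bmf (fun b : I => (\1_D (nf b) : R)) by exact: bmf_comp b1 mnf.
have := Ex_law (Pfin Q) fP (mscaled 1) (mscaled u) tilt_law b2.
rewrite Ex_tilt; last exact: bmf_comp b2 (mscaled 1).
have bX : bmf (fun w => (\1_D (X w) : R)) by exact: bmf_comp b1 _.
have e1 : Ex P (fun w => \1_D (nf (ipscale (1 * m w) (X w))) * p w) = Ex P (fun w => \1_D (X w) * p w).
  apply: ae_eq_Ex.
  - by apply: (bmfM _ bp).1; exact: bmf_comp b2 (mscaled 1).
  - exact: (bmfM bX bp).1.
  - by apply: filterS nfE => w ->.
have e2 : Ex P (fun w => \1_D (nf (ipscale (u * m w) (X w)))) = Ex P (fun w => \1_D (X w)).
  apply: ae_eq_Ex.
  - exact: (bmf_comp b2 (mscaled u)).1.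
  - exact: bX.1.
  - by apply: filterS nfE => w ->.
rewrite e1 e2 => <-; rewrite -(ExZ fP); last exact: bmfM.
by apply: eq_Ex => w; rewrite /p; field; rewrite gt_eqF.
Qed.

End tilting.

(** By [tilt_indep] the centred indicator of an event of X is orthogonal to all exponentials of the
    mass, hence by Laplace uniqueness to all bounded functions of it. *)
Lemma mass_indep : independent2 P (sigma_rv (fun w => pos (m w))) (sigma_rv X).
Proof.
move=> _ _ [B mB <-] [D mD <-]; rewrite !setTI.
have b1 : bmf (\1_D : I -> R) by exact: bmf_indic.
have bX : bmf (fun w => (\1_D (X w) : R)) by exact: bmf_comp b1 _.
pose pD := Ex P (fun w => \1_D (X w)).
have bh : bmf (fun w => \1_D (X w) - pD) by apply: bmfB => //; exact: bmf_cst.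
have := bfun_laplace0 (bfun_wEx fP mm bh).
move=> /(_ _)/wrap[l l0|/(_ (\1_B) (bmf_indic R mB))].
  rewrite (_ : (fun w => _) = (fun w => expR (- l * pos (m w)) * \1_D (X w) - expR (- l * pos (m w)) * pD)); last first.
    by apply/funext => w; ring.
  rewrite (ExB fP); [|by apply: bmfM => //; exact: bE|by apply: bmfM; [exact: bE|exact: bmf_cst]].
  by rewrite tilt_indep// (ExZr fP _ (bE l0)) lap// subrr.
have bB : bmf (fun w => (\1_B (pos (m w)) : R)).
  apply: bmf_comp (bmf_indic R mB) _; exact: (mcomp (@mpos R) mm).
rewrite (_ : (fun w => _) = (fun w => \1_B (pos (m w)) * \1_D (X w) - \1_B (pos (m w)) * pD)); last first.
  by apply/funext => w; ring.
rewrite (ExB fP); [|exact: bmfM|by apply: bmfM => //; exact: bmf_cst].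
rewrite (ExZr fP _ bB) => /eqP; rewrite subr_eq0 => /eqP e.
have mA : measurable ((fun w => pos (m w)) @^-1` B).
  exact: measurable_preim (mcomp (@mpos R) mm) _.
have mC : measurable (X @^-1` D) by exact: measurable_preim (mfPT X) _.
rewrite !prob_Ex//; last exact: measurableI.
rewrite -EFinM; congr _%:E.
rewrite (_ : \1_(_ `&` _) = (fun w => \1_B (pos (m w)) * \1_D (X w))).
  by rewrite e; congr (_ * _); apply: eq_Ex => w; rewrite !indicE.
by apply/funext => w; rewrite !indicE in_setI -natrM mulnb.
Qed.

Lemma mix_mean n (s : wseq R n) (u : R) : all rge0 s -> tst (ef s) -> 0 < u ->
  Emx P (fun w => Emx P (fun w' => MG (ef s) (ipscale (u * pos (m w)) (X w')))) *
    hat s alpha (rho / u) = (rho `^ a * u `^ (- a)) *: N s (rho / u).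
Proof.
move=> s0 hs u0; have := joint s0 hs (lexx 0) u0; rewrite addr0 => <-.
congr (_ * _); apply/matrixP => i j; rewrite !mxE.
have [C gC] := tst_good hs.
pose F (x : R * I) := MG (ef s) (ipscale (u * x.1) x.2) i j.
have bF : bmf F.
  apply: bmf_comp (@bmf_MG R alpha n _ C gC (tst_mmeas hs) i j) _.
  have m1 : mfT (fun x : R * I => u * x.1) by apply: mfM => //; exact: measurable_fst.
  exact: mipscale m1 measurable_snd.
have := @independent2_Ex _ _ _ P _ _ R I (fun w => pos (m w)) X F (mcomp (@mpos R) mm) (mfPT X) mass_indep bF.
rewrite /F /= => e.
transitivity (Ex P (fun w => MG (ef s) (ipscale (u * pos (m w)) (X w)) i j)).
  by rewrite e; apply: eq_Ex => w; rewrite mxE.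
apply: ae_eq_Ex.
- have mV : mfT (fun w => ipscale (u * pos (m w)) (X w)).
    apply: mipscale => //; apply: mfM => //. exact: (mcomp (@mpos R) mm).
  exact: (bmm_MG hs mV i j).1.
- under eq_fun do rewrite oppr0 mul0r expR0 scale1r. exact: (bmm_MG hs (mscaled u) i j).1.
- by apply: filterS m0 => w w0; rewrite oppr0 mul0r expR0 scale1r pos_id// ltW.
Qed.

End independence_of_mass.

(** * Lipschitz dependence of the mean functional on the mass *)

Section scaling_regularity.
Context (R : realType) (n : nat).
Local Notation M := 'M[R]_n.+1.
Implicit Types (G : R -> M) (b : set (R * R)).

Lemma MG_scale_cvg C G m b (c : R) i j : 0 <= c -> good C G -> G 0 = 1 -> is_ip_of m b ->
  mprod (fun x => G (c * x)) (bigb b k) i j @[k --> \oo] --> MG G (ip_scale c b) i j.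
Proof.
rewrite le_eqVlt => /predU1P[<-|c0] gG G0 hb.
  rewrite /ip_scale ltxx (MG_set0 gG). rewrite (_ : (fun k => _) = (fun=> (1 : M) i j)); first exact: cvg_cst.
  by apply/funext => k; rewrite /mprod big1// => U _; rewrite mul0r.
have [C0 sG G1] := gG.
rewrite (MG_scale c0 gG hb); apply: (@MG_cvg _ _ (C * c) _ m); last exact: blocks_of_ip.
split=> [|x x0|x x0]; first by rewrite mulr_ge0// ltW.
  by apply: sG; rewrite mulr_ge0// ltW.
by rewrite -mulrA; apply: G1; rewrite mulr_ge0// ltW.
Qed.

Lemma MG_scale_lip G : tst G -> exists2 C : R, 0 <= C & forall (z z' m : R) b, 0 <= z -> 0 <= z' ->
  is_ip_of m b -> nrm (MG G (ip_scale z b) - MG G (ip_scale z' b)) <= C * m * `|z - z'|.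
Proof.
move=> hG; have [_ G0 sG] := hG; have [C C0 hC] := tst_lip hG.
have gG := lip_good hG C0 hC.
exists (Kn R n * C); first by rewrite mulr_ge0// Kn_ge0.
move=> z z' m b z0 z'0 hb; have B := blocks_of_ip hb.
have mxB (A A' : M) i j : (A - A') i j = A i j - A' i j by rewrite !mxE.
have h : nrm (mprod (fun x => G (z * x)) (bigb b k) - mprod (fun x => G (z' * x)) (bigb b k)) @[k --> \oo] -->
    nrm (MG G (ip_scale z b) - MG G (ip_scale z' b)).
  apply: nrm_cvg => i j; rewrite mxB; under eq_fun do rewrite mxB.
  have h1 := MG_scale_cvg (i := i) (j := j) z0 gG G0 hb. have h2 := MG_scale_cvg (i := i) (j := j) z'0 gG G0 hb.
  exact: (cvgB h1 h2).
rewrite -(cvg_lim (@Rhausdorff R) h); apply: limr_le; first exact: cvgP h.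
apply: nearW => k; have cb := chain_bigb k B.
have b0 U : U \in bigb b k -> 0 < block_len U by move=> Ub; apply: (block_len_ge0 B); exact: cb.2.
apply: (le_trans (nrm_prodB _ _)).
- by move=> U Ub; apply: sG; rewrite mulr_ge0// ltW// b0.
- by move=> U Ub; apply: sG; rewrite mulr_ge0// ltW// b0.
have -> : Kn R n * C * m * `|z - z'| = Kn R n * (C * `|z - z'| * m) by ring.
apply: (ler_wpM2l (Kn_ge0 R n)).
apply: (@le_trans _ _ (\sum_(U <- bigb b k) C * `|z - z'| * block_len U)).
  rewrite big_seq [leRHS]big_seq; apply: ler_sum => U Ub; have l0 := ltW (b0 _ Ub).
  apply: (le_trans (hC _ _ (mulr_ge0 z0 l0) (mulr_ge0 z'0 l0))). by rewrite -mulrBl normrM (ger0_norm l0) mulrA.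
rewrite -mulr_sumr; apply: ler_wpM2l; first by rewrite mulr_ge0.
by have [_ _ h1 _] := B; exact: h1.
Qed.

End scaling_regularity.

Lemma lip_continuous (R : realType) (f : R -> R) (C : R) : (forall x y, `|f x - f y| <= C * `|x - y|) -> continuous f.
Proof.
move=> h x; apply/cvgrPdist_le => e e0.
have D0 : 0 < `|C| + 1 by rewrite ltr_wpDl.
apply/nbhs_ballP; exists (e / (`|C| + 1)) => /=; first exact: divr_gt0.
move=> y /=; rewrite /ball /= => xy; apply: (le_trans (h x y)).
apply: (@le_trans _ _ ((`|C| + 1) * `|x - y|)).
  by apply: ler_wpM2r => //; rewrite (le_trans (ler_norm C))// lerDl.
by rewrite mulrC -ler_pdivlMr// ltW.
Qed.

Lemma pos_lip (R : realType) (x y : R) : `|pos x - pos y| <= `|x - y|.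
Proof.
wlog xy : x y / x <= y => [h|].
  by have [/h//|/ltW/h] := leP x y; rewrite distrC [leRHS]distrC.
rewrite distrC [leRHS]distrC /pos; case: (leP x 0) => x0; case: (leP y 0) => y0 //.
- by rewrite subrr normr0.
- by rewrite subr0 !ger0_norm ?(ltW y0)// ?subr_ge0// lerBrDl -lerBrDr subrr.
- by move: (lt_le_trans x0 xy); rewrite ltNge y0.
Qed.

Lemma Ex_ae_le d (T : mtype d) (R : realType) (P : prob T R) (f : T -> R) (c : R) :
  bmf f -> 0 <= c -> {ae P, forall w, `|f w| <= c} -> `|Ex P f| <= c.
Proof.
move=> bf c0 h; pose g w := Num.max (- c) (Num.min c (f w)).
have mg : mfT g by apply: measurable_maxr => //; apply: measurable_minr => //; exact: bf.1.
have gc w : `|g w| <= c.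
  rewrite ler_norml /g le_max lexx /= ge_max ge_min lexx /= andbT. by rewrite (le_trans _ c0)// oppr_le0.
rewrite (ae_eq_Ex (g := g) bf.1 mg); last first.
  apply: filterS h => w; rewrite ler_norml => /andP[h1 h2]. by rewrite /g (min_idPr h2) (max_idPr h1).
have bg : bmf g by split=> //; exists c.
have bc : bmf (fun _ : T => c) by exact: bmf_cst.
by have := le_norm_Ex (Pfin P) bg bc gc; rewrite Ex_cst1.
Qed.

(** The mean functional at deterministic mass z, if nu is carried by partitions of mass 1. *)
HB.lock Definition Phi (R : realType) (alpha : R) (n : nat) (nu : prob (ipspace alpha) R)
  (G : R -> 'M[R]_n.+1) (z : R) : 'M[R]_n.+1 := Emx nu (fun b => MG G (ipscale z b)).

Section mean_of_scaled.
Context (R : realType) (alpha : R) (n : nat).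
Local Notation I := (ipspace alpha).
Local Notation M := 'M[R]_n.+1.

Variables (nu : prob I R) (G : R -> M).
Hypotheses (hG : tst G) (nu1 : {ae nu, forall b : I, ip_mass b = 1}).

Lemma bmm_MG d (Om : mtype d) (V : Om -> I) : mfT V -> bmm (fun w => MG G (V w)).
Proof.
move=> mV i j; have [C gC] := tst_good hG.
exact: bmf_comp (@bmf_MG R alpha n _ C gC (tst_mmeas hG) i j) mV.
Qed.

Lemma bmm_MG_scale z : bmm (fun b : I => MG G (ipscale z b)).
Proof. by apply: bmm_MG; apply: mipscale => //; exact: measurable_id. Qed.

Lemma PhiE z i j : Phi nu G z i j = Ex nu (fun b : I => MG G (ipscale z b) i j).
Proof. by rewrite unlock mxE. Qed.

Lemma Phi_lip : exists2 C : R, 0 <= C & forall z z' i j, 0 <= z -> 0 <= z' ->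
  `|Phi nu G z i j - Phi nu G z' i j| <= C * `|z - z'|.
Proof.
have [C C0 h] := MG_scale_lip hG; exists C => // z z' i j z0 z'0.
have bz x := bmm_MG_scale x i j.
rewrite (PhiE z) (PhiE z') -(ExB (Pfin nu) (bz z) (bz z')).
apply: Ex_ae_le; [exact: bmfB|by rewrite mulr_ge0|].
apply: filterS nu1 => b m1.
have := h z z' 1 b z0 z'0; rewrite mulr1 => /(_ _)/wrap[|h1].
  by rewrite -m1; exact: is_ip_mass (ip_blocksP b).
have mxB (A A' : M) : (A - A') i j = A i j - A' i j by rewrite !mxE.
by apply: le_trans h1; rewrite -mxB; exact: nrm_entry.
Qed.

Lemma Phi_substoch z i j : 0 <= Phi nu G z i j <= 1.
Proof.
have [C gC] := tst_good hG.
have h (b : I) := substoch_entry i j (substoch_MG gC (ip_blocks_of (ip_blocksP (ipscale z b)))).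
rewrite PhiE; apply/andP; split; first by apply: Ex_ge0 => b; case/andP: (h b).
rewrite -[leRHS](Ex_cst1 nu); apply: (le_Ex (Pfin nu)); [exact: bmm_MG_scale|exact: bmf_cst|].
by move=> b; case/andP: (h b).
Qed.

Lemma bmf_Phi i j : bmf (fun z => Phi nu G (pos z) i j).
Proof.
have [C C0 h] := Phi_lip; apply: bmf01 => [|z]; last exact: Phi_substoch.
apply: continuous_measurable_fun; apply: (@lip_continuous _ _ C) => x y.
apply: (le_trans (h _ _ i j (pos_ge0 x) (pos_ge0 y))); apply: ler_wpM2l => //; exact: pos_lip.
Qed.

Lemma Phi0 : Phi nu G 0 = 1.
Proof.
have [C gC] := tst_good hG; apply/matrixP => i j; rewrite PhiE -[RHS](Ex_cst1 nu); congr Ex.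
by apply/funext => b; rewrite /ipscale /= /ip_scale ltxx (MG_set0 gC).
Qed.

End mean_of_scaled.

(** * Poisson-Dirichlet partitions at Gamma mass *)

Section poisson_dirichlet_mean.
Context (R : realType) (alpha : R).
Hypothesis a01 : 0 < alpha < 1.
Local Notation I := (ipspace alpha).

Definition PDIP (c : bool) (nu : set I -> \bar R) := if c then PDIP_alpha_alpha nu else PDIP_alpha_0 nu.

(** Collects what later arguments take from the killed subordinator: a normalised partition X, a
    Gamma mass m and their joint functional. *)
Lemma PDIP_rep c (nu : prob I R) : PDIP c nu ->
  exists d (Om : mtype d) (P : prob Om R) (X : {mfun Om >-> I}) (m : Om -> R) (rho : R),
  [/\ mfT m, {ae P, forall w, 0 < m w}, 0 < rho, forall D, measurable D -> nu D = P (X @^-1` D) &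
  [/\ {ae P, forall w, ip_mass (X w) = 1}, forall n (s : wseq R n) (l u : R),
        all rge0 s -> tst (ef s) -> 0 <= l -> 0 < u ->
        Emx P (fun w => expR (- l * pos (m w)) *: MG (ef s) (ipscale (u * m w) (X w))) * hat s alpha ((rho + l) / u) =
        (rho `^ shape alpha c * u `^ (- shape alpha c)) *: numer alpha c s ((rho + l) / u),
      forall n (s : wseq R n) r, all rge0 s -> tst (ef s) -> 0 < r -> hat s alpha r \is a GRing.unit &
      forall l, 0 <= l -> Lap P m l = (rho / (rho + l)) `^ shape alpha c]].
Proof.
move=> h.
have {h} : exists d (Om : mtype d) (P : prob Om R) Y Z, killed_subordinator alpha P Y Z /\
    has_law P (fun w => ip_normalize (kblocks c (Y ^~ w) (Z w))) nu by case: c h.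
move=> [d [Om [P [Y [Z [[sY mZ [rho rho0 hZ] i] [X [hX hnu]]]]]]]].
have [m mm hm] := kb_version a01 sY mZ rho0 hZ i c.
exists d, Om, P, X, m, rho; split=> //; first by apply: filterS hm => w [].
split.
- apply: filterS2 hX hm => w e [hw m0]; rewrite e /ip_normalize (ip_massE hw).
  rewrite (ip_massE (is_ip_of_scale _ hw)) ?invr_gt0// mulVf//; exact: lt0r_neq0.
- by move=> n s l u; exact: (joint_mean a01 sY mZ rho0 hZ i hX mm hm).
- by move=> n s r; exact: (hat_unit a01 sY mZ rho0 hZ i).
- by move=> l; exact: (Ex_laplace a01 sY mZ rho0 hZ i hX mm hm).
Qed.

Variables (c : bool) (nu : prob I R).
Hypothesis hnu : PDIP c nu.

Lemma PDIP_mass : {ae nu, forall b : I, ip_mass b = 1}.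
Proof.
have [d [Om [P [X [m [rho [_ _ _ h [[N [mN N0 hN]] _ _ _]]]]]]]] := PDIP_rep hnu.
have mA : measurable [set b : I | ip_mass b != 1].
  rewrite (_ : mkset _ = ~` ((fun b : I => ip_mass b) @^-1` [set 1])).
    apply: measurableC; rewrite -[X in measurable X]setTI. exact: (@measurable_ip_mass R alpha measurableT).
  by apply/seteqP; split=> b /=; [move/eqP|move=> ?; apply/eqP].
exists [set b : I | ip_mass b != 1]; split=> //; last by move=> b /= /eqP.
rewrite h//; apply: (subset_measure0 _ mN _ N0).
  exact: measurable_preim (mfPT X) _.
by apply: subset_trans hN => w /= /eqP.
Qed.

Lemma PDIP_hat_unit n (s : wseq R n) r : all rge0 s -> tst (ef s) -> 0 < r -> hat s alpha r \is a GRing.unit.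
Proof.
have [d [Om [P [X [m [rho [_ _ _ _ [_ _ h _]]]]]]]] := PDIP_rep hnu; exact: h.
Qed.

(** The Gamma variable of rate 1 is the rescaled mass of the killed subordinator, so it need not be
    constructed from a density. *)
Lemma PDIP_gamma : exists d (Om : mtype d) (P : prob Om R) (m : Om -> R), [/\ mfT m, {ae P, forall w, 0 < m w} &
    forall l, 0 <= l -> Lap P m l = (1 / (1 + l)) `^ shape alpha c].
Proof.
have [d [Om [P [X [m [rho [mm m0 rho0 _ [_ _ _ h]]]]]]]] := PDIP_rep hnu.
exists d, Om, P, (fun w => rho * m w); split; first exact: mfM.
  by apply: filterS m0 => w; exact: mulr_gt0.
move=> l l0; have rl : 0 < rho + rho * l by rewrite ltr_wpDr// mulr_ge0// ltW.
have l1 : 0 < 1 + l by rewrite ltr_wpDr.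
rewrite (_ : 1 / (1 + l) = rho / (rho + rho * l)); last first.
  by field; rewrite !gt_eqF.
rewrite -h ?mulr_ge0 ?(ltW rho0)//; apply: ae_eq_Ex.
- by apply: (mcomp (bmf_exppos l0).1); exact: mfM.
- by apply: (mcomp (bmf_exppos (mulr_ge0 (ltW rho0) l0)).1).
- by apply: filterS m0 => w w0; rewrite !pos_id ?mulr_ge0 ?ltW//; congr expR; ring.
Qed.

(** [mix_mean] concerns the mass m of one representation; scaled by [rho / r] it has the Laplace
    transform of B, hence gives the same mean to [Phi]. *)
Lemma gamma_mean n (s : wseq R n) d (Om : mtype d) (P : prob Om R) (B : Om -> R) (r : R) :
  all rge0 s -> tst (ef s) -> 0 < r -> mfT B -> (forall l, 0 <= l -> Lap P B l = (r / (r + l)) `^ shape alpha c) ->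
  Emx P (fun w => Phi nu (ef s) (pos (B w))) * hat s alpha r = r `^ shape alpha c *: numer alpha c s r.
Proof.
move=> s0 hs r0 mB lapB.
have [d' [Om' [P' [X [m [rho [mm m0 rho0 hX [X1 joint hu lap]]]]]]]] := PDIP_rep hnu.
have u0 : 0 < rho / r by exact: divr_gt0.
have := mix_mean mm m0 rho0 X1 joint hu lap s0 hs u0.
have -> : rho / (rho / r) = r by field; rewrite !gt_eqF.
have -> : rho `^ shape alpha c * (rho / r) `^ (- shape alpha c) = r `^ shape alpha c.
  rewrite powRM ?invr_ge0 ?(ltW r0) ?(ltW rho0)// mulrA -powRD ?subrr ?powRr0 ?mul1r; last first.
    by rewrite (gt_eqF rho0) implybT.
  by rewrite -(powR_inv1 (ltW r0)) -powRrM mulN1r opprK.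
move=> <-; congr (_ * _); apply/matrixP => i j; rewrite mxE [RHS]mxE.
have PhE z : Emx P' (fun w' => MG (ef s) (ipscale z (X w'))) i j = Phi nu (ef s) z i j.
  rewrite PhiE mxE (Ex_pushforward (mu := P') (X := X))//; first exact: Pfin. exact: bmm_MG_scale.
transitivity (Ex P' (fun w => Phi nu (ef s) (pos (rho / r * m w)) i j)); last first.
  apply: ae_eq_Ex.
  - by apply: (mcomp (bmf_Phi hs PDIP_mass i j).1); exact: mfM.
  - under eq_fun do rewrite PhE. have e : (fun w => Phi nu (ef s) (rho / r * pos (m w)) i j) =
        (fun w => Phi nu (ef s) (pos (rho / r * pos (m w))) i j).
      by apply/funext => w; rewrite [in RHS]pos_id// mulr_ge0 ?pos_ge0// ltW.
    rewrite e; apply: (mcomp (bmf_Phi hs PDIP_mass i j).1). by apply: mfM; [exact: mcst|exact: (mcomp (@mpos R) mm)].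
  - apply: filterS m0 => w w0; rewrite PhE (pos_id (ltW w0)) pos_id//. by rewrite mulr_ge0 ?(ltW w0)// ltW.
have posK (x : R) : pos (pos x) = pos x by rewrite [LHS]pos_id// pos_ge0.
have mp d1 (T1 : mtype d1) (V : T1 -> R) : mfT V -> mfT (fun w => pos (V w)) by exact: (mcomp (@mpos R)).
have mM : mfT (fun w => rho / r * m w) by exact: mfM.
have := laplace_Ex (Pfin P) (Pfin P') (mp _ _ _ mB) (mp _ _ _ mM) _ _ _ (bmf_Phi hs PDIP_mass i j).
have eK T1 (V : T1 -> R) : (fun w => Phi nu (ef s) (pos (pos (V w))) i j) =
    (fun w => Phi nu (ef s) (pos (V w)) i j) by apply/funext => w; rewrite posK.
rewrite (eK _ B) (eK _ (fun w => rho / r * m w)); apply.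
- by apply: aeW => w; exact: pos_ge0.
- by apply: aeW => w; exact: pos_ge0.
move=> l l0; rewrite lapB//.
have rl : 0 < r + l by rewrite ltr_wpDr.
have l'0 : 0 <= l * (rho / r) by rewrite mulr_ge0// ltW.
have e : r / (r + l) = rho / (rho + l * (rho / r)).
  have -> : rho + l * (rho / r) = rho / r * (r + l) by field; rewrite gt_eqF. by field; rewrite !gt_eqF.
rewrite e -lap//; apply: ae_eq_Ex.
- exact: (mcomp (bmf_exppos l'0).1 mm).
- exact: (mcomp (bmf_exppos l0).1 mM).
- apply: filterS m0 => w w0; rewrite (pos_id (ltW w0)) pos_id; last first.
    by rewrite mulr_ge0 ?(ltW w0)// ltW.
  by congr expR; ring.
Qed.

End poisson_dirichlet_mean.

(** * Laplace transform of the Gamma density *)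

Section gamma_laplace.
Context (R : realType).
Local Notation mu := (@lebesgue_measure R).

Lemma lebesgue_integral_scale (c : R) (f : R -> \bar R) : 0 < c -> mfT f ->
  (forall x, (0 <= f x)%E) -> (\int[mu]_x f x = c%:E * \int[mu]_x f (c * x)%R)%E.
Proof.
move=> c0 mf f0.
have mc : mfT (fun x : measurableTypeR R => c * x : measurableTypeR R).
  exact: mfM.
pose k : {nonneg R} := NngNum (ltW c0).
pose nu : {measure set (measurableTypeR R) -> \bar R} := 
  mscale k (measure_function_pushforward__canonical__measure_function_Measure mu mc).
have E A : measurable A -> mu A = nu A.
  apply: lebesgue_measure_unique => _ [[a b] /= _ <-]. rewrite /nu /mscale /= /pushforward.
  rewrite (_ : _ @^-1` _ = `]a / c, b / c]%classic); last first.
    by apply/seteqP; split=> x /=; rewrite !in_itv /= ltr_pdivrMr// ler_pdivlMr// (mulrC x).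
  rewrite !lebesgue_measure_itv /= !lte_fin ltr_pM2r ?invr_gt0//. case: ifP => _; last by rewrite mule0.
  by rewrite -!EFinB -EFinM; congr _%:E; field; rewrite gt_eqF.
rewrite (eq_measure_integral nu); last by move=> A mA _; exact: E.
rewrite ge0_integral_mscale//; congr (_ * _)%E.
by rewrite ge0_integral_pushforward//= preimage_setT.
Qed.

(** Multiplying the density by [exp(- l x)] is the same, up to a power of c, as rescaling it by
    [c = (r + l) / r]. That the density integrates to 1 is taken from its being the law of B. *)
Lemma gamma_laplace (a r : R) d (Om : mtype d) (P : prob Om R) (B : Om -> R) (l : R) :
  0 < r -> gamma_rv a r P B -> 0 <= l -> Lap P B l = (r / (r + l)) `^ a.
Proof.
move=> r0 [mB hB] l0.
have G0 : 0 <= Gamma_fun a by apply: Rintegral_ge0 => t _; rewrite mulr_ge0 ?powR_ge0 ?expR_ge0.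
pose p (x : R) : R := (0 < x)%R%:R * gamma_pdf a r x.
have p0 x : 0 <= p x by rewrite /p mulr_ge0 ?ler0n// /gamma_pdf !mulr_ge0 ?powR_ge0 ?expR_ge0 ?invr_ge0.
have m1 : mfT (fun x : R => (0 < x)%R%:R : R).
  rewrite (_ : (fun x => _) = \1_(`]0, +oo[%classic)); last first.
    by apply/funext => x; rewrite indicE mem_setE in_itv/= andbT.
  by apply: measurable_indic; exact: measurable_itv.
have mp : mfT p.
  apply: mfM => //; rewrite /gamma_pdf; apply: mfM => //.
  apply: mfM; first by apply: mfM => //; exact: measurable_powR. by apply: mexpR; exact: mfM.
have hp A : measurable A -> P (B @^-1` A) = (\int[mu]_(x in A) (p x)%:E)%E.
  move=> mA; rewrite hB// [in RHS]integral_mkcond [in LHS]integral_mkcond.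
  apply: eq_integral => x _; rewrite !patchE in_setI; case: (x \in A) => //=.
  by rewrite mem_setE in_itv/= andbT /p; case: (0 < x)%R; rewrite ?mul1r ?mul0r.
have ip : mu.-integrable setT (EFin \o p).
  apply/integrableP; split; first exact/mEFin. have := hp setT measurableT; rewrite preimage_setT PsetT => e.
  by under eq_integral do rewrite /= ger0_norm//; rewrite -e ltry.
have -> : Lap P B l = \int[mu]_x (expR (- l * pos x) * p x).
  apply: (@Ex_density _ _ _ leb p) (bmf_exppos l0) => //. exact: Pfin.
pose c := (r + l) / r.
have rl : 0 < r + l by rewrite ltr_wpDr.
have c0 : 0 < c by exact: divr_gt0.
have pE x : expR (- l * pos x) * p x = c `^ (1 - a) * p (c * x).
  rewrite /p pmulr_rgt0//; case: (ltP 0 x) => x0; last by rewrite !mul0r !mulr0.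
  rewrite !mul1r pos_id ?(ltW x0)// /gamma_pdf powRM ?(ltW x0) ?(ltW c0)//.
  have e1 : c `^ (1 - a) * c `^ (a - 1) = 1 by rewrite -powRD ?(gt_eqF c0) ?implybT// subrKA subrr powRr0.
  have -> : expR (- r * (c * x)) = expR (- l * x) * expR (- r * x).
    by rewrite -expRD; congr expR; rewrite /c; field; rewrite gt_eqF.
  move: e1; set u := c `^ _; set v := c `^ _ => e1. by rewrite -[LHS]mul1r -e1; ring.
have h1 : (\int[mu]_x (p x)%:E = 1%E)%E by rewrite -hp// preimage_setT PsetT.
have h2 := lebesgue_integral_scale c0 (proj2 (mEFin _ _) mp) (fun x => p0 x : (0 <= (p x)%:E)%E).
rewrite /Rintegral.
have -> : (\int[mu]_x (expR (- l * pos x) * p x)%:E = (c `^ (1 - a))%:E * \int[mu]_x (p (c * x))%:E)%E.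
  have mpc : mfT (fun x => (p (c * x))%:E).
    by apply/mEFin; apply: (mcomp mp); exact: mfM.
  have pc0 x : setT x -> (0 <= (p (c * x))%:E)%E by rewrite lee_fin.
  have k0 : (0 <= (c `^ (1 - a))%:E :> \bar R)%E by rewrite lee_fin powR_ge0.
  rewrite -(ge0_integralZl mu measurableT mpc pc0 k0). by apply: eq_integral => x _; rewrite pE EFinM.
have : (\int[mu]_x (p (c * x))%:E = (c^-1)%:E)%E.
  have : (c%:E * \int[mu]_x (p (c * x))%:E = 1)%E by rewrite -h2 h1.
  by move=> /(congr1 (fun z => (c^-1)%:E * z)%E); rewrite muleA -EFinM mulVf ?gt_eqF// mul1e mule1.
move=> -> /=; rewrite -(powR_inv1 (ltW c0)) -powRD ?(gt_eqF c0) ?implybT//.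
rewrite (_ : r / (r + l) = c^-1); last by rewrite invf_div.
by rewrite -(powR_inv1 (ltW c0)) -powRrM; congr powR; ring.
Qed.

End gamma_laplace.

Lemma Ex_mixture (R : realType) d' (U : mtype d') (nu : prob U R) (q : R) (u0 : U)
    d (Om : mtype d) (P : prob Om R) (X : {mfun Om >-> U}) :
  (forall D, measurable D -> nu D = (q%:E * \d_u0 D + (1 - q)%:E * distribution P X D)%E) ->
  forall f, bmf f -> Ex nu f = q * f u0 + (1 - q) * Ex P (fun w => f (X w)).
Proof.
move=> h f bf; have fP := Pfin P.
have b0 := bfunctionalB (bfun_Ex (Pfin nu) (@measurable_id _ U setT)) (bfun_wEx fP (mcst u0) (bmf_cst _ q)).
have E g : bmf g -> Ex P (fun w => (1 - q) * g (X w)) = (1 - q) * Ex P (fun w => g (X w)).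
  by move=> bg; rewrite (ExZ fP)//; exact: bmf_comp bg _.
have := bfun_eq b0 (bfun_wEx fP (mfPT X) (bmf_cst _ (1 - q))) _ bf.
move=> /(_ _)/wrap[A mA|]; last by rewrite (Ex_cst1 P (q * f u0)) E// => /eqP; rewrite subr_eq addrC => /eqP.
rewrite (Ex_cst1 P (q * \1_A u0)) E; last exact: bmf_indic.
have := h A mA; rewrite prob_Ex// /distribution /pushforward prob_Ex; last first.
  exact: measurable_preim (mfPT X) _.
rewrite diracE indicE -!EFinM -EFinD => -[->].
rewrite (_ : \1_(X @^-1` A) = (fun w => \1_A (X w))); first by ring.
by apply/funext => w; rewrite !indicE.
Qed.

(** * The law replacing a single block *)

Section mu_law.
Context (R : realType) (alpha : R).
Hypothesis a01 : 0 < alpha < 1.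
Local Notation I := (ipspace alpha).

(** The mean functional at Gamma mass of rate r; see [gamma_mean_W]. *)
Definition W (c : bool) n (s : wseq R n) (r : R) : 'M[R]_n.+1 :=
  (r `^ shape alpha c *: numer alpha c s r) * (hat s alpha r)^-1.

(** The test function into which the kernel with [r = 1/(2y)] turns [ef s]. The new exponent
    [r p / (r + p)] is the one of the Laplace transform of BESQ(0) at time y; the coefficient
    absorbs the mean of the Poisson-Dirichlet part. *)
Definition ks n (s : wseq R n) (r : R) : wseq R n :=
  [seq (r * p.1 / (r + p.1), ((r + p.1) / r) `^ alpha *: (p.2 * W true s r)) | p <- s].

Context (n : nat) (s : wseq R n) (r : R).
Hypotheses (s0 : all rge0 s) (hs : tst (ef s)) (r0 : 0 < r).

Lemma gamma_mean_W c (nu : prob I R) d (Om : mtype d) (P : prob Om R) (B : Om -> R) : PDIP c nu -> mfT B ->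
  (forall l, 0 <= l -> Lap P B l = (r / (r + l)) `^ shape alpha c) ->
  Emx P (fun w => Phi nu (ef s) (pos (B w))) = W c s r.
Proof.
move=> hnu mB hB; have u := PDIP_hat_unit a01 hnu s0 hs r0.
by rewrite /W -(gamma_mean a01 hnu s0 hs r0 mB hB) mulrK.
Qed.

Lemma mean_scaled_indep (nu : prob I R) d (Om : mtype d) (P : prob Om R)
    (B : Om -> R) (X : {mfun Om >-> I}) : mfT B ->
  (forall D, measurable D -> nu D = distribution P X D) -> independent2 P (sigma_rv B) (sigma_rv X) ->
  Emx P (fun w => MG (ef s) (ipscale (B w) (X w))) = Emx P (fun w => Phi nu (ef s) (pos (B w))).
Proof.
move=> mB hX i; apply/matrixP => j k; rewrite mxE [RHS]mxE.
have [C gC] := tst_good hs.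
pose F (x : R * I) := MG (ef s) (ipscale x.1 x.2) j k.
have bF : bmf F.
  apply: bmf_comp (@bmf_MG R alpha n _ C gC (tst_mmeas hs) j k) _. exact: mipscale measurable_fst measurable_snd.
rewrite (independent2_Ex mB (mfPT X) i bF); apply: eq_Ex => w.
rewrite PhiE (Ex_pushforward (Pfin P) (mfPT X) hX); last exact: bmm_MG_scale.
apply: eq_Ex => w'; rewrite /F /=; congr (MG _ _ _ _).
rewrite /ipscale /= /pos; case: (leP (B w) 0) => // b0.
by rewrite /ip_scale ltxx ltNge b0.
Qed.

Lemma ef_ksE x : hat s alpha r \is a GRing.unit -> ef (ks s r) x =
  (\sum_(p <- s) (((r + p.1) / r) `^ alpha * expR (- (r * p.1 / (r + p.1)) * x)) *: p.2) * W true s r.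
Proof.
move=> u; rewrite /ef /ks big_map mulr_suml; apply: eq_bigr => p _ /=.
by rewrite scalerA -[in RHS]scalerAl [in LHS]mulrC.
Qed.

Lemma ks_one : hat s alpha r \is a GRing.unit -> (\sum_(p <- s) ((r + p.1) / r) `^ alpha *: p.2) * W true s r = 1.
Proof.
move=> u; have e : \sum_(p <- s) ((r + p.1) / r) `^ alpha *: p.2 = r `^ (- alpha) *: hat s alpha r.
  rewrite /hat scaler_sumr; apply: eq_big_seq => p ps; rewrite scalerA.
  congr (_ *: _); have p0 : 0 <= p.1 by move/allP: s0 => /(_ _ ps).
  rewrite powRM ?invr_ge0 ?(ltW r0) ?addr_ge0 ?(ltW r0)// mulrC; congr (_ * _).
  by rewrite -(powR_inv1 (ltW r0)) -powRrM mulN1r.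
rewrite e /W /= -scalerAl mulrA -scalerAr mulr1 -scalerAl mulrV// scalerA -powRD.
  by rewrite addNr powRr0 scale1r.
by rewrite (gt_eqF r0) implybT.
Qed.

Lemma mu_mean x (nu : prob I R) : 0 < x -> mu_law x r nu -> Emx nu (fun b : I => MG (ef s) b) = ef (ks s r) x.
Proof.
move=> x0 [d [Om [P [L [B [G [rho [hL hB hG i3 [[X [hX hrho]] hnu]]]]]]]]].
have [mL L0 lapL] := hL; have [mB _] := hB; have [C gC] := tst_good hs.
have fP := Pfin P.
have hu := PDIP_hat_unit a01 (hG : PDIP true (distribution P G)) s0 hs r0.
have mV : mfT (fun w => ipscale (B w) (G w)) by exact: mipscale mB _.
have bF2 := bmm_MG hs mV.
have bF1 : bmm (fun w => ef s (L w)) by apply: bmm_G => // w; exact: ltW.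
have mX := mfPT X.
have E1 : Emx P (fun w => MG (ef s) (X w)) = Emx P (fun w => ef s (L w) * MG (ef s) (ipscale (B w) (G w))).
  apply: Emx_ae; [exact: (bmm_MG hs mX)|exact: bmmM|].
  apply: filterS hX => w ->; rewrite (MG_cat gC (is_ip_single (L0 w))); last first.
    exact: is_ip_scale (ip_blocksP (G w)).
  by rewrite (MG_single (L0 w) gC).
have i23 : independent2 P (sigma_rv B) (sigma_rv G).
  exact: independent3_23 (sigma_rvT L) i3.
have i1 : independent2 P (sigma_rv L) (sigma_rv (fun w => (B w, G w))).
  apply: independent2_sym; apply: independent3_pair => // A1 A2 A3 h1 h2 h3.
  rewrite setIC setIA i3//; rewrite -muleA muleC -muleA//.
have E2 : Emx P (fun w => ef s (L w) * MG (ef s) (ipscale (B w) (G w))) = Emx P (fun w => ef s (L w)) * W true s r.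
  rewrite (Emx_indepM (A := sigma_rv L) (B := sigma_rv (fun w => (B w, G w)))) //.
  - congr (_ * _). rewrite (mean_scaled_indep (nu := distribution P G) mB)//.
    by apply: (gamma_mean_W (c := true)) => // l l0; exact: gamma_laplace hB l0.
  - apply: independent2_gen => //; [exact: sigma_rvI|exact: msrv|]. by apply: msrv; exact: mpair.
  - move=> i j; apply/mfun_inP => _ [A mA <-]; apply: sub_sa. exists ((fun x => ef s x i j) @^-1` A) => //.
    exact: measurable_preim (tst_mmeas hs _ _) _.
  - move=> i j _ [A mA <-]. exists ((fun x : R * I => MG (ef s) (ipscale x.1 x.2) i j) @^-1` A) => //.
    rewrite -[X in measurable X]setTI. have mF : mfT (fun x : R * I => ipscale x.1 x.2).
      exact: mipscale measurable_fst measurable_snd.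
    exact: (bmm_MG hs mF i j).1.
have ex0 : 0 < expR (x * r) - 1 by rewrite subr_gt0 expR_gt1 mulr_gt0.
have E3 : Emx P (fun w => ef s (L w)) = \sum_(p <- s) (((r + p.1) / r) `^ alpha *
    ((expR (x * r ^+ 2 / (r + p.1)) - 1) / (expR (x * r) - 1))) *: p.2.
  rewrite /ef. apply/matrixP => i j; rewrite mxE summxE.
  rewrite (_ : (fun w => _) = (fun w => \sum_(p <- s) (if 0 <= p.1 then expR (- p.1 * L w) else 0) * p.2 i j)); last first.
    apply/funext => w; rewrite summxE; apply: eq_big_seq => p ps. by rewrite mxE (allP s0 _ ps).
  have bp (p : R * 'M[R]_n.+1) : bmf (fun w => if 0 <= p.1 then expR (- p.1 * L w) else 0).
    have [p0|_] := boolP (0 <= p.1); last exact: bmf_cst. apply: bmf01 => [|w].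
      by apply: mexpR; exact: mfM.
    by rewrite expR_ge0 expR_le_1// mulNr oppr_le0 mulr_ge0// ltW.
  rewrite (Ex_sum fP); last by move=> p; apply: bmfM; [exact: bp|exact: bmf_cst].
  apply: eq_big_seq => p ps; rewrite (ExZr fP); last exact: bp. have p0 := allP s0 _ ps; rewrite mxE; congr (_ * _).
  have := lapL p.1 p0; rewrite unlock; have := bp p; rewrite p0 => bp'. by rewrite -(ExE fP bp') => -[].
apply/matrixP => i j; rewrite mxE.
rewrite (Ex_mixture (P := P) (X := X) (q := expR (- x * r)) (u0 := ip_empty alpha)); last first.
- exact: (@bmf_MG R alpha n _ C gC (tst_mmeas hs) i j).
- by move=> D mD; rewrite hnu// hrho.
rewrite (MG_set0 gC).
have -> : Ex P (fun w => MG (ef s) (X w) i j) = Emx P (fun w => MG (ef s) (X w)) i j by rewrite mxE.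
(* The factor [(1 - exp(- x r)) / (exp(x r) - 1)] equals [exp(- x r)], and by [ks_one] the
   contribution of the empty partition cancels the terms - 1 in the transform of L; a pure
   exponential sum in x remains. *)
have E4 : expR (- x * r) *: 1 + (1 - expR (- x * r)) *: (Emx P (fun w => ef s (L w)) * W true s r) = ef (ks s r) x.
  rewrite E3 ef_ksE// -[X in _ *: X + _](ks_one hu) !scalerAl -mulrDl; congr (_ * _).
  rewrite !scaler_sumr -big_split /=; apply: eq_big_seq => p ps.
  have rp : 0 < r + p.1 by rewrite ltr_wpDr// (allP s0 _ ps). rewrite !scalerA -scalerDl; congr (_ *: _).
  have -> : expR (x * r ^+ 2 / (r + p.1)) = expR (x * r) * expR (- (r * p.1 / (r + p.1)) * x).
    by rewrite -expRD; congr expR; field; rewrite gt_eqF.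
  rewrite mulNr expRN; field; rewrite (gt_eqF ex0) gt_eqF//; exact: expR_gt0.
by rewrite E1 E2 -E4 [RHS]mxE [X in _ = X + _]mxE [X in _ = _ + X]mxE.
Qed.

End mu_law.

(** * Concatenation of a summable family *)

Section concatenation.
Context (R : realType).
Variables (m : R) (b : set (R * R)) (g : R * R -> set (R * R)).
Hypotheses (hb : is_ip_of m b) (gi : forall U, is_ip (g U)).
Let f U := (ip_mass (g U))%:E.
Hypothesis fin : (\esum_(U in b) f U < +oo)%E.
Let B := blocks_of_ip hb.

Let f0 (U : R * R) : (0 <= f U)%E.
Proof. by rewrite lee_fin ip_mass_ge0. Qed.

Definition total : R := fine (\esum_(U in b) f U).

Local Notation sh := (ip_concat_shift b g).

Let esum_sub (A A' : set (R * R)) : A `<=` A' -> (\esum_(U in A) f U <= \esum_(U in A') f U)%E.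
Proof.
move=> AA'; rewrite [leRHS](esumID A)//; have /setIidPr -> := AA'.
by rewrite leeDl// esum_ge0.
Qed.

Let esum_fin (A : set (R * R)) : A `<=` b -> \esum_(U in A) f U \is a fin_num.
Proof.
move=> Ab; rewrite ge0_fin_numE ?esum_ge0//; exact: le_lt_trans (esum_sub Ab) fin.
Qed.

Let fine_step (A A' : set (R * R)) U : A `<=` A' -> A' `<=` b -> A' U -> ~ A U ->
  fine (\esum_(V in A) f V) + ip_mass (g U) <= fine (\esum_(V in A') f V).
Proof.
move=> AA' A'b A'U AU; have Ab : A `<=` b by exact: subset_trans AA' A'b.
rewrite -lee_fin EFinD !fineK ?esum_fin// [leRHS](esumID A)//; have /setIidPr -> := AA'.
rewrite leeD2l// -[X in (X <= _)%E]/(f U) -[X in (X <= _)%E](esum_set1 (t := U))//.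
by apply: esum_sub => V ->.
Qed.

Lemma shift_ge0 U : 0 <= sh U.
Proof. by apply: fine_ge0; apply: esum_ge0 => V _; exact: f0. Qed.

Lemma shift_le U V : b U -> b V -> U.1 < V.1 -> sh U + ip_mass (g U) <= sh V.
Proof.
move=> bU bV UV; apply: fine_step => //=.
- by move=> W [bW WU]; split=> //; exact: lt_trans UV.
- by move=> W [].
- by move=> [_]; rewrite ltxx.
Qed.

Lemma shift_total U : b U -> sh U + ip_mass (g U) <= total.
Proof.
by move=> bU; apply: fine_step => //= [W []|[_]]//; rewrite ltxx.
Qed.

Lemma sum_total s : chain b s -> \sum_(U <- s) ip_mass (g U) <= total.
Proof.
move=> cs; have us := chain_uniq cs; rewrite -lee_fin fineK ?esum_fin// -sumEFin.
apply: esum_ge; exists [set` s]; first by split; [exact: finite_seq|exact: cs.2].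
by rewrite fsbig_seq.
Qed.

Lemma near_total (e : R) : 0 < e -> exists2 s, chain b s & total - e < \sum_(U <- s) ip_mass (g U).
Proof.
move=> e0; have [_ inj _ _] := B.
have := ub_ereal_sup_adherent e0 (esum_fin (@subset_refl _ b)).
move=> [_ [A [fA Ab] <-]] h.
exists (sort (fun U V => U.1 <= V.1) (enum_fset (fset_set A))).
  apply: sort_chain => // [|U]; first exact: fset_uniq. by rewrite in_fset_set// inE; exact: Ab.
rewrite -lte_fin -sumEFin EFinB fineK ?esum_fin//; apply: lt_le_trans h _.
by rewrite fsbig_finite// le_eqVlt (perm_big _ (permEl (perm_sort _ _))) eqxx.
Qed.

Lemma total_cvg : \sum_(U <- bigb b k) ip_mass (g U) @[k --> \oo] --> total.
Proof.
apply/cvgrPdist_lt => e e0; have [s cs hs] := near_total e0.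
have := chain_in_big B cs; apply: filterS => k sk.
have ck := chain_bigb k B; have h := sum_total ck.
rewrite ger0_norm ?subr_ge0// ltrBlDr addrC -ltrBlDr; apply: (lt_le_trans hs).
rewrite (chain_subE cs ck sk) big_filter [leRHS](bigID (mem s))/= lerDl.
by apply: sumr_ge0 => U _; rewrite ip_mass_ge0.
Qed.

Definition glue (t : R * R -> seq (R * R)) (s : seq (R * R)) := flatten [seq map (shift (sh U)) (t U) | U <- s].

Lemma glue_chain t s : chain b s -> (forall U, U \in s -> chain (g U) (t U)) -> chain (ip_concat b g) (glue t s).
Proof.
elim: s => [|U s IH] [ss sb] ht; first by split.
have bU : b U by apply: sb; rewrite mem_head.
have sb' V : V \in s -> b V by move=> Vs; apply: sb; rewrite inE Vs orbT.
have [|V Vs|so hb'] := IH.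
- by split=> //; exact: path_sorted ss.
- by apply: ht; rewrite inE Vs orbT.
have [tU tUb] := ht U (mem_head _ _).
have Us V : V \in s -> U.1 < V.1.
  move: ss; rewrite /= path_sortedE; last exact: ltb_trans. by move=> /andP[/allP h _] /h.
split; last first.
  move=> V; rewrite /glue /= mem_cat => /orP[/mapP[W Wt ->]|/hb'//]. by exists U => //; exists W => //; exact: tUb.
rewrite (sorted_pairwise ltb_trans) /glue /= pairwise_cat -!(sorted_pairwise ltb_trans).
apply/and3P; split=> //.
- apply/allrelP => _ V /mapP[W Wt ->] /flattenP[_ /mapP[U' U's ->] /mapP[W' Wt' ->]]. rewrite /ltb /shift /=.
  have [_ hW _] := ipo_mass (gi U); have [W0 W12 W2] := hW _ (tUb _ Wt). have [_ hW' _] := ipo_mass (gi U').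
  have [W'0 _ _] := hW' _ ((ht U' (mem_behead (s := U :: s) U's)).2 _ Wt').
  apply: (@lt_le_trans _ _ (sh U + ip_mass (g U))).
    by rewrite ltrD2l; exact: lt_le_trans W12 W2.
  by apply: (le_trans (shift_le bU (sb' _ U's) (Us _ U's))); rewrite lerDl.
- rewrite sorted_map; apply: sub_sorted tU => V W. by rewrite /ltb /relpre /shift /= ltrD2l.
Qed.

Lemma tl_glue t s : tl (glue t s) = \sum_(U <- s) tl (t U).
Proof.
rewrite /glue; elim: s => [|U s IH]; first by rewrite big_nil /tl big_nil.
by rewrite big_cons -IH /= tl_cat tl_shift.
Qed.

Lemma mprod_glue n (G : R -> 'M[R]_n.+1) t s : mprod G (glue t s) = \prod_(U <- s) mprod G (t U).
Proof.
rewrite /glue; elim: s => [|U s IH]; first by rewrite big_nil /mprod big_nil.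
by rewrite big_cons -IH /= mprod_cat mprod_shift.
Qed.

Let bigc U k : chain (g U) (bigb (g U) k).
Proof. by apply: chain_bigb; apply: ip_blocks_of. Qed.

Let tl_big_cvg s : \sum_(U <- s) tl (bigb (g U) k) @[k --> \oo] --> \sum_(U <- s) ip_mass (g U).
Proof.
apply: cvg_big => [|U _]; first exact: add_continuous.
by apply: cvg_tl_big; exact: ip_blocks_of.
Qed.

Lemma is_ip_of_concat : is_ip_of total (ip_concat b g).
Proof.
apply/is_ip_ofP; split; last first.
  move=> e e0; have e2 : 0 < e / 2 by rewrite divr_gt0. have [s cs hs] := near_total e2.
  have := @tl_big_cvg s => /cvgrPdist_lt/(_ _ e2)[k _ /(_ k (leqnn k)) /= hk].
  exists (glue (fun U => bigb (g U) k) s); first by apply: glue_chain.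
  rewrite tl_glue; move: hk; rewrite ltr_norml => /andP[_ hk]; lra.
have bb U V : b U -> g U V -> [/\ 0 <= V.1, V.1 < V.2 & V.2 <= ip_mass (g U)].
  by move=> bU gV; have [_ h _] := ipo_mass (gi U); exact: h.
split.
- by apply: fine_ge0; apply: esum_ge0.
- move=> _ [U bU [V gV <-]] /=; have [V0 V12 V2] := bb U V bU gV.
  split; [by rewrite addr_ge0// shift_ge0|by rewrite ltrD2l|]. by apply: le_trans (shift_total bU); rewrite lerD2l.
have ord U V W W' : b U -> b V -> g U W -> g V W' -> U.1 < V.1 -> sh U + W.2 <= sh V + W'.1.
  move=> bU bV gW gW' UV; have [_ _ W2] := bb U W bU gW; have [W'0 _ _] := bb V W' bV gW'.
  apply: (@le_trans _ _ (sh U + ip_mass (g U))); first by rewrite lerD2l.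
  by apply: (le_trans (shift_le bU bV UV)); rewrite lerDl.
move=> _ _ [U bU [W gW <-]] [V bV [W' gW' <-]] [x []].
rewrite /block_itv /= !in_itv /= => /andP[x1 x2] /andP[x3 x4].
have [UV|VU|UV] := ltgtP U.1 V.1.
- by have := lt_trans x3 (lt_le_trans x2 (ord _ _ _ _ bU bV gW gW' UV)); rewrite ltxx.
- by have := lt_trans x1 (lt_le_trans x4 (ord _ _ _ _ bV bU gW' gW VU)); rewrite ltxx.
have [_ inj _ _] := B; have e := inj _ _ bU bV UV; subst V.
have [_ _ tr] := ipo_mass (gi U); rewrite (tr W W' gW gW')//.
exists (x - sh U); rewrite /block_itv /= !in_itv /=; split.
  by rewrite ltrBrDl x1 ltrBlDl.
by rewrite ltrBrDl x3 ltrBlDl.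
Qed.

(** With s fixed, the constituents are exhausted by chains; the length missed in the concatenation
    then tends to that of the constituents outside s. *)
Lemma MG_concat_le n (G : R -> 'M[R]_n.+1) C s : good C G -> chain b s ->
  nrm (MG G (ip_concat b g) - \prod_(U <- s) MG G (g U)) <= Kn R n * C * (total - \sum_(U <- s) ip_mass (g U)).
Proof.
move=> gG cs; have BC := blocks_of_ip is_ip_of_concat.
pose F k := mprod G (glue (fun U => bigb (g U) k) s).
have mxB (A A' : 'M[R]_n.+1) i j : (A - A') i j = A i j - A' i j by rewrite !mxE.
have h1 : nrm (MG G (ip_concat b g) - F k) @[k --> \oo] --> nrm (MG G (ip_concat b g) - \prod_(U <- s) MG G (g U)).
  apply: nrm_cvg => i j; rewrite mxB; under eq_fun do rewrite mxB. apply: cvgB; first exact: cvg_cst.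
  rewrite /F; under eq_fun do rewrite mprod_glue.
  by apply: mx_prod_cvg => U _ i' j'; exact: (MG_cvg gG (ip_blocks_of (gi U))).
have h2 : Kn R n * C * (total - \sum_(U <- s) tl (bigb (g U) k)) @[k --> \oo] -->
    Kn R n * C * (total - \sum_(U <- s) ip_mass (g U)).
  by apply: cvgM; [exact: cvg_cst|apply: cvgB; [exact: cvg_cst|exact: tl_big_cvg]].
apply: (ler_cvg_to h1 h2); apply: nearW => k; rewrite -tl_glue.
by apply: MG_approx => //; exact: glue_chain.
Qed.

Lemma MG_concat_cvg n (G : R -> 'M[R]_n.+1) C i j : good C G ->
  (\prod_(U <- bigb b k) MG G (g U)) i j @[k --> \oo] --> MG G (ip_concat b g) i j.
Proof.
move=> gG; apply/cvgrPdist_le => e e0.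
have : Kn R n * C * (total - \sum_(U <- bigb b k) ip_mass (g U)) @[k --> \oo] --> Kn R n * C * (total - total).
  by apply: cvgM; [exact: cvg_cst|apply: cvgB; [exact: cvg_cst|exact: total_cvg]].
rewrite (subrr total) mulr0 => h.
move/cvgrPdist_le/(_ _ e0): h; apply: filterS => k hk.
rewrite sub0r normrN in hk; apply: le_trans hk; apply: le_trans (ler_norm _).
apply: le_trans (MG_concat_le gG (chain_bigb k B)).
have mxB (A A' : 'M[R]_n.+1) : (A - A') i j = A i j - A' i j by rewrite !mxE.
by rewrite -mxB; exact: nrm_entry.
Qed.

End concatenation.

(** * Product functionals of independent families *)

Section family.
Context d (Om : mtype d) (R : realType) (P : prob Om R) (alpha : R).
Local Notation I := (ipspace alpha).
Variables (b : set (R * R)) (G : R * R -> {mfun Om >-> I}).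
Hypothesis iG : independent_family P b (fun U => sigma_rv (G U)).

(** An intersection-stable class for the joint information of the members in l; independence of one
    further member is verified on it and then extended. *)
Definition cylinders (l : seq (R * R)) : set (set Om) :=
  [set A | exists2 A_ : R * R -> set Om, forall V, V \in l -> sigma_rv (G V) (A_ V) &
    A = \bigcap_(V in [set` l]) A_ V].

Let sG (U : R * R) : sigma_rv (G U) `<=` measurable.
Proof. by apply: msrv; exact: mfPT. Qed.

Lemma cylinders_measurable l : cylinders l `<=` measurable.
Proof.
move=> _ [A hA ->]; apply: fin_bigcap_measurable; first exact: finite_seq.
by move=> V /hA; exact: sG.
Qed.

Lemma cylindersI l : setI_closed (cylinders l).
Proof.
move=> _ _ [A hA ->] [A' hA' ->]; exists (fun V => A V `&` A' V); last by rewrite bigcapI.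
by move=> V Vl; apply: sigma_rvI; [exact: hA|exact: hA'].
Qed.

Lemma cylinders_indep l U : uniq (rcons l U) -> (forall V, V \in rcons l U -> b V) ->
  independent2 P (cylinders l) (sigma_rv (G U)).
Proof.
move=> ul lb _ C [A hA ->] hC; have := ul; rewrite rcons_uniq => /andP[Ul ul'].
pose A' V := if V == U then C else A V.
have A'E V : V \in l -> A' V = A V by move=> Vl; rewrite /A'; case: eqP => // VU; rewrite -VU Vl in Ul.
have h1 : P (\bigcap_(V in [set` rcons l U]) A' V) = (\prod_(V <- rcons l U) P (A' V))%E.
  apply: iG => // V Vl; split; first exact: lb.
  move: Vl; rewrite mem_rcons inE /A'; case: eqP => [->//|_ /= Vl]; exact: hA.
have h2 : P (\bigcap_(V in [set` l]) A V) = (\prod_(V <- l) P (A V))%E.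
  by apply: iG => // V Vl; split; [apply: lb; rewrite mem_rcons inE Vl orbT|exact: hA].
rewrite h2; transitivity (P (\bigcap_(V in [set` rcons l U]) A' V)).
  congr (P _); apply/seteqP; split=> w.
    move=> [h wC] V /=; rewrite mem_rcons inE => /orP[/eqP ->|Vl]; first by rewrite /A' eqxx.
    by rewrite A'E//; exact: h.
  move=> h; split; last by have := h U; rewrite /= mem_rcons inE eqxx /A' eqxx; exact.
  by move=> V Vl; rewrite -A'E//; apply: h; rewrite /= mem_rcons inE Vl orbT.
rewrite h1 -cats1 big_cat big_seq1 /A' eqxx; congr (_ * _)%E.
by apply: eq_big_seq => V Vl; rewrite -/(A' V) A'E.
Qed.

Context (n : nat) (s : wseq R n).
Hypothesis hs : tst (ef s).

Let M (U : R * R) w := MG (ef s) (G U w).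

Let mM i j : mfT (fun b' : I => MG (ef s) b' i j).
Proof.
have [C gC] := tst_good hs; have h := @bmf_MG R alpha n _ C gC (tst_mmeas hs) i j; exact: h.1.
Qed.

Lemma sigma_M U i j : sigma_rv (fun w => M U w i j) `<=` sigma_rv (G U).
Proof.
move=> _ [A mA <-]; exists ((fun b : I => MG (ef s) b i j) @^-1` A) => //.
exact: measurable_preim (mM i j) mA.
Qed.

Lemma mmeas_family (A : set (set Om)) (l : seq (R * R)) : (forall U, U \in l -> sigma_rv (G U) `<=` <<s A >>) ->
  @mmeas _ (gsalg A) R n (fun w => \prod_(U <- l) M U w).
Proof.
elim: l => [|U l IH] h.
  by under [X in mmeas X]eq_fun do rewrite big_nil; exact: mmeas_cst.
under [X in mmeas X]eq_fun do rewrite big_cons.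
apply: mmeasM; last by apply: IH => V Vl; apply: h; rewrite inE Vl orbT.
move=> i j; apply/mfun_inP; apply: subset_trans (@sigma_M U i j) _.
by apply: h; rewrite mem_head.
Qed.

Lemma family_substoch (l : seq (R * R)) w : substoch (\prod_(U <- l) M U w).
Proof.
apply: substoch_prod => U _; have [C gC] := tst_good hs.
exact: substoch_MG gC (ip_blocks_of (ip_blocksP (G U w))).
Qed.

Lemma bmm_family (l : seq (R * R)) : bmm (fun w => \prod_(U <- l) M U w).
Proof.
move=> i j; apply: bmf01 => [|w]; last exact: substoch_entry (family_substoch l w).
apply: (@mfun_inM _ _ (@measurable _ Om)) => //.
apply: mmeas_family => U _; apply: subset_trans (@sG U) _; exact: sub_sa.
Qed.

Lemma family_mean (l : seq (R * R)) : uniq l -> (forall V, V \in l -> b V) ->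
  Emx P (fun w => \prod_(U <- l) M U w) = \prod_(U <- l) Emx P (M U).
Proof.
elim/last_ind: l => [|l U IH] ul lb.
  rewrite big_nil; apply/matrixP => i j; rewrite mxE -[RHS](Ex_cst1 P); congr Ex.
  by apply/funext => w; rewrite big_nil.
have := ul; rewrite rcons_uniq => /andP[Ul ul'].
rewrite -cats1 big_cat big_seq1 -IH//; last by move=> V Vl; apply: lb; rewrite mem_rcons inE Vl orbT.
rewrite (_ : Emx P _ = Emx P (fun w => (\prod_(V <- l) M V w) * M U w)); last first.
  by congr Emx; apply/funext => w; rewrite big_cat big_seq1.
apply: (Emx_indepM (A := cylinders l) (B := sigma_rv (G U))).
- apply: independent2_gen; [exact: cylindersI|exact: cylinders_measurable|exact: sG|]. exact: cylinders_indep.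
- exact: bmm_family.
- exact: (bmm_MG hs (mfPT (G U))).
- apply: mmeas_family => V Vl A hA; apply: sub_sa. exists (fun W => if W == V then A else setT).
    by move=> W _; case: eqP => [->//|_]; exact: sigma_rvT.
  apply/seteqP; split=> w; first by move=> Aw W _; case: eqP. by move=> /(_ V Vl); rewrite eqxx.
- exact: sigma_M.
Qed.

End family.

(** * Transition kernels acting on product functionals *)

Section kappa_mean.
Context (R : realType) (alpha : R).
Hypothesis a01 : 0 < alpha < 1.
Local Notation I := (ipspace alpha).

Lemma substoch_Emx d (Om : mtype d) (P : prob Om R) n (F : Om -> 'M[R]_n.+1) :
  bmm F -> (forall w, substoch (F w)) -> substoch (Emx P F).
Proof.
move=> bF sF; split=> [i j|i]; first by rewrite mxE; apply: Ex_ge0 => w; have [] := sF w.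
under eq_bigr do rewrite mxE.
rewrite -(Ex_sum (Pfin P)); last by move=> j; exact: bF.
rewrite -[leRHS](Ex_cst1 P); apply: (le_Ex (Pfin P)); [|exact: bmf_cst|].
  by apply: bmf_sum => j; exact: bF.
by move=> w; have [] := sF w.
Qed.

Let alpha0 : 0 < alpha. Proof. by case/andP: a01. Qed.

Definition single (x : R) (x0 : 0 < x) : I :=
  IPSpace (ex_intro _ x (is_ip_single x0)) (has_diversity_single alpha0 x0).

Definition kappa (c : bool) : R -> I -> (set I -> \bar R) -> Prop := if c then @kappa0 R alpha else @kappa1 R alpha.

Lemma kappa_family_of c y (b : I) nu : 0 < y -> kappa c y b nu ->
  exists d (Om : mtype d) (P : prob Om R) (G : R * R -> {mfun Om >-> I}), kappa_family y b P G.
Proof.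
move=> y0; case: c; rewrite /kappa /kappa0 /kappa1 (gt_eqF y0).
  by move=> [d [Om [P [G [B [G0 [[h _] _ _ _ _]]]]]]]; exists d, Om, P, G.
by move=> [d [Om [P [G [h _ _]]]]]; exists d, Om, P, G.
Qed.

Section at_time.
Variables (c : bool) (y : R) (K : I -> prob I R).
Hypotheses (y0 : 0 < y) (hK : forall b, kappa c y b (K b)).
Let r := (2 * y)^-1.

Let r0 : 0 < r. Proof. by rewrite invr_gt0 mulr_gt0. Qed.

(** Existence is read off the kernel started from a single block of length x. *)
Lemma mu_law_ex (x : R) : 0 < x -> exists nu : prob I R, mu_law x r nu.
Proof.
move=> x0; have [d [Om [P [G [h _]]]]] := kappa_family_of y0 (hK (single x0)).
have := h (0, x) erefl; rewrite /block_len /= subr0 => h'; exists (distribution P (G (0, x))).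
exact: h'.
Qed.

Context (n : nat) (s : wseq R n).
Hypotheses (s0 : all rge0 s) (hs : tst (ef s)).

Lemma kappa_hat_unit rho : 0 < rho -> hat s alpha rho \is a GRing.unit.
Proof.
have [nu [d [Om [P [L [B [G [_ [_ _ hG _ _]]]]]]]]] := mu_law_ex ltr01.
exact: (PDIP_hat_unit a01 (hG : PDIP true (distribution P G)) s0 hs).
Qed.

Lemma ks_ge0 : all rge0 (ks alpha s r).
Proof.
rewrite all_map; apply: sub_all s0 => p p0 /=.
by rewrite divr_ge0 ?mulr_ge0 ?addr_ge0// ltW.
Qed.

(** Substochasticity cannot be seen from the coefficients: for x > 0 the matrix is by [mu_mean] a
    mean of substochastic matrices. *)
Lemma tst_ks : tst (ef (ks alpha s r)).
Proof.
split; first by exists (ks alpha s r) => //; exact: ks_ge0.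
  rewrite ef_ksE ?kappa_hat_unit// -[RHS](ks_one s0 r0 (kappa_hat_unit r0)).
  by congr (_ * _); apply: eq_bigr => p _; rewrite mulr0 expR0 mulr1.
move=> x; rewrite le_eqVlt => /predU1P[<-|x0].
  rewrite ef_ksE ?kappa_hat_unit//. rewrite (_ : _ * _ = 1); first exact: substoch1.
  rewrite -[RHS](ks_one s0 r0 (kappa_hat_unit r0)).
  by congr (_ * _); apply: eq_bigr => p _; rewrite mulr0 expR0 mulr1.
have [nu hnu] := mu_law_ex x0; rewrite -(mu_mean a01 s0 hs r0 x0 hnu).
have [C gC] := tst_good hs.
apply: substoch_Emx; first exact: (bmm_MG hs (@measurable_id _ I setT)).
by move=> b; exact: substoch_MG gC (ip_blocks_of (ip_blocksP b)).
Qed.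

Section concat_mean.
Context d (Om : mtype d) (P : prob Om R) (b : I) (G : R * R -> {mfun Om >-> I}).
Hypotheses (hG : kappa_family y b P G) (fG : {ae P, forall w, summable_family b (fun U => G U) w}).

Lemma concat_prod_mean k : Emx P (fun w => \prod_(U <- bigb b k) MG (ef s) (G U w)) =
  mprod (ef (ks alpha s r)) (bigb b k).
Proof.
have [hmu iG] := hG; have B := ip_blocks_of (ip_blocksP b).
have cb := chain_bigb k B.
rewrite (family_mean iG hs (chain_uniq cb) cb.2) /mprod big_seq [RHS]big_seq.
apply: eq_bigr => U Ub; have bU := cb.2 _ Ub.
have h := mu_mean a01 s0 hs r0 (block_len_ge0 B bU) (hmu U bU).
rewrite -h; apply/matrixP => i j; rewrite mxE [RHS]mxE; symmetry.
have [C gC] := tst_good hs.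
by apply: Ex_pushforward; [exact: Pfin|exact: mfPT|by []|exact: (@bmf_MG R alpha n _ C gC (tst_mmeas hs) i j)].
Qed.

(** Common to both types: F is 1 for type 1 and the functional of the additional leftmost partition
    for type 0. Means are taken for finitely many constituents, and the limit follows by dominated
    convergence. *)
Lemma concat_mean (A : 'M[R]_n.+1) (F H : Om -> 'M[R]_n.+1) : bmm F -> bmm H ->
  {ae P, forall w, H w = F w * MG (ef s) (ip_concat b (fun U => G U w))} ->
  (forall k, Emx P (fun w => F w * \prod_(U <- bigb b k) MG (ef s) (G U w)) =
    A * Emx P (fun w => \prod_(U <- bigb b k) MG (ef s) (G U w))) ->
  Emx P H = A * MG (ef (ks alpha s r)) b.
Proof.
move=> bF bH hH hFk; have [C gC] := tst_good hs; have [C' gC'] := tst_good tst_ks.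
have B := ip_blocks_of (ip_blocksP b); apply/matrixP => i j.
have bp k := bmm_family G hs (bigb b k).
have bFp k := bmmM bF (bp k).
have l1 : (A * mprod (ef (ks alpha s r)) (bigb b k)) i j @[k --> \oo] --> (A * MG (ef (ks alpha s r)) b) i j.
  apply: (mxM_cvg (A := fun=> A) (B := fun k => mprod (ef (ks alpha s r)) (bigb b k))) => i' j'.
    exact: cvg_cst.
  exact: (MG_cvg gC' B).
have l2 : Emx P (fun w => F w * \prod_(U <- bigb b k) MG (ef s) (G U w)) i j @[k --> \oo] --> Emx P H i j.
  rewrite mxE; under eq_fun do rewrite mxE. have [D hD] : exists D : R, forall w i j, `|F w i j| <= D.
    have hD i' j' : exists D : R, forall w, `|F w i' j'| <= D by have [_] := bF i' j'.
    pose D i' j' := projT1 (cid (hD i' j')); exists (\sum_i' \sum_j' `|D i' j'|) => w i' j'.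
    have := projT2 (cid (hD i' j')) w; rewrite -/(D i' j') => h. apply: (le_trans h); apply: (le_trans (ler_norm _)).
    rewrite (bigD1 i')//= (bigD1 j')//= -addrA lerDl addr_ge0//; first exact: sumr_ge0.
    by apply: sumr_ge0 => l _; exact: sumr_ge0.
  apply: (@Ex_cvg_ae _ _ _ P (Pfin P) _ _ (\sum_(l < n.+1) D)).
  - by move=> k; exact: (bFp k i j).1.
  - exact: bH.
  - move=> k w; rewrite mxE; apply: (le_trans (ler_norm_sum _ _ _)); apply: ler_sum => l _.
    rewrite normrM -[leRHS]mulr1; apply: ler_pM => //.
    have /andP[h0 h1] := substoch_entry l j (family_substoch G hs (bigb b k) w). by rewrite ger0_norm.
  - apply: filterS2 hH fG => w -> fw. apply: (mxM_cvg (A := fun=> F w)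
        (B := fun k => \prod_(U <- bigb b k) MG (ef s) (G U w))) => i' j'.
      exact: cvg_cst.
    exact: (MG_concat_cvg (i := i') (j := j') (is_ip_mass (ip_blocksP b)) (fun U => ip_blocksP (G U w)) fw gC).
have e : (fun k => (A * mprod (ef (ks alpha s r)) (bigb b k)) i j) =
    (fun k => Emx P (fun w => F w * \prod_(U <- bigb b k) MG (ef s) (G U w)) i j).
  by apply/funext => k; rewrite hFk concat_prod_mean.
rewrite e in l1; apply: (cvg_unique _ l2 l1); exact: Rhausdorff.
Qed.

End concat_mean.

Lemma kappa_mean b : Emx (K b) (fun b' : I => MG (ef s) b') =
  (if c then W alpha true s r else 1) * MG (ef (ks alpha s r)) b.
Proof.
have [C gC] := tst_good hs.
have toX d (Om : mtype d) (P : prob Om R) (X : {mfun Om >-> I}) :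
    (forall D, measurable D -> K b D = distribution P X D) ->
    Emx (K b) (fun b' : I => MG (ef s) b') = Emx P (fun w => MG (ef s) (X w)).
  move=> h; apply/matrixP => i j; rewrite mxE [RHS]mxE.
  by apply: Ex_pushforward; [exact: Pfin|exact: mfPT|by []|exact: (@bmf_MG R alpha n _ C gC (tst_mmeas hs) i j)].
have := hK b; case: (c); rewrite /kappa /kappa0 /kappa1 (gt_eqF y0); last first.
  move=> [d [Om [P [G [hG fG [X [hX hnu]]]]]]]; rewrite (toX _ _ _ _ hnu).
  apply: (concat_mean hG fG (F := fun=> 1)); [exact: bmm_cst|exact: (bmm_MG hs (mfPT X))| |].
    by apply: filterS hX => w ->; rewrite mul1r.
  by move=> k; rewrite mul1r; congr Emx; apply/funext => w; rewrite mul1r.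
move=> [d [Om [P [G [B [G0 [[hG fG] hB hG0 i3 [X [hX hnu]]]]]]]]]; rewrite (toX _ _ _ _ hnu).
have [mB _] := hB.
have mV : mfT (fun w => ipscale (B w) (G0 w)) by exact: mipscale mB _.
have bF := bmm_MG hs mV.
have SP : sigma_process (ip_blocks b) G setT.
  exact: (@measurableT _ (gsalg (\bigcup_(U in ip_blocks b) sigma_rv (G U)))).
have SM : sigma_process (ip_blocks b) G `<=` measurable.
  apply: smallest_sub; first exact: sigma_algebra_measurable. by move=> A [U _]; apply: msrv; exact: mfPT.
have i12 A1 A2 : sigma_rv B A1 -> sigma_rv G0 A2 -> P (A1 `&` A2) = (P A1 * P A2)%E.
  by move=> h1 h2; have := i3 _ _ _ h1 h2 SP; rewrite setIT PsetT mule1.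
apply: (concat_mean hG fG (F := fun w => MG (ef s) (ipscale (B w) (G0 w)))) => //.
- exact: (bmm_MG hs (mfPT X)).
- apply: filterS2 hX fG => w -> fw. have [m hm] := is_ip_scale (B w) (ip_blocksP (G0 w)).
  apply: (MG_cat gC hm); exists (total b (fun U => G U w)).
  exact: (is_ip_of_concat (is_ip_mass (ip_blocksP b)) (fun U => ip_blocksP (G U w)) fw).
move=> k.
pose A := [set A1 `&` A2 | A1 in sigma_rv B & A2 in sigma_rv G0].
have sBA : sigma_rv B `<=` <<s A >>.
  by move=> D hD; apply: sub_sa; exists D => //; exists setT; [exact: sigma_rvT|rewrite setIT].
have sGA : sigma_rv G0 `<=` <<s A >>.
  by move=> D hD; apply: sub_sa; exists setT; [exact: sigma_rvT|exists D => //; rewrite setTI].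
rewrite (Emx_indepM (A := A) (B := sigma_process (ip_blocks b) G)).
- congr (_ * _); rewrite (mean_scaled_indep hs (nu := distribution P G0) mB)//.
  apply: (gamma_mean_W a01 s0 hs r0 (c := true)) => // l l0; exact: gamma_laplace hB l0.
- apply: independent2_gen => //.
  + move=> _ _ [A1 h1 [A2 h2 <-]] [A1' h1' [A2' h2' <-]]; rewrite setIACA.
    by exists (A1 `&` A1'); [exact: sigma_rvI|exists (A2 `&` A2') => //; exact: sigma_rvI].
  + move=> _ [A1 h1 [A2 h2 <-]]; apply: measurableI.
      exact: (msrv mB).
    exact: (msrv (mfPT G0)).
  + by move=> _ D [A1 h1 [A2 h2 <-]] hD; rewrite i3// i12.
- exact: bF.
- exact: (bmm_family G hs).
- move=> i j. have mB' : @measurable_fun _ _ (gsalg A) R setT B by apply/mfun_inP.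
  have mG' : @measurable_fun _ _ (gsalg A) I setT G0 by apply/mfun_inP.
  have mV' : @measurable_fun _ _ (gsalg A) I setT (fun w => ipscale (B w) (G0 w)).
    exact: mipscale mB' mG'.
  exact: (mcomp (@bmf_MG R alpha n _ C gC (tst_mmeas hs) i j).1 mV').
- move=> i j. apply: (proj1 (mfun_inP (\bigcup_(U in ip_blocks b) sigma_rv (G U)) _)).
  apply: (mmeas_family hs) => U Ub; apply: subset_trans (@sub_sigma_algebra _ _ _). move=> D hD; exists U => //=.
  by apply: (chain_bigb k (ip_blocks_of (ip_blocksP b))).2.
Qed.

End at_time.
End kappa_mean.

(** * Integration against kernels and product laws *)

Section kernel_means.
Context d d' (X : mtype d) (Y : mtype d') (R : realType).
Variable K : X -> prob Y R.
Hypothesis mK : forall D, measurable D -> mfT (fun x => K x D).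

Lemma bmf_kernel (f : Y -> R) : bmf f -> bmf (fun x => Ex (K x) f).
Proof.
move=> bf; have [mf [C hC]] := bf.
have C0 y : 0 <= f y + C by have := hC y; rewrite ler_norml => /andP[+ _]; rewrite -subr_ge0 opprK.
have bC : bmf (fun y => f y + C) by apply: bmfD => //; exact: bmf_cst.
have E x : Ex (K x) f = Ex (K x) (fun y => f y + C) - C.
  by rewrite (ExD (Pfin (K x)) bf (bmf_cst _ _)) Ex_cst1 addrK.
split.
  under eq_fun do rewrite E; apply: mfB => //. apply: (mcomp (@fine_measurable R setT measurableT)).
  apply: (measurable_fun_integral_kernel (l := fun x => K x)) => //. by apply/mEFin; exact: bC.1.
exists C => x; rewrite -(Ex_cst1 (K x) C).
by apply: (le_norm_Ex (Pfin (K x)) bf (bmf_cst _ _)).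
Qed.

Lemma bfun_kernel d0 (Om : mtype d0) (P : prob Om R) (V : Om -> X) :
  mfT V -> bfun (fun f => Ex P (fun w => Ex (K (V w)) f)).
Proof.
move=> mV; have fP := Pfin P; have fK x := Pfin (K x).
have b f : bmf f -> bmf (fun w => Ex (K (V w)) f) by move=> bf; exact: bmf_comp (bmf_kernel bf) mV.
split.
- move=> f g bf bg; rewrite -(ExD fP (b _ bf) (b _ bg)); apply: eq_Ex => w. exact: (ExD (fK _) bf bg).
- move=> c f bf; rewrite -(ExZ fP _ (b _ bf)); apply: eq_Ex => w; exact: (ExZ (fK _) c bf).
- move=> f_ f C mf hC cf; have bf n : bmf (f_ n) by split=> //; exists C.
  apply: (@Ex_cvg _ _ _ P fP _ _ C); first by move=> n; exact: (b _ (bf n)).1.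
    move=> n w; rewrite -(Ex_cst1 (K (V w)) C). exact: (le_norm_Ex (fK _) (bf n) (bmf_cst _ _)).
  by move=> w; exact: (Ex_cvg (fK _) mf hC cf).
Qed.

End kernel_means.

Section product_law.
Context d d' (X : mtype d) (Y : mtype d') (R : realType).
Variables (P : prob X R) (Q : prob Y R).

(** Realises an independent pair with given laws; it serves for the two parts of a block cut in
    two. *)
Lemma product_ex : exists T : prob (X * Y)%type R, [/\ forall f, bmf f -> Ex T (fun x => f x.1) = Ex P f,
      forall f, bmf f -> Ex T (fun x => f x.2) = Ex Q f &
      forall f g, bmf f -> bmf g -> Ex T (fun x => f x.1 * g x.2) = Ex P f * Ex Q g].
Proof.
pose M : {measure set (X * Y) -> \bar R} := (P \x Q)%E.
have ME A B : measurable A -> measurable B -> M (A `*` B) = (P A * Q B)%E.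
  by move=> mA mB; exact: product_measure1E.
have MT : M setT = 1%E by rewrite -setXTT ME// !PsetT mule1.
pose T : prob (X * Y)%type R := mnormalize M (\d_(point : X * Y)).
have TE A : T A = M A by rewrite /T /= /mnormalize MT onee_eq0 /= invr1 mule1.
have T1 A : measurable A -> P A = T (fst @^-1` A).
  move=> mA; rewrite TE (_ : _ @^-1` _ = A `*` setT) ?ME// ?PsetT ?mule1//. by apply/seteqP; split=> x /= => [|[]].
have T2 A : measurable A -> Q A = T (snd @^-1` A).
  move=> mA; rewrite TE (_ : _ @^-1` _ = setT `*` A) ?ME// ?PsetT ?mul1e//. by apply/seteqP; split=> x /= => [|[]].
have fT := Pfin T.
exists T; split.
- by move=> f bf; rewrite (Ex_pushforward fT measurable_fst T1 bf).
- by move=> f bf; rewrite (Ex_pushforward fT measurable_snd T2 bf).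
move=> f g bf bg.
rewrite (Ex_pushforward fT measurable_fst T1 bf) (Ex_pushforward fT measurable_snd T2 bg).
apply: (independent2_ExM measurable_fst measurable_snd) => //.
move=> _ _ [A mA <-] [B mB <-]; by rewrite !setTI -T1// -T2// -ME// TE; congr (M _).
Qed.

End product_law.

(** * The transition of the mass and the kernel identity at fixed mass *)

Section mass_semigroup.
Context (R : realType) (alpha : R).
Hypothesis a01 : 0 < alpha < 1.
Local Notation I := (ipspace alpha).
Variables (c : bool) (y : R) (K : I -> prob I R).
Hypotheses (y0 : 0 < y) (hK : forall b, kappa c y b (K b)).
Hypothesis mK : forall D, measurable D -> mfT (fun b => K b D).
Let r := (2 * y)^-1.

Let r0 : 0 < r. Proof. by rewrite invr_gt0 mulr_gt0. Qed.

(** Encodes the scalar test function [exp(- l x)], whose product functional is [exp(- l mass)]. *)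
Definition one_s (l : R) : seq (R * 'M[R]_1) := sl l 1 (s_one R).

Let one_s0 l : 0 <= l -> all rge0 (one_s l).
Proof. by move=> l0; apply: sl_ge0 => //; exact: one_ge0. Qed.

Let tst_one_s l : 0 <= l -> tst (ef (one_s l)).
Proof. by move=> l0; apply: tst_sl => //; [exact: one_ge0|exact: tst_one]. Qed.

Let MG_one_s l (b : I) : 0 <= l -> MG (ef (one_s l)) b = expR (- l * ip_mass b) *: 1.
Proof. by move=> l0; rewrite (MG_exp l0 (is_ip_mass (ip_blocksP b))). Qed.

Let hat_one_s l : hat (one_s l) alpha r = (r + l) `^ alpha *: 1.
Proof. by rewrite /hat big_seq1 /= mulr0 addr0. Qed.

Let W_one_s l : 0 <= l -> W alpha true (one_s l) r = (r / (r + l)) `^ alpha *: 1.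
Proof.
move=> l0; have rl : 0 < r + l by rewrite ltr_wpDr.
rewrite /W /= hat_one_s invrZ ?unitr1 ?unitfE ?lt0r_neq0 ?powR_gt0// invr1.
rewrite -scalerAl mul1r scalerA powRM ?(ltW r0)//; last by rewrite invr_ge0 ltW.
by rewrite -(powR_inv1 (ltW rl)) -powRrM mulN1r powRN.
Qed.

Let ks_one_s l : 0 <= l -> ks alpha (one_s l) r = one_s (r * l / (r + l)).
Proof.
move=> l0; have rl : 0 < r + l by rewrite ltr_wpDr.
have e : ((r + l) / r) `^ alpha *: (1 * ((r / (r + l)) `^ alpha *: 1)) = 1 :> 'M[R]_1.
  rewrite mul1r scalerA -powRM.
  - by rewrite mulrA divfK ?lt0r_neq0// divff ?lt0r_neq0// powR1 scale1r.
  - by rewrite divr_ge0 ?(ltW r0) ?(ltW rl).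
  - by rewrite divr_ge0 ?(ltW r0) ?(ltW rl).
by rewrite /ks W_one_s// /one_s /sl /s_one /= !mulr0 !addr0 e.
Qed.

Lemma bmf_mass (f : R -> R) : bmf f -> bmf (fun b : I => f (ip_mass b)).
Proof. by move=> bf; apply: bmf_comp bf _; exact: measurable_ip_mass. Qed.

Let pos_mass (b : I) : pos (ip_mass b) = ip_mass b.
Proof. by rewrite pos_id// ip_mass_ge0//; exact: ip_blocksP. Qed.

Lemma bmf_expmass l : 0 <= l -> bmf (fun b : I => expR (- l * ip_mass b)).
Proof.
move=> l0; have := bmf_mass (bmf_exppos l0).
by rewrite (_ : (fun _ => _) = (fun b : I => expR (- l * ip_mass b)))//; apply/funext => b; rewrite pos_mass.
Qed.

(** [kappa_mean] for a scalar test function. The right side depends on b through its mass only and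
    is the Laplace transform of BESQ at time y started from that mass. *)
Lemma mass_laplace (b : I) l : 0 <= l -> Ex (K b) (fun b' : I => expR (- l * ip_mass b')) =
  (if c then (r / (r + l)) `^ alpha else 1) * expR (- (r * l / (r + l)) * ip_mass b).
Proof.
move=> l0; have l1 : 0 <= r * l / (r + l) by rewrite divr_ge0 ?mulr_ge0 ?addr_ge0// ltW.
have := kappa_mean a01 y0 hK (one_s0 l0) (tst_one_s l0) b.
rewrite -/r ks_one_s// MG_one_s// W_one_s//.
rewrite (_ : (fun b' : I => MG _ b') = (fun b' : I => expR (- l * ip_mass b') *: 1)); last first.
  by apply/funext => b'; rewrite MG_one_s.
rewrite expR_mean_one; last exact: bmf_expmass.
by case: (c) => e; apply: scale1_inj; rewrite e -?scalerAl mul1r ?scalerA// mul1r.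
Qed.

Let one := single a01 (ltr01 : 0 < (1 : R)).

Lemma mass_scale_one z : 0 <= z -> ip_mass (ipscale z one) = z.
Proof.
by move=> z0; rewrite (ip_mass_scale z0 (ip_blocksP one)) (ip_massE (is_ip_single ltr01)) mulr1.
Qed.

(** The transition of the mass during time y. By [mass_laplace] any initial partition of mass z
    gives the same value; a scaled unit block is taken. *)
Definition Qz (z : R) (f : R -> R) : R := Ex (K (ipscale z one)) (fun b : I => f (ip_mass b)).

Lemma measurable_scale_one d (Om : mtype d) (V : Om -> R) : mfT V -> mfT (fun w => ipscale (V w) one).
Proof. by move=> mV; apply: mipscale mV _; exact: mcst. Qed.

Lemma Qz_laplace z l : 0 <= z -> 0 <= l -> Qz z (fun x => expR (- l * pos x)) =
  (if c then (r / (r + l)) `^ alpha else 1) * expR (- (r * l / (r + l)) * z).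
Proof.
move=> z0 l0; rewrite -[in RHS](mass_scale_one z0) -mass_laplace//.
by apply: eq_Ex => b; rewrite pos_mass.
Qed.

Lemma bfun_Qz d (Om : mtype d) (P : prob Om R) (V : Om -> R) : mfT V -> bfun (fun f => Ex P (fun w => Qz (V w) f)).
Proof.
move=> mV.
have h := bfun_kernel mK P (measurable_scale_one mV).
exact: (bfun_comp (@measurable_ip_mass R alpha) h).
Qed.

(* The single block of length z + h may be cut in two: the mass at time y is then a
   sum of independent variables, the second of which vanishes with probability
   at least [expR (- h * r)]. *)
Lemma Qz_step z h (f : R -> R) (M : R) : 0 <= z -> 0 < h -> bmf f -> (forall x, `|f x| <= M) ->
  `|Qz (z + h) f - Qz z f| <= 2 * M * r * h.
Proof.
move=> z0 h0 bf fM; have M0 : 0 <= M by exact: le_trans (normr_ge0 _) (fM 0).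
have [nu hnu] := mu_law_ex a01 y0 hK h0.
have [T [T1 T2 T12]] := product_ex (K (ipscale z one)) nu.
have fT := Pfin T.
have m1 : mfT (fun x : I * I => ip_mass x.1) by apply: mcomp (@measurable_ip_mass R alpha) measurable_fst.
have m2 : mfT (fun x : I * I => ip_mass x.2) by apply: mcomp (@measurable_ip_mass R alpha) measurable_snd.
have m0 (b : I) : 0 <= ip_mass b by exact: ip_mass_ge0 (ip_blocksP b).
have E : Qz (z + h) f = Ex T (fun x : I * I => f (ip_mass x.1 + ip_mass x.2)).
  apply: (laplace_Ex (Pfin _) fT (@measurable_ip_mass R alpha) (mfD m1 m2)) => //.
  - by apply: aeW => b; exact: m0.
  - by apply: aeW => x; rewrite addr_ge0. move=> l l0; rewrite mass_laplace// mass_scale_one ?addr_ge0 ?(ltW h0)//.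
  transitivity (Ex T (fun x : I * I => expR (- l * ip_mass x.1) * expR (- l * ip_mass x.2))); last first.
    by apply: eq_Ex => x; rewrite -expRD mulrDr.
  rewrite (T12 _ _ (bmf_expmass l0) (bmf_expmass l0)) mass_laplace// mass_scale_one//.
  rewrite mulrDr expRD mulrA; congr (_ * _); apply: scale1_inj. rewrite -expR_mean_one; last exact: bmf_expmass.
  have := mu_mean a01 (one_s0 l0) (tst_one_s l0) r0 h0 hnu. rewrite -/r ks_one_s// => e.
  rewrite (_ : (fun b : I => _) = (fun b : I => MG (ef (one_s l)) b)); last first.
    by apply/funext => b'; rewrite MG_one_s.
  by rewrite e /one_s efE_sl efE_one.
have -> : Qz z f = Ex T (fun x : I * I => f (ip_mass x.1)).
  by rewrite (T1 (fun b : I => f (ip_mass b)))//; exact: bmf_mass.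
pose N := [set b : I | ip_mass b != 0].
have mN : measurable N.
  rewrite (_ : N = ~` ((fun b : I => ip_mass b) @^-1` [set 0])).
    apply: measurableC; rewrite -[X in measurable X]setTI. exact: (@measurable_ip_mass R alpha measurableT).
  by apply/seteqP; split=> b /=; [move/eqP|move=> ?; apply/eqP].
have b1 : bmf (\1_N : I -> R) by exact: bmf_indic.
have b2 : bmf (fun x : I * I => (\1_N x.2 : R)) by exact: bmf_comp b1 measurable_snd.
have b3 : bmf (fun x : I * I => f (ip_mass x.1 + ip_mass x.2)).
  exact: bmf_comp bf (mfD m1 m2).
have b4 : bmf (fun x : I * I => f (ip_mass x.1)) by exact: bmf_comp bf m1.
rewrite E -(ExB fT b3 b4).
apply: (@le_trans _ _ (Ex T (fun x : I * I => 2 * M * \1_N x.2))).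
  apply: (le_norm_Ex fT); first exact: bmfB.
    by apply: bmfM => //; exact: bmf_cst.
  move=> x; rewrite indicE; case: (boolP (x.2 \in N)) => xN.
    rewrite mulr1; apply: (le_trans (ler_normB _ _)). by rewrite mulr_natl mulr2n; apply: lerD.
  have -> : ip_mass x.2 = 0 by apply/eqP; apply: contraNT xN => h1; rewrite inE. by rewrite addr0 subrr normr0 mulr0.
rewrite (ExZ fT _ b2) (T2 _ b1) -[leRHS]mulrA; apply: ler_wpM2l; first by rewrite mulr_ge0.
have [d [Om [P [L [B [G [rho [_ _ _ _ [[X [_ hrho]] hnu']]]]]]]]] := hnu.
rewrite (Ex_mixture (P := P) (X := X) (q := expR (- h * r)) (u0 := ip_empty alpha)) //; last first.
  by move=> D mD; rewrite hnu'// hrho.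
rewrite indicE memNset ?mulr0 ?add0r; last by rewrite /N /= /ip_empty /= ip_mass_set0 eqxx.
have eh : 0 <= 1 - expR (- h * r) by rewrite subr_ge0 expR_le_1// mulNr oppr_le0 mulr_ge0// ltW.
apply: (@le_trans _ _ (1 - expR (- h * r))).
  have h1 : Ex P (fun w => (\1_N (X w) : R)) <= 1.
    rewrite -[leRHS](Ex_cst1 P). apply: (le_Ex (Pfin P)); [exact: bmf_comp b1 _|exact: bmf_cst|].
    by move=> w; rewrite indicE; case: (_ \in _); rewrite ?ler01.
  by rewrite -[leRHS]mulr1; apply: ler_wpM2l.
have := expR_ge1Dx (- h * r); rewrite mulNr (mulrC r); lra.
Qed.

Lemma Qz_lip (f : R -> R) (M : R) : bmf f -> (forall x, `|f x| <= M) ->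
  forall z z', 0 <= z -> 0 <= z' -> `|Qz z f - Qz z' f| <= 2 * M * r * `|z - z'|.
Proof.
move=> bf fM z z'; wlog zz : z z' / z <= z' => [h z0 z'0|z0 _].
  have [/h|/ltW/h] := leP z z'; first exact. by rewrite distrC (distrC z); apply.
move: zz; rewrite le_eqVlt => /predU1P[->|zz]; first by rewrite !subrr !normr0 mulr0.
have h0 : 0 < z' - z by rewrite subr_gt0.
have e : z + (z' - z) = z' by rewrite addrC subrK.
have := Qz_step z0 h0 bf fM; rewrite e => h.
by rewrite distrC (distrC z) (ger0_norm (ltW h0)).
Qed.

Variable nu : prob I R.
Hypothesis hnu : PDIP c nu.
Context (n : nat) (s : wseq R n).
Hypotheses (s0 : all rge0 s) (hs : tst (ef s)).
Local Notation M := 'M[R]_n.+1.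

Let hu rho : 0 < rho -> hat s alpha rho \is a GRing.unit.
Proof. by move=> h; exact: (PDIP_hat_unit a01 hnu s0 hs h). Qed.

Let Wr := W alpha true s r.
(** Inverse rates add: [1/rho' = 1/rho + 1/r], that is [1/rho + 2y]. *)
Let rho' (rho : R) := rho * r / (rho + r).

Let rho'0 rho : 0 < rho -> 0 < rho' rho.
Proof. by move=> h; rewrite divr_gt0 ?mulr_gt0 ?addr_gt0. Qed.

Let scA (a a' : R) (X : M) : a *: (a' *: X) = (a * a') *: X.
Proof. exact: scalerA. Qed.

Let scAl (a : R) (X X' : M) : (a *: X) * X' = a *: (X * X').
Proof. by rewrite scalerAl. Qed.

Let scAr (a : R) (X X' : M) : X * (a *: X') = a *: (X * X').
Proof. by rewrite scalerAr. Qed.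

Let Wr_unit : Wr \is a GRing.unit.
Proof.
rewrite /Wr /W /= -scalerAl mul1r scaler_unit ?unitrV ?hu//.
by rewrite unitfE lt0r_neq0// powR_gt0.
Qed.

(** The number [rho + r p / (r + p)] is [(rho + r) (rho' + p) / (r + p)], and the power of [r + p]
    cancels against the coefficient in [ks]. *)
Lemma hat_ks rho : 0 < rho ->
  hat (ks alpha s r) alpha rho = ((rho + r) / r) `^ alpha *: (hat s alpha (rho' rho) * Wr).
Proof.
move=> h; rewrite /hat big_map mulr_suml scaler_sumr big_seq [RHS]big_seq.
apply: eq_bigr => p ps /=; have p0 : 0 <= p.1 by exact: (allP s0 _ ps).
have rp : 0 < r + p.1 by rewrite ltr_wpDr.
have hr : 0 < rho + r by rewrite addr_gt0.
have n1 : 0 <= (rho + r) / r by rewrite divr_ge0 ?ltW.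
have n2 : 0 <= rho' rho + p.1 by rewrite addr_ge0// ltW// rho'0.
have n3 : 0 <= rho + r * p.1 / (r + p.1) by rewrite addr_ge0 ?divr_ge0 ?mulr_ge0// ltW.
have n4 : 0 <= (r + p.1) / r by rewrite divr_ge0 ?ltW.
rewrite scA scAl scA; congr (_ *: _); rewrite -!powRM//.
by congr (_ `^ _); rewrite /rho'; field; rewrite !gt_eqF.
Qed.

(** With exponent alpha - 1 one power of [r + p] is left over; writing it as
    [(rho' + p) + (r - rho')] produces the two terms. *)
Lemma hat_ks_pred rho : 0 < rho -> hat (ks alpha s r) (alpha - 1) rho =
  ((rho + r) `^ (alpha - 1) * (r `^ alpha)^-1) *:
  ((hat s alpha (rho' rho) + (r - rho' rho) *: hat s (alpha - 1) (rho' rho)) * Wr).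
Proof.
move=> h; rewrite /hat big_map [in RHS]scaler_sumr -big_split /= mulr_suml scaler_sumr.
apply: eq_big_seq => p ps.
have p0 : 0 <= p.1 by exact: (allP s0 _ ps).
have rp : 0 < r + p.1 by rewrite ltr_wpDr.
have hr : 0 < rho + r by rewrite addr_gt0.
have hp : 0 < rho' rho + p.1 by rewrite ltr_wpDr// rho'0.
rewrite !scA -scalerDl scAl scA; congr (_ *: _).
have -> : rho + r * p.1 / (r + p.1) = (rho + r) * ((rho' rho + p.1) / (r + p.1)).
  by rewrite /rho'; field; rewrite !gt_eqF.
have i1 : 0 <= r^-1 by rewrite invr_ge0 ltW.
have i2 : 0 <= (r + p.1)^-1 by rewrite invr_ge0 ltW.
have i3 : 0 <= (rho' rho + p.1) / (r + p.1) by rewrite divr_ge0 ?ltW.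
rewrite (powRM _ (ltW hr) i3) (powRM _ (ltW hp) i2) (powRM _ (ltW rp) i1).
have iE (x a : R) : 0 < x -> x^-1 `^ a = (x `^ a)^-1.
  by move=> x0; rewrite -(powR_inv1 (ltW x0)) -powRrM mulN1r powRN.
rewrite (iE _ _ rp) (iE _ _ r0) -(powR_pred alpha hp) -(powR_pred alpha rp).
rewrite (_ : r - rho' rho = (r + p.1) - (rho' rho + p.1)); last by ring.
have k0 : (r + p.1) `^ (alpha - 1) != 0 by rewrite lt0r_neq0// powR_gt0.
have k1 : r `^ alpha != 0 by rewrite lt0r_neq0// powR_gt0.
by field; rewrite k0 k1.
Qed.

(** For type 1, the probability that the mass has vanished by time y when its initial law is
    exponential of rate rho: the mean of [exp(- r b)] over that law. *)
Definition defect (rho : R) : R := if c then 0 else rho / (rho + r).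
Let A : M := if c then Wr else 1.

(** The factor [Wr] introduced by [ks] cancels between numerator and inverse. The right side is the
    mean functional for a mixture of mass 0 and Gamma mass of rate rho', the mixture found in
    [mix_mass]. *)
Lemma W_ks rho : 0 < rho -> A * W alpha c (ks alpha s r) rho =
  defect rho *: 1 + (1 - defect rho) *: W alpha c s (rho' rho).
Proof.
move=> h; have hr : 0 < rho + r by rewrite addr_gt0.
have H1 := hu (rho'0 h); set H' := hat s alpha (rho' rho) in H1 *.
have k1 : 0 < ((rho + r) / r) `^ alpha by apply: powR_gt0; exact: divr_gt0.
have E : (hat (ks alpha s r) alpha rho)^-1 = (((rho + r) / r) `^ alpha)^-1 *: (Wr^-1 * H'^-1).
  have uk : ((rho + r) / r) `^ alpha \is a GRing.unit by rewrite unitfE lt0r_neq0.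
  have UU : H' * Wr \is a GRing.unit by rewrite unitrMl. by rewrite hat_ks// (invrZ uk UU) (invrM H1 Wr_unit).
rewrite /A /defect /W E /numer /shape; case: (c).
  rewrite subr0 scale0r scale1r add0r !scAl !mul1r !scAr !scA. rewrite mulrA divrr// mul1r; congr (_ *: _).
  have -> : rho' rho = rho * ((rho + r) / r)^-1 by rewrite /rho'; field; rewrite !gt_eqF.
  have q0 : 0 < (rho + r) / r by rewrite divr_gt0. rewrite [RHS]powRM ?(ltW h) ?invr_ge0 ?(ltW q0)//; congr (_ * _).
  by rewrite -(powR_inv1 (ltW q0)) -powRrM mulN1r powRN.
rewrite mul1r hat_ks_pred// -/H' !powRr1 ?(ltW h) ?(ltW (rho'0 h))//.
set H2 := hat s (alpha - 1) (rho' rho).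
have cancel (X : M) : X * Wr * (Wr^-1 * H'^-1) = X * H'^-1 by rewrite mulrA mulrK.
rewrite !scAl !scAr !scA cancel (mulrDl H') (divrr H1) scAl scalerDr scA.
have -> : rho * ((rho + r) `^ (alpha - 1) * (r `^ alpha)^-1) * (((rho + r) / r) `^ alpha)^-1 = rho / (rho + r).
  rewrite powRM ?(ltW hr)//; last by rewrite invr_ge0 ltW.
  rewrite -(powR_inv1 (ltW r0)) -powRrM mulN1r powRN -(powR_pred alpha hr).
  have a0 : (rho + r) `^ (alpha - 1) != 0 by rewrite lt0r_neq0// powR_gt0.
  have a1 : r `^ alpha != 0 by rewrite lt0r_neq0// powR_gt0. by field; rewrite a0 a1 gt_eqF.
by congr (_ + _ *: _); rewrite /rho'; field; rewrite gt_eqF.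
Qed.

Lemma pos_scale (u x : R) : 0 <= u -> pos (u * x) = u * pos x.
Proof. by move=> u0; rewrite /pos maxr_pMr// mulr0. Qed.

Section gamma_variable.
Context d (Om : mtype d) (P : prob Om R) (m : Om -> R).
Hypotheses (mm : mfT m) (m0 : {ae P, forall w, 0 < m w}).
Hypothesis lap : forall l, 0 <= l -> Lap P m l = (1 / (1 + l)) `^ shape alpha c.
Let fP := Pfin P.

Let mu_ (u : R) : mfT (fun w => u * m w).
Proof. exact: mfM. Qed.

Lemma lap_scale (rho l : R) : 0 < rho -> 0 <= l ->
  Ex P (fun w => expR (- l * pos (rho^-1 * m w))) = (rho / (rho + l)) `^ shape alpha c.
Proof.
move=> h l0; have i0 : 0 <= rho^-1 by rewrite invr_ge0 ltW.
have hl : 0 < rho + l by rewrite ltr_wpDr.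
rewrite (_ : rho / (rho + l) = 1 / (1 + l * rho^-1)); last first.
  have -> : 1 + l * rho^-1 = (rho + l) / rho by field; rewrite gt_eqF. by field; rewrite !gt_eqF.
rewrite -lap ?mulr_ge0//; apply: eq_Ex => w; rewrite pos_scale//.
by congr expR; ring.
Qed.

(** The mass transition preserves Gamma laws up to an atom at 0; this is checked on Laplace
    transforms. *)
Lemma mix_mass (rho : R) (f : R -> R) : 0 < rho -> bmf f ->
  Ex P (fun w => Qz (pos (rho^-1 * m w)) (fun x => f (pos x))) =
  defect rho * f 0 + (1 - defect rho) * Ex P (fun w => f (pos ((rho' rho)^-1 * m w))).
Proof.
move=> h bf; set q := defect rho.
have mV : mfT (fun w => pos (rho^-1 * m w)).
  exact: (mcomp (@mpos R) (mu_ _)).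
have b1 := bfun_Qz P mV.
have b2 : bfun (fun f : R -> R => Ex P (fun w => q * f ((fun=> 0) w))).
  exact: (bfun_wEx fP (mcst (0 : R)) (bmf_cst _ q)).
have b3 : bfun (fun f : R -> R => Ex P (fun w => (1 - q) * f ((rho' rho)^-1 * m w))).
  exact: (bfun_wEx fP (mu_ (rho' rho)^-1) (bmf_cst _ (1 - q))).
have hr : 0 < rho + r by rewrite addr_gt0.
have b3' g : bmf g -> bmf (fun w => g ((rho' rho)^-1 * m w)) by move=> bg; exact: bmf_comp bg (mu_ _).
have := bfun_laplace (bfunctionalB b1 b2) b3.
move=> /(_ _)/wrap[l l0|/(_ f bf)/eqP].
  have rl : 0 < r + l by rewrite ltr_wpDr. have t0 : 0 <= r * l / (r + l) by rewrite divr_ge0 ?mulr_ge0// ltW.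
  have rt : 0 < rho + r * l / (r + l) by rewrite ltr_wpDr. have rl' : 0 < rho' rho + l by rewrite ltr_wpDr// rho'0.
  have -> : Ex P (fun w => Qz (pos (rho^-1 * m w)) (fun x => expR (- l * pos x))) =
    (if c then (r / (r + l)) `^ alpha else 1) * (rho / (rho + r * l / (r + l))) `^ shape alpha c.
    rewrite -lap_scale// -(ExZ fP); last exact: bmf_comp (bmf_exppos t0) (mu_ _).
    apply: eq_Ex => w; rewrite (Qz_laplace)//; exact: pos_ge0.
  rewrite pos_id// mulr0 expR0 mulr1 Ex_cst1 (ExZ fP); last exact: b3' (bmf_exppos l0).
  have e : rho + r * l / (r + l) = (rho * (r + l) + r * l) / (r + l) by field; rewrite gt_eqF.
  have e' : rho' rho + l = (rho * (r + l) + r * l) / (rho + r) by rewrite /rho'; field; rewrite gt_eqF.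
  have e0 : 0 < rho * (r + l) + r * l by rewrite ltr_wpDr ?mulr_gt0// mulr_ge0// ltW.
  rewrite lap_scale ?rho'0// /q /defect /shape; case: (c).
    rewrite !subr0 mul1r -powRM ?divr_ge0 ?(ltW r0) ?(ltW rl) ?(ltW h) ?(ltW rt)//.
    by congr (_ `^ _); rewrite e e' /rho'; field; rewrite !gt_eqF.
  have n1 : 0 <= rho / (rho + r * l / (r + l)) by rewrite divr_ge0 ?ltW.
  have n2 : 0 <= rho' rho / (rho' rho + l) by rewrite divr_ge0 ?ltW ?rho'0.
  by rewrite !powRr1// mul1r e e' /rho'; field; rewrite !gt_eqF.
rewrite (Ex_cst1 P) (ExZ fP); last first.
  have bfp : bmf (fun x => f (pos x)) by exact: bmf_comp bf (@mpos R). exact: b3' bfp.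
by rewrite [pos 0]pos_id// subr_eq addrC => /eqP.
Qed.

Definition PhiQ (z : R) : M := \matrix_(i, j) Qz z (fun x => Phi nu (ef s) (pos x) i j).

(** The difference of the two sides of the kernel identity at fixed mass; it is shown to vanish by
    way of its means at Gamma masses. *)
Definition gap (z : R) : M := A * Phi nu (ef (ks alpha s r)) z - PhiQ z.

Let nu1 := PDIP_mass a01 hnu.
Let hk := tst_ks a01 y0 hK s0 hs.
Let k0 := ks_ge0 alpha y0 s0.

Lemma gap_lip : exists2 C : R, 0 <= C & forall i j z z', 0 <= z -> 0 <= z' ->
  `|gap z i j - gap z' i j| <= C * `|z - z'|.
Proof.
have [C C0 hC] := Phi_lip hk nu1.
exists (nrm A * C + 2 * 1 * r); first by rewrite addr_ge0 ?mulr_ge0 ?nrm_ge0// ltW.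
move=> i j z z' z0 z'0.
have E x : gap x i j = (A * Phi nu (ef (ks alpha s r)) x) i j -
    Qz x (fun x => Phi nu (ef s) (pos x) i j) by rewrite mxE [X in _ + X]mxE [X in - X]mxE.
have tri (a q a' q' : R) : `|a - q - (a' - q')| <= `|a - a'| + `|q - q'|.
  by rewrite (_ : a - q - (a' - q') = (a - a') - (q - q')); [exact: ler_normB|ring].
rewrite !E mulrDl; apply: (le_trans (tri _ _ _ _)); apply: lerD; last first.
  apply: (Qz_lip (bmf_Phi hs nu1 i j)) => // x.
  by have /andP[h0 h1] := Phi_substoch nu hs (pos x) i j; rewrite ger0_norm.
rewrite mxE [X in _ - X]mxE -sumrB; apply: (le_trans (ler_norm_sum _ _ _)).
apply: (@le_trans _ _ (\sum_k `|A i k| * (C * `|z - z'|))).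
  apply: ler_sum => k _; rewrite -mulrBr normrM; apply: ler_wpM2l => //; exact: hC.
rewrite -mulr_suml -mulrA; apply: ler_wpM2r; first by rewrite mulr_ge0.
by rewrite /nrm [leRHS](bigD1 i)//= lerDl; apply: sumr_ge0 => k _; exact: sumr_ge0.
Qed.

Let gp i j x := gap (pos x) i j.

Let gp_pos u i j x : 0 < u -> gp i j (u * pos x) = gp i j (u * x).
Proof. by move=> u0; rewrite /gp !pos_scale ?(ltW u0)// [pos (pos x)]pos_id ?pos_ge0. Qed.

Lemma bmf_gap i j : bmf (gp i j).
Proof.
have [C C0 hC] := gap_lip; split.
  apply: continuous_measurable_fun; apply: (@lip_continuous _ _ C) => x x'.
  apply: (le_trans (hC i j _ _ (pos_ge0 x) (pos_ge0 x'))); apply: ler_wpM2l => //; exact: pos_lip.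
exists (nrm A + 1) => x; rewrite /gp /gap mxE; apply: (le_trans (ler_normD _ _)); apply: lerD.
  rewrite mxE; apply: (le_trans (ler_norm_sum _ _ _)). apply: (@le_trans _ _ (\sum_k `|A i k|)).
    apply: ler_sum => k _; rewrite normrM -[leRHS]mulr1; apply: ler_wpM2l => //.
    by have /andP[h0 h1] := Phi_substoch nu hk (pos x) k j; rewrite ger0_norm.
  by rewrite /nrm [leRHS](bigD1 i)//= lerDl; apply: sumr_ge0 => k _; exact: sumr_ge0.
rewrite mxE normrN mxE /Qz; apply: Ex_ae_le => //; first exact: bmf_mass (bmf_Phi hs nu1 i j).
apply: aeW => b; have /andP[h0 h1] := Phi_substoch nu hs (pos (ip_mass b)) i j.
by rewrite ger0_norm.
Qed.

Lemma gap_mean (u : R) i j : 0 < u -> Ex P (fun w => gp i j (u * m w)) = 0.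
Proof.
move=> u0; pose rho := u^-1; have h : 0 < rho by rewrite invr_gt0.
have uE : u = rho^-1 by rewrite invrK.
have bk : bmm (fun w => Phi nu (ef (ks alpha s r)) (pos (rho^-1 * m w))).
  by move=> i' j'; exact: bmf_comp (bmf_Phi hk nu1 i' j') (mu_ _).
have EA : Emx P (fun w => A * Phi nu (ef (ks alpha s r)) (pos (rho^-1 * m w))) = A * W alpha c (ks alpha s r) rho.
  rewrite EmxMl//; congr (_ * _); apply: (gamma_mean_W a01 k0 hk h hnu (mu_ _)) => l l0. exact: lap_scale.
have posK (x : R) : pos (pos x) = pos x by rewrite [LHS]pos_id// pos_ge0.
have EQ : Ex P (fun w => PhiQ (pos (rho^-1 * m w)) i j) =
    (defect rho *: 1 + (1 - defect rho) *: W alpha c s (rho' rho)) i j.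
  have bf := bmf_Phi hs nu1 i j. transitivity (Ex P (fun w => Qz (pos (rho^-1 * m w))
      (fun x => (fun x' => Phi nu (ef s) (pos x') i j) (pos x)))).
    apply: eq_Ex => w; rewrite mxE; congr Qz; apply/funext => x; by rewrite posK.
  rewrite (mix_mass h bf) pos_id// Phi0// [RHS]mxE [X in _ = X + _]mxE [X in _ = _ + X]mxE. congr (_ + _ * _).
  rewrite -(gamma_mean_W (P := P) a01 s0 hs (rho'0 h) hnu (mu_ (rho' rho)^-1)); last first.
    by move=> l l0; exact: lap_scale (rho'0 h) l0.
  by rewrite mxE; apply: eq_Ex => w; rewrite posK.
have mxB (X Y : M) : (X - Y) i j = X i j - Y i j by rewrite !mxE.
have bA : bmm (fun _ : Om => A) by exact: bmm_cst.
have bQ : bmf (fun w => PhiQ (pos (rho^-1 * m w)) i j).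
  have := bmfB (bmmM bA bk i j) (bmf_comp (bmf_gap i j) (mu_ rho^-1)).
  rewrite (_ : (fun _ => _) = (fun w => PhiQ (pos (rho^-1 * m w)) i j))//. apply/funext => w; rewrite /gp /gap.
  by rewrite mxB opprB addrC subrK.
transitivity (Ex P (fun w => (A * Phi nu (ef (ks alpha s r)) (pos (rho^-1 * m w))) i j -
    PhiQ (pos (rho^-1 * m w)) i j)).
  by apply: eq_Ex => w; rewrite uE /gp /gap mxB.
rewrite (ExB fP (bmmM bA bk i j) bQ) EQ -W_ks// -EA mxE subrr//.
Qed.

(** Under an exponential weight the law of m becomes that of a multiple of m, so [gap_mean] at all
    scales gives orthogonality to the exponentials. *)
Lemma gap_tilt (u l : R) i j : 0 < u -> 0 <= l -> Ex P (fun w => expR (- l * pos (m w)) * gp i j (u * m w)) = 0.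
Proof.
move=> u0 l0; set c1 : R := (1 / (1 + l)) `^ shape alpha c.
have l1 : 0 < 1 + l by rewrite ltr_wpDr.
have b1 : bfun (fun f => Ex P (fun w => expR (- l * pos (m w)) * f (m w))).
  by apply: bfun_wEx => //; exact: bmf_comp (bmf_exppos l0) mm.
have b2 : bfun (fun f => Ex P (fun w => c1 * f ((1 + l)^-1 * m w))).
  exact: (bfun_wEx fP (mu_ (1 + l)^-1) (bmf_cst _ c1)).
pose g x := gp i j (u * x).
have bg : bmf g by apply: bmf_comp (bmf_gap i j) _; exact: mfM.
have gpos x : g (pos x) = g x by exact: gp_pos.
have := bfun_laplace b1 b2.
move=> /(_ _)/wrap[l' l'0|/(_ g bg)].
  have ll : 0 < 1 + l + l' by rewrite ltr_wpDr. rewrite (ExZ fP); last exact: bmf_comp (bmf_exppos l'0) (mu_ _).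
  rewrite lap_scale// -powRM ?divr_ge0 ?(ltW l1) ?(ltW ll)//.
  rewrite (_ : 1 / (1 + l) * ((1 + l) / (1 + l + l')) = 1 / (1 + (l + l'))); last first.
    by rewrite addrA; field; rewrite !gt_eqF.
  rewrite -lap ?addr_ge0//; apply: eq_Ex => w; rewrite -expRD; congr expR; ring.
rewrite (ExZ fP); last first.
  have bgp : bmf (fun x => g (pos x)) by exact: bmf_comp bg (@mpos R). exact: bmf_comp bgp (mu_ _).
have -> : Ex P (fun w => g (pos ((1 + l)^-1 * m w))) = 0.
  rewrite -(gap_mean i j (divr_gt0 u0 l1)); apply: eq_Ex => w; rewrite gpos /g mulrA. by [].
rewrite mulr0 => e; rewrite -[RHS]e; apply: eq_Ex => w.
by rewrite gpos.
Qed.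

(** Being orthogonal to every bounded function of m, the gap at [u m] is orthogonal to itself. *)
Lemma gap_ae (u : R) i j : 0 < u -> {ae P, forall w, gp i j (u * m w) = 0}.
Proof.
move=> u0; pose g x := gp i j (u * x).
have bg : bmf g by apply: bmf_comp (bmf_gap i j) _; exact: mfM.
have bgm : bmf (fun w => g (m w)) by exact: bmf_comp bg mm.
have gpos x : g (pos x) = g x by exact: gp_pos.
have b1 : bfun (fun f => Ex P (fun w => g (m w) * f (m w))).
  exact: (bfun_wEx fP mm bgm).
have := bfun_laplace0 b1.
move=> /(_ _)/wrap[l l0|/(_ g bg) e].
  rewrite -[RHS](gap_tilt i j u0 l0); apply: eq_Ex => w; exact: mulrC.
have bg2 : bmf (fun w => g (m w) * g (m w)) by exact: bmfM.
have e2 : (\int[P]_w `| (g (m w) * g (m w))%:E | = 0)%E.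
  transitivity (\int[P]_w (g (m w) * g (m w))%:E)%E.
    by apply: eq_integral => w _; rewrite gee0_abs// lee_fin -expr2 sqr_ge0.
  rewrite -(ExE fP bg2); congr _%:E; rewrite -[RHS]e; congr Ex. by apply/funext => w; rewrite gpos.
have mg2 : mfT (fun w => (g (m w) * g (m w))%:E) by apply/mEFin; exact: bg2.1.
have := (ae_eq_integral_abs P measurableT mg2).1 e2.
by apply: filterS => w /(_ Logic.I) [] /eqP; rewrite -expr2 sqrf_eq0 => /eqP.
Qed.

(** A single outcome w is fixed for which m w > 0 and the gap vanishes at all positive rational
    multiples of m w. These are dense in the half-line, and the gap is Lipschitz. *)
Lemma gap_zero z : 0 <= z -> gap z = 0.
Proof.
move=> z0; apply/matrixP => i j; rewrite [RHS]mxE.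
have [C C0 hC] := gap_lip.
have h : {ae P, forall w, forall k l : nat, gp i j (k.+1%:R / l.+1%:R * m w) = 0}.
  by apply: ae_foralln => k; apply: ae_foralln => l; apply: gap_ae; rewrite divr_gt0.
have [w [w0 wh]] : exists w, 0 < m w /\ forall k l : nat, gp i j (k.+1%:R / l.+1%:R * m w) = 0.
  have [N [mN N0 hN]] : {ae P, forall w, 0 < m w /\ forall k l : nat, gp i j (k.+1%:R / l.+1%:R * m w) = 0}.
    by apply: filterS2 m0 h.
  have [w Nw] : exists w, ~ N w.
    apply: contrapT => H; have NT : N = setT.
      by apply/seteqP; split=> // w _; apply: contrapT => Nw; apply: H; exists w.
    by move: N0; rewrite NT PsetT => /eqP; rewrite onee_eq0.
  exists w; apply: contrapT => H; apply: Nw; exact: hN.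
have zm : 0 <= z / m w by rewrite divr_ge0// ltW.
have hl (l : nat) : `|gap z i j| <= C * (m w * l.+1%:R^-1).
  pose k := Num.trunc (z / m w * l.+1%:R). have u0 : 0 <= k.+1%:R / l.+1%:R * m w by rewrite mulr_ge0 ?divr_ge0// ltW.
  have := wh k l; rewrite /gp pos_id// => e.
  have := hC i j z _ z0 u0; rewrite e subr0 => /le_trans; apply; apply: ler_wpM2l => //.
  have -> : z - k.+1%:R / l.+1%:R * m w = m w * (l.+1%:R^-1 * (z / m w * l.+1%:R - k.+1%:R)).
    by field; rewrite !gt_eqF.
  rewrite normrM (gtr0_norm w0); apply: ler_wpM2l; first exact: ltW.
  rewrite normrM gtr0_norm ?invr_gt0// -[leRHS]mulr1; apply: ler_wpM2l; first by rewrite invr_ge0.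
  have /andP[h1 h2] : k%:R <= z / m w * l.+1%:R < k.+1%:R by apply: trunc_itv; rewrite mulr_ge0.
  rewrite ler0_norm ?subr_le0 ?(ltW h2)// -natr1; lra.
apply/eqP; rewrite -normr_le0; apply/ler_addgt0Pl => e e0; rewrite addr0.
have D0 : 0 < C * m w + 1 by rewrite ltr_wpDl// mulr_ge0// ltW.
have [l _ hlm] := near_infty_natSinv_lt (PosNum (divr_gt0 e0 D0)).
have := hlm l (leqnn l) => /= h1; apply: (le_trans (hl l)).
rewrite mulrA; apply: (@le_trans _ _ ((C * m w + 1) * l.+1%:R^-1)).
  by apply: ler_wpM2r; rewrite ?invr_ge0// lerDl.
by rewrite mulrC -ler_pdivlMr// ltW.
Qed.

End gamma_variable.

Lemma kernel_identity z : 0 <= z -> A * Phi nu (ef (ks alpha s r)) z = PhiQ z.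
Proof.
have [d [Om [P [m [mm m0 lap]]]]] := PDIP_gamma a01 hnu.
move=> z0; have := gap_zero mm m0 lap z0; rewrite /gap => /eqP; rewrite subr_eq0 => /eqP.
exact.
Qed.

End mass_semigroup.

(** * Gaussian increments and a discrete exponential martingale *)

Section gaussian.
Context (R : realType).
Local Notation mu := (@lebesgue_measure R).

(** Completing the square: the exponential shifts the mean of the normal density to [a sg^2]. *)
Lemma normal_mgf (sg a : R) : sg != 0 ->
  (\int[mu]_x (expR (a * x) * normal_pdf 0 sg x)%:E = (expR (a ^+ 2 * sg ^+ 2 / 2))%:E)%E.
Proof.
move=> s0; have e x : expR (a * x) * normal_pdf 0 sg x = expR (a ^+ 2 * sg ^+ 2 / 2) * normal_pdf (a * sg ^+ 2) sg x.
  rewrite !normal_pdfE// mulrCA [RHS]mulrCA; congr (_ * _); rewrite /normal_fun -!expRD.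
  by congr expR; field; rewrite s0.
transitivity ((expR (a ^+ 2 * sg ^+ 2 / 2))%:E * \int[mu]_x (normal_pdf (a * sg ^+ 2) sg x)%:E)%E.
  rewrite -ge0_integralZl.
  - by apply: eq_integral => x _; rewrite e EFinM.
  - exact: measurableT.
  - by apply/mEFin; exact: measurable_normal_pdf.
  - by move=> x _; rewrite lee_fin normal_pdf_ge0.
  - by rewrite lee_fin expR_ge0.
by rewrite integral_normal_pdf mule1.
Qed.

Context d (Om : mtype d) (P : prob Om R).

(** The law of D determines means of bounded functions; the exponential is reached by truncation at
    M and monotone convergence on both sides. *)
Lemma integral_normal_rv (sg a : R) (D : Om -> R) : sg != 0 -> mfT D ->
  (forall A : set R, measurable A -> P (D @^-1` A) = normal_prob 0 sg A) ->
  (\int[P]_w (expR (a * D w))%:E = (expR (a ^+ 2 * sg ^+ 2 / 2))%:E)%E.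
Proof.
move=> s0 mD hD; rewrite -(normal_mgf a s0).
pose g (M : nat) (x : R) : R := Num.min (expR (a * x)) M%:R.
have mE : mfT (fun x : R => expR (a * x)) by apply: mexpR; exact: mfM.
have g0 M x : 0 <= g M x by rewrite /g le_min expR_ge0 ler0n.
have bg M : bmf (g M).
  split; first by apply: measurable_minr. by exists M%:R => x; rewrite ger0_norm ?g0// /g ge_min lexx orbT.
have gnd x M M' : (M <= M')%N -> g M x <= g M' x by move=> MM; rewrite /g le_min !ge_min lexx ler_nat MM orbT.
have gcvg x : g M x @[M --> \oo] --> expR (a * x).
  apply: cvg_near_cst; have := nbhs_infty_gtr (expR (a * x)); apply: filterS => M hM.
  by rewrite /g; apply/min_idPl; exact: ltW.
have pdf0 x := normal_pdf_ge0 0 sg x.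
have mp : mfT (normal_pdf 0 sg) by exact: measurable_normal_pdf.
have E M : (\int[P]_w (g M (D w))%:E = \int[mu]_x (g M x * normal_pdf 0 sg x)%:E)%E.
  rewrite -(ExE (Pfin P)); last exact: bmf_comp (bg M) mD.
  have -> : Ex P (fun w => g M (D w)) = \int[mu]_x (g M x * normal_pdf 0 sg x).
    apply: (@Ex_density _ _ _ leb (normal_pdf 0 sg)) => //.
      exact: integrable_normal_pdf.
    exact: Pfin. exact: bg.
  rewrite /Rintegral fineK//. apply: (integrable_fin_num measurableT); apply: density_integrable => //.
    exact: integrable_normal_pdf.
  exact: bg.
have c1 : (\int[P]_w (g M (D w))%:E)%E @[M --> \oo] --> (\int[P]_w (expR (a * D w))%:E)%E.
  rewrite (_ : (fun w => (expR (a * D w))%:E) = (fun w => limn (fun M => (g M (D w))%:E))); last first.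
    apply/funext => w; apply/esym/cvg_lim => //; apply: cvg_EFin; first exact: nearW. exact: gcvg.
  apply: cvg_monotone_convergence => //.
  - by move=> M; apply/mEFin; exact: (bmf_comp (bg M) mD).1.
  - by move=> M w _; rewrite lee_fin.
  - by move=> w _ M M' MM; rewrite lee_fin gnd.
have c2 : (\int[mu]_x (g M x * normal_pdf 0 sg x)%:E)%E @[M --> \oo] -->
    (\int[mu]_x (expR (a * x) * normal_pdf 0 sg x)%:E)%E.
  rewrite (_ : (fun x => (expR (a * x) * normal_pdf 0 sg x)%:E) =
      (fun x => limn (fun M => (g M x * normal_pdf 0 sg x)%:E))); last first.
    apply/funext => x; apply/esym/cvg_lim => //; apply: cvg_EFin; first exact: nearW.
    by apply: cvgM; [exact: gcvg|exact: cvg_cst].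
  apply: cvg_monotone_convergence => //.
  - by move=> M; apply/mEFin; apply: mfM => //; exact: (bg M).1.
  - by move=> M x _; rewrite lee_fin mulr_ge0.
  - by move=> x _ M M' MM; rewrite lee_fin ler_wpM2r// gnd.
move: c1; under eq_fun do rewrite E.
by move=> c1; apply: (cvg_unique _ c1 c2).
Qed.

Variables (h : R) (h0 : 0 < h).

(** With the past values U and th held fixed, the mean over the independent normal increment is
    given by [normal_mgf]. *)
Lemma gauss_step (F : set (set Om)) (U th D : Om -> R) : sigma_algebra setT F -> F `<=` measurable ->
  mfun_in F U -> mfun_in F th -> mfT D -> (forall w, 0 <= U w) -> independent2 P F (sigma_rv D) ->
  (forall A : set R, measurable A -> P (D @^-1` A) = normal_prob 0 (Num.sqrt h) A) ->
  (\int[P]_w (U w * expR (th w * D w))%:E = \int[P]_w (U w * expR (th w ^+ 2 * h / 2))%:E)%E.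
Proof.
move=> sF Fm mU mth mD U0 i hD.
pose X w := (U w, th w).
have mX : mfun_in F X by exact: mpair.
have FE : <<s F >> = F by rewrite sigma_algebra_id.
have iX : independent2 P (sigma_rv X) (sigma_rv D).
  by apply: independent2W i => //; have := (mfun_inP _ _).1 mX; rewrite FE.
pose G (x : (R * R) * R) : \bar R := (`|x.1.1| * expR (x.1.2 * x.2))%:E.
have mG : mfT G.
  have m1 : mfT (fun x : (R * R) * R => x.1.1).
    exact: mcomp measurable_fst measurable_fst.
  have m2 : mfT (fun x : (R * R) * R => x.1.2).
    exact: mcomp measurable_snd measurable_fst.
  apply/mEFin; apply: mfM; first exact: mcomp m1. apply: mexpR.
  have m3 : mfT (fun x : (R * R) * R => x.2) by exact: measurable_snd. exact: (mfM m2 m3).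
have G0 x : (0 <= G x)%E by rewrite lee_fin mulr_ge0 ?expR_ge0.
have mXm : mfT X by exact: mfun_inM Fm mX.
have := independent2_integral mXm mD iX mG G0; rewrite /G /X /=.
under eq_integral do rewrite ger0_norm//; move=> ->.
apply: eq_integral => w _; rewrite ger0_norm//.
have s0 : Num.sqrt h != 0 by rewrite lt0r_neq0// sqrtr_gt0.
under eq_integral do rewrite EFinM.
rewrite ge0_integralZl ?lee_fin//.
- by rewrite (integral_normal_rv (th w) s0 mD hD) -EFinM sqr_sqrtr// ltW.
- apply/mEFin; apply: mexpR. exact: mfM.
Qed.

Variables (F : nat -> set (set Om)) (th D : nat -> Om -> R) (xi : Om -> R) (Th : R).
Hypotheses (sF : forall i, sigma_algebra setT (F i)) (Fm : forall i, F i `<=` measurable).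
Hypotheses (Fmono : forall i, F i `<=` F i.+1) (mth : forall i, mfun_in (F i) (th i)).
Hypotheses (mDF : forall i, mfun_in (F i.+1) (D i)).
Hypotheses (iD : forall i, independent2 P (F i) (sigma_rv (D i))).
Hypotheses (hD : forall i (A : set R), measurable A -> P (D i @^-1` A) = normal_prob 0 (Num.sqrt h) A).
Hypotheses (mxi : mfun_in (F 0) xi) (xi0 : forall w, 0 <= xi w <= 1).
Hypothesis thb : forall i w, `|th i w| <= Th.

(** Discrete stochastic exponential of [- th D] started from xi; the compensator is the logarithm of
    the normal moment generating function, which keeps the mean constant. *)
Definition gmart (n : nat) (w : Om) : R := xi w * expR (\sum_(i < n) (- th i w * D i w - th i w ^+ 2 * h / 2)).

Lemma gmartS n w : gmart n.+1 w = gmart n w * expR (- th n w * D n w - th n w ^+ 2 * h / 2).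
Proof. by rewrite /gmart big_ord_recr /= expRD mulrA. Qed.

Lemma gmart_ge0 n w : 0 <= gmart n w.
Proof. by rewrite mulr_ge0 ?expR_ge0//; case/andP: (xi0 w). Qed.

Let up n (f : Om -> R) : mfun_in (F n) f -> mfun_in (F n.+1) f.
Proof. apply: mfun_in_sub => A hA; apply: sub_sa; exact: Fmono. Qed.

Let mexp n (f : Om -> R) : mfun_in (F n) f -> mfun_in (F n) (fun w => expR (f w)).
Proof. by move=> mf; exact: (mexpR mf). Qed.

Let mq n : mfun_in (F n) (fun w => th n w ^+ 2 * h / 2).
Proof.
have m2 : mfun_in (F n) (fun w => th n w ^+ 2) by exact: (measurable_funX 2 (@mth n)).
by apply: mfM; [apply: mfM; [exact: m2|exact: mcst]|exact: mcst].
Qed.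

Lemma gmart_mfun n : mfun_in (F n) (gmart n).
Proof.
elim: n => [|n IH].
  rewrite (_ : gmart 0 = xi)//. by apply/funext => w; rewrite /gmart big_ord0 expR0 mulr1.
rewrite (_ : gmart n.+1 = fun w => gmart n w * expR (- th n w * D n w - th n w ^+ 2 * h / 2)); last first.
  by apply/funext => w; exact: gmartS.
have mt := up (@mth n).
apply: mfM; first exact: (up IH).
apply: mexp; apply: mfB; last exact: (up (@mq n)).
by apply: mfM; [exact: (mcomp (@oppr_measurable R setT) mt)|exact: (@mDF n)].
Qed.

Let mD n : mfT (D n).
Proof. exact: (mfun_inM (@Fm n.+1) (@mDF n)). Qed.

Lemma gmart_measurable n : mfT (gmart n).
Proof. exact: (mfun_inM (@Fm n) (@gmart_mfun n)). Qed.

Let mquad n c : mfun_in (F n) (fun w => expR (- (c * (th n w ^+ 2 * h / 2)))).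
Proof.
have m1 : mfun_in (F n) (fun w => c * (th n w ^+ 2 * h / 2)).
  by apply: mfM; [exact: mcst|exact: (@mq n)].
by apply: mexp; exact: (mcomp (@oppr_measurable R setT) m1).
Qed.

Lemma gmart_mean n : (\int[P]_w (gmart n w)%:E = \int[P]_w (xi w)%:E)%E.
Proof.
elim: n => [|n IH].
  by apply: eq_integral => w _; rewrite /gmart big_ord0 expR0 mulr1.
rewrite -IH; pose U w := gmart n w * expR (- (1 * (th n w ^+ 2 * h / 2))).
transitivity (\int[P]_w (U w * expR (- th n w * D n w))%:E)%E.
  apply: eq_integral => w _; rewrite gmartS /U -(mulrA (gmart n w)) -expRD; congr (_ * expR _)%:E; ring.
have mU : mfun_in (F n) U by apply: mfM; [exact: (@gmart_mfun n)|exact: mquad].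
have mt : mfun_in (F n) (fun w => - th n w).
  exact: (mcomp (@oppr_measurable R setT) (@mth n)).
have U0 w : 0 <= U w by rewrite mulr_ge0 ?gmart_ge0 ?expR_ge0.
rewrite (gauss_step (@sF n) (@Fm n) mU mt (@mD n) U0 (@iD n) (@hD n)).
apply: eq_integral => w _; rewrite /U -(mulrA (gmart n w)) -expRD.
rewrite (_ : _ + _ = 0) ?expR0 ?mulr1//; by ring.
Qed.

(** In the square the increment contributes [2 th^2 h] to the exponent and the compensator removes
    [th^2 h]. The bound depends on n and h only through their product, so it is uniform over the
    grids of a fixed interval and yields uniform integrability. *)
Lemma gmart_sq n : (\int[P]_w (gmart n w ^+ 2)%:E <= (expR (n%:R * (Th ^+ 2 * h)))%:E)%E.
Proof.
elim: n => [|n IH].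
  rewrite mul0r expR0; apply: (@le_trans _ _ (\int[P]_w 1)%E); last first.
    by rewrite integral_cst// mul1e probability_le1.
  apply: ge0_le_integral => //.
  - by move=> w _; rewrite lee_fin sqr_ge0.
  - by apply/mEFin; apply: measurable_funX; exact: gmart_measurable.
  - move=> w _; rewrite /gmart big_ord0 expR0 mulr1 lee_fin. by have /andP[x0 x1] := xi0 w; rewrite exprn_ile1.
pose U w := gmart n w ^+ 2 * expR (- (2 * (th n w ^+ 2 * h / 2))).
have eU : (\int[P]_w (gmart n.+1 w ^+ 2)%:E = \int[P]_w (U w * expR (- 2 * th n w * D n w))%:E)%E.
  apply: eq_integral => w _; rewrite gmartS /U exprMn -(mulrA (gmart n w ^+ 2)) -expRD.
  by rewrite [expR _ ^+ 2]expr2 -expRD; congr (_ * expR _)%:E; ring.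
have mg : mfun_in (F n) (fun w => gmart n w ^+ 2) by exact: (measurable_funX 2 (@gmart_mfun n)).
have mU : mfun_in (F n) U by apply: mfM; [exact: mg|exact: mquad].
have mt2 : mfun_in (F n) (fun w => - 2 * th n w).
  by apply: mfM; [exact: mcst|exact: (@mth n)].
have U0 w : 0 <= U w by rewrite mulr_ge0 ?sqr_ge0 ?expR_ge0.
rewrite eU (gauss_step (@sF n) (@Fm n) mU mt2 (@mD n) U0 (@iD n) (@hD n)).
apply: (@le_trans _ _ (\int[P]_w ((expR (Th ^+ 2 * h))%:E * (gmart n w ^+ 2)%:E))%E).
  have mg2 : mfT (fun w => gmart n w ^+ 2) by apply: measurable_funX; exact: gmart_measurable.
  have mt : mfT (th n) by exact: (mfun_inM (@Fm n) (@mth n)). apply: ge0_le_integral => //.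
  - by move=> w _; rewrite lee_fin mulr_ge0 ?expR_ge0.
  - apply/mEFin; apply: mfM.
      exact: (mfun_inM (@Fm n) mU).
    apply: mexpR. have m1 := mfun_inM (@Fm n) mt2.
    have m2 : mfT (fun w => (- 2 * th n w) ^+ 2) by exact: measurable_funX.
    by apply: mfM; [apply: mfM; [exact: m2|exact: mcst]|exact: mcst].
  - by apply/mEFin; exact: mfM.
  move=> w _; rewrite -EFinM lee_fin /U -(mulrA (gmart n w ^+ 2)) -expRD mulrC; apply: ler_wpM2r; first exact: sqr_ge0.
  rewrite ler_expR (_ : _ + _ = th n w ^+ 2 * h); last by field.
  rewrite ler_pM2r//; have /ler_normlP[a1 a2] := thb n w; rewrite -real_normK ?num_real//.
  by apply: lerXn2r; rewrite ?nnegrE// (le_trans _ (thb n w)).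
have m2 : mfT (fun w => (gmart n w ^+ 2)%:E).
  by apply/mEFin; exact: (mfun_inM (@Fm n) mg).
have g2 w : setT w -> (0 <= (gmart n w ^+ 2)%:E)%E by rewrite lee_fin sqr_ge0.
have e0 : (0 <= (expR (Th ^+ 2 * h))%:E :> \bar R)%E by rewrite lee_fin expR_ge0.
rewrite (ge0_integralZl P measurableT m2 g2 e0) -natr1 mulrDl mul1r addrC expRD EFinM.
exact: lee_wpmul2l.
Qed.

End gaussian.

Lemma halfline_cont (R : realType) (z : R -> R) : {within `[0, +oo[%classic, continuous z} ->
  forall x, 0 <= x -> forall e : R, 0 < e -> exists2 dl : R, 0 < dl &
    forall t, 0 <= t -> `|x - t| < dl -> `|z x - z t| < e.
Proof.
move=> /subspace_continuousP cz x x0 e e0.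
have Ax : `[0, +oo[%classic x by rewrite /= in_itv/= x0.
have /cvgrPdist_lt/(_ e e0) := cz x Ax; rewrite /within /=.
move=> /nbhs_ballP[dl /= dl0 h]; exists dl => // t t0 xt.
by apply: h => //=; rewrite in_itv/= t0.
Qed.

Lemma unif_cont_itv (R : realType) (z : R -> R) (y : R) : {within `[0, +oo[%classic, continuous z} ->
  forall w : R, 0 < w -> exists2 eta : R, 0 < eta &
    forall s t, 0 <= s <= y -> 0 <= t <= y -> `|s - t| < eta -> `|z s - z t| <= w.
Proof.
move=> /halfline_cont cz w w0.
pose Q (k : nat) (x : R) := 0 <= x <= y -> forall t, 0 <= t <= y -> `|x - t| < k.+1%:R^-1 -> `|z x - z t| <= w.
have : \forall k \near \oo, `[0, y]%classic `<=` Q k.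
  apply: ((compact_near_coveringP `[0, y]%classic).1 (@segment_compact R 0 y) nat \oo Q _) => x.
  rewrite /= in_itv/= => /andP[x0 xy]. have [dl dl0 hd] := cz x x0 (w / 2) (divr_gt0 w0 (ltr0Sn R 1)).
  have d20 : 0 < dl / 2 by rewrite divr_gt0. exists (ball x (dl / 2), [set k | (k.+1%:R^-1 : R) < dl / 2]).
    by split; [exact: nbhsx_ballx|exact: (near_infty_natSinv_lt (PosNum d20))].
  move=> [x' k] /= [bx hk] /andP[x'0 x'y] t /andP[t0 ty] xt; rewrite /ball /= in bx.
  have h1 : `|z x - z x'| < w / 2 by apply: hd => //; lra. have h2 : `|z x - z t| < w / 2.
    apply: hd => //; have : `|x - t| <= `|x - x'| + `|x' - t|.
      by rewrite (le_trans _ (ler_normD _ _))// addrA subrK.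
    by have := lt_trans xt hk; lra.
  have : `|z x' - z t| <= `|z x' - z x| + `|z x - z t|.
    by rewrite (le_trans _ (ler_normD _ _))// addrA subrK.
  have h3 : `|z x' - z x| < w / 2 by rewrite distrC. by move: h2 h3; lra.
move=> [k _ /(_ k (leqnn k)) h]; exists k.+1%:R^-1 => // s t s01 t01 st.
by apply: (h s) => //; rewrite /= in_itv/=.
Qed.

(** * The time-dependent exponent of the BESQ martingale *)

Section phi.
Context (R : realType) (y lam : R).
Hypotheses (y0 : 0 < y) (l0 : 0 < lam).

(** Solution of the Riccati equation [phi' = 2 phi^2] with final value lam at y; with it the terms
    proportional to Z in the drift of [exp(- phi(t) Z(t))] cancel. [phi_diff] is the exact
    difference form. *)
Definition phi (t : R) : R := lam / (1 + 2 * lam * (y - t)).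

Let den t : t <= y -> 1 <= 1 + 2 * lam * (y - t).
Proof. by move=> ty; rewrite lerDl !mulr_ge0 ?subr_ge0// ltW. Qed.

Let den0 t : t <= y -> 0 < 1 + 2 * lam * (y - t).
Proof. by move=> /den; exact: lt_le_trans. Qed.

Lemma phi_gt0 t : t <= y -> 0 < phi t.
Proof. by move=> ty; rewrite divr_gt0// den0. Qed.

Lemma phi_le t : t <= y -> phi t <= lam.
Proof. by move=> ty; rewrite ler_pdivrMr ?den0// ler_peMr ?den// ltW. Qed.

Lemma phi_y : phi y = lam.
Proof. by rewrite /phi subrr mulr0 addr0 divr1. Qed.

Lemma phi_diff s t : s <= y -> t <= y -> phi t - phi s = 2 * phi s * phi t * (t - s).
Proof.
move=> sy ty; rewrite /phi; field; rewrite !gt_eqF ?den0//.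
Qed.

(** The antiderivative of phi vanishing at y; [- delta * lphi 0] is the contribution of the drift
    delta up to time y. *)
Definition lphi (t : R) : R := - (ln (1 + 2 * lam * (y - t)) / 2).

Lemma lphi_y : lphi y = 0.
Proof. by rewrite /lphi subrr mulr0 addr0 ln1 mul0r oppr0. Qed.

Lemma lphi_le0 t : t <= y -> lphi t <= 0.
Proof. by move=> ty; rewrite oppr_le0 divr_ge0// ln_ge0// den. Qed.

Let ln_le (x : R) : 0 < x -> ln x <= x - 1.
Proof.
move=> x0; have e : 1 + (x - 1) = x by rewrite addrC subrK.
by have := @le_ln1Dx R (x - 1); rewrite e; apply; rewrite ltrBrDl addrN.
Qed.

Lemma lphi_diff_ge s t : s <= t -> t <= y -> phi s * (t - s) <= lphi t - lphi s.
Proof.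
move=> st ty; have sy := le_trans st ty; have a0 := den0 sy; have b0 := den0 ty.
rewrite /lphi opprK; set a := 1 + 2 * lam * (y - s) in a0 *; set b := 1 + 2 * lam * (y - t) in b0 *.
have -> : phi s * (t - s) = (1 - b / a) / 2 by rewrite /phi -/a /b /a; field; rewrite gt_eqF.
have : ln (b / a) <= b / a - 1 by apply: ln_le; exact: divr_gt0.
rewrite ln_div ?posrE//; lra.
Qed.

Lemma lphi_diff_le s t : s <= t -> t <= y -> lphi t - lphi s <= phi t * (t - s).
Proof.
move=> st ty; have sy := le_trans st ty; have a0 := den0 sy; have b0 := den0 ty.
rewrite /lphi opprK; set a := 1 + 2 * lam * (y - s) in a0 *; set b := 1 + 2 * lam * (y - t) in b0 *.
have -> : phi t * (t - s) = (a / b - 1) / 2 by rewrite /phi -/b /b /a; field; rewrite gt_eqF.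
have : ln (a / b) <= a / b - 1 by apply: ln_le; exact: divr_gt0.
rewrite ln_div ?posrE//; lra.
Qed.

End phi.

(** * Pathwise estimates on a two-scale grid *)

Section grid.
Context (R : realType) (y lam delta K : R) (J N : nat).
Hypotheses (y0 : 0 < y) (l0 : 0 < lam) (d0 : 0 <= delta) (K0 : 0 < K) (J0 : (0 < J)%N) (N0 : (0 < N)%N).
Local Notation phi := (phi y lam).
Local Notation lphi := (lphi y lam).

(** There are J coarse cells, on which phi is frozen, each cut into N fine cells. On a coarse cell
    the noise term is then a constant times a difference of Riemann sums of the square root of Z,
    the sums whose limit defines the Ito integral. *)
Definition mesh : R := y / (J * N)%N%:R.
Definition sg (i : nat) : R := i%:R * mesh.
Definition tc (j : nat) : R := sg (j * N).

(** Uses only coarse times up to the j-th, so the integrand stays adapted, and remains 0 once it is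
    0. *)
Definition act (z : R -> R) (j : nat) : R := \prod_(j' < j.+1) ((z (tc j') <= K)%R%:R : R).

(* Integrand of the exponential martingale: [phi] is frozen on each coarse
   interval and the path is stopped at the first coarse time above K. *)
Definition thp (z : R -> R) (i : nat) : R :=
  2 * phi (tc (i %/ N)) * act z (i %/ N) * Num.sqrt (Num.min (z (sg i)) (2 * K)).

Definition dB (b : R -> R) (i : nat) : R := b (sg i.+1) - b (sg i).

Definition logX (z b : R -> R) : R := \sum_(0 <= i < J * N) (- thp z i * dB b i - thp z i ^+ 2 * mesh / 2).

Definition RS (z b : R -> R) (j : nat) : R := \sum_(0 <= i < j * N) Num.sqrt (z (sg i)) * dB b i.

Let JN0 : 0 < (J * N)%N%:R :> R. Proof. by rewrite ltr0n muln_gt0 J0. Qed.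

Lemma mesh_gt0 : 0 < mesh. Proof. exact: divr_gt0. Qed.

Lemma sg_bound i : (i <= J * N)%N -> 0 <= sg i <= y.
Proof.
move=> iJ; rewrite /sg mulr_ge0 ?ler0n ?(ltW mesh_gt0)//=.
by rewrite /mesh mulrA ler_pdivrMr// mulrC ler_pM2l// ler_nat.
Qed.

Lemma tc_bound j : (j <= J)%N -> 0 <= tc j <= y.
Proof. by move=> jJ; apply: sg_bound; rewrite leq_mul2r jJ orbT. Qed.

Lemma tc0 : tc 0 = 0. Proof. by rewrite /tc /sg mul0n mul0r. Qed.

Lemma tcJ : tc J = y. Proof. by rewrite /tc /sg /mesh mulrCA divff ?mulr1// gt_eqF. Qed.

Lemma tcS j : tc j.+1 - tc j = y / J%:R.
Proof.
rewrite /tc /sg /mesh -mulrBl mulSn natrD addrK natrM.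
by field; rewrite !pnatr_eq0 -!lt0n J0 N0.
Qed.

Lemma act_step z : exists2 js, (js <= J)%N &
  (forall j, (j < J)%N -> act z j = (j < js)%N%:R) /\ (forall j, (j < js)%N -> z (tc j) <= K).
Proof.
pose a j := K < z (tc j); exists (find a (iota 0 J)).
  by rewrite -[leqRHS](size_iota 0 J) find_size.
have lt_a j : (j < find a (iota 0 J))%N -> z (tc j) <= K.
  move=> jf; have jJ : (j < J)%N.
    by rewrite -[ltnRHS](size_iota 0 J); exact: leq_trans jf (find_size _ _).
  by have := before_find 0 jf; rewrite nth_iota// add0n /a => /negbT; rewrite -leNgt.
split=> // j jJ; case: ltnP => hj.
  by rewrite /act big1// => -[j' /= j'j] _; rewrite lt_a//; exact: leq_ltn_trans hj.
have hf : (find a (iota 0 J) < j.+1)%N by rewrite ltnS.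
have hs : has a (iota 0 J) by rewrite has_find size_iota; exact: leq_ltn_trans jJ.
have nf : (z (tc (find a (iota 0 J))) <= K) = false.
  have := nth_find 0 hs; rewrite nth_iota ?add0n; last by rewrite -[ltnRHS](size_iota 0 J) -has_find.
  by rewrite /a ltNge => /negPf.
by rewrite /act (bigD1 (Ordinal hf))//= nf mul0r.
Qed.

Section path.
Variables (z b I : R -> R) (e w Zm : R) (js : nat).
Hypotheses (z0 : forall t, 0 <= t -> 0 <= z t) (zI : forall t, 0 <= t -> z t = z 0 + delta * t + 2 * I t).
Hypotheses (hRS : forall j, (j <= J)%N -> `|RS z b j - I (tc j)| <= e).
Hypotheses (hw : forall s t, 0 <= s <= y -> 0 <= t <= y -> `|s - t| <= y / J%:R -> `|z s - z t| <= w).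
Hypotheses (wK : w <= K) (hZ : forall t, 0 <= t <= y -> z t <= Zm).
Hypotheses (jsJ : (js <= J)%N) (hact : forall j, (j < J)%N -> act z j = (j < js)%N%:R).
Hypothesis hK : forall j, (j < js)%N -> z (tc j) <= K.

Let Dl := y / J%:R.

Let Dl0 : 0 < Dl. Proof. by rewrite divr_gt0// ltr0n. Qed.

Let meshN : N%:R * mesh = Dl.
Proof. by rewrite /mesh /Dl natrM; field; rewrite !pnatr_eq0 -!lt0n J0 N0. Qed.

Let blk j := \sum_(j * N <= i < j.+1 * N) (- thp z i * dB b i - thp z i ^+ 2 * mesh / 2).
(** The increment over a coarse cell that Ito's formula predicts for the logarithm. *)
Let tgt j := phi (tc j) * z (tc j) - phi (tc j.+1) * z (tc j.+1) + delta * (phi (tc j) * Dl).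

Let in_blk j i : (j < J)%N -> (j * N <= i < j.+1 * N)%N ->
  [/\ (i %/ N)%N = j, 0 <= sg i <= y, `|sg i - tc j| <= Dl & `|tc j.+1 - sg i| <= Dl].
Proof.
move=> jJ /andP[i1 i2]; have iJN : (i <= J * N)%N.
  by apply: (leq_trans (ltnW i2)); rewrite leq_mul2r jJ orbT.
split; [|exact: sg_bound| |].
- by apply/eqP; rewrite eqn_leq leq_divRL// i1 andbT -ltnS ltn_divLR.
- rewrite /tc /sg -mulrBl -natrB// normrM (gtr0_norm mesh_gt0) ger0_norm ?ler0n// -meshN.
  by rewrite ler_pM2r ?mesh_gt0// ler_nat leq_subLR ltnW// -[X in (_ <= X)%N]mulSnr.
- rewrite /tc /sg -mulrBl -natrB; last exact: ltnW. rewrite normrM (gtr0_norm mesh_gt0) ger0_norm ?ler0n// -meshN.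
  by rewrite ler_pM2r ?mesh_gt0// ler_nat leq_subLR mulSnr leq_add2r.
Qed.

Let blk_inactive j : (js <= j)%N -> (j < J)%N -> blk j = 0.
Proof.
move=> jsj jJ; rewrite /blk big_nat big1// => i hi.
have [ij _ _ _] := in_blk jJ hi.
by rewrite /thp ij hact// ltnNge jsj /= mulr0 mul0r oppr0 mul0r expr0n /= !mul0r subrr.
Qed.

Let blk_active j : (j < js)%N -> `|blk j - tgt j| <=
  4 * lam * e + 4 * lam ^+ 3 * Dl ^+ 2 * Zm + 2 * lam ^+ 2 * Dl * w.
Proof.
move=> jjs; have jJ := leq_trans jjs jsJ.
have /andP[t0 ty] := tc_bound (ltnW jJ); have /andP[t'0 t'y] := tc_bound jJ.
have tt : tc j.+1 - tc j = Dl by exact: tcS.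
set p := phi (tc j); set p' := phi (tc j.+1); set zz := z (tc j.+1).
have p0 : 0 < p by exact: phi_gt0.
have p1 : p <= lam by exact: phi_le.
have p'0 : 0 < p' by exact: phi_gt0.
have p'1 : p' <= lam by exact: phi_le.
have zz0 : 0 <= zz by exact: z0.
have zzZ : zz <= Zm by apply: hZ; rewrite t'0.
pose Q := \sum_(j * N <= i < j.+1 * N) z (sg i) * mesh.
have jN : (j * N <= j.+1 * N)%N by rewrite leq_mul2r leqnSn orbT.
have eB : blk j = - 2 * p * (RS z b j.+1 - RS z b j) - 2 * p ^+ 2 * Q.
  have -> : RS z b j.+1 - RS z b j = \sum_(j * N <= i < j.+1 * N) Num.sqrt (z (sg i)) * dB b i.
    by rewrite /RS (big_cat_nat (n := j * N))//= addrAC subrr add0r.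
  rewrite /Q !mulr_sumr -sumrN -big_split /= /blk; apply: eq_big_nat => i hi.
  (* On an active cell the coarse value is at most K and the oscillation at most w <= K, so the
     truncation at 2K in [thp] has no effect. *)
  have [ij /andP[s0 sy] si _] := in_blk jJ hi. have zi : z (sg i) <= 2 * K.
    have := hw (s := sg i) (t := tc j); rewrite s0 sy t0 ty => /(_ isT isT si).
    by move=> /ler_normlP[_ h1]; have := hK jjs; have := wK; lra.
  rewrite /thp ij hact// jjs mulr1 (min_idPl zi) -/p.
  have eS : z (sg i) = Num.sqrt (z (sg i)) ^+ 2 by rewrite sqr_sqrtr ?z0.
  move: eS; set S := Num.sqrt (z (sg i)) => eS; rewrite eS; by field.
have eI : 2 * (I (tc j.+1) - I (tc j)) = zz - z (tc j) - delta * Dl.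
  have e1 := zI t'0; have e2 := zI t0; rewrite /zz; move: tt => tt.
  have -> : tc j.+1 = tc j + Dl by rewrite -tt addrC subrK.
  move: e1; have -> : tc j.+1 = tc j + Dl by rewrite -tt addrC subrK. by move=> e1; rewrite e1 e2; ring.
have eP : p' - p = 2 * p * p' * Dl by rewrite -tt; exact: phi_diff.
pose E1 := RS z b j.+1 - I (tc j.+1); pose E0 := RS z b j - I (tc j).
(* The error splits into that of the Riemann sums, a second-order term from the change of phi, and
   the oscillation of z within the cell; the first-order terms cancel by [phi_diff]. *)
have -> : blk j - tgt j = - 2 * p * (E1 - E0) + (2 * p * Dl * zz * (p' - p) + 2 * p ^+ 2 * (Dl * zz - Q)).
  rewrite eB /tgt -/p -/p' -/zz. have -> : RS z b j.+1 = E1 + I (tc j.+1) by rewrite /E1 subrK.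
  have -> : I (tc j.+1) = I (tc j) + (zz - z (tc j) - delta * Dl) / 2 by rewrite -eI; field.
  have -> : RS z b j = E0 + I (tc j) by rewrite /E0 subrK. apply/eqP; rewrite -subr_eq0; apply/eqP.
  by transitivity (zz * (p' - p - 2 * p * p' * Dl)); [field|rewrite eP subrr mulr0].
have b1 : `|E1 - E0| <= 2 * e.
  by apply: (le_trans (ler_normB _ _)); rewrite mulr_natl mulr2n; apply: lerD; apply: hRS => //; exact: ltnW.
have e0 : 0 <= e by apply: le_trans (hRS (leq0n J)).
have w0 : 0 <= w by apply: le_trans (hw (s := 0) (t := 0) _ _ _); rewrite ?lexx ?(ltW y0)// subrr normr0 ltW.
have b2 : `|Dl * zz - Q| <= Dl * w.
  have -> : Dl * zz - Q = \sum_(j * N <= i < j.+1 * N) (zz - z (sg i)) * mesh.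
    rewrite /Q -meshN -mulrA [mesh * zz]mulrC. have -> : N%:R * (zz * mesh) = \sum_(j * N <= i < j.+1 * N) zz * mesh.
      by rewrite sumr_const_nat mulSn addnK mulr_natl.
    by rewrite -sumrB; apply: eq_bigr => i _; rewrite mulrBl.
  rewrite -meshN mulrAC; apply: (le_trans (ler_norm_sum _ _ _)).
  have -> : N%:R * w * mesh = \sum_(j * N <= i < j.+1 * N) w * mesh.
    by rewrite sumr_const_nat mulSn addnK -mulrA mulr_natl.
  rewrite big_nat [leRHS]big_nat; apply: ler_sum => i hi. have [_ si _ si'] := in_blk jJ hi.
  rewrite normrM (gtr0_norm mesh_gt0) ler_pM2r ?mesh_gt0//. by apply: hw => //; rewrite t'0.
apply: (le_trans (ler_normD _ _)); rewrite -(addrA (4 * lam * e)); apply: lerD.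
  have e2p : `|- 2 * p| = 2 * p by rewrite normrM normrN (gtr0_norm p0) gtr0_norm. rewrite normrM e2p.
  apply: (@le_trans _ _ (2 * lam * (2 * e))); last by rewrite le_eqVlt; apply/orP; left; apply/eqP; ring.
  by apply: ler_pM => //; [rewrite mulr_ge0// ltW|rewrite ler_pM2l].
apply: (le_trans (ler_normD _ _)); apply: lerD.
  have pp := ltW p0; have pp' := ltW p'0; have DD := ltW Dl0.
  rewrite eP ger0_norm; last by do ?[exact: DD|done|apply: mulr_ge0].
  have -> : 2 * p * Dl * zz * (2 * p * p' * Dl) = 4 * (p * (p * p')) * Dl ^+ 2 * zz by ring.
  apply: ler_pM => //; first by do ?[exact: sqr_ge0|done|apply: mulr_ge0]. apply: ler_wpM2r; first exact: sqr_ge0.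
  rewrite ler_pM2l// !exprS expr0 mulr1. by apply: ler_pM => //; [rewrite mulr_ge0|apply: ler_pM].
rewrite normrM ger0_norm; last by rewrite mulr_ge0// sqr_ge0.
rewrite -(mulrA (2 * lam ^+ 2)); apply: ler_pM => //; first by rewrite mulr_ge0// sqr_ge0.
by rewrite ler_pM2l// ler_sqr ?nnegrE ?(ltW p0) ?(ltW l0).
Qed.

Lemma path_bound : `|logX z b - (phi 0 * z 0 - phi (tc js) * z (tc js) +
    delta * \sum_(0 <= j < js) phi (tc j) * Dl)| <=
  J%:R * (4 * lam * e + 4 * lam ^+ 3 * Dl ^+ 2 * Zm + 2 * lam ^+ 2 * Dl * w).
Proof.
set c := (4 * lam * e + _ + _).
have c0 : 0 <= c.
  have e0 : 0 <= e by apply: le_trans (hRS (leq0n J)). have w0 : 0 <= w.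
    by apply: le_trans (hw (s := 0) (t := 0) _ _ _); rewrite ?lexx ?(ltW y0)// subrr normr0 ltW.
  have Z0 : 0 <= Zm by apply: (le_trans (z0 (lexx 0))); apply: hZ; rewrite lexx ltW.
  by rewrite /c !addr_ge0// !mulr_ge0 ?exprn_ge0// ltW.
have -> : logX z b = \sum_(0 <= j < js) blk j.
  rewrite /logX big_nat_mul (big_cat_nat (n := js))//= [X in _ + X]big_nat [X in _ + X]big1 ?addr0//.
  by move=> j /andP[h1 h2]; exact: blk_inactive.
have -> : phi 0 * z 0 - phi (tc js) * z (tc js) + delta * \sum_(0 <= j < js) phi (tc j) * Dl =
    \sum_(0 <= j < js) tgt j.
  rewrite /tgt big_split /= -mulr_sumr; congr (_ + _).
  have := telescope_sumr (fun j => - (phi (tc j) * z (tc j))) (leq0n js).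
  rewrite tc0 opprK addrC => <-; apply: eq_bigr => j _; by rewrite opprK addrC.
rewrite -sumrB; apply: (le_trans (ler_norm_sum _ _ _)).
apply: (@le_trans _ _ (\sum_(0 <= j < js) c)).
  by rewrite big_nat [leRHS]big_nat; apply: ler_sum => j /andP[_ h]; exact: blk_active.
by rewrite sumr_const_nat subn0 -[leLHS]mulr_natl; apply: ler_wpM2r => //; rewrite ler_nat.
Qed.

End path.

Lemma phi_sum_le js : (js <= J)%N -> \sum_(0 <= j < js) phi (tc j) * (y / J%:R) <= - lphi 0.
Proof.
move=> jsJ; apply: (@le_trans _ _ (\sum_(0 <= j < js) (lphi (tc j.+1) - lphi (tc j)))).
  rewrite big_nat [leRHS]big_nat; apply: ler_sum => j /andP[_ h]; have jJ := leq_trans h jsJ.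
  rewrite -(tcS j); apply: lphi_diff_ge => //; last by have /andP[] := tc_bound jJ.
  by rewrite -subr_ge0 tcS divr_ge0 ?ler0n// ltW.
rewrite telescope_sumr// tc0 gerDr; apply: lphi_le0 => //; by have /andP[] := tc_bound jsJ.
Qed.

(** Right sums of the increasing function phi dominate its integral [- lphi 0], and they exceed the
    left sums by the increment of phi times the length of a cell. *)
Lemma phi_sum_ge : - lphi 0 - lam * (y / J%:R) <= \sum_(0 <= j < J) phi (tc j) * (y / J%:R).
Proof.
have h : \sum_(0 <= j < J) (lphi (tc j.+1) - lphi (tc j)) <= \sum_(0 <= j < J) phi (tc j.+1) * (y / J%:R).
  rewrite big_nat [leRHS]big_nat; apply: ler_sum => j /andP[_ jJ].
  rewrite -(tcS j); apply: lphi_diff_le => //; last by have /andP[] := tc_bound jJ.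
  by rewrite -subr_ge0 tcS divr_ge0 ?ler0n// ltW.
rewrite telescope_sumr// tcJ tc0 lphi_y add0r in h.
have Dl0 : 0 < y / J%:R by rewrite divr_gt0// ltr0n.
have e : \sum_(0 <= j < J) phi (tc j.+1) * (y / J%:R) - \sum_(0 <= j < J) phi (tc j) * (y / J%:R) <= lam * (y / J%:R).
  rewrite -sumrB (eq_bigr (fun j => (phi (tc j.+1) - phi (tc j)) * (y / J%:R))); last first.
    by move=> j _; rewrite mulrBl.
  rewrite -mulr_suml telescope_sumr// tcJ tc0 phi_y ler_pM2r// gerBl ltW//. by apply: phi_gt0 => //; exact: ltW.
lra.
Qed.

End grid.

Section pathlim.
Context (R : realType) (y lam delta K : R) (Nk : nat -> nat) (z b I : R -> R).
Hypotheses (y0 : 0 < y) (l0 : 0 < lam) (d0 : 0 <= delta) (K0 : 0 < K) (N0 : forall k, (0 < Nk k)%N).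
Hypotheses (z0 : forall t, 0 <= t -> 0 <= z t) (cz : {within `[0, +oo[%classic, continuous z}).
Hypotheses (zI : forall t, 0 <= t -> z t = z 0 + delta * t + 2 * I t).
Hypothesis hRS : \forall k \near \oo, forall j, (j <= k.+1)%N ->
  `|RS y k.+1 (Nk k) z b j - I (tc y k.+1 (Nk k) j)| <= k.+1%:R^-1 ^+ 2.

Let near_inv (c : R) : 0 < c -> \forall k \near \oo, k.+1%:R^-1 < c.
Proof. by move=> c0; exact: (near_infty_natSinv_lt (PosNum c0)). Qed.

Lemma path_ub : exists2 Zm : R, 0 <= Zm & forall t, 0 <= t <= y -> z t <= Zm.
Proof.
have cz' : {within `[0, y]%classic, continuous z}.
  by apply: continuous_subspaceW cz => t /=; rewrite !in_itv/= => /andP[-> _].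
have [c c0 hc] := EVT_max (ltW y0) cz'; exists (z c).
  by apply: z0; move: c0; rewrite in_itv/= => /andP[].
by move=> t ht; apply: hc; rewrite in_itv.
Qed.

(** Over k + 1 cells the Riemann errors [1/(k+1)^2] and the second-order terms add up to order
    [1/(k+1)]; the oscillation term is kept below eps/2 by the choice of w. *)
Lemma path_close (eps : R) : 0 < eps -> \forall k \near \oo, forall js, (js <= k.+1)%N ->
  (forall j, (j < k.+1)%N -> act y K k.+1 (Nk k) z j = (j < js)%N%:R) ->
  (forall j, (j < js)%N -> z (tc y k.+1 (Nk k) j) <= K) -> `|logX y lam K k.+1 (Nk k) z b - (phi y lam 0 * z 0 -
     phi y lam (tc y k.+1 (Nk k) js) * z (tc y k.+1 (Nk k) js) +
     delta * \sum_(0 <= j < js) phi y lam (tc y k.+1 (Nk k) j) * (y / k.+1%:R))| <= eps.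
Proof.
move=> eps0; have [Zm Zm0 hZm] := path_ub.
pose w := Num.min K (eps / (4 * lam ^+ 2 * y)).
have q0 : 0 < 4 * lam ^+ 2 * y by rewrite !mulr_gt0// exprn_gt0.
have w0 : 0 < w by rewrite lt_min K0 divr_gt0.
have [eta eta0 heta] := unif_cont_itv y cz w0.
pose c := 4 * lam + 4 * lam ^+ 3 * y ^+ 2 * Zm.
have c0 : 0 < c by rewrite ltr_pwDl ?mulr_gt0// mulr_ge0// !mulr_ge0 ?exprn_ge0// ltW.
have n1 := near_inv (divr_gt0 eta0 y0); have n2 := near_inv (divr_gt0 eps0 (mulr_gt0 (ltr0Sn R 1) c0)).
move: n1 n2 hRS; apply: filterS3 => k h1 h2 h3 js jsk ha hK.
have wle : w <= eps / (4 * lam ^+ 2 * y) by rewrite ge_min lexx orbT.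
have hw s t : 0 <= s <= y -> 0 <= t <= y -> `|s - t| <= y / k.+1%:R -> `|z s - z t| <= w.
  move=> hs ht st; apply: heta => //; apply: (le_lt_trans st). by move: h1; rewrite ltr_pdivlMr// mulrC.
have wK : w <= K by rewrite ge_min lexx.
have pb := path_bound y0 l0 (ltn0Sn k) (N0 k) z0 zI h3 hw wK hZm jsk ha hK.
apply: (le_trans pb).
have -> : k.+1%:R * (4 * lam * k.+1%:R^-1 ^+ 2 + 4 * lam ^+ 3 * (y / k.+1%:R) ^+ 2 * Zm +
    2 * lam ^+ 2 * (y / k.+1%:R) * w) = c * k.+1%:R^-1 + 2 * lam ^+ 2 * y * w.
  have : (k.+1%:R : R) != 0 by rewrite pnatr_eq0. by rewrite /c; move: (k.+1%:R : R) => jj jj0; field.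
have b1 : c * k.+1%:R^-1 <= eps / 2.
  by have := ltW h2; rewrite ler_pdivlMr ?mulr_gt0// => h; rewrite ler_pdivlMr//; apply: le_trans h; rewrite le_eqVlt; apply/orP; left; apply/eqP; ring.
have b2 : 2 * lam ^+ 2 * y * w <= eps / 2.
  by move: wle; rewrite ler_pdivlMr// => h; rewrite ler_pdivlMr//; apply: le_trans h; rewrite le_eqVlt; apply/orP; left; apply/eqP; ring.
by apply: (le_trans (lerD b1 b2)); rewrite -splitr.
Qed.

Let A := - delta * lphi y lam 0.
Let X k := expR (- phi y lam 0 * z 0) * expR (logX y lam K k.+1 (Nk k) z b).

(** Dropping the nonnegative term phi times Z leaves a bound that depends neither on K nor on the
    path; only the rank from which it holds may do so. *)
Lemma path_bounded : \forall k \near \oo, X k <= expR (1 + A).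
Proof.
have := path_close (ltr01 : 0 < 1 :> R); apply: filterS => k h.
have [js jsk [ha hK]] := act_step y K k.+1 (Nk k) z.
have := h js jsk ha hK; move=> /ler_normlP[_ h1].
rewrite /X -expRD ler_expR.
have := phi_sum_le y0 l0 (ltn0Sn k) (N0 k) jsk => hs.
have /andP[t0 ty] := tc_bound y0 (ltn0Sn k) (N0 k) jsk.
have p1 : 0 <= phi y lam (tc y k.+1 (Nk k) js) * z (tc y k.+1 (Nk k) js).
  by rewrite mulr_ge0 ?z0// ltW// phi_gt0.
have := ler_wpM2l d0 hs; move: h1 p1; rewrite /A.
set u := phi _ _ _ * z (tc _ _ _ _); set v := delta * \sum_(_ <= _ < _) _; set p := phi y lam 0 * z 0.
rewrite !mulNr -/p mulrN; lra.
Qed.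

Lemma path_cvg : (forall k j, (j <= k.+1)%N -> z (tc y k.+1 (Nk k) j) <= K) ->
  X k @[k --> \oo] --> expR (- lam * z y + A).
Proof.
move=> hK; rewrite /X; under eq_fun do rewrite -expRD.
apply: (continuous_cvg _ (@continuous_expR R _)).
apply/cvgrPdist_le => eps eps0.
have c0 : 0 < delta * lam * y + 1 by rewrite ltr_wpDl// !mulr_ge0// ltW.
have n1 := near_inv (divr_gt0 (divr_gt0 eps0 (ltr0Sn R 1)) c0).
have := path_close (divr_gt0 eps0 (ltr0Sn R 1)); move: n1; apply: filterS2 => k h1 h2.
have ha j : (j < k.+1)%N -> act y K k.+1 (Nk k) z j = (j < k.+1)%N%:R.
  move=> jk; rewrite jk /act big1// => i _; rewrite hK//. by apply: ltnW; exact: leq_trans (ltn_ord i) jk.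
have hK' j : (j < k.+1)%N -> z (tc y k.+1 (Nk k) j) <= K by move=> jk; apply: hK; exact: ltnW.
have := h2 k.+1 (leqnn _) ha hK'; rewrite tcJ// phi_y => h3.
have h4 := phi_sum_le y0 l0 (ltn0Sn k) (N0 k) (leqnn k.+1).
have h5 := phi_sum_ge y0 l0 (ltn0Sn k) (N0 k).
have h6 : delta * (lam * (y / k.+1%:R)) <= eps / 2.
  move: h1; rewrite ltr_pdivlMr// => /ltW; apply: le_trans.
  have -> : delta * (lam * (y / k.+1%:R)) = k.+1%:R^-1 * (delta * lam * y) by ring. by rewrite ler_pM2l// lerDl.
have := ler_wpM2l d0 h4; have := ler_wpM2l d0 h5; move: h3 h6; rewrite /A.
set v := \sum_(_ <= _ < _) _; set p := phi y lam 0 * z 0; set X0 := logX _ _ _ _ _ _ _.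
rewrite !mulNr -/p mulrBr mulrN => h3 h6 h7 h8; rewrite ler_norml; move: h3; rewrite ler_norml.
move: h6 h7 h8; move: (delta * v) (delta * lphi y lam 0) (delta * (lam * (y / k.+1%:R))) => a1 a2 a3.
by move=> h6 h7 h8 /andP[h9 h10]; apply/andP; split; lra.
Qed.

End pathlim.

Lemma measurable_sqrtr (R : realType) : mfT (@Num.sqrt R).
Proof. by apply: continuous_measurable_fun; exact: sqrt_continuous. Qed.

Lemma tc_indep (R : realType) (y : R) (J N N' j : nat) : (0 < J)%N -> (0 < N)%N -> (0 < N')%N ->
  tc y J N j = tc y J N' j.
Proof.
move=> J0 N0 N'0; rewrite /tc /sg /mesh !natrM.
have : (J%:R : R) != 0 by rewrite pnatr_eq0 -lt0n.
have : (N%:R : R) != 0 by rewrite pnatr_eq0 -lt0n.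
have : (N'%:R : R) != 0 by rewrite pnatr_eq0 -lt0n.
by move: (J%:R : R) (N%:R : R) (N'%:R : R) (j%:R : R) => a b c e; move=> c0 b0 a0; field; rewrite a0 b0 c0.
Qed.

(** * Riemann sums of the Ito integral along the grids *)

Section ito_grid.
Context d (Om : mtype d) (R : realType) (P : prob Om R).
Variables (y : R) (Z B I : R -> Om -> R).
Hypotheses (y0 : 0 < y) (ito : forall t, 0 <= t -> ito_integral P (fun s w => Num.sqrt (Z s w)) B t (I t)).
Hypotheses (I0 : forall w, I 0 w = 0).
Hypotheses (mZ : forall t, 0 <= t -> mfT (Z t)) (mB : forall t, 0 <= t -> mfT (B t)).

Definition err J N (e : R) (j : nat) : set Om := [set w | e <= `|RS y J N (Z ^~ w) (B ^~ w) j - I (tc y J N j) w|].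

Lemma sg_ge0 J N i : 0 <= sg y J N i.
Proof. by rewrite mulr_ge0// divr_ge0// ltW. Qed.

Lemma measurable_err J N e j : measurable (err J N e j).
Proof.
rewrite /err -[X in measurable X]setTI.
apply: (measurable_fun_le measurableT); first exact: mcst.
apply: (mcomp (@normr_measurable R setT)); apply: mfB; last first.
  by have [] := ito (sg_ge0 J N (j * N)).
apply: measurable_sum => i; apply: mfM.
  by apply: (mcomp (@measurable_sqrtr R)); apply: mZ; exact: sg_ge0.
by apply: mfB; apply: mB; exact: sg_ge0.
Qed.

(** The fine grid up to a coarse time is an admissible partition of small mesh, and the finitely
    many coarse times are treated together. *)
Lemma err_small J (e eta : R) : (0 < J)%N -> 0 < e -> 0 < eta ->
  \forall N \near \oo, forall j : 'I_J.+1, (P (err J N.+1 e j) <= eta%:E)%E.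
Proof.
move=> J0 e0 eta0; apply: filter_forall => j.
have t0 : 0 <= tc y J 1 j by exact: sg_ge0.
have [_ /(_ e eta e0 eta0)[h h0 hh]] := ito t0.
have := near_infty_natSinv_lt (PosNum (divr_gt0 h0 y0)); apply: filterS => N /= hN.
have [j0|j0] := posnP (val j).
  have -> : err J N.+1 e j = set0.
    apply/seteqP; split=> // w; rewrite /err /= j0 /RS /tc /sg mul0n big_geq// mul0r I0 subrr normr0.
    by rewrite leNgt e0.
  by rewrite measure0 lee_fin ltW.
pose s := mkseq (fun i => sg y J N.+1 i.+1) (j * N.+1).
have m0 : 0 < mesh y J N.+1 by exact: mesh_gt0.
have nS i : (i <= j * N.+1)%N -> (0 :: s)`_i = sg y J N.+1 i.
  by case: i => [|i] /= ij; [rewrite /sg mul0r|rewrite nth_mkseq].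
have szs : size s = (j * N.+1)%N by rewrite size_mkseq.
have := hh s; have -> : tc y J 1 j = tc y J N.+1 j by exact: tc_indep.
have eL w : left_riemann_sum (fun x => Num.sqrt (Z x w)) (B ^~ w) s = RS y J N.+1 (Z ^~ w) (B ^~ w) j.
  rewrite /left_riemann_sum szs; apply: eq_big_nat => i /andP[_ ij]. by rewrite !nS//; exact: ltnW.
under [X in P X]eq_fun do rewrite eL.
apply.
  split.
    apply/(pathP 0) => i; rewrite szs => ij; rewrite -[X in _ < X]/((0 :: s)`_i.+1) !nS//; last exact: ltnW.
    by rewrite /sg ltr_pM2r// ltr_nat.
  have -> : last 0 s = (0 :: s)`_(size s) by rewrite (last_nth 0). by rewrite szs nS.
move=> i; rewrite szs => ij; rewrite !nS//; last exact: ltnW.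
rewrite /sg -mulrBl -natrB// subSnn mul1r /mesh.
apply: (@le_lt_trans _ _ (y / N.+1%:R)); last by move: hN; rewrite ltr_pdivlMr// mulrC.
rewrite ler_pM2l// lef_pV2 ?posrE ?ltr0n ?muln_gt0 ?J0// ler_nat.
by rewrite leq_pmull.
Qed.

(** Convergence in probability allows [Nk k] to be chosen so large that the probabilities of a bad
    error are summable over k; the Borel-Cantelli lemma makes the statement almost sure. *)
Lemma ito_grid_cvg : exists2 Nk : nat -> nat, forall k, (0 < Nk k)%N &
  {ae P, forall w, \forall k \near \oo, forall j, (j <= k.+1)%N ->
    `|RS y k.+1 (Nk k) (Z ^~ w) (B ^~ w) j - I (tc y k.+1 (Nk k) j) w| <= k.+1%:R^-1 ^+ 2}.
Proof.
pose e k : R := k.+1%:R^-1 ^+ 2.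
(* The division by k + 2 shares the bound among the coarse times 0 to k + 1; the remaining powers of
   1/2 have sum at most 1. *)
pose eta k : R := (1 / (2 ^ k.+1)%:R) / k.+2%:R.
have h k : exists N, (0 < N)%N /\ forall j : 'I_k.+2, (P (err k.+1 N (e k) j) <= (eta k)%:E)%E.
  have e0 : 0 < e k by rewrite exprn_gt0// invr_gt0.
  have n0 : 0 < eta k by rewrite divr_gt0// divr_gt0// ltr0n expn_gt0. have [N _ hN] := err_small (ltn0Sn k) e0 n0.
  by exists N.+1; split=> // j; exact: (hN N (leqnn N) j).
have [Nk hNk] := choice h; exists Nk; first by move=> k; have [] := hNk k.
pose bad k := \big[setU/set0]_(j < k.+2) err k.+1 (Nk k) (e k) j.
have mbad k : measurable (bad k) by apply: bigsetU_measurable => j _; exact: measurable_err.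
exists (lim_sup_set bad); split.
- by apply: bigcap_measurable => // n _; apply: bigcup_measurable => k _; exact: mbad.
- apply: lim_sup_set_cvg0 => //; apply: (@le_lt_trans _ _ 1%:E); last exact: ltry.
  apply: (le_trans _ (@epsilon_trick0 R 1 xpredT ler01)). apply: lee_nneseries => k; first by [].
  move=> _; apply: (@le_trans _ _ (\sum_(j < k.+2) P (err k.+1 (Nk k) (e k) j))%E).
    by apply: (Boole_inequality P) => j _; exact: measurable_err.
  apply: (@le_trans _ _ (\sum_(j < k.+2) (eta k)%:E)%E).
    by apply: lee_sum => j _; have [_] := hNk k; exact.
  rewrite sumEFin lee_fin sumr_const card_ord -[X in X <= _]mulr_natr /eta. by rewrite divfK// pnatr_eq0.
- move=> w nw n _; apply: contrapT => nb; apply: nw.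
  exists n => // k nk j jk; rewrite leNgt; apply/negP => hj; apply: nb.
  exists k => //; rewrite /bad -bigcup_mkord; exists j => //. by rewrite /err /= ltW.
Qed.

End ito_grid.

Lemma measurable_le_ind (R : realType) (K : R) : mfT (fun x : R => ((x <= K)%R%:R : R)).
Proof.
rewrite (_ : (fun x : R => _) = \1_(`]-oo, K]%classic)); first exact: measurable_indic.
apply/funext => x; rewrite indicE; congr (_%:R); congr nat_of_bool.
by apply/idP/idP; rewrite inE /= in_itv.
Qed.

Section truncation.
Context d (Om : mtype d) (R : realType) (P : prob Om R).

Lemma bmf_trunc (X : Om -> R) (M : R) : mfT X -> (forall w, 0 <= X w) -> 0 <= M -> bmf (fun w => Num.min (X w) M).
Proof.
move=> mX X0 M0; split; first by apply: measurable_minr => //; exact: mcst.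
by exists M => w; rewrite ger0_norm ?le_min ?X0// ge_min lexx orbT.
Qed.

(** Where X exceeds M it is at most [X^2 / M], so truncation costs at most C / M of the mean. *)
Lemma trunc_mean (X xi : Om -> R) (C M : R) : mfT X -> (forall w, 0 <= X w) ->
  bmf xi -> (forall w, 0 <= xi w) -> 0 < M -> (\int[P]_w (X w)%:E = \int[P]_w (xi w)%:E)%E ->
  (\int[P]_w (X w ^+ 2)%:E <= C%:E)%E -> `|Ex P (fun w => Num.min (X w) M) - Ex P xi| <= C / M.
Proof.
move=> mX X0 bxi xi0 M0 eX qX; have bT := bmf_trunc mX X0 (ltW M0).
have fP := Pfin P; have m0 w : 0 <= Num.min (X w) M by rewrite le_min X0 ltW.
have mE (f : Om -> R) : mfT f -> mfT (fun w => (f w)%:E).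
  by move=> mf; exact/mEFin.
have mX2 : mfT (fun w => X w ^+ 2) by exact: measurable_funX.
have mX2M : mfT (fun w => M^-1 * X w ^+ 2) by exact: mfM.
have C0 : 0 <= C by rewrite -lee_fin; apply: le_trans qX; apply: integral_ge0 => w _; rewrite lee_fin sqr_ge0.
have h1 : Ex P (fun w => Num.min (X w) M) <= Ex P xi.
  rewrite -lee_fin !ExE// -eX; apply: ge0_le_integral => //.
  - by move=> w _; rewrite lee_fin.
  - by apply: mE; exact: bT.1.
  - exact: mE.
  - by move=> w _; rewrite lee_fin ge_min lexx.
have h2 : Ex P xi <= Ex P (fun w => Num.min (X w) M) + C / M.
  rewrite -lee_fin EFinD !ExE// -eX.
  apply: (@le_trans _ _ (\int[P]_w ((Num.min (X w) M)%:E + (M^-1 * X w ^+ 2)%:E))%E).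
    apply: ge0_le_integral => //.
    - by move=> w _; rewrite lee_fin.
    - exact: mE.
    - by apply: emeasurable_funD; apply: mE => //; exact: bT.1.
    - move=> w _; rewrite -EFinD lee_fin; case: (leP (X w) M) => h.
        by rewrite lerDl mulr_ge0 ?sqr_ge0// invr_ge0 ltW.
      apply: ler_wpDl; first exact: ltW. by rewrite mulrC ler_pdivlMr// expr2 ler_wpM2l// ltW.
  rewrite ge0_integralD//; last 4 first.
  - by move=> w _; rewrite lee_fin.
  - by apply: mE; exact: bT.1.
  - by move=> w _; rewrite lee_fin mulr_ge0 ?sqr_ge0// invr_ge0 ltW.
  - exact: mE. apply: leeD => //; under eq_integral do rewrite EFinM. rewrite ge0_integralZl//; last 3 first.
  - exact: mE.
  - by move=> w _; rewrite lee_fin sqr_ge0.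
  - by rewrite lee_fin invr_ge0 ltW.
  rewrite mulrC EFinM; apply: lee_pmul => //; first by rewrite lee_fin invr_ge0 ltW.
  by apply: integral_ge0 => w _; rewrite lee_fin sqr_ge0.
have : 0 <= C / M by rewrite divr_ge0// ltW.
by rewrite ler_norml => h3; apply/andP; split; lra.
Qed.

End truncation.

(** * Laplace transform of BESQ at a fixed time *)

Section besq_laplace.
Context d (Om : mtype d) (R : realType) (P : prob Om R).
Variables (F : R -> set (set Om)) (B Z I : R -> Om -> R) (y lam delta : R).
Hypotheses (y0 : 0 < y) (l0 : 0 < lam) (d0 : 0 <= delta) (hF : filtration F) (hB : brownian_motion P F B).
Hypotheses (aZ : adapted F Z) (Z0 : forall w t, 0 <= t -> 0 <= Z t w).
Hypotheses (cZ : forall w, {within `[0, +oo[%classic, continuous (Z ^~ w)}).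
Hypotheses (ito : forall t, 0 <= t -> ito_integral P (fun s w => Num.sqrt (Z s w)) B t (I t)).
Hypotheses (ZI : forall w t, 0 <= t -> Z t w = Z 0 w + delta * t + 2 * I t w).

Let adapted_mfun (X : R -> Om -> R) s t : 0 <= s -> s <= t -> adapted F X -> mfun_in (F t) (X s).
Proof.
move=> s0 st aX; apply/mfun_inP => A /(aX s s0) FA; apply: sub_sa.
by have [_ _ h] := hF; exact: h FA.
Qed.

Let Fm t : 0 <= t -> F t `<=` measurable. Proof. by have [_ h _] := hF; exact: h. Qed.

Let mZ t : 0 <= t -> mfT (Z t).
Proof. by move=> t0; exact: (mfun_inM (Fm t0) (adapted_mfun t0 (lexx t) aZ)). Qed.

Let mB t : 0 <= t -> mfT (B t).
Proof.
by move=> t0; have [aB _ _ _ _] := hB; exact: (mfun_inM (Fm t0) (adapted_mfun t0 (lexx t) aB)).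
Qed.

Let xi (w : Om) : R := expR (- phi y lam 0 * Z 0 w).

Let xi01 w : 0 <= xi w <= 1.
Proof.
rewrite expR_ge0 /= /xi -expR0 ler_expR mulNr oppr_le0 mulr_ge0 ?Z0//.
by rewrite ltW// phi_gt0// ltW.
Qed.

Let mexpZ (c : R) t : 0 <= t -> mfT (fun w => expR (c * Z t w)).
Proof.
by move=> t0; apply: mexpR; apply: mfM => //; exact: mZ.
Qed.

Let bxi : bmf xi. Proof. by apply: bmf01 => //; exact: mexpZ. Qed.

Let Xs K J N w := xi w * expR (logX y lam K J N (Z ^~ w) (B ^~ w)).

Let Th K : R := 2 * lam * Num.sqrt (2 * K).

(** On a fixed grid the approximating exponential is an instance of [gmart] with a bounded adapted
    integrand; its second moment is bounded independently of the grid. *)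
Let Xs_facts K J N : 0 < K -> (0 < J)%N -> (0 < N)%N ->
  [/\ mfT (Xs K J N), (\int[P]_w (Xs K J N w)%:E = \int[P]_w (xi w)%:E)%E &
      (\int[P]_w (Xs K J N w ^+ 2)%:E <= (expR (Th K ^+ 2 * y))%:E)%E].
Proof.
move=> K0 J0 N0; have [aB _ _ iB nB] := hB; have h0 : 0 < mesh y J N by exact: mesh_gt0.
have sg0 i : 0 <= sg y J N i by exact: sg_ge0.
have sg_le i j : (i <= j)%N -> sg y J N i <= sg y J N j by move=> ij; rewrite ler_pM2r// ler_nat.
have sgS i : sg y J N i.+1 - sg y J N i = mesh y J N by rewrite -mulrBl -natrB// subSnn mul1r.
have sg_lt i : sg y J N i < sg y J N i.+1 by rewrite -subr_gt0 sgS.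
pose G i := F (sg y J N i).
(* Beyond the grid the integrand is set to 0, so that one bound holds for all i. *)
pose th i w := if (i < J * N)%N then thp y lam K J N (Z ^~ w) i else 0.
pose D i w := dB y J N (B ^~ w) i.
have sF i : sigma_algebra setT (G i) by have [h _ _] := hF; exact: h.
have Gm i : G i `<=` measurable by exact: Fm.
have Gmono i : G i `<=` G i.+1 by have [_ _ h] := hF; apply: h => //; exact: ltW.
have mth i : mfun_in (G i) (th i).
  rewrite /th; case: ltnP => iJ; last exact: mcst. rewrite /thp; apply: mfM.
    apply: mfM; first exact: mcst. rewrite /act; apply: measurable_prod => j _.
    have mj : mfun_in (G i) (Z (tc y J N j)).
      apply: (@adapted_mfun Z (tc y J N j) (sg y J N i)); [exact: sg0| |exact: aZ]; apply: sg_le.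
      by apply: (leq_trans _ (leq_trunc_div i N)); rewrite leq_mul2r -ltnS ltn_ord orbT.
    exact: (mcomp (measurable_le_ind K) mj).
  apply: (mcomp (@measurable_sqrtr R)); apply: measurable_minr; last exact: mcst.
  by apply: (@adapted_mfun Z (sg y J N i)); [exact: sg0|exact: lexx|exact: aZ].
have mD i : mfun_in (G i.+1) (D i) by apply: mfB; apply: adapted_mfun => //; exact: ltW.
have iD i : independent2 P (G i) (sigma_rv (D i)) by exact: iB.
have hD i (A : set R) : measurable A -> P (D i @^-1` A) = normal_prob 0 (Num.sqrt (mesh y J N)) A.
  by move=> mA; rewrite -(sgS i); exact: nB.
have mx0 : mfun_in (G 0%N) xi.
  apply: mexpR; apply: mfM; first exact: mcst. by apply: adapted_mfun => //; rewrite /sg mul0r.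
have thb i w : `|th i w| <= Th K.
  have T0 : 0 <= Th K by rewrite mulr_ge0 ?sqrtr_ge0// mulr_ge0// ltW.
  rewrite /th; case: ltnP => iJ; last by rewrite normr0. have /andP[t0 ty] : 0 <= tc y J N (i %/ N) <= y.
    by apply: tc_bound => //; rewrite ltnW// ltn_divLR// mulnC.
  have p1 := phi_gt0 l0 ty; have p2 := phi_le l0 ty. have a0 : 0 <= act y K J N (Z ^~ w) (i %/ N) <= 1.
    rewrite /act; elim/big_rec: _ => [|j x _ /andP[x0 x1]]; first by rewrite ler01 lexx.
    by case: (_ <= K); rewrite ?mul1r ?mul0r ?x0 ?x1 ?lexx ?ler01.
  have /andP[a1 a2] := a0.
  rewrite /thp /Th ger0_norm; last by do ?[exact: sqrtr_ge0|exact: a1|exact: (ltW p1)|done|apply: mulr_ge0].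
  apply: ler_pM; first by do ?[exact: a1|exact: (ltW p1)|done|apply: mulr_ge0].
  - exact: sqrtr_ge0.
  - rewrite -[leRHS]mulr1; apply: ler_pM => //; first by rewrite mulr_ge0 ?(ltW p1). by rewrite ler_pM2l.
  - by rewrite ler_sqrt ?mulr_ge0 ?(ltW K0)// ge_min lexx orbT.
have eX w : Xs K J N w = gmart (mesh y J N) th D xi (J * N) w.
  rewrite /Xs /gmart /logX big_mkord; congr (_ * expR _); apply: eq_bigr => i _. by rewrite /th ltn_ord.
have -> : Xs K J N = gmart (mesh y J N) th D xi (J * N) by apply/funext.
split; first exact: (gmart_measurable _ Gm Gmono mth mD mx0 _).
  exact: (gmart_mean h0 sF Gm Gmono mth mD iD hD mx0 xi01 _).
have := gmart_sq h0 sF Gm Gmono mth mD iD hD mx0 xi01 thb (J * N).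
have -> : (J * N)%:R * (Th K ^+ 2 * mesh y J N) = Th K ^+ 2 * y; last by [].
rewrite /mesh; have : ((J * N)%:R : R) != 0 by rewrite pnatr_eq0 muln_eq0 negb_or -!lt0n J0.
by move: ((J * N)%:R : R) => x x0; field.
Qed.

Let A := - delta * lphi y lam 0.
(** Eventual bound of the approximating exponentials along almost every path, the same for every
    K. *)
Let c := expR (1 + A).
Let L w := expR (- lam * Z y w + A).

Let L01 w : 0 <= L w <= c.
Proof.
rewrite expR_ge0 ler_expR lerD2r mulNr (@le_trans _ _ 0)// oppr_le0.
by rewrite mulr_ge0 ?Z0// ltW.
Qed.

Let mL : mfT L.
Proof.
apply: mexpR; apply: mfD; last exact: mcst.
by apply: mfM; [exact: mcst|apply: mZ; exact: ltW].
Qed.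

Let bL : bmf L.
Proof. by split=> //; exists c => w; have /andP[h1 h2] := L01 w; rewrite ger0_norm. Qed.

(** For fixed K the means of the truncated exponentials tend to the mean of xi. On paths that stay
    below K at the grid times the exponentials tend to L. Since c does not depend on K, the event of
    the other paths is removed by letting K grow. *)
Lemma besq_sde_laplace : Ex P xi = Ex P L.
Proof.
have fP := Pfin P.
have I00 w : I 0 w = 0.
  have := ZI w (lexx 0); rewrite mulr0 addr0 => /eqP; rewrite eq_sym -subr_eq0 addrC addKr.
  by rewrite mulf_eq0 pnatr_eq0 /= => /eqP.
have [Nk N0 hNk] := ito_grid_cvg y0 ito I00 mZ mB.
have tc0' k j : 0 <= tc y k.+1 (Nk k) j by exact: sg_ge0.
pose X K k := Xs K k.+1 (Nk k).
have X0 K k w : 0 <= X K k w by rewrite mulr_ge0 ?expR_ge0.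
pose Y K k w := Num.min (X K k w) c.
have c0 : 0 < c by exact: expR_gt0.
have Yc K k w : 0 <= Y K k w <= c by rewrite le_min X0 ltW//= ge_min lexx orbT.
have mX K k : 0 < K -> mfT (X K k) by move=> K0; have [] := Xs_facts K0 (ltn0Sn k) (N0 k).
have bY K k : 0 < K -> bmf (Y K k) by move=> K0; apply: bmf_trunc => //; [exact: mX|exact: ltW].
have evb K : 0 < K -> {ae P, forall w, \forall k \near \oo, X K k w <= c}.
  move=> K0; apply: filterS hNk => w hw.
  exact: (@path_bounded R y lam delta K Nk (Z ^~ w) (B ^~ w) (I ^~ w) y0 l0 d0 K0 N0 (@Z0 w) (@cZ w) (@ZI w) hw).
(* Truncation at a large M nearly preserves the mean by the second moment; truncation at M and at c
   agree for large k along almost every path. *)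
have cY K : 0 < K -> Ex P (Y K k) @[k --> \oo] --> Ex P xi.
  move=> K0; apply/cvgrPdist_le => eps eps0. pose C := expR (Th K ^+ 2 * y); pose M := c + C / (eps / 2).
  have C0 : 0 < C by exact: expR_gt0. have e20 : 0 < eps / 2 by rewrite divr_gt0.
  have M0 : 0 < M by rewrite addr_gt0// divr_gt0. have CM : C / M <= eps / 2.
    rewrite ler_pdivrMr// /M mulrDr [X in _ + X]mulrC divfK ?gt_eqF//. by rewrite lerDr mulr_ge0// ltW.
  have bM k : bmf (fun w => Num.min (X K k w) M) by apply: bmf_trunc => //; [exact: mX|exact: ltW].
  have h0 : Ex P (fun w => Num.min (X K k w) M - Y K k w) @[k --> \oo] --> Ex P (fun=> 0 : R).
    apply: (@Ex_cvg_ae _ _ _ P fP _ _ (M + c)).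
    - by move=> k; apply: mfB; [exact: (bM k).1|exact: (bY K k K0).1].
    - exact: bmf_cst.
    - move=> k w; apply: (le_trans (ler_normB _ _)); apply: lerD.
        by rewrite ger0_norm; [rewrite ge_min lexx orbT|rewrite le_min X0 ltW].
      by have /andP[h1 h2] := Yc K k w; rewrite ger0_norm.
    - apply: filterS (evb K K0) => w hw; apply: (cvg_near_cst _). apply: filterS hw => k hk; rewrite /Y (min_idPl hk).
      rewrite (min_idPl _) ?subrr//; apply: (le_trans hk); rewrite lerDl. by rewrite divr_ge0// ltW.
  rewrite Ex_cst1 in h0; move/cvgrPdist_le: h0 => /(_ _ e20). apply: filterS => k; rewrite sub0r normrN => hk.
  have [_ h1 h2] := Xs_facts K0 (ltn0Sn k) (N0 k).
  have h3 := trunc_mean (mX K k K0) (X0 K k) bxi (fun w => (andP (xi01 w)).1) M0 h1 h2.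
  rewrite (ExB fP (bM k) (bY K k K0)) in hk; rewrite -/C in h3; move: hk h3 CM; rewrite -/(X K k).
  move: (Ex P (fun w => Num.min (X K k w) M)) (Ex P (Y K k)) (Ex P xi) (C / M) => a b e f.
  by rewrite !ler_norml => /andP[? ?] /andP[? ?] ?; apply/andP; split; lra.
(* Only countably many grid times are tested, which makes the set measurable; by continuity on
   [[0, y]] every path belongs to it for large m. *)
pose OK m := [set w | forall k j, (j <= k.+1)%N -> Z (tc y k.+1 (Nk k) j) w <= m.+1%:R].
have mOK m : measurable (OK m).
  have -> : OK m = \bigcap_k \bigcap_(j in [set j | (j <= k.+1)%N]) [set w | Z (tc y k.+1 (Nk k) j) w <= m.+1%:R].
    by apply/seteqP; split=> [w h k _ j jk|w h k j jk]; [exact: h|exact: (h k Logic.I j jk)].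
  apply: bigcap_measurable => // k _; apply: bigcap_measurable => [|j _]; first by exists 0%N.
  rewrite -[X in measurable X]setTI; apply: (measurable_fun_le measurableT); last exact: mcst. exact: mZ.
pose g m w : R := \1_(OK m) w.
have g01 m w : 0 <= g m w <= 1 by rewrite /g indicE; case: (_ \in _); rewrite ?ler01 ?lexx.
have bg m : bmf (g m) by exact: bmf_indic.
have b1g m : bmf (fun w => c * (1 - g m w)).
  by apply: bmfM; [exact: bmf_cst|apply: bmfB => //; exact: bmf_cst].
have key m : `|Ex P xi - Ex P L| <= Ex P (fun w => c * (1 - g m w)).
  have K0 : (0 : R) < m.+1%:R by []. have bYL k : bmf (fun w => Y m.+1%:R k w - L w) by apply: bmfB => //; exact: bY.
  have YLc k w : `|Y m.+1%:R k w - L w| <= c.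
    have /andP[h1 h2] := Yc m.+1%:R k w; have /andP[h3 h4] := L01 w. by rewrite ler_norml; apply/andP; split; lra.
  pose f k w := (Y m.+1%:R k w - L w) * g m w. have bf k : bmf (f k) by exact: bmfM.
  have cf : Ex P (f k) @[k --> \oo] --> (0 : R).
    rewrite -(Ex_cst1 P (0 : R)); apply: (@Ex_cvg_ae _ _ _ P fP _ _ c).
    - by move=> k; exact: (bf k).1.
    - exact: bmf_cst.
    - move=> k w; rewrite normrM -[leRHS]mulr1; have /andP[h1 h2] := g01 m w.
      by apply: ler_pM => //; rewrite ger0_norm.
    - have ae := evb _ K0; move: ae hNk; apply: filterS2 => w h1 h2; rewrite /f /g.
      have [wK|wK] := pselect (OK m w); last first.
        rewrite indicE memNset//; under eq_fun do rewrite mulr0; exact: cvg_cst.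
      rewrite indicE mem_set//; under eq_fun do rewrite mulr1.
      have := @path_cvg R y lam delta _ Nk (Z ^~ w) (B ^~ w) (I ^~ w) y0 l0 d0 K0 N0 (@Z0 w) (@cZ w) (@ZI w) h2 wK.
      rewrite -/A -[X in _ --> X]/(L w) => h3; rewrite -(subrr (L w)); apply: cvgB; last exact: cvg_cst.
      apply: cvg_trans h3; apply: near_eq_cvg; apply: filterS h1 => k hk. by rewrite /Y (min_idPl hk).
  have c1 : `|Ex P (Y m.+1%:R k) - Ex P L - Ex P (f k)| @[k --> \oo] --> `|Ex P xi - Ex P L - 0|.
    by apply: cvg_norm; apply: cvgB => //; apply: cvgB; [exact: cY|exact: cvg_cst].
  rewrite subr0 in c1; apply: (ler_cvg_to c1 (cvg_cst _)); apply: nearW => k. rewrite -ExB//; last exact: bY.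
  rewrite -ExB//; apply: le_norm_Ex => //; first exact: bmfB. move=> w; rewrite /f -[X in X - _]mulr1 -mulrBr normrM.
  have /andP[h1 h2] := g01 m w; have h3 : 0 <= 1 - g m w by rewrite subr_ge0.
  by apply: ler_pM => //; rewrite ger0_norm.
have cg : Ex P (fun w => c * (1 - g m w)) @[m --> \oo] --> (0 : R).
  rewrite -(Ex_cst1 P (0 : R)); apply: (@Ex_cvg _ _ _ P fP _ _ c).
  - by move=> m; exact: (b1g m).1.
  - move=> m w; have /andP[h1 h2] := g01 m w; rewrite ger0_norm ?mulr_ge0 ?subr_ge0 ?(ltW c0)//.
    by rewrite ler_piMr ?(ltW c0)// lerBlDr lerDl.
  - move=> w; apply: (cvg_near_cst _). have [Zm Zm0 hZ] := path_ub y0 (@Z0 w) (@cZ w).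
    have := nbhs_infty_ge (Num.truncn Zm).+1; apply: filterS => m hm.
    rewrite /g indicE mem_set ?subrr ?mulr0// => k j jk. apply: le_trans (hZ _ (tc_bound y0 (ltn0Sn k) (N0 k) jk)) _.
    apply: (le_trans (ltW (truncnS_gt _))); rewrite ler_nat. exact: leq_trans hm (leqnSn m).
apply/eqP; rewrite -subr_eq0 -normr_le0.
by apply: (ler_cvg_to (cvg_cst _) cg); apply: nearW => m; exact: key.
Qed.

End besq_laplace.

Section besq.
Context (R : realType) (alpha : R).
Hypothesis a01 : 0 < alpha < 1.

Lemma besq_fdd1 d (Om : mtype d) (P : prob Om R) d' (Om' : mtype d')
    (P' : prob Om' R) (Z : R -> Om -> R) (Z' : R -> Om' -> R) (t : R) (f : R -> R) :
  (forall n (t : 'I_n -> R) (A : 'I_n -> set R), (forall i, 0 <= t i /\ measurable (A i)) ->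
    P (\bigcap_i (Z (t i) @^-1` A i)) = P' (\bigcap_i (Z' (t i) @^-1` A i))) ->
  0 <= t -> mfT (Z t) -> mfT (Z' t) -> bmf f -> Ex P (fun w => f (Z t w)) = Ex P' (fun w => f (Z' t w)).
Proof.
move=> fdd t0 mZ mZ' bf; have fP := Pfin P; have fP' := Pfin P'.
have one (T : Type) (X : T -> R) (A : set R) : \bigcap_(i in [set: 'I_1]) (X @^-1` A) = X @^-1` A.
  by apply/seteqP; split=> w; [move=> /(_ ord0 Logic.I)|move=> h i _].
apply: (Ex_law fP fP' mZ mZ') bf => A mA; have h := fdd 1%N (fun=> t) (fun=> A); rewrite !one in h.
by apply: h => i; split.
Qed.

Let dlt (c : bool) : R := if c then 2 * alpha else 0.

Lemma besq_laplace c d (Om : mtype d) (P : prob Om R) (Z : R -> Om -> R) (y l : R) :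
  besq (dlt c) P Z -> 0 < y -> 0 <= l -> let r := (2 * y)^-1 in Ex P (fun w => expR (- l * Z y w)) =
  (if c then (r / (r + l)) `^ alpha else 1) * Ex P (fun w => expR (- (r * l / (r + l)) * Z 0 w)).
Proof.
move=> [mZ Z0 cZ [d' [Om' [P' [Z' [sde fdd]]]]]] y0 l0 r; have [a0 a1] := andP a01.
have r0 : 0 < r by rewrite invr_gt0 mulr_gt0.
move: l0; rewrite le_eqVlt => /predU1P[<-|l0].
  rewrite addr0 divff ?gt_eqF// powR1 if_same mul1r mulr0 mul0r; apply: eq_Ex => w. by rewrite oppr0 !mul0r.
have [F [B [J [[hF hB] aZ' hZ' ito eq]]]] := sde.
have dl0 : 0 <= dlt c by rewrite /dlt; case: (c) => //; rewrite mulr_ge0// ltW.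
have Z'0 w t : 0 <= t -> 0 <= Z' t w by have [h _ _] := hZ' w; exact: h.
have cZ' w : {within `[0, +oo[%classic, continuous (Z' ^~ w)} by have [_ h _] := hZ' w.
have eZ' w t : 0 <= t -> Z' t w = Z' 0 w + dlt c * t + 2 * J t w.
  move=> t0; rewrite (eq t w t0); congr (_ + _ + _); rewrite /besq_lifetime.
  (* For delta = 0 the drift vanishes whatever the lifetime is, and for delta > 0 the lifetime is
     infinite: in both cases the equation holds without stopping. *)
  move: dl0; rewrite le_eqVlt => /predU1P[<-|->]; first by rewrite !mul0r. by rewrite (min_idPl (leey _)).
have mZ' t : 0 <= t -> mfT (Z' t).
  move=> t0; have [_ Fm _] := hF; move=> _ A mA; apply: (Fm t t0); apply: (aZ' t t0). by exists A.
have key := besq_sde_laplace y0 l0 dl0 hF hB aZ' Z'0 cZ' ito eZ'.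
have ly : 0 < 1 + 2 * l * (y - 0) by rewrite subr0 ltr_wpDr// !mulr_ge0// ltW.
have bE (a : R) : 0 <= a -> bmf (fun x : R => expR (- a * pos x)).
  move=> ha; apply: bmf01 => [|x].
    apply: mexpR; apply: mfM => //. by apply: measurable_maxr => //; exact: mcst.
  by rewrite expR_ge0 /= -expR0 ler_expR mulNr oppr_le0 mulr_ge0// pos_ge0.
have tr (a t : R) : 0 <= a -> 0 <= t -> Ex P (fun w => expR (- a * Z t w)) = Ex P' (fun w => expR (- a * Z' t w)).
  move=> ha t0; have := besq_fdd1 fdd t0 (mZ t t0) (mZ' t t0) (bE a ha).
  have -> : (fun w => expR (- a * pos (Z t w))) = (fun w => expR (- a * Z t w)).
    by apply/funext => w; rewrite pos_id// Z0.
  have -> // : (fun w => expR (- a * pos (Z' t w))) = (fun w => expR (- a * Z' t w)).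
  by apply/funext => w; rewrite pos_id// Z'0.
have ep : r * l / (r + l) = phi y l 0.
  by rewrite /phi /r; field; rewrite !gt_eqF// ?subr0// ?addr_gt0// ?mulr_gt0// subr0 in ly *.
have er : r / (r + l) = (1 + 2 * l * (y - 0))^-1.
  by rewrite /r; field; rewrite !gt_eqF// ?addr_gt0// ?mulr_gt0// subr0 in ly *.
have p0 : 0 <= phi y l 0 by rewrite divr_ge0// ltW.
rewrite ep !tr// ?(ltW l0) ?(ltW y0)// key.
have bZ : bmf (fun w => expR (- l * Z' y w)).
  apply: bmf01 => [|w].
    apply: mexpR; apply: mfM => //. by apply: mZ'; exact: ltW.
  by rewrite expR_ge0 /= -expR0 ler_expR mulNr oppr_le0 mulr_ge0// ?Z'0// ltW.
have -> : (fun w => expR (- l * Z' y w + - dlt c * lphi y l 0)) =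
    (fun w => expR (- dlt c * lphi y l 0) * expR (- l * Z' y w)).
  by apply/funext => w; rewrite expRD mulrC.
rewrite ExZ//; last exact: Pfin.
rewrite mulrA -[LHS]mul1r; congr (_ * _); rewrite /dlt er; case: (c) => /=; last by rewrite oppr0 mul0r expR0 mulr1.
rewrite /powR gt_eqF ?invr_gt0// lnV ?posrE// -expRD -[LHS]expR0 /lphi; congr expR; by field.
Qed.

End besq.

(** * Pseudo-stationarity at a fixed time *)

Section main.
Context (R : realType) (alpha : R).
Hypothesis a01 : 0 < alpha < 1.
Local Notation I := (ipspace alpha).

Lemma MG_blocks n (G : R -> 'M[R]_n.+1) (b b' : I) : ip_blocks b = ip_blocks b' -> MG G b = MG G b'.
Proof. by move=> ->. Qed.

Lemma Emx_law d (Om : mtype d) (P : prob Om R) (X : Om -> I) (mu : prob I R)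
    n (G : R -> 'M[R]_n.+1) : tst G -> mfT X ->
  (forall D, measurable D -> mu D = P (X @^-1` D)) -> Emx mu (fun b : I => MG G b) = Emx P (fun w => MG G (X w)).
Proof.
move=> hG mX h; apply/matrixP => i j; rewrite mxE [RHS]mxE.
apply: (@Ex_pushforward _ _ _ _ _ P mu X (fun b : I => MG G b i j)) => //.
  exact: Pfin.
exact: (bmm_MG hG (@measurable_id _ _ _) i j).
Qed.

Lemma kernel_mixture d (Om : mtype d) (Q : prob Om R) (X Y : Om -> I)
    (K : I -> prob I R) n (G : R -> 'M[R]_n.+1) : tst G ->
  (forall D, measurable D -> mfT (fun b => K b D)) -> mfT X -> mfT Y ->
  (forall D, measurable D -> (Q (Y @^-1` D) = \int[Q]_w K (X w) D)%E) ->
  Emx Q (fun w => MG G (Y w)) = Emx Q (fun w => Emx (K (X w)) (fun b : I => MG G b)).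
Proof.
move=> hG mK mX mY h; have fQ := Pfin Q.
apply/matrixP => i j; rewrite mxE [RHS]mxE.
transitivity (Ex Q (fun w => Ex (K (X w)) (fun b => MG G b i j))); last first.
  by apply: eq_Ex => w; rewrite mxE.
apply: (bfun_eq (bfun_Ex fQ mY) (bfun_kernel mK Q mX)) (bmm_MG hG (@measurable_id _ _ _) i j) => A mA.
transitivity (fine (Q (Y @^-1` A))); first exact: Ex_indicX.
rewrite h// /Ex /Rintegral; congr fine; apply: eq_integral => w _.
by rewrite -/(Rintegral _ _ _) -/(Ex _ _) Ex_indic// fineK//; apply: fin_num_measure.
Qed.

(** The kernel turns [ef s] into [ef (ks alpha s r)]; given the initial law, [kernel_identity] at
    mass [Z 0] moves the transition from the partition to its mass, and the mass transition has the
    Laplace transform of [Z y]. *)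
Lemma evolution_mean c d (Om : mtype d) (P : prob Om R) (betabar : {mfun Om >-> I})
    (Z : R -> Om -> R) d' (Om' : mtype d') (Q : prob Om' R) (X0 Xy : Om' -> I)
    (X : Om -> I) (K : I -> prob I R) (y : R) n (s : wseq R n) :
  PDIP c (distribution P betabar) -> besq (if c then 2 * alpha else 0) P Z ->
  independent2 P (sigma_rv betabar) (sigma_process [set t : R | 0 <= t] Z) ->
  0 < y -> (forall b, kappa c y b (K b)) -> (forall D, measurable D -> mfT (fun b => K b D)) ->
  mfT X0 -> mfT Xy -> mfT X ->
  {ae P, forall w, ip_blocks (X w) = ip_scale (Z 0 w) (betabar w)} ->
  (forall D, measurable D -> Q (X0 @^-1` D) = P (X @^-1` D)) ->
  (forall D, measurable D -> (Q (Xy @^-1` D) = \int[Q]_w K (X0 w) D)%E) -> all rge0 s -> tst (ef s) ->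
  Emx Q (fun w => MG (ef s) (Xy w)) = Emx P (fun w => MG (ef s) (ipscale (Z y w) (betabar w))).
Proof.
move=> hnu hZ hi y0 hK mK mX0 mXy mX hX hQ hQy s0 hs.
have [mZ Z0 _ _] := hZ; have yy := ltW y0; pose nu := distribution P betabar : prob I R.
set r := (2 * y)^-1; have r0 : 0 < r by rewrite invr_gt0 mulr_gt0.
have nu1 : {ae nu, forall b : I, ip_mass b = 1} by exact: (PDIP_mass a01 hnu).
have tk := tst_ks a01 y0 hK s0 hs; have k0 := ks_ge0 alpha y0 s0.
have ind t : 0 <= t -> independent2 P (sigma_rv (Z t)) (sigma_rv betabar).
  move=> t0; apply: independent2_sym; apply: independent2W hi => // A hA. by apply: sub_sa; exists t.
have ms t (G : wseq R n) : 0 <= t -> tst (ef G) ->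
    Emx P (fun w => MG (ef G) (ipscale (Z t w) (betabar w))) = Emx P (fun w => Phi nu (ef G) (pos (Z t w))).
  by move=> t0 hG; apply: mean_scaled_indep => //; [exact: mZ|exact: ind].
rewrite (kernel_mixture hs mK mX0 mXy hQy) (ms y s yy hs).
set A := (if c then W alpha true s r else 1).
have -> : (fun w => Emx (K (X0 w)) (fun b : I => MG (ef s) b)) = (fun w => A * MG (ef (ks alpha s r)) (X0 w)).
  by apply/funext => w; rewrite (kappa_mean a01 y0 hK s0 hs).
rewrite EmxMl; [|exact: Pfin|exact: bmm_MG].
have -> : Emx Q (fun w => MG (ef (ks alpha s r)) (X0 w)) = Emx P (fun w => MG (ef (ks alpha s r)) (X w)).
  pose X' : {mfun Om >-> I} := mfun_Sub (mem_set mX).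
  rewrite -(@Emx_law _ _ Q X0 (distribution P X') _ _ tk mX0); last by move=> D mD; rewrite hQ. exact: Emx_law.
have -> : Emx P (fun w => MG (ef (ks alpha s r)) (X w)) =
    Emx P (fun w => MG (ef (ks alpha s r)) (ipscale (Z 0 w) (betabar w))).
  apply: Emx_ae; [exact: bmm_MG| |].
    by apply: bmm_MG => //; apply: mipscale => //; exact: mZ.
  by apply: filterS hX => w hw; apply: MG_blocks; exact: hw.
rewrite (ms 0 _ (lexx 0) tk) -EmxMl; [|exact: Pfin|]; last first.
  by move=> i j; apply: (bmf_comp (bmf_Phi tk nu1 i j)); exact: mZ.
apply/matrixP => i j; rewrite mxE [RHS]mxE.
pose f x := Phi nu (ef s) (pos x) i j.
have -> : (fun w => (A * Phi nu (ef (ks alpha s r)) (pos (Z 0 w))) i j) = (fun w => Qz a01 K (Z 0 w) f).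
  apply/funext => w; have z0 : 0 <= Z 0 w by exact: Z0.
  by rewrite pos_id// (kernel_identity a01 y0 hK mK hnu s0 hs z0) mxE.
have bf : bmf f by exact: bmf_Phi.
have b1 := bfun_Qz a01 mK P (mZ 0 (lexx 0)).
have b2 := bfun_Ex (Pfin P) (mZ y yy).
have := bfun_laplace b1 b2 _ bf.
have ff : (fun x => f (pos x)) = f by apply/funext => x; rewrite /f (pos_id (pos_ge0 x)).
rewrite ff => /(_ _)/wrap[l l0|->]; last first.
  by apply: eq_Ex => w; rewrite /f (pos_id (pos_ge0 _)).
have -> : (fun w => Qz a01 K (Z 0 w) (fun x => expR (- l * pos x))) = (fun w =>
    (if c then (r / (r + l)) `^ alpha else 1) * expR (- (r * l / (r + l)) * Z 0 w)).
  by apply/funext => w; rewrite (Qz_laplace a01 y0 hK (Z0 w 0 (lexx 0)) l0).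
rewrite ExZ; [|exact: Pfin|]; last first.
  apply: bmf01 => [|w].
    apply: mexpR; apply: mfM => //; exact: mZ.
  rewrite expR_ge0 /= -expR0 ler_expR mulNr oppr_le0 mulr_ge0 ?Z0//. by rewrite divr_ge0 ?mulr_ge0 ?addr_ge0// ltW.
rewrite -(besq_laplace a01 hZ y0 l0); congr Ex.
by apply/funext => w; rewrite pos_id// Z0.
Qed.

End main.

(** The strong Markov property at the constant stopping time 0, on the whole space. *)
Lemma hunt_transition (R : realType) (alpha : R) (kap : R -> ipspace alpha -> (set (ipspace alpha) -> \bar R) -> Prop)
    d (Om : mtype d) (Q : prob Om R) (beta : R -> {mfun Om >-> ipspace alpha}) (y : R) :
  continuous_hunt_process kap Q beta -> 0 <= y -> exists K : ipspace alpha -> prob (ipspace alpha) R,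
  [/\ forall b, kap y b (K b), forall D, measurable D -> mfT (fun b => K b D) &
      forall D, measurable D -> (Q (beta y @^-1` D) = \int[Q]_w K (beta 0%R w) D)%E].
Proof.
move=> [_ [F [k [[sF Fm _] _ _ hk Mk]]]] y0.
pose K (b : ipspace alpha) : prob (ipspace alpha) R := mnormalize (k y b) (\d_b).
have KE b : K b = k y b :> (set (ipspace alpha) -> \bar R).
  by apply/funext => A; rewrite /K /= /mnormalize prob_kernel onee_eq0 /= invr1 mule1.
exists K; split=> [b|D mD|D mD].
- by rewrite KE; exact: hk.
- by under eq_fun do rewrite KE; exact: measurable_kernel.
- have FT t : 0 <= t -> F t setT by move=> t0; have [F0 FC _] := sF t t0; have := FC _ F0; rewrite setD0.
  have st : stopping_time F (fun=> 0%:E).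
    split=> [w|t t0]; first by [].
    by have := FT t t0; congr (F t _); apply/funext => w; rewrite /= lee_fin t0 /mkset propeqE.
  have sT : stopped_sigma F (fun=> 0%:E) setT.
    by split=> [|t t0]; [exact: measurableT|rewrite setTI; exact: st.2].
  have := Mk _ st _ sT y y0 D mD; rewrite /= add0r.
  rewrite (_ : setT `&` [set w | (0%:E < +oo)%E /\ D (beta y w)] = beta y @^-1` D); last first.
    by apply/seteqP; split=> [w [_ []]|w h]; [|split=> //; split=> //; exact: ltry].
  rewrite (_ : setT `&` [set w | (0%:E < +oo)%E] = setT); last first.
    by apply/seteqP; split=> // w _; split=> //; exact: ltry.
  by move=> ->; apply: eq_integral => w _; rewrite KE.
Qed.

(* betabar and Z live on the probability space P, the evolution beta on Q. *)
Theorem theorem1p5 (R : realType) (alpha : R) (halpha : 0 < alpha < 1)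
  (d : measure_display) (Om : measurableType d) (P : probability Om R)
  (betabar : {mfun Om >-> ipspace alpha}) (Z : R -> Om -> R)
  (d' : measure_display) (Om' : measurableType d') (Q : probability Om' R)
  (beta : R -> {mfun Om' >-> ipspace alpha})
  (hcase : [/\ PDIP_alpha_0 (distribution P betabar), besq 0 P Z &
               type1_evolution Q beta]
           \/
           [/\ PDIP_alpha_alpha (distribution P betabar),
               besq (2 * alpha) P Z & type0_evolution Q beta])
  (hindep : independent2 P (sigma_rv betabar)
              (sigma_process [set y : R | 0 <= y] Z))
  (h0 : has_law P (fun w => ip_scale (Z 0 w) (betabar w))
          (distribution Q (beta 0))) :
  forall y : R, 0 <= y ->
    has_law P (fun w => ip_scale (Z y w) (betabar w))
      (distribution Q (beta y)).
Proof.
move=> y; rewrite le_eqVlt => /predU1P[<-//|y0]; have yy := ltW y0.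
have [c [hnu hZ hE]] : exists c, [/\ PDIP c (distribution P betabar),
    besq (if c then 2 * alpha else 0) P Z & continuous_hunt_process (@kappa R alpha c) Q beta].
  by case: hcase => h; [exists false|exists true].
have [K [hK mK hQ]] := hunt_transition hE yy.
have [mZ _ _ _] := hZ; have [X [hX lX]] := h0.
have mY : mfT (fun w => ipscale (Z y w) (betabar w)) by apply: mipscale => //; exact: mZ.
pose Y : {mfun Om >-> ipspace alpha} := mfun_Sub (mem_set mY).
exists Y; split; first by apply: aeW.
move=> D mD; apply: (ip_law_unique (mu := distribution Q (beta y)) (nu := distribution P Y)) => // n G hG i j.
have [[s s0 Gs] _ _] := hG; have eG : G = ef s by exact/funext.
rewrite eG in hG *.
have e1 := Emx_law (mu := distribution Q (beta y)) hG (mfPT (beta y)) (fun _ _ => erefl).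
have e2 := Emx_law (mu := distribution P Y) hG mY (fun _ _ => erefl).
have e3 := evolution_mean halpha hnu hZ hindep y0 hK mK (mfPT (beta 0)) (mfPT (beta y)) (mfPT X) hX lX hQ s0 hG.
have := etrans e1 (etrans e3 (esym e2)) => /matrixP/(_ i j).
by rewrite !mxE.
Qed.
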